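(* Assume Hypothesis A (stated in the context) holds. There exists $k\in\mathbb{Z}_+$ such that a $k$-connected $\mathrm{GF}(4)$-representable matroid with at least $2k$ elements is contained in $\mathcal{SL}_4$ if and only if it has no minor isomorphic to any of $F_7$, $F_7^*$, $V_1$, $V_1^*$, $V_2$, $V_3$, $V_3^*$, $P_1$, $P_1^*$, $P_2$, $P_3$, $P_3^*$, $Y_9$, $Y_9^*$. Moreover, assume Hypothesis B (stated in the context) holds; then there exist $k,n\in\mathbb{Z}_+$ such that a vertically $k$-connected $\mathrm{GF}(4)$-representable matroid with an $M(K_n)$-minor is contained in $\mathcal{SL}_4$ if and only if it has no minor isomorphic to any of $F_7$, $F_7^*$, $V_1$, $V_2$, $V_3$, $P_1$, $P_2$, $P_3$, $Y_9$.
   Context: $\mathcal{SL}_4$ is the class of $\mathrm{GF}(4)$-representable matroids $M$ for which there is a prime power $q$ such that $M$ is representable over every field with at least $q$ elements. $F_7$ is the Fano plane. Let $\alpha\in\mathrm{GF}(4)$ satisfy $\alpha^2=\alpha+1$. The following are column matroids over $\mathrm{GF}(4)$ of the given matrices (rows separated by semicolons): $V_1$: $[1,0,0,1,0,1,1,1,1;\ 0,1,0,1,1,\alpha^2,\alpha^2,\alpha,0;\ 0,0,1,0,1,1,\alpha,1,\alpha]$. $V_2$: $[1,0,0,0,1,1,1,0;\ 0,1,0,0,\alpha^2,\alpha,\alpha,1;\ 0,0,1,0,\alpha,\alpha^2,\alpha,1;\ 0,0,0,1,\alpha^2,\alpha^2,\alpha,\alpha]$. $V_3$: $[1,0,0,0,1,0,1,1,1;\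 0,1,0,0,\alpha,1,\alpha^2,\alpha^2,1;\ 0,0,1,0,\alpha,1,\alpha,1,\alpha^2;\ 0,0,0,1,0,1,1,0,0]$. $P_1$: $[0,1,1,1,1,1,0,0,0;\ 0,1,\alpha,0,0,0,1,1,1;\ 1,0,0,1,\alpha,\alpha^2,1,\alpha,\alpha^2]$. $P_2$: $[1,0,0,0,1,0,1,1;\ 0,1,0,0,\alpha,1,1,1;\ 0,0,1,0,1,1,0,1;\ 0,0,0,1,\alpha^2,1,\alpha^2,0]$. $P_3$: $[0,1,1,1,1,1,1,0,0;\ 0,1,\alpha,\alpha^2,0,0,0,1,1;\ 1,0,0,0,1,\alpha,\alpha^2,1,\alpha]$. $Y_9$ (the Perles configuration): $[1,0,0,1,1,0,\alpha,\alpha,1;\ 0,1,0,1,0,1,\alpha,1,\alpha;\ 0,0,1,0,1,1,1,0,1]$. ''$k$-connected'' is in Tutte's sense. A matroid is vertically $k$-connected if for every $X\subseteq E$ with $r(X)+r(E-X)-r(M)<k$, $X$ or $E-X$ is spanning; $M$ is cyclically $k$-connected if $M^*$ is vertically $k$-connected. Represented matroids: for a field $\mathbb{F}$, an $\mathbb{F}$-represented matroid is a pair $(E,U)$ with $U$ a subspace of $\mathbb{F}^E$; a matrix $A$ whose row space is $U$ represents it, written $M(A)$; its dual is $(E,U^\perp)$; $\widetilde M$ is the underlying abstract matroid; $M|X=(X,U|X)$, $M\backslash X=M|(E-X)$, $M/X=(M^*\backslash X)^*$; simplicity, connectivity and minors come from $\widetilde M$. $\mathbb{F}_p$ is the prime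 subfield. Frame templates: for $\Gamma\le\mathbb{F}^\times$, a $\Gamma$-frame matrix has at most two nonzero entries per column, each nonzero column contains an entry $1$, and a second nonzero entry (if any) equals $-\gamma$, $\gamma\in\Gamma$. A frame template over $\mathbb{F}$ is $\Phi=(\Gamma,C,X,Y_0,Y_1,A_1,\Delta,\Lambda)$ with $\Gamma\le\mathbb{F}^\times$; $C,X,Y_0,Y_1$ pairwise disjoint finite sets; $A_1\in\mathbb{F}^{X\times(C\cup Y_0\cup Y_1)}$; $\Lambda\le\mathbb{F}^X$ and $\Delta\le\mathbb{F}^{C\cup Y_0\cup Y_1}$ additive subgroups closed under scaling by $\Gamma$. $A'\in\mathbb{F}^{B\times E}$ respects $\Phi$ if $X\subseteq B$, $C,Y_0,Y_1\subseteq E$, $A'[X,C\cup Y_0\cup Y_1]=A_1$, and there is $Z\subseteq E-(C\cup Y_0\cup Y_1)$ with $A'[X,Z]=0$, columns of $A'[B-X,Z]$ unit vectors, $A'[B-X,E-(C\cup Y_0\cup Y_1\cup Z)]$ a $\Gamma$-frame matrix, columns of $A'[X,E-(C\cup Y_0\cup Y_1\cup Z)]$ in $\Lambda$, rows of $A'[B-X,C\cup Y_0\cup Y_1]$ in $\Delta$. $A$ conforms to $\Phi$ if for some such $A',Z$: $A[B,E-Z]=A'[B,E-Z]$ and each column $i\in Z$ of $A$ is the sum of columns $i$ and some $j\in Y_1$ of $A'$. An $\mathbb{F}$-represented matroid conforms to $\Phi$ if isomorphic to $M(A)/C\backslash Y_1$ for some conforming $A$; $\mathcal{M}(\Phi)$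 is the set of these. Hypothesis A: for every finite field $\mathbb{F}$, positive integer $m$, and minor-closed class $\mathcal{M}$ of $\mathbb{F}$-represented matroids, there exist $k\in\mathbb{Z}_+$ and frame templates $\Phi_1,\dots,\Phi_s,\Psi_1,\dots,\Psi_t$ over $\mathbb{F}$ such that $\mathcal{M}\supseteq\mathcal{M}(\Phi_i)$ for all $i$, $\mathcal{M}$ contains the duals of all members of each $\mathcal{M}(\Psi_j)$, and every simple $k$-connected $M\in\mathcal{M}$ with at least $2k$ elements such that $\widetilde M$ has no $\mathrm{PG}(m-1,\mathbb{F}_p)$-minor either lies in some $\mathcal{M}(\Phi_i)$ or has $M^*$ in some $\mathcal{M}(\Psi_j)$. Hypothesis B: same setting; there exist $k,n\in\mathbb{Z}_+$ and frame templates $\Phi_1,\dots,\Phi_s,\Psi_1,\dots,\Psi_t$ with (1) $\mathcal{M}\supseteq\mathcal{M}(\Phi_i)$; (2) $\mathcal{M}$ contains duals of members of each $\mathcal{M}(\Psi_j)$; (3) every simple vertically $k$-connected $M\in\mathcal{M}$ with an $M(K_n)$-minor but no $\mathrm{PG}(m-1,\mathbb{F}_p)$-minor lies in some $\mathcal{M}(\Phi_i)$; (4) for every cosimple cyclically $k$-connected $M\in\mathcal{M}$ with an $M^*(K_n)$-minor but no $\mathrm{PG}(m-1,\mathbb{F}_p)$-minor, $M^*$ lies in some $\mathcal{M}(\Psi_j)$. *)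

(* Defs.v *)
From HB Require Import structures.
From Stdlib Require List.
From mathcomp Require Import all_boot all_order all_algebra all_fingroup.

Set Implicit Arguments.
Unset Strict Implicit.
Unset Printing Implicit Defensive.

Import GRing.Theory.
Local Open Scope ring_scope.

Record matroid := Matroid {
  mground :> finType;
  rank : {set mground} -> nat;
  rank_le_card : forall X, (rank X <= #|X|)%N;
  rankS : forall X Y : {set mground}, X \subset Y -> (rank X <= rank Y)%N;
  rank_submod : forall X Y,
    (rank (X :|: Y) + rank (X :&: Y) <= rank X + rank Y)%N
}.

Definition miso (M N : matroid) : Prop :=
  exists f : M -> N, bijective f /\ forall X : {set M}, rank (f @: X) = rank X.

Definition spanning (M : matroid) (X : {set M}) : Prop :=
  rank X = rank [set: M].

Definition simple (M : matroid) : Prop :=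
  forall X : {set M}, (#|X| <= 2)%N -> rank X = #|X|.

Section Restriction.
Variables (M : matroid) (S : {set M}).
Let E : finType := {x : M | x \in S}.

Definition restrict_rank (X : {set E}) : nat := rank (val @: X).

Fact restrict_le_card X : (restrict_rank X <= #|X|)%N.
Proof. by rewrite (leq_trans (rank_le_card _)) // leq_imset_card. Qed.

Fact restrict_rankS (X Y : {set E}) :
  X \subset Y -> (restrict_rank X <= restrict_rank Y)%N.
Proof. by move=> sXY; apply/rankS/imsetS. Qed.

Fact restrict_submod X Y :
  (restrict_rank (X :|: Y) + restrict_rank (X :&: Y)
   <= restrict_rank X + restrict_rank Y)%N.
Proof.
rewrite /restrict_rank imsetU imsetI; first exact: rank_submod.
by move=> x y _ _; apply: val_inj.
Qed.

Definition restrict : matroid :=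
  Matroid restrict_le_card restrict_rankS restrict_submod.
End Restriction.

Section Dual.
Variable M : matroid.

(* The truncated subtraction is exact: see [dual_rank_exact]. *)
Definition dual_rank (X : {set M}) : nat :=
  #|X| + rank (~: X) - rank [set: M].

Fact rank0 : rank (set0 : {set M}) = 0%N.
Proof. by apply/eqP; rewrite -leqn0 -(@cards0 M) rank_le_card. Qed.

Fact rankU_le (X Y : {set M}) : (rank (X :|: Y) <= rank X + rank Y)%N.
Proof. exact: leq_trans (leq_addr _ _) (rank_submod X Y). Qed.

Fact dual_rank_exact X :
  (dual_rank X + rank [set: M] = #|X| + rank (~: X))%N.
Proof.
rewrite subnK // -(setUCr X) (leq_trans (rankU_le _ _)) // leq_add2r.
exact: rank_le_card.
Qed.

Fact dual_le_card X : (dual_rank X <= #|X|)%N.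
Proof.
by rewrite -(leq_add2r (rank [set: M])) dual_rank_exact leq_add2l rankS.
Qed.

Fact dual_rankS (X Y : {set M}) :
  X \subset Y -> (dual_rank X <= dual_rank Y)%N.
Proof.
move=> sXY; rewrite -(leq_add2r (rank [set: M])) !dual_rank_exact.
rewrite -(cardsID X Y) (setIidPr sXY) -addnA leq_add2l.
have -> : ~: X = (Y :\: X) :|: ~: Y.
  apply/setP=> x; rewrite !inE; case: (boolP (x \in X)) => //= xX.
    by rewrite (subsetP sXY).
  by case: (x \in Y).
by rewrite (leq_trans (rankU_le _ _)) // leq_add2r rank_le_card.
Qed.

Fact dual_submod X Y :
  (dual_rank (X :|: Y) + dual_rank (X :&: Y) <= dual_rank X + dual_rank Y)%N.
Proof.
rewrite -(leq_add2r (rank [set: M] + rank [set: M])).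
rewrite addnACA [leqRHS]addnACA !dual_rank_exact.
rewrite addnACA [leqRHS]addnACA cardsUI leq_add2l.
by rewrite setCU setCI addnC rank_submod.
Qed.

Definition dual : matroid := Matroid dual_le_card dual_rankS dual_submod.
End Dual.

Definition delete (M : matroid) (D : {set M}) : matroid := restrict (~: D).

Definition contract (M : matroid) (C : {set M}) : matroid :=
  dual (delete (C : {set dual M})).

(* [D] is a subset of the ground set of M / C. *)
Definition has_minor (M N : matroid) : Prop :=
  exists (C : {set M}) (D : {set contract C}), miso (delete D) N.

Definition cosimple (M : matroid) : Prop := simple (dual M).

(* Submodularity gives [rank setT <= rank X + rank (~: X)]. *)
Definition conn (M : matroid) (X : {set M}) : nat :=
  rank X + rank (~: X) - rank [set: M].

Definition separation (j : nat) (M : matroid) (X : {set M}) : Prop :=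
  [/\ (j <= #|X|)%N, (j <= #|~: X|)%N & (conn X < j)%N].

Definition k_connected (k : nat) (M : matroid) : Prop :=
  forall (j : nat) (X : {set M}), (0 < j < k)%N -> ~ separation j X.

Definition vertically_connected (k : nat) (M : matroid) : Prop :=
  forall X : {set M}, (conn X < k)%N -> spanning X \/ spanning (~: X).

Definition cyclically_connected (k : nat) (M : matroid) : Prop :=
  vertically_connected k (dual M).

(* [F^o] is F as a vector space over itself, so [fvec F E] is the space F^E. *)
Definition fvec (F : fieldType) (E : finType) : vectType F := {ffun E -> F^o}.

Section ColumnMatroid.
Variables (F : fieldType) (B E : finType) (A : B -> E -> F).

Definition mxcol (e : E) : fvec F B := [ffun b => A b e].
Definition mxrow (b : B) : fvec F E := [ffun e => A b e].

Definition col_rank (X : {set E}) : nat := \dim <<[seq mxcol e | e in X]>>.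

Fact col_le_card X : (col_rank X <= #|X|)%N.
Proof. by rewrite (leq_trans (dim_span _)) // size_image. Qed.

Let col_spanS (X Y : {set E}) :
  X \subset Y -> (<<[seq mxcol e | e in X]>> <= <<[seq mxcol e | e in Y]>>)%VS.
Proof.
move=> sXY; apply: sub_span => _ /imageP[e eX ->].
exact/image_f/(subsetP sXY).
Qed.

Fact col_rankS (X Y : {set E}) : X \subset Y -> (col_rank X <= col_rank Y)%N.
Proof. by move=> sXY; apply/dimvS/col_spanS. Qed.

Fact col_submod X Y :
  (col_rank (X :|: Y) + col_rank (X :&: Y) <= col_rank X + col_rank Y)%N.
Proof.
rewrite /col_rank -[leqRHS]dimv_sum_cap leq_add //; apply: dimvS.
  apply/span_subvP=> _ /imageP[e + ->]; rewrite inE => /orP[eX | eY].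
    by apply: (subvP (addvSl _ _)); apply/memv_span/image_f.
  by apply: (subvP (addvSr _ _)); apply/memv_span/image_f.
by rewrite subv_cap !col_spanS ?subsetIl ?subsetIr.
Qed.

Definition col_matroid : matroid := Matroid col_le_card col_rankS col_submod.
End ColumnMatroid.

Definition representable (F : fieldType) (M : matroid) : Prop :=
  exists (r : nat) (A : 'I_r -> M -> F), forall X : {set M}, col_rank A X = rank X.

Definition prime_power (q : nat) : Prop :=
  exists p e : nat, [/\ prime p, (0 < e)%N & q = (p ^ e)%N].

Definition at_least (q : nat) (T : eqType) : Prop :=
  exists s : seq T, uniq s /\ size s = q.

(* [K] plays the role of GF(4). *)
Definition SL4 (K : fieldType) (M : matroid) : Prop :=
  representable K M /\
  exists q : nat, prime_power q /\
    forall F : fieldType, at_least q F -> representable F M.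

(* Each point of the projective space of V = (F_p)^m is given by its unique
   spanning vector whose first nonzero coordinate is 1. *)
Definition normalized (p m : nat) (v : 'rV['F_p]_m) : bool :=
  [exists i, (v 0 i == 1) && [forall j : 'I_m, (j < i)%N ==> (v 0 j == 0)]].

(* PG(m - 1, p), for p prime *)
Definition PG (m p : nat) : matroid :=
  @col_matroid 'F_p 'I_m {v : 'rV['F_p]_m | normalized v} (fun i v => val v 0 i).

Definition F7 : matroid := PG 3 2.

Section CycleMatroid.
Variables (V E : finType) (ends : E -> V * V).

Definition adj (X : {set E}) : rel V :=
  [rel u v | [exists e in X, (ends e == (u, v)) || (ends e == (v, u))]].

Definition components (X : {set E}) : nat := n_comp (adj X) V.

Definition cycle_rank (X : {set E}) : nat := #|V| - components X.

Let adj_sym X : symmetric (adj X).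
Proof.
by move=> u v; apply/existsP/existsP => -[e H]; exists e; rewrite orbC.
Qed.

Let con_sym X : connect_sym (adj X).
Proof. exact/sym_connect_sym/adj_sym. Qed.

Let adjS (X Y : {set E}) : X \subset Y -> subrel (adj X) (adj Y).
Proof.
move=> sXY u v /exists_inP[e eX H]; apply/exists_inP; exists e => //.
exact: (subsetP sXY).
Qed.

Let conS (X Y : {set E}) :
  X \subset Y -> subrel (connect (adj X)) (connect (adj Y)).
Proof.
by move=> sXY; apply: connect_sub => u v /(adjS sXY) /connect1.
Qed.

Let connected_in (X : {set E}) (e : E) : bool :=
  connect (adj X) (ends e).1 (ends e).2.

Let connectU1 X e u v : connect (adj (e |: X)) u v =
  [|| connect (adj X) u v,
      connect (adj X) u (ends e).1 && connect (adj X) (ends e).2 v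
    | connect (adj X) u (ends e).2 && connect (adj X) (ends e).1 v].
Proof.
set a := (ends e).1; set b := (ends e).2.
have ab : connect (adj (e |: X)) a b.
  apply/connect1/exists_inP; exists e; first exact: setU11.
  by rewrite [ends e]surjective_pairing eqxx.
have sX : X \subset e |: X by apply: subsetUr.
apply/idP/idP; last first.
  case/or3P=> [|/andP[ua bv]|/andP[ub av]]; first exact: conS.
    exact: connect_trans (connect_trans (conS sX ua) ab) (conS sX bv).
  rewrite con_sym in ab.
  exact: connect_trans (connect_trans (conS sX ub) ab) (conS sX av).
case/connectP=> p pP ->; elim/last_ind: p pP => [|p w IH] /=.
  by rewrite connect0.
rewrite rcons_path last_rcons => /andP[/IH {}IH].
set z := last u p in IH * => /exists_inP[f]; rewrite !inE => /orP[/eqP->|fX] Hf.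
  have [[za wb]|[zb wa]] : (z = a /\ w = b) \/ (z = b /\ w = a).
  - by rewrite /a /b; case/orP: Hf => /eqP->; [left | right].
  - rewrite za wb in IH *; rewrite !connect0 !andbT.
    by case/or3P: IH => [->|/andP[->]|/andP[->]]; rewrite ?orbT.
  - rewrite zb wa in IH *; rewrite !connect0 !andbT.
    by case/or3P: IH => [->|/andP[->]|/andP[->]]; rewrite ?orbT.
have zw : connect (adj X) z w by apply/connect1/exists_inP; exists f.
case/or3P: IH => [uz|/andP[ua bz]|/andP[ub az]]; apply/or3P.
- by apply: Or31; apply: connect_trans zw.
- by apply: Or32; rewrite ua (connect_trans bz).
- by apply: Or33; rewrite ub (connect_trans az).
Qed.

Let componentsE X : components X = #|[set x | roots (adj X) x]|.
Proof.
by rewrite /components /n_comp_mem cardsE; apply: eq_card => x; rewrite !inE andbT.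
Qed.

Let componentsU1 X e :
  (components (e |: X) + ~~ connected_in X e = components X)%N.
Proof.
rewrite /connected_in.
set a := (ends e).1; set b := (ends e).2.
have sX : X \subset e |: X by apply: subsetUr.
case: (boolP (connect (adj X) a b)) => [ab | nab] /=.
  rewrite addn0; apply: eq_n_comp => u v; rewrite connectU1 -/a -/b.
  apply/or3P/idP => [[//|/andP[ua bv]|/andP[ub av]]|uv]; last exact: Or31.
    exact: connect_trans (connect_trans ua ab) bv.
  by rewrite con_sym in ab; apply: connect_trans (connect_trans ub ab) av.
rewrite !componentsE; set R := [set x | roots (adj X) x].
have rR x : fingraph.root (adj X) x \in R by rewrite inE roots_root.
have rK x : x \in R -> fingraph.root (adj X) x = x by rewrite inE => /eqP.
rewrite (cardsD1 (fingraph.root (adj X) b) R) rR addnC; congr (_ + _)%N.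
rewrite -(@card_in_imset _ _ (fingraph.root (adj (e |: X))) (R :\ fingraph.root (adj X) b)).
  apply: eq_card => z; rewrite !inE; apply/eqP/imsetP => [zr | [y _ ->]]; last first.
    exact/eqP/roots_root.
  have [zb | nzb] := eqVneq (fingraph.root (adj X) z) (fingraph.root (adj X) b).
    exists (fingraph.root (adj X) a).
      by rewrite !inE root_connect // nab roots_root.
    rewrite -[LHS]zr; apply/eqP; rewrite root_connect // con_sym.
    rewrite connectU1 -/a -/b; apply/or3P/Or32; rewrite con_sym connect_root.
    by rewrite /= con_sym -(root_connect (con_sym X)) zb eqxx.
  exists (fingraph.root (adj X) z); first by rewrite !inE nzb roots_root.
  rewrite -[LHS]zr; apply/eqP; rewrite root_connect //.
  exact/(conS sX)/connect_root.
move=> x y /setD1P[xb xR] /setD1P[yb yR] /eqP; rewrite root_connect //.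
rewrite connectU1 -/a -/b -(rK x xR) -(rK y yR) in xb yb *.
case/or3P => [|/andP[_]|/andP[+ _]]; rewrite -root_connect // => /eqP.
- by rewrite !rK ?rR.
- by move=> by_; rewrite by_ !rK ?rR ?eqxx // in yb.
- by move=> xb_; rewrite -xb_ !rK ?rR ?eqxx // in xb.
Qed.

Let components_le X : (components X <= #|V|)%N.
Proof. by rewrite componentsE max_card. Qed.

Let cycle_rankU1 X e :
  cycle_rank (e |: X) = (cycle_rank X + ~~ connected_in X e)%N.
Proof.
apply/eqP; rewrite -(eqn_add2r (components (e |: X))) subnK //.
by rewrite -addnA [(~~ _ + _)%N]addnC componentsU1 subnK.
Qed.

Let cycle_rank0 : cycle_rank set0 = 0%N.
Proof.
apply/eqP; rewrite subn_eq0 componentsE cardsE.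
apply/subset_leq_card/subsetP => x _; apply/eqP.
have: connect (adj set0) x (fingraph.root (adj set0) x) by apply: connect_root.
case/connectP => -[|y p] //= /andP[/exists_inP[e]].
by rewrite inE.
Qed.

Let set_ind (P : {set E} -> Prop) :
  P set0 -> (forall e X, P X -> P (e |: X)) -> forall X, P X.
Proof.
move=> P0 PU X; have [n] := ubnP #|X|; elim: n X => // n IH X ltXn.
have [-> // | [e eX]] := set_0Vmem X; rewrite -(setD1K eX); apply/PU/IH.
by rewrite (cardsD1 e) eX in ltXn.
Qed.

Fact cycle_le_card X : (cycle_rank X <= #|X|)%N.
Proof.
elim/set_ind: X => [|e X IH]; first by rewrite cycle_rank0.
have [eX | neX] := boolP (e \in X); first by rewrite setUC (setUidPl _) ?sub1set.
by rewrite cycle_rankU1 cardsU1 neX addnC leq_add // leq_b1.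
Qed.

Fact cycle_rankS (X Y : {set E}) :
  X \subset Y -> (cycle_rank X <= cycle_rank Y)%N.
Proof.
move/setUidPl; rewrite setUC => <-.
elim/set_ind: Y => [|e Y IH]; first by rewrite setU0.
by rewrite setUCA cycle_rankU1 (leq_trans IH) // leq_addr.
Qed.

Fact cycle_submod X Y :
  (cycle_rank (X :|: Y) + cycle_rank (X :&: Y) <= cycle_rank X + cycle_rank Y)%N.
Proof.
suff H (S T D : {set E}) : S \subset T ->
    (cycle_rank (D :|: T) + cycle_rank S <= cycle_rank (D :|: S) + cycle_rank T)%N.
  by have:= H (X :&: Y) Y X (subsetIr X Y); rewrite (setUidPl (subsetIl X Y)).
move=> sST; elim/set_ind: D => [|e D IH]; first by rewrite !set0U addnC.
rewrite -!setUA !cycle_rankU1 addnAC [leqRHS]addnAC leq_add //.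
have: connected_in (D :|: S) e -> connected_in (D :|: T) e.
  by apply: conS; apply: setUS.
by case: (connected_in _ _) => [->|_] //; apply: leq_b1.
Qed.

Definition cycle_matroid : matroid :=
  Matroid cycle_le_card cycle_rankS cycle_submod.
End CycleMatroid.

(* M(K_n) *)
Definition MK (n : nat) : matroid :=
  @cycle_matroid 'I_n {e : 'I_n * 'I_n | (e.1 < e.2)%N} val.

Record rmatroid (F : fieldType) := RMatroid {
  rground : finType;
  rspace : {vspace fvec F rground}
}.

Section Represented.
Variable F : fieldType.

(* M(A) *)
Definition rmx (B E : finType) (A : B -> E -> F) : rmatroid F :=
  @RMatroid F E <<[seq mxrow A b | b : B]>>.

(* The column matroid of a matrix with row space [rspace M]; the choice of a
   basis of [rspace M] is immaterial. *)
Definition underlying (M : rmatroid F) : matroid :=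
  col_matroid (fun (i : 'I_(\dim (rspace M))) (e : rground M) =>
    tnth (vbasis (rspace M)) i e).

Section Restrict.
Variables (E : finType) (S : {set E}).

Definition fres (u : fvec F E) : fvec F {x : E | x \in S} :=
  [ffun x => u (val x)].

Fact fres_linear : linear fres.
Proof. by move=> c u v; apply/ffunP => x; rewrite !ffunE. Qed.
HB.instance Definition _ :=
  GRing.isLinear.Build F (fvec F E) (fvec F {x : E | x \in S}) _ fres fres_linear.
End Restrict.

Definition rrestrict (M : rmatroid F) (S : {set rground M}) : rmatroid F :=
  RMatroid (linfun (@fres _ S) @: rspace M)%VS.

Definition rdelete (M : rmatroid F) (D : {set rground M}) : rmatroid F :=
  rrestrict (~: D).

Section Orthogonal.
Variable E : finType.

Definition dotf (u v : fvec F E) : F^o := \sum_e u e * v e.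

Fact dotf_linear u : linear (dotf u).
Proof.
move=> c v w; rewrite /dotf scaler_sumr -big_split; apply: eq_bigr => e _ /=.
by rewrite !ffunE mulrDr mulrCA.
Qed.
HB.instance Definition _ u :=
  GRing.isLinear.Build F (fvec F E) F^o _ (dotf u) (dotf_linear u).

Definition orthv (U : {vspace fvec F E}) : {vspace fvec F E} :=
  (\bigcap_(u <- vbasis U) lker (linfun (dotf u)))%VS.

Lemma memv_orthv (U : {vspace fvec F E}) v :
  reflect (forall u, u \in U -> dotf u v = 0) (v \in orthv U).
Proof.
have dotC u w : dotf u w = dotf w u by apply: eq_bigr => e _; rewrite mulrC.
rewrite /orthv big_tuple; apply: (iffP idP) => [/subv_bigcapP H u | H].
  move=> /coord_vbasis ->; rewrite dotC linear_sum big1 // => i _.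
  rewrite linearZ /= dotC; have:= H i isT; rewrite -memvE memv_ker lfunE /=.
  by rewrite (tnth_nth 0) => /eqP ->; rewrite scaler0.
apply/subv_bigcapP => i _; rewrite -memvE memv_ker lfunE /= H //.
by rewrite vbasis_mem ?mem_tnth.
Qed.
End Orthogonal.

Definition rdual (M : rmatroid F) : rmatroid F := RMatroid (orthv (rspace M)).

Definition rcontract (M : rmatroid F) (C : {set rground M}) : rmatroid F :=
  rdual (@rdelete (rdual M) C).

(* M / C \ D, for disjoint sets C and D of elements of M *)
Definition rminor (M : rmatroid F) (C D : {set rground M}) : rmatroid F :=
  @rdelete (rcontract C) [set x | val x \in D].

(* Isomorphism is up to projective equivalence, that is, up to relabelling the
   coordinates and rescaling them by nonzero scalars. *)
Definition riso (M N : rmatroid F) : Prop :=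
  exists (f : rground M -> rground N) (d : rground M -> F),
    [/\ bijective f,
        forall e, d e != 0
      & forall v : fvec F (rground N), (v \in rspace N) =
          (([ffun e => d e * v (f e)] : fvec F (rground M)) \in rspace M)].

Definition minor_closed (P : rmatroid F -> Prop) : Prop :=
  [/\ forall M N, riso M N -> P M -> P N,
      forall M D, P M -> P (@rdelete M D)
    & forall M C, P M -> P (@rcontract M C)].
End Represented.

(* The disjoint sets C, X, Y_0, Y_1 are arbitrary finite types, and the union
   of C, Y_0 and Y_1 is their sum type. *)
Record frame_template (F : finFieldType) := FrameTemplate {
  tGamma : {group {unit F}};
  tC : finType;
  tX : finType;
  tY0 : finType;
  tY1 : finType;
  tA1 : tX -> (tC + tY0 + tY1)%type -> F;
  tDelta : {set {ffun (tC + tY0 + tY1)%type -> F^o}};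
  tLambda : {set {ffun tX -> F^o}};
  tDelta_zmod : zmod_closed tDelta;
  tDelta_scale : forall (g : {unit F}) d,
    g \in tGamma -> d \in tDelta -> val g *: d \in tDelta;
  tLambda_zmod : zmod_closed tLambda;
  tLambda_scale : forall (g : {unit F}) l,
    g \in tGamma -> l \in tLambda -> val g *: l \in tLambda
}.

Section Templates.
Variable F : finFieldType.

Definition frame_column (G : {group {unit F}}) (B : finType) (v : B -> F) : Prop :=
  (#|[set b | v b != 0%R]| <= 2)%N /\
  ((exists b, v b != 0) ->
   exists b, v b = 1 /\
     forall b', b' != b -> v b' != 0 -> exists2 g : {unit F}, g \in G & v b' = - val g).

Definition unit_column (B : finType) (v : B -> F) : Prop :=
  exists b, v b = 1 /\ forall b', b' != b -> v b' = 0.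

Variable Phi : frame_template F.
Let C := tC Phi.
Let X := tX Phi.
Let Y0 := tY0 Phi.
Let Y1 := tY1 Phi.
Let Y := (C + Y0 + Y1)%type.

(* Rows are indexed by B = X + B', where B' is B - X; columns by E = Y + E',
   where Y is the union of C, Y_0 and Y_1, and E' is E - Y. *)
Definition respects (B' E' : finType) (A' : X + B' -> Y + E' -> F) (Z : {set E'}) :
    Prop :=
  (forall x y, A' (inl x) (inl y) = tA1 x y) /\
  (forall z, z \in Z -> forall x, A' (inl x) (inr z) = 0) /\
  (forall z, z \in Z -> unit_column (fun b => A' (inr b) (inr z))) /\
  (forall e, e \notin Z -> frame_column (tGamma Phi) (fun b => A' (inr b) (inr e))) /\
  (forall e, e \notin Z -> [ffun x => A' (inl x) (inr e)] \in tLambda Phi) /\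
  (forall b, [ffun y => A' (inr b) (inl y)] \in tDelta Phi).

Definition mx_conforms (B' E' : finType) (A : X + B' -> Y + E' -> F) : Prop :=
  exists (A' : X + B' -> Y + E' -> F) (Z : {set E'}),
    [/\ respects A' Z,
        forall b y, A b (inl y) = A' b (inl y),
        forall b e, e \notin Z -> A b (inr e) = A' b (inr e)
      & forall z, z \in Z -> exists y1 : Y1,
          forall b, A b (inr z) = A' b (inr z) + A' b (inl (inr y1))].

(* M belongs to the class M(Phi). *)
Definition conforms (M : rmatroid F) : Prop :=
  exists (B' E' : finType) (A : X + B' -> Y + E' -> F),
    mx_conforms A /\
    riso (@rminor F (rmx A) [set inl (inl (inl c)) | c : C]
                            [set inl (inr y) | y : Y1]) M.
End Templates.

Definition hypothesisA : Prop :=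
  forall (F : finFieldType) (p m : nat) (P : rmatroid F -> Prop),
  p \in [pchar F] -> (0 < m)%N -> minor_closed P ->
  exists (k s t : nat)
         (Phi : 'I_s -> frame_template F) (Psi : 'I_t -> frame_template F),
  [/\ (0 < k)%N,
      forall i M, conforms (Phi i) M -> P M,
      forall j M, conforms (Psi j) M -> P (rdual M)
    & forall M : rmatroid F, P M ->
        simple (underlying M) -> k_connected k (underlying M) ->
        (2 * k <= #|rground M|)%N -> ~ has_minor (underlying M) (PG m p) ->
        (exists i, conforms (Phi i) M) \/ (exists j, conforms (Psi j) (rdual M))].

Definition hypothesisB : Prop :=
  forall (F : finFieldType) (p m : nat) (P : rmatroid F -> Prop),
  p \in [pchar F] -> (0 < m)%N -> minor_closed P ->
  exists (k n s t : nat)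
         (Phi : 'I_s -> frame_template F) (Psi : 'I_t -> frame_template F),
  (0 < k)%N /\ (0 < n)%N /\
  (forall i M, conforms (Phi i) M -> P M) /\
  (forall j M, conforms (Psi j) M -> P (rdual M)) /\
  (forall M : rmatroid F, P M ->
     simple (underlying M) -> vertically_connected k (underlying M) ->
     has_minor (underlying M) (MK n) -> ~ has_minor (underlying M) (PG m p) ->
     exists i, conforms (Phi i) M) /\
  (forall M : rmatroid F, P M ->
     cosimple (underlying M) -> cyclically_connected k (underlying M) ->
     has_minor (underlying M) (dual (MK n)) -> ~ has_minor (underlying M) (PG m p) ->
     exists j, conforms (Psi j) (rdual M)).

(* [a] is a root of x^2 = x + 1 in K = GF(4). *)

Section ExcludedMinors.
Variables (K : fieldType) (a : K).

Definition mx_of_rows (n : nat) (rows : seq (seq K)) : 'M[K]_(size rows, n) :=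
  \matrix_(i, j) (nth [::] rows i)`_j.

Definition V1 : matroid := col_matroid (mx_of_rows 9 [::
  [:: 1; 0; 0; 1; 0; 1;      1;      1; 1];
  [:: 0; 1; 0; 1; 1; a ^+ 2; a ^+ 2; a; 0];
  [:: 0; 0; 1; 0; 1; 1;      a;      1; a]]).

Definition V2 : matroid := col_matroid (mx_of_rows 8 [::
  [:: 1; 0; 0; 0; 1;      1;      1; 0];
  [:: 0; 1; 0; 0; a ^+ 2; a;      a; 1];
  [:: 0; 0; 1; 0; a;      a ^+ 2; a; 1];
  [:: 0; 0; 0; 1; a ^+ 2; a ^+ 2; a; a]]).

Definition V3 : matroid := col_matroid (mx_of_rows 9 [::
  [:: 1; 0; 0; 0; 1; 0; 1;      1;      1];
  [:: 0; 1; 0; 0; a; 1; a ^+ 2; a ^+ 2; 1];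
  [:: 0; 0; 1; 0; a; 1; a;      1;      a ^+ 2];
  [:: 0; 0; 0; 1; 0; 1; 1;      0;      0]]).

Definition P1 : matroid := col_matroid (mx_of_rows 9 [::
  [:: 0; 1; 1; 1; 1; 1;      0; 0; 0];
  [:: 0; 1; a; 0; 0; 0;      1; 1; 1];
  [:: 1; 0; 0; 1; a; a ^+ 2; 1; a; a ^+ 2]]).

Definition P2 : matroid := col_matroid (mx_of_rows 8 [::
  [:: 1; 0; 0; 0; 1;      0; 1;      1];
  [:: 0; 1; 0; 0; a;      1; 1;      1];
  [:: 0; 0; 1; 0; 1;      1; 0;      1];
  [:: 0; 0; 0; 1; a ^+ 2; 1; a ^+ 2; 0]]).

Definition P3 : matroid := col_matroid (mx_of_rows 9 [::
  [:: 0; 1; 1; 1;      1; 1; 1;      0; 0];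
  [:: 0; 1; a; a ^+ 2; 0; 0; 0;      1; 1];
  [:: 1; 0; 0; 0;      1; a; a ^+ 2; 1; a]]).

Definition Y9 : matroid := col_matroid (mx_of_rows 9 [::
  [:: 1; 0; 0; 1; 1; 0; a; a; 1];
  [:: 0; 1; 0; 1; 0; 1; a; 1; a];
  [:: 0; 0; 1; 0; 1; 1; 1; 0; 1]]).
End ExcludedMinors.

Definition no_minor_in (l : seq matroid) (M : matroid) : Prop :=
  forall N, List.In N l -> ~ has_minor M N.

(* Main.v *)
(* Excluding F7 keeps the minor-closed class free of PG(2, 2), so the structure
   hypothesis puts a highly connected member, or its dual, into a frame template.
   The five rank-3 excluded minors F7, V1, P1, P3, Y9 constrain such a template
   severely: modulo the contracted set, every element becomes a vector of
   coordinate sum zero (a "word") over the vertices of a complete graph all of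
   whose edges e_i - e_j may be added without leaving the class.  A word over
   GF(4) that is not excluded has support at most four, and a finite search, whose
   outcome is recorded as certificates, shows that the words lie in one of a few
   families.  Each family has a representation depending on a parameter, and any
   sufficiently large field contains a value of the parameter avoiding the roots
   of the finitely many determinants that have to be nonzero.
   Conversely a matroid in SL4 is representable over the rationals, and so are its
   minors and duals, whereas none of the listed matroids is: normalising a
   representation on a frame leaves a system of equations with no rational
   solution. *)

Require Import Defs.
From HB Require Import structures.
From Stdlib Require List.
From mathcomp Require Import all_boot all_order all_algebra all_fingroup.
From mathcomp Require Import zify ring.

From Stdlib Require Strings.String.
Set Implicit Arguments.
Unset Strict Implicit.
Unset Printing Implicit Defensive.

Import GRing.Theory.
Local Open Scope ring_scope.

(** A template describes a matrix before [C] is contracted and [Y_1] is deleted, and it puts no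
    condition on the elements of [Y_0]; this is the obstacle. Excluding [F7] forces every element of
    Lambda into the span of the columns of [C] ([lambda_W]) and makes Delta vanish on all
    combinations of template columns that land in Lambda ([delta_vanish]). Hence, modulo [C], a
    column is determined by its entries outside [X] and a combination of columns of [Y_1]. The
    vertices of the complete graph are therefore the rows outside [X], one vertex per element of
    [Y_1], and one more that makes the coordinate sum zero. The elements of [Y_0] are reached by
    connectivity: they are few, so the others span them; this is why the final connectivity exceeds
    the sizes of all sets [Y_0]. The search is not trusted: its hints and certificates are data that
    Boolean tests recheck. All characteristics are treated at once by comparing bases: a determinant
    is an integer polynomial in the parameter that is zero or has a coefficient 1 or -1. *)

Notation mxcol := Defs.mxcol.
Notation mxrow := Defs.mxrow.

(** * Minors as rank identities, and their duals *)

Lemma contract_rank (M : matroid) (C : {set M}) (X : {set contract C}) :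
  (rank X + rank C = @rank M ((val @: X) :|: C))%N.
Proof.
pose D := delete (C : {set dual M}).
pose im (Y : {set D}) : {set M} := val @: Y.
have im0 (Y : {set D}) : im Y \subset ~: C.
  by apply/subsetP => _ /imsetP[y _ ->]; apply: (valP y).
have imT : im [set: D] = ~: C.
  apply/eqP; rewrite eqEsubset im0; apply/subsetP => x xC.
  by apply/imsetP; exists (Sub x xC); rewrite ?inE.
(* The rank of a contraction unfolds to dual ranks on two levels. Each is used in its additive form,
   which avoids truncated subtraction, and the claim is then linear arithmetic. *)
have E1 := @dual_rank_exact M (~: C); rewrite setCK in E1.
have imC : ~: (im (~: X)) = im X :|: C.
  apply/setP => x; rewrite !inE; have [xC|nxC] /= := boolP (x \in C).
    by rewrite orbT; apply/negP => /(subsetP (im0 _)); rewrite inE xC.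
  have xC : x \in ~: C by rewrite inE.
  pose y : D := Sub x xC; rewrite orbF -[x]/(val y) !(mem_imset _ _ val_inj).
  by rewrite inE negbK.
have E2 := @dual_rank_exact M (im (~: X)); rewrite imC card_imset in E2; last exact: val_inj.
have cX : (#|X| + #|~: X| = #|~: C|)%N.
  by rewrite cardsC -cardsT -imT card_imset //; apply: val_inj.
have E3 := @dual_rank_exact D X.
have e1 : @rank D [set: D] = dual_rank (~: C) by rewrite -imT.
rewrite e1 in E3.
have e3 : @rank D (~: X) = dual_rank (im (~: X)) by [].
rewrite e3 in E3.
change (@dual_rank D X + rank C = @rank M (im X :|: C))%N.
move: E1 E2 cX E3.
set x1 := dual_rank (~: C); set x2 := dual_rank (im _); set x3 := dual_rank (_ : {set D}).
set x4 := #|_|; set x5 := #|_|; set x8 := rank (im X :|: C); set x9 := #|_|.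
lia.
Qed.

(** A minor is encoded by an injection instead of nested subtypes: the elements outside [C] and
    outside the image are the deleted ones. In this form composition, duality and transport of
    minors are rank computations. *)
Lemma has_minorP (M N : matroid) :
  has_minor M N <->
  exists (C : {set M}) (f : N -> M),
    [/\ injective f, forall x, f x \notin C &
        forall X : {set N}, (rank X + rank C = rank ((f @: X) :|: C))%N].
Proof.
split=> [[C [D [g [[g' gK g'K] gr]]]]|[C [f [finj fC fr]]]].
  exists C, (fun x => val (val (g' x))); split.
  - move=> x y /val_inj/val_inj; exact: (can_inj g'K).
  - by move=> x; have := valP (val (g' x)); rewrite inE.
  move=> X; have := gr (g' @: X).
  have -> : g @: (g' @: X) = X.
    rewrite -imset_comp -[RHS]imset_id; apply: eq_imset => x /=; exact: g'K.
  move=> ->; have -> : [set val (val (g' x)) | x in X] = val @: ((val @: (g' @: X)) : {set contract C}).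
    by rewrite -!imset_comp.
  by rewrite -contract_rank.
pose f1 (x : N) : contract C := Sub (f x) (etrans (in_setC _ _) (fC x)).
have f1E x : val (f1 x) = f x by [].
have f1inj : injective f1 by move=> x y /(congr1 val); apply: finj.
pose D : {set contract C} := ~: (f1 @: setT).
have f2P x : f1 x \in ~: D by rewrite setCK imset_f ?inE.
pose f2 (x : N) : delete D := Sub (f1 x) (f2P x).
have f2inj : injective f2 by move=> x y /(congr1 val); apply: f1inj.
have f2s : forall y : delete D, y \in codom f2.
  move=> y; have /imsetP[x _ yx] : val y \in f1 @: setT by move: (valP y); move: (val y) => z; rewrite /D setCK.
  by apply/codomP; exists x; apply: val_inj.
have cardE : (#|delete D| <= #|N|)%N.
  rewrite -(card_codom f2inj); apply/subset_leq_card/subsetP => y _; exact: f2s.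
exists C, D; have [g f2K gK] := inj_card_bij f2inj cardE.
exists g; split; first by exists f2.
move=> X; apply/eqP; rewrite -(eqn_add2r (rank C)) fr.
have -> : rank X = @rank (contract C) (val @: X) by [].
rewrite contract_rank; apply/eqP; congr (rank (_ :|: _)).
rewrite -!imset_comp; apply: eq_imset => y /=.
by rewrite -[in RHS](gK y).
Qed.

Lemma has_minor_trans (M N P : matroid) : has_minor M N -> has_minor N P -> has_minor M P.
Proof.
move=> /has_minorP[C [f [finj fC fr]]] /has_minorP[D [g [ginj gD gr]]].
apply/has_minorP; exists (C :|: f @: D), (f \o g); split; first exact: inj_comp.
  by move=> x; rewrite inE negb_or fC /= mem_imset.
move=> X; have := gr X; have := fr (g @: X :|: D); have := fr D.
rewrite [C :|: _]setUC setUA imset_comp -imsetU; lia.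
Qed.

Lemma miso_minor (M N : matroid) : miso M N -> has_minor M N.
Proof.
case=> f [[g fK gK] fr]; apply/has_minorP; exists set0, g; split; first exact: can_inj gK.
  by move=> x; rewrite inE.
move=> X; rewrite rank0 addn0 setU0 -fr; congr rank.
rewrite -imset_comp -[LHS]imset_id; apply: eq_imset => x; exact/esym/gK.
Qed.

Lemma miso_sym (M N : matroid) : miso M N -> miso N M.
Proof.
case=> f [[g fK gK] fr]; exists g; split; first by exists f.
move=> X; rewrite -fr; congr rank.
rewrite -imset_comp -[RHS]imset_id; apply: eq_imset => x; exact/gK.
Qed.

Lemma dual_dual_rank (M : matroid) (X : {set M}) : @rank (dual (dual M)) X = @rank M X.
Proof.
have e3 : (@dual_rank (dual M) X + @dual_rank M [set: M] = #|X| + @dual_rank M (~: X))%N :=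
  @dual_rank_exact (dual M) X.
have e2 := @dual_rank_exact M (~: X).
have e1 := @dual_rank_exact M [set: M].
rewrite setCK in e2; rewrite setCT rank0 cardsT in e1.
have e4 := cardsC X; change (@dual_rank (dual M) X = @rank M X).
lia.
Qed.

(** Duality exchanges deletion and contraction: the set [D] contracted in the dual is the one
    deleted in [M], the complement of [C] and of the image of [f]. *)
Lemma dual_rank_minor (M N : matroid) (C : {set M}) (f : N -> M) (X : {set N}) :
  injective f -> (forall x, f x \notin C) ->
  (forall X : {set N}, (rank X + rank C = rank ((f @: X) :|: C))%N) ->
  let D := ~: (C :|: f @: [set: N]) in
  (dual_rank X + dual_rank D = dual_rank (f @: X :|: D))%N.
Proof.
move=> finj fC fr D.
have := dual_rank_exact X; have := dual_rank_exact D.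
have := dual_rank_exact (f @: X :|: D).
have -> : ~: (f @: X :|: D) = f @: (~: X) :|: C.
  apply/setP => y; rewrite !inE negb_or negbK.
  have [yC|nyC] /= := boolP (y \in C); last rewrite orbF.
    by rewrite orbT andbT; apply/imsetP => -[x _ yx]; rewrite yx (negPf (fC x)) in yC.
  have [/imsetP[x _ ->]|ny] := boolP (y \in f @: setT).
    by rewrite /= ?orbT ?andbT ?orbF !mem_imset // inE.
  rewrite /= ?andbF ?andbT ?orbF; apply/esym/imsetP => -[x _ yx].
  by rewrite yx imset_f ?inE in ny.
have -> : #|f @: X :|: D| = (#|X| + #|D|)%N.
  rewrite cardsU (_ : _ :&: _ = set0) ?cards0 ?subn0 ?card_imset //.
  apply/setP => y; rewrite !inE; apply/andP => -[/imsetP[x _ ->]].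
  by rewrite imset_f ?orbT // inE.
have -> : ~: D = f @: [set: N] :|: C by rewrite setCK setUC.
have := fr [set: N]; have := fr (~: X); lia.
Qed.

Lemma dual_minor (M N : matroid) : has_minor M N -> has_minor (dual M) (dual N).
Proof.
move=> /has_minorP[C [f [finj fC fr]]]; apply/has_minorP.
exists (~: (C :|: f @: [set: N])), f; split=> //.
  by move=> x; rewrite !inE negb_or negb_and !negbK imset_f ?orbT ?inE.
by move=> X; apply: (@dual_rank_minor M N).
Qed.

(** * Representations by vectors in arbitrary spaces *)

Section Spans.
Variables (F : fieldType).

(** The span behind [col_rank], for vectors of any space: representations may then live in product
    spaces and be pushed through linear maps. *)
Definition sp (vT : vectType F) (E : finType) (phi : E -> vT) (X : {set E}) : {vspace vT} :=
  <<[seq phi e | e in X]>>%VS.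

Variables (vT : vectType F).
Implicit Types (U : {vspace vT}).

Lemma mem_sp (E : finType) (phi : E -> vT) (X : {set E}) e :
  e \in X -> phi e \in sp phi X.
Proof. by move=> eX; apply/memv_span/image_f. Qed.

Lemma spP (E : finType) (phi : E -> vT) (X : {set E}) U :
  reflect (forall e, e \in X -> phi e \in U) (sp phi X <= U)%VS.
Proof.
apply: (iffP span_subvP) => [H e eX | H _ /imageP[e eX ->]]; last exact: H.
exact/H/image_f.
Qed.

Lemma eq_sp (E : finType) (phi psi : E -> vT) (X : {set E}) :
  {in X, phi =1 psi} -> sp phi X = sp psi X.
Proof. by move=> H; congr span; apply/eq_in_map => e; rewrite mem_enum; apply: H. Qed.

Lemma spS (E : finType) (phi : E -> vT) (X Y : {set E}) :
  X \subset Y -> (sp phi X <= sp phi Y)%VS.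
Proof. by move=> sXY; apply/spP => e eX; apply/mem_sp/(subsetP sXY). Qed.

Lemma spU (E : finType) (phi : E -> vT) (X Y : {set E}) :
  sp phi (X :|: Y) = (sp phi X + sp phi Y)%VS.
Proof.
apply/eqP; rewrite eqEsubv subv_add !spS ?subsetUl ?subsetUr //= andbT.
apply/spP => e; rewrite inE => /orP[] eX.
  by apply: (subvP (addvSl _ _)); apply: mem_sp.
by apply: (subvP (addvSr _ _)); apply: mem_sp.
Qed.

Lemma sp_imset (E E' : finType) (phi : E -> vT) (f : E' -> E) (X : {set E'}) :
  sp phi (f @: X) = sp (phi \o f) X.
Proof.
apply/eqP; rewrite eqEsubv; apply/andP; split; apply/spP => e.
  by case/imsetP=> x xX ->; apply: (mem_sp (phi \o f)).
by move=> eX; apply: (mem_sp phi); apply: imset_f.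
Qed.

Lemma sp_scale (E : finType) (phi psi : E -> vT) (c : E -> F) (X : {set E}) :
  (forall e, e \in X -> c e != 0 /\ phi e = c e *: psi e) -> sp phi X = sp psi X.
Proof.
move=> H; apply/eqP; rewrite eqEsubv; apply/andP; split; apply/spP => e eX.
  by have [_ ->] := H e eX; apply/memvZ/mem_sp.
have [c0 E1] := H e eX; rewrite -[psi e](scalerK c0) -E1.
exact/memvZ/mem_sp.
Qed.

Lemma sp_lin (wT : vectType F) (T : 'Hom(vT, wT)) (E : finType) (phi : E -> vT) (X : {set E}) :
  sp (T \o phi) X = (T @: sp phi X)%VS.
Proof. by rewrite limg_span -map_comp. Qed.

Definition represents (M : matroid) (phi : M -> vT) :=
  forall X : {set M}, \dim (sp phi X) = rank X.

Lemma linear_Hom (wT : vectType F) (f : vT -> wT) :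
  linear f -> exists T : 'Hom(vT, wT), T =1 f.
Proof.
move=> fl; exists (linfun (HB.pack f (GRing.isLinear.Build _ _ _ _ f fl) : {linear vT -> wT})).
by move=> v; rewrite lfunE.
Qed.

(** Replaces the quotient by [U]: applying a map with kernel [U] contracts elements that span [U],
    and no quotient space has to be built. *)
Lemma exists_lker U : exists T : 'End(vT), lker T = U.
Proof.
exists (\1 - projv U)%VF; apply/vspaceP => v; rewrite memv_ker.
rewrite add_lfunE opp_lfunE id_lfunE subr_eq0; apply/eqP/idP => [-> | /projv_id -> //].
exact: memv_proj.
Qed.

End Spans.

Section Representations.
Variables (F : fieldType).

Lemma represents_representable (vT : vectType F) (M : matroid) (phi : M -> vT) :
  represents phi -> representable F M.
Proof.
move=> rep; pose b := vbasis {:vT}.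
pose T0 (v : vT) : fvec F 'I_(\dim {:vT}) := [ffun i => coord b i v].
have T0l : linear T0.
  by move=> c u v; apply/ffunP => i; rewrite !ffunE linearP.
have [T TE] := linear_Hom T0l.
exists (\dim {:vT}), (fun i e => coord b i (phi e)) => X.
rewrite -rep; transitivity (\dim (T @: sp phi X)%VS); last apply: limg_dim_eq.
  rewrite -sp_lin; congr (\dim _); apply: eq_sp => e _ /=.
  by rewrite TE.
apply/eqP; rewrite -subv0; apply/subvP => v /memv_capP[_]; rewrite memv_ker TE => /eqP T0v.
rewrite memv0 (coord_vbasis (memvf v)) big1 // => i _.
by have /ffunP/(_ i) := T0v; rewrite !ffunE -/b => ->; rewrite scale0r.
Qed.

Lemma representableP (M : matroid) : representable F M ->
  exists r (A : 'I_r -> M -> F), represents (mxcol A).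
Proof. by case=> r [A H]; exists r, A. Qed.

(** On the span of [Y :|: C] the kernel of [T] is exactly the span of [C], so rank and nullity of
    [T] give the rank in the contraction. *)
Lemma represents_minor_rank (vT wT : vectType F) (M : matroid) (phi : M -> vT)
    (T : 'Hom(vT, wT)) (C Y : {set M}) :
  represents phi -> (sp phi C <= lker T)%VS ->
  (sp phi (Y :|: C) :&: lker T <= sp phi C)%VS ->
  (\dim (T @: sp phi Y) + rank C = rank (Y :|: C))%N.
Proof.
move=> rep sC sY; have -> : (T @: sp phi Y = T @: sp phi (Y :|: C))%VS.
  rewrite spU limgD.
  have -> : (T @: sp phi C = 0)%VS.
    apply/eqP; rewrite -subv0; apply/subvP => _ /memv_imgP[v vC ->].
    by rewrite memv0 -memv_ker (subvP sC).
  by rewrite addv0.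
rewrite -!rep addnC -[RHS](limg_ker_dim T); congr (\dim _ + _)%N.
apply/eqP; rewrite eqEsubv sY subv_cap sC spS ?andbT //; exact: subsetUr.
Qed.

(** The criterion by which certificates produce minors: [T] realises the contraction of [C] and
    sends the chosen elements to nonzero multiples of a representation of [N]. *)
Lemma linear_minor (vT wT : vectType F) (M N : matroid) (phi : M -> vT) (psi : N -> wT)
    (T : 'Hom(vT, wT)) (C : {set M}) (f : N -> M) (c : N -> F) :
  represents phi -> represents psi -> injective f -> (forall x, f x \notin C) ->
  (forall x, c x != 0 /\ T (phi (f x)) = c x *: psi x) ->
  (sp phi C <= lker T)%VS ->
  (sp phi ((f @: setT) :|: C) :&: lker T <= sp phi C)%VS ->
  has_minor M N.
Proof.
move=> rM rN finj fC Tf sC sK; apply/has_minorP; exists C, f; split=> // X.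
rewrite -(represents_minor_rank rM sC).
  rewrite -rN sp_imset -sp_lin; congr (\dim _ + _)%N.
  by apply/esym/(@sp_scale _ _ _ _ _ c) => e _; apply: Tf.
apply: subv_trans sK; apply: capvS => //; apply: spS; apply: setSU; exact/imsetS/subsetT.
Qed.

Lemma representable_minor (M N : matroid) :
  has_minor M N -> representable F M -> representable F N.
Proof.
move=> /has_minorP[C [f [finj fC fr]]] /representableP[r [A rep]].
have [T TK] := exists_lker (sp (mxcol A) C).
apply: (@represents_representable _ _ (T \o (mxcol A \o f))) => X.
rewrite sp_lin -sp_imset; apply/eqP; rewrite -(eqn_add2r (rank C)) fr.
by rewrite (represents_minor_rank rep) ?TK // capvSr.
Qed.

Lemma representable_miso (M N : matroid) : miso M N -> representable F M -> representable F N.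
Proof. by move/miso_minor/representable_minor. Qed.

End Representations.

(** * Row spaces, column ranks and orthogonal complements *)

Section RowColumn.
Variable F : fieldType.

Lemma memv_sp_sum (vT : vectType F) (E : finType) (phi : E -> vT) (k : E -> F) (X : {set E}) :
  \sum_(e in X) k e *: phi e \in sp phi X.
Proof. by apply: memv_suml => e eX; apply/memvZ/mem_sp. Qed.

(** Expanding each column in a basis of the column space factors the matrix, so every row is a
    combination of that many vectors. Applied to the transpose as well, this gives equality. *)
Lemma row_rank_le (B E : finType) (A : B -> E -> F) :
  (\dim (sp (mxrow A) [set: B]) <= \dim (sp (mxcol A) [set: E]))%N.
Proof.
set U := sp (mxcol A) _; pose w := vbasis U.
pose y (k : 'I_(\dim U)) : fvec F E := [ffun e => coord w k (mxcol A e)].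
have AE b e : A b e = \sum_(k < \dim U) (w`_k) b * y k e.
  have /coord_vbasis/ffunP/(_ b) : mxcol A e \in U by apply: mem_sp; rewrite inE.
  rewrite ffunE => ->; rewrite sum_ffunE; apply: eq_bigr => k _.
  by rewrite !ffunE mulrC.
have /dimvS : (sp (mxrow A) [set: B] <= sp y [set: 'I_(\dim U)])%VS.
  apply/spP => b _; have -> : mxrow A b = \sum_(k in [set: 'I_(\dim U)]) (w`_k) b *: y k.
    apply/ffunP => e; rewrite ffunE AE sum_ffunE; apply: eq_big => k; first by rewrite inE.
    by rewrite !ffunE.
  exact: memv_sp_sum.
move/leq_trans; apply; rewrite (leq_trans (dim_span _)) // size_image cardsT card_ord //.
Qed.

Lemma row_col_rank (B E : finType) (A : B -> E -> F) :
  \dim (sp (mxrow A) [set: B]) = \dim (sp (mxcol A) [set: E]).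
Proof.
by apply/eqP; rewrite eqn_leq row_rank_le (row_rank_le (fun e b => A b e)).
Qed.

(* The rank function of the matroid represented by a subspace of F^E. *)
Definition rk (E : finType) (U : {vspace fvec F E}) (X : {set E}) : nat :=
  \dim (linfun (@fres F E X) @: U)%VS.

(** The rank of a set of columns depends only on the row space; this links [col_matroid] with
    matroids given by subspaces. *)
Lemma col_rank_rk (B E : finType) (A : B -> E -> F) (X : {set E}) :
  col_rank A X = rk (sp (mxrow A) [set: B]) X.
Proof.
pose A' (b : B) (x : {x : E | x \in X}) := A b (val x).
have := row_col_rank A'; rewrite /rk -sp_lin.
have -> : sp (mxrow A') [set: B] = sp (linfun (@fres F E X) \o mxrow A) [set: B].
  by apply: eq_sp => b _ /=; rewrite lfunE; apply/ffunP => x; rewrite !ffunE.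
move=> ->; rewrite -[col_rank A X]/(\dim (sp (mxcol A) X)).
congr (\dim _); apply/eqP; rewrite eqEsubv; apply/andP; split; apply/spP.
  move=> e eX; have -> : mxcol A e = mxcol A' (Sub e eX) by apply/ffunP => b; rewrite !ffunE.
  by apply: mem_sp; rewrite inE.
move=> x _; have -> : mxcol A' x = mxcol A (val x) by apply/ffunP => b; rewrite !ffunE.
exact/mem_sp/valP.
Qed.

Lemma rk_ker (E : finType) (U : {vspace fvec F E}) (X : {set E}) :
  (\dim (U :&: lker (linfun (@fres F E X))) + rk U X = \dim U)%N.
Proof. exact: limg_ker_dim. Qed.

Lemma mem_ker_fres (E : finType) (X : {set E}) (v : fvec F E) :
  reflect (forall e, e \in X -> v e = 0) (v \in lker (linfun (@fres F E X))).
Proof.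
rewrite memv_ker lfunE /=; apply: (iffP eqP) => [/ffunP H e eX | H].
  by have := H (Sub e eX); rewrite !ffunE.
by apply/ffunP => x; rewrite !ffunE H //; apply: valP.
Qed.

Lemma dim_fvec (E : finType) : \dim {: fvec F E} = #|E|.
Proof. by rewrite dimvf /dim /= muln1. Qed.

Lemma sp_vbasis (vT : vectType F) (U : {vspace vT}) :
  sp (fun i : 'I_(\dim U) => tnth (vbasis U) i) setT = U.
Proof.
apply/eqP; rewrite eqEsubv; apply/andP; split.
  by apply/spP => i _; apply: vbasis_mem; apply: mem_tnth.
apply/subvP => v /coord_vbasis ->; apply: memv_suml => i _; apply: memvZ.
by rewrite -tnth_nth; apply: (mem_sp (fun i => tnth (vbasis U) i)); rewrite inE.
Qed.

Lemma dotfC (E : finType) (u v : fvec F E) : dotf u v = dotf v u.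
Proof. by apply: eq_bigr => e _; rewrite mulrC. Qed.

Lemma dim_orthv (E : finType) (U : {vspace fvec F E}) : (\dim (orthv U) + \dim U = #|E|)%N.
Proof.
pose A (i : 'I_(\dim U)) (e : E) : F := tnth (vbasis U) i e.
have rowA i : mxrow A i = tnth (vbasis U) i by apply/ffunP => e; rewrite ffunE.
pose L0 (v : fvec F E) : fvec F 'I_(\dim U) := [ffun i => dotf (mxrow A i) v].
have L0l : linear L0.
  by move=> c u v; apply/ffunP => i; rewrite !ffunE linearP.
have [L LE] := linear_Hom L0l.
have kL : lker L = orthv U.
  apply/vspaceP => v; rewrite memv_ker LE; apply/eqP/memv_orthv => [/ffunP H u | H].
    move=> /coord_vbasis ->; rewrite dotfC linear_sum big1 // => i _.
    rewrite linearZ /= dotfC -tnth_nth -rowA; have := H i; rewrite !ffunE => ->.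
    exact: scaler0.
  by apply/ffunP => i; rewrite !ffunE; apply: H; rewrite rowA; apply/vbasis_mem/mem_tnth.
have lL : (L @: fullv)%VS = sp (mxcol A) setT.
  apply/eqP; rewrite eqEsubv; apply/andP; split; last first.
    apply/spP => e _; apply/memv_imgP; exists [ffun x => (x == e)%:R : F^o]; first exact: memvf.
    rewrite LE; apply/ffunP => i; rewrite !ffunE /dotf (bigD1 e) //= !ffunE eqxx mulr1.
    by rewrite big1 ?addr0 // => x /negPf xe; rewrite ffunE xe mulr0.
  apply/subvP => _ /memv_imgP[v _ ->]; rewrite LE.
  have -> : L0 v = \sum_(e in [set: E]) v e *: mxcol A e.
    apply/ffunP => i; rewrite ffunE sum_ffunE; apply: eq_big => e; first by rewrite inE.
    by rewrite !ffunE mulrC.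
  exact: memv_sp_sum.
have := limg_ker_dim L fullv; rewrite capfv kL lL dim_fvec -row_col_rank.
by have -> : sp (mxrow A) setT = U by rewrite -[RHS]sp_vbasis; apply: eq_sp => i _.
Qed.

Lemma orthvK (E : finType) (U : {vspace fvec F E}) : orthv (orthv U) = U.
Proof.
apply/esym/eqP; rewrite eqEdim; apply/andP; split; last first.
  by have := dim_orthv U; have := dim_orthv (orthv U); lia.
apply/subvP => u uU; apply/memv_orthv => v /memv_orthv H; rewrite dotfC; exact: H.
Qed.

(** The vectors orthogonal to the restriction of [orthv U] to [X], extended by zero, are exactly the
    vectors of [U] that vanish off [X]. Counting dimensions gives the rank formula of the dual. *)
Lemma rk_orthv (E : finType) (U : {vspace fvec F E}) (X : {set E}) :
  (rk (orthv U) X + \dim U = #|X| + rk U (~: X))%N.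
Proof.
pose G := {x : E | x \in X}.
pose x0 (w : fvec F G) : fvec F E := [ffun e => oapp w 0 (insub e)].
have x0l : linear x0.
  move=> c u v; apply/ffunP => e; rewrite !ffunE; case: (insub e) => [x|] /=; first by rewrite !ffunE.
  by rewrite scaler0 addr0.
have [T TE] := linear_Hom x0l.
have x0in (w : fvec F G) (x : G) : x0 w (val x) = w x by rewrite ffunE valK.
have x0out (w : fvec F G) e : e \notin X -> x0 w e = 0 by move=> eX; rewrite ffunE insubN.
have dotx (w : fvec F G) (v : fvec F E) : dotf v (x0 w) = dotf (fres X v) w.
  rewrite /dotf (bigID (mem X)) /= [X in _ + X]big1 => [|e eX]; last by rewrite x0out ?mulr0.
  rewrite addr0 (reindex_omap (val : G -> E) insub) /=; last first.
    by move=> e eX; rewrite insubT.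
  by apply: eq_big => [x|x _]; rewrite ?x0in ?ffunE // valK eqxx (valP x).
set V := (linfun (fres X) @: orthv U)%VS.
have VE : (T @: orthv V)%VS = (U :&: lker (linfun (@fres F E (~: X))))%VS.
  apply/vspaceP => v; rewrite memv_cap; apply/memv_imgP/andP => [[w /memv_orthv wV ->]|[vU /mem_ker_fres vX]].
    rewrite TE; split.
      rewrite -(orthvK U); apply/memv_orthv => u uU; rewrite dotx; apply: wV.
      by rewrite -[fres X u](lfunE (@fres F E X)); apply: memv_img.
    by apply/mem_ker_fres => e; rewrite inE => /x0out.
  have vE : v = x0 (fres X v).
    apply/ffunP => e; have [eX|eX] := boolP (e \in X).
      by rewrite -[e]/(val (Sub e eX : G)) x0in ffunE.
    by rewrite x0out // vX // inE.
  exists (fres X v); last by rewrite TE.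
  apply/memv_orthv => _ /memv_imgP[u uU ->]; rewrite lfunE /= -dotx -vE dotfC.
  by move/memv_orthv: uU; apply.
have dT : \dim (T @: orthv V) = \dim (orthv V).
  apply: limg_dim_eq; apply/eqP; rewrite -subv0; apply/subvP => w /memv_capP[_].
  rewrite memv_ker TE memv0 => /eqP/ffunP w0; apply/eqP/ffunP => x.
  by rewrite -x0in w0 !ffunE.
have := rk_ker U (~: X); rewrite -VE dT; have := dim_orthv V; rewrite card_sig.
have -> : #|[pred x in X]| = #|X| by apply: eq_card.
rewrite /rk -/V; lia.
Qed.

End RowColumn.

Section ChangeOfField.

Lemma sp_mxcol_sub (F : fieldType) (B E : finType) (A : B -> E -> F) (X : {set E}) :
  sp (mxcol A) X = sp (mxcol (fun b (x : {x : E | x \in X}) => A b (val x))) setT.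
Proof.
pose A' (b : B) (x : {x : E | x \in X}) := A b (val x).
rewrite -/A'; apply/eqP; rewrite eqEsubv; apply/andP; split; apply/spP.
  move=> e eX; have -> : mxcol A e = mxcol A' (Sub e eX) by apply/ffunP => b; rewrite !ffunE.
  by apply: mem_sp; rewrite inE.
move=> x _; have -> : mxcol A' x = mxcol A (val x) by apply/ffunP => b; rewrite !ffunE.
exact/mem_sp/valP.
Qed.

Lemma dim_sp_mxrank (F : fieldType) (B E : finType) (A : B -> E -> F) :
  \dim (sp (mxcol A) setT) = \rank (\matrix_(i < #|E|, j < #|B|) A (enum_val j) (enum_val i)).
Proof.
set Q := \matrix_(i, j) _; apply/eqP; rewrite eqn_leq; apply/andP; split.
  pose w (k : 'I_(\rank Q)) : fvec F B := [ffun b => row_base Q k (enum_rank b)].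
  have /dimvS/leq_trans : (sp (mxcol A) setT <= sp w setT)%VS.
    apply/spP => e _.
    have -> : mxcol A e = \sum_(k in setT) col_base Q (enum_rank e) k *: w k.
      apply/ffunP => b; rewrite ffunE sum_ffunE.
      have -> : A b e = Q (enum_rank e) (enum_rank b) by rewrite mxE !enum_rankK.
      rewrite -{1}(mulmx_base Q) mxE; apply: eq_big => k; first by rewrite inE.
      by rewrite !ffunE.
    exact: memv_sp_sum.
  by apply; rewrite (leq_trans (dim_span _)) // size_image cardsT card_ord.
set U := sp _ _; pose w := vbasis U.
pose L : 'M[F]_(#|E|, \dim U) := \matrix_(i, k) coord w k (mxcol A (enum_val i)).
pose R : 'M[F]_(\dim U, #|B|) := \matrix_(k, j) (w`_k) (enum_val j).
have -> : Q = L *m R.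
  apply/matrixP => i j; rewrite !mxE.
  have /coord_vbasis/ffunP/(_ (enum_val j)) : mxcol A (enum_val i) \in U by apply: mem_sp; rewrite inE.
  rewrite ffunE => ->; rewrite sum_ffunE; apply: eq_bigr => k _.
  by rewrite !ffunE !mxE.
exact: leq_trans (mxrankM_maxr _ _) (rank_leq_row _).
Qed.

Lemma col_rank_map (F1 F2 : fieldType) (s : {rmorphism F1 -> F2}) (B E : finType)
    (A : B -> E -> F1) (X : {set E}) :
  col_rank (fun b e => s (A b e)) X = col_rank A X.
Proof.
transitivity (\dim (sp (mxcol (fun b e => s (A b e))) X)); first by [].
transitivity (\dim (sp (mxcol A) X)); last by [].
rewrite (sp_mxcol_sub A) (sp_mxcol_sub (fun b e => s (A b e))).
rewrite !dim_sp_mxrank -(mxrank_map s); congr mxrank.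
by apply/matrixP => i j; rewrite !mxE.
Qed.

Fact to_regular_is_zmod_morphism (F : fieldType) : zmod_morphism (fun x : F => x : F^o).
Proof. by []. Qed.
Fact to_regular_is_monoid_morphism (F : fieldType) : monoid_morphism (fun x : F => x : F^o).
Proof. by []. Qed.

(** Coordinates of vectors in [fvec F E] have type [F^o], so [underlying] is a column matroid over
    [F^o]; the identity from [F] is a ring morphism, and ranks are invariant under those. *)
Lemma col_rank_regular (F : fieldType) (B E : finType) (A : B -> E -> F) (X : {set E}) :
  @col_rank F^o B E A X = @col_rank F B E A X.
Proof.
pose s : F -> F^o := fun x => x.
pose s1 : {rmorphism F -> F^o} := HB.pack s
  (GRing.isZmodMorphism.Build _ _ s (@to_regular_is_zmod_morphism F))
  (GRing.isMonoidMorphism.Build _ _ s (@to_regular_is_monoid_morphism F)).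
exact: (col_rank_map s1 A X).
Qed.

End ChangeOfField.

(** * Represented matroids, their minors and duals *)

Section Underlying.
Variable F : fieldType.

Lemma underlying_rank (M : rmatroid F) (X : {set rground M}) :
  @rank (underlying M) X = rk (rspace M) X.
Proof.
pose A (i : 'I_(\dim (rspace M))) (e : rground M) : F := tnth (vbasis (rspace M)) i e.
have rE : sp (mxrow A) setT = rspace M.
  by rewrite -[RHS]sp_vbasis; apply: eq_sp => i _; apply/ffunP => e; rewrite ffunE.
by change (@col_rank F^o _ _ A X = rk (rspace M) X); rewrite col_rank_regular col_rank_rk rE.
Qed.

Lemma rmx_rank (B E : finType) (A : B -> E -> F) (X : {set E}) :
  @rank (underlying (rmx A)) X = col_rank A X.
Proof.
rewrite underlying_rank col_rank_rk; congr (rk _ X); rewrite /sp /=.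
by congr span; rewrite /image_mem; congr map; apply: eq_enum => b; rewrite !inE.
Qed.

Lemma underlying_dual (M : rmatroid F) (X : {set rground M}) :
  @rank (underlying (rdual M)) X = @rank (dual (underlying M)) X.
Proof.
have e1 : (@dual_rank (underlying M) X + @rank (underlying M) [set: rground M]
  = #|X| + @rank (underlying M) (~: X))%N := @dual_rank_exact (underlying M) X.
change (@rank (underlying (rdual M)) X = @dual_rank (underlying M) X).
move: e1; rewrite !underlying_rank.
have := rk_orthv (rspace M) X; have := rk_ker (rspace M) [set: rground M].
have -> : (rspace M :&: lker (linfun (@fres F _ [set: rground M])) = 0)%VS.
  apply/eqP; rewrite -subv0; apply/subvP => v /memv_capP[_ /mem_ker_fres H].
  by rewrite memv0; apply/eqP/ffunP => e; rewrite H ?inE // ffunE.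
rewrite dimv0 /= add0n => ->.
set a := rk _ X; set b := rk _ (~: X); set c := dual_rank _; set e := #|X|.
lia.
Qed.

(** Both ranks are codimensions of subspaces of vectors that vanish on a set. Restriction to [S]
    maps one such subspace onto the other, and its kernel consists of the vectors vanishing on [S]
    in either case. *)
Lemma underlying_restrict (M : rmatroid F) (S : {set rground M}) (X : {set rground (rrestrict S)}) :
  @rank (underlying (rrestrict S)) X = @rank (@restrict (underlying M) S) X.
Proof.
rewrite underlying_rank -[RHS]/(@rank (underlying M) (val @: X)) underlying_rank.
apply/eqP; rewrite -(eqn_add2l (\dim (rspace M :&: lker (linfun (@fres F _ (val @: X)))))).
rewrite rk_ker.
have e1 := rk_ker (rspace (rrestrict S)) X.
have e2 : rk (rspace M) S = \dim (rspace (rrestrict S)) by [].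
have e3 := rk_ker (rspace M) S.
have k1 := limg_ker_dim (linfun (@fres F _ S)) (rspace M :&: lker (linfun (@fres F _ (val @: X)))).
have k2 : (rspace M :&: lker (linfun (@fres F _ (val @: X))) :&: lker (linfun (@fres F _ S))
   = rspace M :&: lker (linfun (@fres F _ S)))%VS.
  apply/vspaceP => v; rewrite !memv_cap -andbA; congr (_ && _).
  apply/andP/idP => [[]//|H]; split=> //; apply/mem_ker_fres => _ /imsetP[x _ ->].
  by move/mem_ker_fres: H; apply; apply: valP.
have k3 : (linfun (@fres F _ S) @: (rspace M :&: lker (linfun (@fres F _ (val @: X))))
   = rspace (rrestrict S) :&: lker (linfun (@fres F _ X)))%VS.
  apply/vspaceP => w; rewrite memv_cap.
  apply/memv_imgP/andP => [[v /memv_capP[vM /mem_ker_fres vX] ->]|[/memv_imgP[v vM ->] /mem_ker_fres wX]].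
    split; first exact: memv_img.
    by apply/mem_ker_fres => x xX; rewrite lfunE /= ffunE vX ?imset_f.
  exists v => //; rewrite memv_cap vM; apply/mem_ker_fres => _ /imsetP[x xX ->].
  by have := wX x xX; rewrite lfunE /= ffunE.
rewrite k2 k3 in k1; apply/eqP.
move: e1 e2 e3 k1; set a := rk _ X; set b := \dim _; set c := \dim _.
lia.
Qed.

End Underlying.

Section RepresentedMinors.
Variable F : fieldType.
Implicit Type M : rmatroid F.

Lemma riso_miso M N : riso M N -> miso (underlying M) (underlying N).
Proof.
case=> f [d [bf d0 fE]]; exists f; split=> // X.
change (@rank (underlying N) (f @: X) = @rank (underlying M) X).
have [g fK gK] := bf.
pose t (v : fvec F (rground N)) : fvec F (rground M) := [ffun e => d e * v (f e)].
have tl : linear t.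
  by move=> c u v; apply/ffunP => e; rewrite !ffunE mulrDr mulrCA.
have [T TE] := linear_Hom tl.
have T0 : (lker T = 0)%VS.
  apply/eqP; rewrite -subv0; apply/subvP => v; rewrite memv_ker TE memv0 => /eqP/ffunP v0.
  apply/eqP/ffunP => x; have /eqP := v0 (g x).
  by rewrite !ffunE gK mulf_eq0 (negPf (d0 _)) /= => /eqP.
have surj (w : fvec F (rground M)) : exists v, w = T v.
  exists [ffun x => (d (g x))^-1 * w (g x)]; rewrite TE; apply/ffunP => e.
  by rewrite !ffunE fK mulrA mulfV ?mul1r.
have TU : (T @: rspace N = rspace M)%VS.
  apply/vspaceP => w; have [v ->] := surj w; apply/memv_imgP/idP => [[u uN]|vM].
    rewrite !TE => ->; by rewrite -fE.
  by exists v => //; rewrite fE -/(t v) -TE.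
have dT (U : {vspace fvec F (rground N)}) : \dim (T @: U)%VS = \dim U.
  by apply: limg_dim_eq; rewrite T0 capv0.
have e1 := rk_ker (rspace N) (f @: X); have e2 := rk_ker (rspace M) X.
rewrite !underlying_rank.
have e3 : (T @: (rspace N :&: lker (linfun (@fres F _ (f @: X)))) =
    rspace M :&: lker (linfun (@fres F _ X)))%VS.
  apply/vspaceP => w; have [v ->] := surj w; rewrite memv_cap.
  have mE : (T v \in T @: rspace N)%VS = (v \in rspace N).
    by rewrite TU fE -/(t v) -TE.
  apply/memv_imgP/andP => [[u /memv_capP[uN uk] Tuv]|[vM /mem_ker_fres vk]].
    have uv : v = u.
      apply/eqP; rewrite -subr_eq0 -memv0 -T0 memv_ker linearB /= Tuv subrr.
      by [].
    rewrite uv -TU memv_img //; split=> //; apply/mem_ker_fres => e eX.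
    by rewrite TE ffunE (mem_ker_fres _ _ uk) ?mulr0 ?imset_f.
  exists v => //; rewrite memv_cap -mE TU vM; apply/mem_ker_fres => _ /imsetP[e eX ->].
  have /eqP := vk e eX; rewrite TE ffunE mulf_eq0 (negPf (d0 e)) /= => /eqP //.
have e4 := dT (rspace N); have e5 := dT (rspace N :&: lker (linfun (@fres F _ (f @: X))))%VS.
rewrite TU in e4; rewrite e3 in e5; apply/eqP.
by rewrite -(eqn_add2l (\dim (rspace M :&: lker (linfun (@fres F _ X))))) e2 e5 e1 e4.
Qed.

Lemma rdelete_minor M (D : {set rground M}) : has_minor (underlying M) (underlying (rdelete D)).
Proof.
apply/has_minorP; exists set0, (fun x => val x); split; first exact: val_inj.
  by move=> x; rewrite inE.
by move=> X; rewrite rank0 addn0 setU0; apply: (underlying_restrict X).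
Qed.

Lemma rcontract_rank M (C : {set rground M}) (X : {set rground (rcontract C)}) :
  (@rank (underlying (rcontract C)) X + @rank (underlying M) C
   = @rank (underlying M) (val @: X :|: C))%N.
Proof.
have := @contract_rank (underlying M) C X.
suff -> : @rank (underlying (rcontract C)) X = @rank (@contract (underlying M) C) X by [].
rewrite underlying_dual.
change (@dual_rank (underlying (@rdelete _ (rdual M) C)) X
  = @dual_rank (delete (C : {set dual (underlying M)})) X).
rewrite /dual_rank.
have H Y : @rank (underlying (@rdelete _ (rdual M) C)) Y = @rank (delete (C : {set dual (underlying M)})) Y.
  rewrite [LHS](@underlying_restrict _ (rdual M)).
  exact: underlying_dual.
by rewrite !H.
Qed.

Lemma rcontract_minor M (C : {set rground M}) : has_minor (underlying M) (underlying (rcontract C)).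
Proof.
apply/has_minorP; exists C, (fun x => val x); split; first exact: val_inj.
  by move=> x; have := valP x; rewrite inE.
by move=> X; apply: rcontract_rank.
Qed.

Lemma minor_closed_no_minor (L : seq matroid) :
  minor_closed (fun M => no_minor_in L (underlying M)).
Proof.
split.
- move=> M N /riso_miso/miso_minor MN H P PL NP; apply: (H P PL).
  exact: has_minor_trans MN NP.
- by move=> M D H P PL NP; apply: (H P PL); apply: has_minor_trans NP; apply: rdelete_minor.
- by move=> M C H P PL NP; apply: (H P PL); apply: has_minor_trans NP; apply: rcontract_minor.
Qed.

Lemma rminor_rank M (C D : {set rground M}) (X : {set rground (rminor C D)}) :
  (@rank (underlying (rminor C D)) X + @rank (underlying M) C
   = @rank (underlying M) ([set val (val x) | x in X] :|: C))%N.
Proof.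
rewrite [X in (X + _)%N](@underlying_restrict _ (rcontract C)).
by rewrite [X in (X + _)%N = _](_ : _ = @rank (underlying (rcontract C)) (val @: X)) // rcontract_rank -imset_comp.
Qed.

Section OfMatrix.
Variables (B E : finType) (A : B -> E -> F) (C D : {set E}).

Lemma rmx_represents : represents (vT := fvec F B) (M := underlying (rmx A)) (mxcol A).
Proof. by move=> X; rewrite rmx_rank. Qed.

Lemma rminor_represents (wT : vectType F) (T : 'Hom(fvec F B, wT)) :
  lker T = sp (mxcol A) C ->
  represents (M := underlying (@rminor F (rmx A) C D)) (fun x => T (mxcol A (val (val x)))).
Proof.
move=> kT X; apply/eqP; rewrite -(eqn_add2r (@rank (underlying (rmx A)) C)).
rewrite rminor_rank -(represents_minor_rank rmx_represents (T := T)) ?kT ?capvSr //.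
rewrite -sp_lin sp_imset; apply/eqP; congr (\dim _ + _)%N.
Qed.

(** The analogue of [linear_minor] for a minor of [rmx A] with a further set [C1] contracted.
    Everything is stated on the columns of [A], so that the subtypes of the minor stay hidden from
    later constructions. *)
Lemma rminor_linear (wT : vectType F) (T : 'Hom(fvec F B, wT)) (C1 : {set E})
    (N : matroid) (psi : N -> wT) (f : N -> E) (c : N -> F) :
  represents psi -> injective f -> (forall x, f x \notin C :|: D :|: C1) ->
  [disjoint C1 & C :|: D] ->
  (forall x, c x != 0 /\ T (mxcol A (f x)) = c x *: psi x) ->
  (sp (mxcol A) (C :|: C1) <= lker T)%VS ->
  (sp (mxcol A) (f @: setT :|: (C :|: C1)) :&: lker T <= sp (mxcol A) (C :|: C1))%VS ->
  has_minor (underlying (@rminor F (rmx A) C D)) N.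
Proof.
move=> rN finj fCD dC1 Tf kT sK.
set G := rground (@rminor F (rmx A) C D).
have inG e : e \notin C :|: D -> exists x : G, val (val x) = e.
  rewrite inE negb_or => /andP[eC eD].
  have eC' : e \in ~: C by rewrite inE.
  pose y : rground (@rcontract F (rmx A) C) := Sub e eC'.
  have yD : y \in ~: [set x | val x \in D] by rewrite !inE.
  by exists (Sub y yD).
have fG x : exists y : G, val (val y) == f x.
  by have [|y <-] := inG (f x); [have := fCD x; rewrite inE negb_or => /andP[] | exists y].
pose f' x := xchoose (fG x).
have f'E x : val (val (f' x)) = f x by apply/eqP/(xchooseP (fG x)).
pose C' : {set G} := [set x | val (val x) \in C1].
have imC' : [set val (val x) | x in C'] = C1.
  apply/setP => e; apply/imsetP/idP => [[x + ->]|eC]; first by rewrite inE.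
  have [|x xe] := inG e; first by rewrite (disjointFr dC1).
  by exists x; rewrite ?inE xe.
apply/has_minorP; exists C', f'; split.
- by move=> x y /(congr1 (fun z => val (val z))); rewrite !f'E => /finj.
- by move=> x; rewrite inE f'E; have := fCD x; rewrite inE negb_or => /andP[].
move=> X.
have e1 := rminor_rank C'; have e2 := rminor_rank (f' @: X :|: C').
have imX : [set val (val x) | x in f' @: X :|: C'] = f @: X :|: C1.
  rewrite imsetU imC' -imset_comp; congr (_ :|: _); apply: eq_imset => x /=; exact: f'E.
have e3 := @represents_minor_rank F (fvec F B) wT (underlying (rmx A)) (mxcol A) T (C :|: C1) (f @: X) rmx_represents kT.
have e4 : \dim (T @: sp (mxcol A) (f @: X)) = rank X.
  rewrite -rN sp_imset -sp_lin; congr (\dim _).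
  by apply/(@sp_scale _ _ _ _ _ c) => e _; apply: Tf.
rewrite e4 in e3; rewrite imX in e2; rewrite imC' in e1.
have {}e3 := e3 (subv_trans (capvS (spS (mxcol A) (setSU _ (imsetS _ (subsetT X)))) (subvv _)) sK).
move: e1 e2 e3.
rewrite -[f @: X :|: C1 :|: C]setUA [C1 :|: C]setUC.
set a := @rank (underlying (rmx A)) C; set b := @rank (underlying (rmx A)) (C :|: C1).
set d := @rank (underlying (rmx A)) (_ :|: (_ :|: _)).
move=> {}e1 {}e2 {}e3; apply/eqP; rewrite -(eqn_add2r a) -addnA e1 e3.
exact/eqP/esym.
Qed.
End OfMatrix.
End RepresentedMinors.

Section DualRepresentable.

Lemma representable_dual (F : fieldType) (M : matroid) : representable F M -> representable F (dual M).
Proof.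
case=> r [A rA].
apply: (@representable_miso _ (underlying (rdual (rmx A)))).
  exists id; split; first by exists id.
  move=> X; rewrite imset_id; apply/esym.
  change (@rank (underlying (rdual (rmx A))) X = @dual_rank M X).
  rewrite underlying_dual.
  change (@dual_rank (underlying (rmx A)) X = @dual_rank M X).
  rewrite /dual_rank !rmx_rank !rA //.
have [r' [A' H]] : representable F^o (underlying (rdual (rmx A))) by eexists; eexists => X; reflexivity.
exists r', A' => X; rewrite -H; exact/esym/col_rank_regular.
Qed.

Lemma SL4_minor (K : fieldType) (M N : matroid) : has_minor M N -> SL4 K M -> SL4 K N.
Proof.
move=> MN [rK [q [pq H]]]; split; first exact: representable_minor MN rK.
by exists q; split=> // F qF; apply: representable_minor MN (H F qF).
Qed.

Lemma SL4_dual (K : fieldType) (M : matroid) : SL4 K M -> SL4 K (dual M).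
Proof.
move=> [rK [q [pq H]]]; split; first exact: representable_dual.
by exists q; split=> // F qF; apply: representable_dual (H F qF).
Qed.

Lemma miso_dual_dual (M : matroid) : miso (dual (dual M)) M.
Proof.
exists id; split; first by exists id.
by move=> X; rewrite imset_id; apply/esym/dual_dual_rank.
Qed.

End DualRepresentable.

(** * Small sets in highly connected matroids *)

Section Connectivity.
Variable M : matroid.

Lemma conn_dual (X : {set M}) : @conn (dual M) X = conn X.
Proof.
rewrite /conn.
have e1 := dual_rank_exact X; have e2 := dual_rank_exact (~: X); have e3 := dual_rank_exact [set: M].
rewrite setCK in e2; rewrite setCT rank0 cardsT in e3; have := cardsC X.
change (@rank (dual M) X) with (dual_rank X); change (@rank (dual M) (~: X)) with (dual_rank (~: X)).
change (@rank (dual M) [set: dual M]) with (dual_rank [set: M]).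
have := rankU_le X (~: X); rewrite setUCr.
lia.
Qed.

Lemma k_connected_dual k : k_connected k M -> k_connected k (dual M).
Proof.
by move=> H j X jk [s1 s2 s3]; apply: (H j X jk); split; rewrite -?conn_dual.
Qed.

(* Small sets in a highly connected matroid are independent, with spanning complement. *)
Lemma k_connected_small k (X : {set M}) :
  k_connected k M -> (2 * k <= #|M|)%N -> (#|X| < k)%N -> rank X = #|X| /\ spanning (~: X).
Proof.
move=> kM cM Xk; have r1 := rank_le_card X; have r2 := rankS (subsetT (~: X)).
have r3 := rankU_le X (~: X); rewrite setUCr in r3.
have cX := cardsC X; rewrite /spanning.
have [X0|X0] := posnP #|X|.
  move/eqP: X0; rewrite cards_eq0 => /eqP ->; by rewrite cards0 rank0 setC0.
have nsep := kM #|X| X; have {nsep} : ~ (conn X < #|X|)%N.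
  by move=> cX1; apply: nsep; [rewrite X0 | split=> //; lia].
rewrite /conn; lia.
Qed.

Lemma k_connected_simple k : (2 < k)%N -> k_connected k M -> (2 * k <= #|M|)%N -> simple M.
Proof.
move=> k2 kM cM X X2; by have [] := k_connected_small kM cM (leq_ltn_trans X2 k2).
Qed.

(** A set smaller than the rank cannot span, so of the two outcomes of vertical connectivity only
    the spanning complement remains. *)
Lemma vertically_connected_small k (X : {set M}) :
  vertically_connected k M -> (#|X| < k)%N -> (#|X| < rank [set: M])%N -> spanning (~: X).
Proof.
move=> vM Xk Xr; have r1 := rank_le_card X; have r2 := rankS (subsetT (~: X)).
have [|//|//] := vM X; first by rewrite /conn; lia.
by rewrite /spanning => E; lia.
Qed.

Lemma k_connectedW k k' : (k' <= k)%N -> k_connected k M -> k_connected k' M.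
Proof. by move=> le H j X /andP[j0 jk]; apply: H; rewrite j0 (leq_trans jk). Qed.

Lemma vertically_connectedW k k' :
  (k' <= k)%N -> vertically_connected k M -> vertically_connected k' M.
Proof. by move=> le H X Xk; apply: H; apply: leq_trans Xk le. Qed.

End Connectivity.

(** * Words over a complete graph *)

(** Codes for 0, 1, [a] and [a^2], on which the finite checks are evaluated; [ev] carries the
    results to the field. *)
Variant g4 := O4 | I4 | A4 | B4.

Definition g4_nat (x : g4) : nat := match x with O4 => 0 | I4 => 1 | A4 => 2 | B4 => 3 end.
Definition nat_g4 (n : nat) : g4 := match n with 0 => O4 | 1 => I4 | 2 => A4 | _ => B4 end.
Lemma g4_natK : cancel g4_nat nat_g4. Proof. by case. Qed.
HB.instance Definition _ := Equality.copy g4 (can_type g4_natK).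

Definition gadd (x y : g4) : g4 :=
  match x, y with
  | O4, z | z, O4 => z
  | I4, I4 | A4, A4 | B4, B4 => O4
  | I4, A4 | A4, I4 => B4
  | I4, B4 | B4, I4 => A4
  | A4, B4 | B4, A4 => I4
  end.
Definition gmul (x y : g4) : g4 :=
  match x, y with
  | O4, _ | _, O4 => O4
  | I4, z | z, I4 => z
  | A4, A4 => B4
  | B4, B4 => A4
  | A4, B4 | B4, A4 => I4
  end.
Definition gsum (s : seq g4) : g4 := foldr gadd O4 s.
Definition wnth (w : seq g4) (i : nat) : g4 := nth O4 w i.

Section Codes.
Variables (K : fieldType) (a : K).
Hypothesis (ha : a ^+ 2 = a + 1) (char2 : 1 + 1 = 0 :> K).

Definition ev (x : g4) : K := match x with O4 => 0 | I4 => 1 | A4 => a | B4 => a ^+ 2 end.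

Lemma addrr2 (x : K) : x + x = 0.
Proof. by rewrite -[x]mul1r -mulrDl char2 mul0r. Qed.

Lemma oppr2 (x : K) : - x = x.
Proof. by apply/eqP; rewrite eq_sym -addr_eq0 addrr2. Qed.

Lemma ev_add x y : ev (gadd x y) = ev x + ev y.
Proof.
case: x; case: y; rewrite /= ?add0r ?addr0 ?addrr2 // ?ha.
- exact: addrC.
- by rewrite addrCA char2 addr0.
- by rewrite addrA addrr2 add0r.
- by rewrite -addrA char2 addr0.
- by rewrite addrAC addrr2 add0r.
Qed.

Lemma ev_mul x y : ev (gmul x y) = ev x * ev y.
Proof.
have a3 : a * a ^+ 2 = 1 by rewrite ha mulrDr mulr1 -expr2 ha addrAC addrr2 add0r.
case: x; case: y; rewrite /= ?mul0r ?mulr0 ?mul1r ?mulr1 // -?expr2 ?a3 //.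
- by rewrite mulrC a3.
- by rewrite expr2 {1}expr2 -mulrA a3 mulr1.
Qed.

Lemma a_neq0 : a != 0.
Proof. by apply/eqP => a0; move/eqP: ha; rewrite a0 expr0n /= add0r eq_sym oner_eq0. Qed.

Lemma ev_eq0 x : (ev x == 0) = (x == O4).
Proof.
by case: x; rewrite /= ?eqxx ?oner_eq0 ?expf_eq0 ?(negPf a_neq0).
Qed.

Lemma ev_sum (s : seq g4) : ev (gsum s) = \sum_(x <- s) ev x.
Proof. by elim: s => [|x s IH]; rewrite ?big_nil // big_cons /= ev_add IH. Qed.

Lemma ev_gsum_iota m (f : nat -> g4) : ev (gsum [seq f i | i <- iota 0 m]) = \sum_(i < m) ev (f i).
Proof. by rewrite ev_sum big_map -[iota 0 m]/(iota 0 (0 + m)) -{1}[m]subn0 big_mkord. Qed.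

Definition cv (w : seq g4) : fvec K 'I_3 := [ffun l : 'I_3 => ev (wnth w l) : K^o].

End Codes.

Variant el := Ed of nat & nat | Wd of nat.
Definition el_sum (e : el) : nat * nat + nat := match e with Ed i j => inl (i, j) | Wd k => inr k end.
Definition sum_el (x : nat * nat + nat) : el := match x with inl p => Ed p.1 p.2 | inr k => Wd k end.
Lemma el_sumK : cancel el_sum sum_el. Proof. by case. Qed.
HB.instance Definition _ := Equality.copy el (can_type el_sumK).

(** A certificate on vertices 0, ..., m - 1. [cW]: words that must be present; [cT]: images of the
    vertices in dimension three; [cC]: elements to contract; [cS]: a lift of each of the three unit
    vectors; [cO]: coefficients expressing the edges at vertex 0, up to lifts, by contracted
    elements; [cN]: index of the excluded minor; [cM]: for each of its columns an element and a
    scalar. *)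
Record mcert := MCert {
  cW : seq (seq g4);
  cT : seq (seq g4);
  cC : seq el;
  cS : seq (seq g4);
  cO : seq (seq g4);
  cN : nat;
  cM : seq (el * g4) }.

Definition unitw (m i j : nat) : seq g4 :=
  [seq gadd (if l == i then I4 else O4) (if l == j then I4 else O4) | l <- iota 0 m].

Section CertCheck.
Variable ct : mcert.
Let m := size (cT ct).
Definition elw (e : el) : seq g4 :=
  match e with Ed i j => unitw m i j | Wd k => nth [::] (cW ct) k end.
Definition elok (e : el) : bool :=
  match e with Ed i j => (i < m)%N && (j < m)%N | Wd k => (k < size (cW ct))%N end.
Definition appT (w : seq g4) : seq g4 :=
  [seq gsum [seq gmul (wnth w i) (wnth (nth [::] (cT ct) i) l) | i <- iota 0 m] | l <- iota 0 3].
Definition Tdiff i l := gadd (wnth (nth [::] (cT ct) i) l) (wnth (nth [::] (cT ct) 0) l).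
(** The equation with [cS] and [cO] certifies the kernel: a vector of sum zero that is killed by the
    map [cT] is a combination of the elements of [cC]. Contraction of [cC] is then the projection to
    dimension three. *)
Definition cert_ok (cols : seq (seq g4)) : bool :=
  [&& (0 < m)%N,
      all elok (cC ct),
      all (fun w => gsum [seq wnth w i | i <- iota 0 m] == O4) (cW ct),
      all (fun x => elok x.1) (cM ct),
      all (fun e => all (fun l => wnth (appT (elw e)) l == O4) (iota 0 3)) (cC ct),
      all (fun i => all (fun j =>
        wnth (unitw m i 0) j ==
        gadd (gsum [seq gmul (Tdiff i l) (wnth (nth [::] (cS ct) l) j) | l <- iota 0 3])
             (gsum [seq gmul (wnth (nth [::] (cO ct) i) k)
                             (wnth (elw (nth (Wd 0) (cC ct) k)) j) | k <- iota 0 (size (cC ct))]))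
        (iota 0 m)) (iota 0 m),
      size (cM ct) == size cols
    & all (fun x => let p := nth (Wd 0, O4) (cM ct) x in
        (p.2 != O4) && all (fun l => wnth (appT (elw p.1)) l
           == gmul p.2 (wnth (nth [::] cols x) l)) (iota 0 3)) (iota 0 (size cols))].
End CertCheck.

(** Images are fixed by [cert_ok] only up to scalars; this test ensures that different columns come
    from different elements and that none of these is contracted. *)
Definition nonpar (cols : seq (seq g4)) : bool :=
  all (fun x => has (fun l => wnth (nth [::] cols x) l != O4) (iota 0 3) &&
    all (fun y => (x == y) || all (fun c => has (fun l =>
      wnth (nth [::] cols x) l != gmul c (wnth (nth [::] cols y) l)) (iota 0 3)) [:: I4; A4; B4])
    (iota 0 (size cols))) (iota 0 (size cols)).

Section CliqueExtension.
Variables (K : finFieldType) (a : K).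
Hypothesis (ha : a ^+ 2 = a + 1) (char2 : 1 + 1 = 0 :> K).
Variables (Vt E : finType) (c : E -> fvec K Vt).
Hypothesis sum0 : forall e, \sum_u c e u = 0.

Notation ev := (ev a).

Definition dl (u : Vt) : fvec K Vt := [ffun x => (x == u)%:R : K^o].

Definition wv (rs : seq Vt) (w : seq g4) : fvec K Vt :=
  [ffun u => (if u \in rs then ev (wnth w (index u rs)) else 0) : K^o].

Definition cphi (x : E + Vt * Vt) : fvec K Vt :=
  match x with inl e => c e | inr uv => dl uv.1 - dl uv.2 end.

(* The vectors [c e] together with all the edges of the complete graph on [Vt]. *)
Definition Mplus : matroid := col_matroid (fun u x => cphi x u).

Lemma Mplus_represents : represents (M := Mplus) cphi.
Proof.
move=> X; transitivity (\dim (sp (mxcol (fun u x => cphi x u)) X)); last first.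
  exact/esym/(@col_rank_regular K).
by congr (\dim _); apply: eq_sp => x _; apply/ffunP => u; rewrite [RHS]ffunE.
Qed.

Definition present (rs : seq Vt) (w : seq g4) : Prop :=
  exists e s, s != 0 /\ c e = s *: wv rs w.

(* [w], pushed forward along the map that merges every vertex outside [rs] with
   the first vertex of [rs], is a multiple of some [c e]. *)
Definition mpresent (rs : seq Vt) (w : seq g4) : Prop :=
  exists e s, s != 0 /\ forall u, u \in rs -> index u rs != 0%N -> c e u = s * ev (wnth w (index u rs)).

Definition target (N : matroid) (cols : seq (seq g4)) : Prop :=
  exists idx : N -> nat, [/\ injective idx, forall x, (idx x < size cols)%N &
    represents (fun x => cv a (nth [::] cols (idx x)))].

Lemma sum_dl (v : fvec K Vt) : v = \sum_u v u *: dl u.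
Proof.
apply/ffunP => x; rewrite sum_ffunE (bigD1 x) //= !ffunE eqxx big1 => [|u /negPf ux].
  by rewrite addr0 /= [_ *: _]mulr1.
by rewrite !ffunE eq_sym ux [_ *: _]mulr0.
Qed.

Lemma sum_dlE (u : Vt) : \sum_x dl u x = 1.
Proof.
rewrite (bigD1 u) //= ffunE eqxx big1 ?addr0 // => x /negPf xu; by rewrite ffunE xu.
Qed.

Section CertSound.
Variables (ct : mcert) (cols : seq (seq g4)) (N : matroid) (rs : seq Vt).
Hypothesis (ok : cert_ok ct cols) (np : nonpar cols) (tN : target N cols).
Hypothesis (urs : uniq rs) (srs : size rs = size (cT ct)).
Hypothesis pr : forall w, w \in cW ct -> mpresent rs w.
Let m := size (cT ct).

Lemma wv_sum (g : Vt -> K) (w : seq g4) (u0 : Vt) :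
  \sum_u wv rs w u * g u = \sum_(i < m) ev (wnth w i) * g (nth u0 rs i).
Proof.
rewrite (bigID (mem rs)) /= [X in _ + X]big1 => [|u /negPf nu]; last by rewrite ffunE nu mul0r.
rewrite addr0 -(big_uniq _ urs) /= (big_nth u0) srs big_mkord; apply: eq_bigr => i _.
by rewrite ffunE mem_nth ?index_uniq ?srs.
Qed.

(** Besides the elements of [cC], the edges from vertices outside [rs] to the first vertex [r0] are
    contracted. This merges those vertices with [r0], so a word need only be known away from [r0]:
    its value there is forced by the coordinate sum zero. *)
Theorem cert_sound : has_minor Mplus N.
Proof.
move: (ok); rewrite /cert_ok -/m => /and5P[m0 okC okW okM /and4P[kC kS /eqP sM kM]].
have [idx [idxI idxL rN]] := tN.
have u0 : Vt by move: srs m0; rewrite /m => <-; case: (rs).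
pose r0 := nth u0 rs 0.
have r0in : r0 \in rs by rewrite mem_nth ?srs.
have fe (k : 'I_(size (cW ct))) : exists es : E * K, es.2 != 0 /\
    forall u, u \in rs -> index u rs != 0%N -> c es.1 u = es.2 * ev (wnth (nth [::] (cW ct) k) (index u rs)).
  by have [|e [s [s0 es]]] := pr (w := nth [::] (cW ct) k); [rewrite mem_nth | exists (e, s)].
have [ek ekP] := fin_all_exists fe.
pose C1 : {set E + Vt * Vt} := [set inr (u, r0) | u in [pred u | u \notin rs]].
have r00 : index r0 rs = 0%N by rewrite index_uniq ?srs.
have inC1 u : u \notin rs -> dl u - dl r0 \in sp cphi C1.
  move=> ur; rewrite -[dl u - dl r0]/(cphi (inr (u, r0))); apply: mem_sp.
  by apply/imsetP; exists u.
have sumwv w : \sum_u wv rs w u = ev (gsum [seq wnth w i | i <- iota 0 m]).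
  rewrite ev_gsum_iota //; have := wv_sum (fun=> 1) w u0.
  rewrite (eq_bigr (fun u => wv rs w u)) => [->|u _]; last exact: mulr1.
  by apply: eq_bigr => i _; rewrite mulr1.
pose re (e : el) : E + Vt * Vt :=
  match e with Ed i j => inr (nth u0 rs i, nth u0 rs j)
  | Wd k => if insub k is Some k' then inl (ek k').1 else inr (u0, u0) end.
have reP e : elok ct e -> exists s : K, s != 0 /\ cphi (re e) - s *: wv rs (elw ct e) \in sp cphi C1.
  case: e => [i j /andP[im jm]|k kW] /=; last first.
    rewrite insubT /=; have [s0 es] := ekP (Ordinal kW).
    set s := (ek _).2 in s0 es *; set e := (ek _).1 in es *; rewrite /= in es.
    exists s; split=> //; set d := _ - _.
    have d0 : \sum_u d u = 0.
      rewrite (eq_bigr (fun u => c e u - s * wv rs (nth [::] (cW ct) k) u)) => [|u _]; last by rewrite !ffunE.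
      rewrite sumrB sum0 -mulr_sumr sumwv (eqP (allP okW _ (mem_nth [::] kW))) /=.
      by rewrite mulr0 subrr.
    have -> : d = \sum_u (d u : K) *: (dl u - dl r0).
      rewrite (eq_bigr (fun u => (d u : K) *: dl u - (d u : K) *: dl r0)) => [|u _]; last exact: scalerBr.
      by rewrite sumrB -sum_dl -scaler_suml d0 scale0r subr0.
    apply: memv_suml => u _; have [ur|nur] := boolP (u \in rs); last exact/memvZ/inC1.
    have [u0'|u0'] := eqVneq (index u rs) 0%N.
      by rewrite -(nth_index u0 ur) u0' subrr scaler0 mem0v.
    have -> : (d u : K) = 0 by rewrite !ffunE ur es // subrr.
    by rewrite scale0r mem0v.
  exists 1; split; first exact: oner_neq0.
  rewrite scale1r (_ : _ - _ = 0) ?mem0v //; apply/eqP; rewrite subr_eq0; apply/eqP.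
  apply/ffunP => u; rewrite !ffunE.
  have [ur|nur] := boolP (u \in rs); last first.
    have H x : (x < m)%N -> (u == nth u0 rs x) = false.
      by move=> xm; apply: contraNF nur => /eqP ->; rewrite mem_nth ?srs.
    by rewrite !H // subrr.
  have iu : (index u rs < m)%N by rewrite /m -srs index_mem.
  rewrite /wnth (nth_map 0%N) ?size_iota // nth_iota // add0n ev_add //.
  have H x : (x < m)%N -> (u == nth u0 rs x) = (index u rs == x).
    move=> xm; apply/eqP/eqP => [->|<-]; first by rewrite index_uniq ?srs.
    by rewrite nth_index.
  by rewrite !H // (oppr2 char2); case: ifP; case: ifP.
(* Vertices outside [rs] get index 0, in accordance with the merging. *)
pose ti (u : Vt) : nat := if u \in rs then index u rs else 0%N.
pose T0 (v : fvec K Vt) : fvec K 'I_3 :=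
  [ffun l : 'I_3 => \sum_u v u * ev (wnth (nth [::] (cT ct) (ti u)) l) : K^o].
have T0l : linear T0.
  move=> k u v; apply/ffunP => l; rewrite !ffunE /= scaler_sumr -big_split /=.
  by apply: eq_bigr => x _; rewrite !ffunE mulrDl -mulrA.
have [T TE] := linear_Hom T0l.
have TW w : T (wv rs w) = cv a (appT ct w).
  rewrite TE; apply/ffunP => l; rewrite !ffunE (wv_sum _ _ u0).
  rewrite /wnth (nth_map 0%N) ?size_iota // nth_iota // add0n ev_gsum_iota //.
  apply: eq_bigr => i _; rewrite ev_mul //; congr (_ * ev (nth _ (nth _ _ _) _)).
  by rewrite /ti mem_nth ?srs // index_uniq ?srs.
pose CC : {set E + Vt * Vt} := C1 :|: [set x | x \in [seq re e | e <- cC ct]].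
pose U := sp cphi CC.
have C1U : (sp cphi C1 <= U)%VS by apply/spS/subsetUl.
have inU1 u : u \notin rs -> dl u - dl r0 \in U by move=> ur; apply/(subvP C1U)/inC1.
have inU2 k : (k < size (cC ct))%N -> wv rs (elw ct (nth (Wd 0) (cC ct) k)) \in U.
  move=> kC'.
  have /reP[s [s0 es]] : elok ct (nth (Wd 0) (cC ct) k) by move/all_nthP: okC; apply.
  set w := wv _ _ in es *; set p := cphi _ in es.
  have -> : w = s^-1 *: (p - (p - s *: w)) by rewrite opprB addrCA subrr addr0 scalerK.
  apply/memvZ/memvB; last exact: (subvP C1U).
  apply: mem_sp; rewrite !inE; apply/orP; right.
  by rewrite -(nth_map (Wd 0) (inr (u0, u0)) re) // mem_nth ?size_map.
have t0 l : ev (wnth (nth [::] (cT ct) (ti r0)) l) = ev (wnth (nth [::] (cT ct) 0) l).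
  by rewrite /ti r0in index_uniq ?srs.
pose td (u : Vt) (l : 'I_3) : K := ev (Tdiff ct (ti u) l).
(* The identities recorded in [cS] and [cO]: modulo the contracted span, each edge at [r0] equals
   the lift of its image. *)
have key u : dl u - dl r0 - \sum_l td u l *: wv rs (nth [::] (cS ct) l) \in U.
  have [ur|nur] := boolP (u \in rs); last first.
    rewrite big1 ?subr0 ?inU1 // => l _; rewrite /td /Tdiff /ti (negPf nur) ev_add //.
    by rewrite (addrr2 char2) scale0r.
  have iu : (index u rs < m)%N by rewrite /m -srs index_mem.
  have -> : dl u - dl r0 - \sum_l td u l *: wv rs (nth [::] (cS ct) l) =
     \sum_(k < size (cC ct)) ev (wnth (nth [::] (cO ct) (index u rs)) k) *: wv rs (elw ct (nth (Wd 0) (cC ct) k)).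
    apply/eqP; rewrite subr_eq; apply/eqP; rewrite [RHS]addrC.
        have /allP/(_ (index u rs)) := kS; rewrite mem_iota iu => /(_ isT) /allP kSi.
    apply/ffunP => x; rewrite [RHS]ffunE !sum_ffunE.
    have [xr|nxr] := boolP (x \in rs); last first.
      rewrite !ffunE !big1 => [|k _|l _]; rewrite ?ffunE ?(negPf nxr) ?[_ *: _]mulr0 //.
      have H y : y \in rs -> (x == y) = false by move=> yr; apply: contraNF nxr => /eqP ->.
      by rewrite !H // subrr addr0.
    have ix : (index x rs < m)%N by rewrite /m -srs index_mem.
    have := kSi (index x rs); rewrite mem_iota ix => /(_ isT)/eqP/(congr1 ev).
    rewrite ev_add // !ev_gsum_iota // => E1.
    transitivity (ev (wnth (unitw m (index u rs) 0) (index x rs))).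
      rewrite /wnth (nth_map 0%N) ?size_iota // nth_iota // add0n ev_add // !ffunE.
      have -> : (x == u) = (index x rs == index u rs).
        by apply/eqP/eqP => [->//|e1]; rewrite -(nth_index u0 xr) e1 nth_index.
      have -> : (x == r0) = (index x rs == 0%N).
        by apply/eqP/eqP => [->|e1]; rewrite /r0 ?index_uniq ?srs // -e1 nth_index.
      by rewrite (oppr2 char2); case: ifP; case: ifP.
    rewrite E1; congr (_ + _); apply: eq_bigr => l _; rewrite !ffunE xr /= ev_mul //.
    by rewrite /td /ti ur.
  by apply: memv_suml => k _; apply/memvZ/inU2.
have TtdE (v : fvec K Vt) (l : 'I_3) : \sum_u v u = 0 -> T v l = \sum_u (v u : K) * td u l.
  move=> v0; rewrite TE ffunE; apply/esym.
  pose tt u := ev (wnth (nth [::] (cT ct) (ti u)) l).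
  pose tt0 := ev (wnth (nth [::] (cT ct) 0) l).
  rewrite (eq_bigr (fun u => (v u : K) * tt u + (v u : K) * tt0)) => [|u _]; last first.
    by rewrite -mulrDr /td /Tdiff ev_add.
  by rewrite big_split /= -mulr_suml v0 mul0r addr0.
(* A vector of sum zero is a combination of the differences [dl u - dl r0]; the lifts add up to the
   lift of its image, which is zero. *)
have kerT (v : fvec K Vt) : \sum_u v u = 0 -> T v = 0 -> v \in U.
  move=> v0 Tv.
  have -> : v = \sum_u (v u : K) *: (dl u - dl r0 - \sum_l td u l *: wv rs (nth [::] (cS ct) l)).
    rewrite (eq_bigr (fun u => (v u : K) *: dl u - (v u : K) *: dl r0 -
       \sum_l ((v u : K) * td u l) *: wv rs (nth [::] (cS ct) l))) => [|u _]; last first.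
      rewrite !scalerBr scaler_sumr; congr (_ - _); apply: eq_bigr => l _.
      by rewrite scalerA.
    rewrite !sumrB -sum_dl -scaler_suml v0 scale0r subr0 exchange_big /= big1 ?subr0 // => l _.
    by rewrite -scaler_suml -TtdE // Tv ffunE scale0r.
  by apply: memv_suml => u _; apply/memvZ/key.
(* The coordinate sum as a linear form: its kernel contains all elements, so [kerT] applies to the
   whole span. *)
pose zs (v : fvec K Vt) : K^o := \sum_u v u.
have zsl : linear zs.
  move=> k u v; rewrite /zs scaler_sumr -big_split /=; apply: eq_bigr => x _.
  by rewrite !ffunE.
have [Z ZE] := linear_Hom zsl.
have sumphi X : (sp cphi X <= lker Z)%VS.
  apply/spP => -[e|[u v]] _; rewrite memv_ker ZE /zs.
    by rewrite sum0.
  rewrite (eq_bigr (fun x => dl u x - dl v x)) => [|x _]; last by rewrite !ffunE.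
  by rewrite sumrB !sum_dlE subrr.
have C1T : (sp cphi C1 <= lker T)%VS.
  apply/spP => x /imsetP[u /negPf ur ->].
  rewrite memv_ker; apply/eqP/ffunP => l; rewrite [RHS]ffunE TtdE; last first.
    by apply/eqP; have := sumphi [set inr (u, r0)]; move/spP/(_ _ (set11 _)); rewrite memv_ker ZE.
  rewrite /= big1 // => y _; rewrite !ffunE.
  have [->|yu] := eqVneq y u.
    by rewrite /td /Tdiff /ti ur ev_add // (addrr2 char2) mulr0.
  have [->|yr] := eqVneq y r0; last by rewrite subrr mul0r.
  by rewrite /td /Tdiff ev_add // t0 (addrr2 char2) mulr0.
have Tre e : elok ct e -> exists s : K, s != 0 /\ T (cphi (re e)) = s *: T (wv rs (elw ct e)).
  move=> /reP[s [s0 /(subvP C1T)]]; rewrite memv_ker linearB linearZ /= subr_eq0 => /eqP es.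
  by exists s.
have CT : (U <= lker T)%VS.
  apply/spP => x; rewrite inE => /orP[xC1|]; first by apply/(subvP C1T)/mem_sp.
  rewrite inE => /mapP[e eC ->]; have /Tre[s [s0 es]] := allP okC e eC.
  rewrite memv_ker es TW; apply/eqP/ffunP => l; rewrite !ffunE.
  have /allP/(_ (nat_of_ord l)) := allP kC e eC; rewrite mem_iota ltn_ord => /(_ isT)/eqP ->.
  by rewrite [_ *: _]mulr0.
pose M x := nth (Wd 0, O4) (cM ct) (idx x).
have Mok x : elok ct (M x).1 by move/all_nthP: okM; apply; rewrite sM.
have Mim x : (M x).2 != O4 /\ T (wv rs (elw ct (M x).1)) = ev (M x).2 *: cv a (nth [::] cols (idx x)).
  have /allP/(_ (idx x)) := kM; rewrite mem_iota idxL => /(_ isT) /andP[M2 Ml]; split=> //.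
  rewrite TW; apply/ffunP => l; rewrite !ffunE.
  by move/allP: Ml => /(_ (nat_of_ord l)); rewrite mem_iota ltn_ord => /(_ isT)/eqP ->; rewrite ev_mul.
have fs x : exists s, s != 0 /\ T (cphi (re (M x).1)) = s *: cv a (nth [::] cols (idx x)).
  have [s [s0 es]] := Tre _ (Mok x); have [M2 MT] := Mim x.
  exists (s * ev (M x).2); rewrite mulf_neq0 ?(ev_eq0 ha) //; split=> //.
  by rewrite es MT scalerA.
have [cc ccP] := fin_all_exists fs.
have cvnz x : cv a (nth [::] cols (idx x)) != 0.
  have /allP/(_ (idx x)) := np; rewrite mem_iota idxL => /(_ isT)/andP[/hasP[l l3 hl] _].
  rewrite mem_iota /= in l3; apply: contraNneq hl => /ffunP/(_ (Ordinal l3)).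
  by rewrite !ffunE /= => /eqP; rewrite (ev_eq0 ha).
have evs (s : K) (x y : g4) : s * ev x = ev y -> x != O4 -> s != 0 -> exists2 g, g \in [:: I4; A4; B4] & s = ev g.
  move=> E1 x0 s0; have y0 : y != O4.
    by rewrite -(ev_eq0 ha) -E1 mulf_neq0 // (ev_eq0 ha).
  have : exists2 g, g \in [:: I4; A4; B4] & gmul g x = y.
    by case: (x) x0 => //; case: (y) y0 => // _ _;
       first [by exists I4 | by exists A4 | by exists B4].
  case=> g gin E2; exists g => //; apply: (mulIf (x := ev x)); first by rewrite (ev_eq0 ha).
  by rewrite E1 -E2 ev_mul.
apply: (@linear_minor _ _ _ Mplus N cphi _ T CC (fun x => re (M x).1) cc) => //.
- exact: Mplus_represents.
- move=> x y exy; apply: idxI; apply/eqP; case: eqP => // /eqP nxy.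
  have [sx ex] := ccP x; have [sy ey] := ccP y; rewrite exy ey in ex.
  have /allP/(_ (idx x)) := np; rewrite mem_iota idxL => /(_ isT)/andP[/hasP[l l3 hl] /allP/(_ (idx y))].
  rewrite mem_iota idxL (negPf nxy) => /(_ isT) /orP[//|H].
  have exy2 : cv a (nth [::] cols (idx x)) = ((cc x)^-1 * cc y) *: cv a (nth [::] cols (idx y)).
    by rewrite -scalerA ex scalerA mulVf ?scale1r.
  rewrite mem_iota /= in l3.
  have el l' (l3' : (l' < 3)%N) : ev (wnth (nth [::] cols (idx x)) l') = (cc x)^-1 * cc y * ev (wnth (nth [::] cols (idx y)) l').
    by have /ffunP/(_ (Ordinal l3')) := exy2; rewrite !ffunE.
  have ly : wnth (nth [::] cols (idx y)) l != O4.
    apply: contraNneq hl => ly; have := el l l3; rewrite ly mulr0 => /eqP.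
    by rewrite (ev_eq0 ha).
  have [|g gin eg] := evs _ _ _ (esym (el l l3)) ly; first by rewrite mulf_neq0 ?invr_eq0.
  have /hasP[l' l3' hl'] := allP H g gin.
  rewrite mem_iota /= in l3'; case/negP: hl'; apply/eqP.
  have := el l' l3'; rewrite eg -ev_mul //.
  have evI : injective ev.
    move=> p q; case: (eqVneq p q) => // npq e1; exfalso.
    have : ev (gadd p q) == 0 by rewrite ev_add // e1 (addrr2 char2).
    by rewrite (ev_eq0 ha); move: npq; case: (p); case: (q).
  exact: evI.
- move=> x; apply/negP => xC; have : cphi (re (M x).1) \in lker T by apply: (subvP CT); apply: mem_sp.
  have [s0 es] := ccP x; rewrite memv_ker es scaler_eq0 (negPf s0) /=.
  exact/negP.
- apply/subvP => v /memv_capP[/(subvP (sumphi _))]; rewrite !memv_ker ZE => /eqP v0 /eqP Tv.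
  exact: kerT.
Qed.
End CertSound.
End CliqueExtension.

(** * Certificates for the classification of words *)

(** Entries are separated by spaces (code 32). Subtracting 48 turns digits into their values and the
    letters E and W into 21 and 39. *)
Fixpoint tokens (s : String.string) (cur : seq nat) : seq (seq nat) :=
  match s with
  | String.EmptyString => [:: rev cur]
  | String.String ch s' =>
    let n := Ascii.nat_of_ascii ch in
    if n == 32%N then rev cur :: tokens s' [::] else tokens s' ((n - 48)%N :: cur)
  end.
Definition parse (s : String.string) : seq (seq nat) :=
  if s is String.EmptyString then [::] else tokens s [::].
Definition parsew (s : String.string) : seq (seq g4) := map (map nat_g4) (parse s).
Definition parsel (s : String.string) : seq nat := head [::] (parse s).
(* In the data, "Eij" stands for the edge ij and "Wk" for the k-th word; the
   last digit of an entry of [cM] is a scalar. *)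
Definition parse_el (t : seq nat) : el * g4 :=
  match t with
  | 21 :: i :: j :: r => (Ed i j, nat_g4 (head 0%N r))
  | 39 :: k :: r => (Wd k, nat_g4 (head 0%N r))
  | _ => (Wd 0, O4)
  end.
Definition mkcert (x : String.string * String.string * String.string * String.string *
    String.string * nat * String.string) : mcert :=
  let: (w, t, cc, s, o, n, mm) := x in
  MCert (parsew w) (parsew t) (map (fst \o parse_el) (parse cc)) (parsew s) (parsew o) n
    (map parse_el (parse mm)).

(** A configuration on [nn] vertices whose words [nX] are known to be present. [nF] gives a family
    with the labels of its general vertices, [nE] further nodes with the labels of their
    vertices. *)
Record node := Node {
  nn : nat;
  nX : seq (seq g4);
  nF : option (nat * seq nat);
  nE : seq (nat * seq nat) }.
Definition mknode (x : nat * String.string * option (nat * String.string) *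
    seq (nat * String.string)) : node :=
  let: (n, w, f, e) := x in
  Node n (parsew w) (omap (fun y => (y.1, parsel y.2)) f) (map (fun y => (y.1, parsel y.2)) e).

(* [fk] vertices in general position, further vertices [fV] and points [fY] in
   their span; [fP] and [fQ] give the corresponding vertices and points over an
   arbitrary field, as integer polynomials in a parameter. *)
Record fam := Fam {
  fk : nat;
  fV : seq (seq g4);
  fY : seq (seq g4);
  fP : seq (seq (seq int));
  fQ : seq (seq (seq int)) }.
Definition mkfam (x : nat * String.string * String.string * seq (seq (seq int)) *
    seq (seq (seq int))) : fam :=
  let: (k, v, y, p, q) := x in Fam k (parsew v) (parsew y) p q.

Import String.StringSyntax.
Local Open Scope string_scope.
Local Open Scope nat_scope.

(** Fields in the order of [mcert]. Entries 0 and 1, for the words 1111 and 11123, are also used by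
    index, to find the shape of a single word. *)
Definition raw_certs := [::
("1111","000 001 010 100","","1001 1010 1100","",0,"E011 E021 E121 E031 E131 E231 W01");
("11123","000 001 010 100 100","E34","10010 10100 11000","0 0 0 0 1",0,"E011 E021 E121 E031 E131 E231 W01");
("000123 123000","000 013 032 202 103 001","W0 W1","200130 210120 100230","00 00 02 00 00 20",2,"E051 E141 E232 E032 E343 E041 E253 E151 E011");
("00123 11330","000 001 110 130 100","W0","10230 00330 11000","0 0 0 0 2",0,"E011 E232 W11 E041 E141 E021 E121");
("00123 11220","000 001 320 010 100","W0","10230 10010 11000","0 0 0 0 2",0,"E011 E031 E131 E041 E141 E233 W11");
("00123 12210","000 330 301 302 303","W0","20130 02130 00220","0 0 0 0 2",2,"E233 E013 W13 E043 E023 E033 E143 E123 E133");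
("00123 11303","000 001 320 010 100","W0","10230 10010 11000","0 0 0 0 2",0,"E011 E031 E131 E041 E141 E233 W11");
("00123 11202","000 001 010 100 320","W0","10010 10100 11000","0 0 0 0 2",0,"E011 E021 E121 E031 E131 E231 W11");
("00123 12102","000 330 301 302 303","W0","20130 02130 00220","0 0 0 0 2",2,"E233 E013 W13 E043 E023 E033 E143 E123 E133");
("000123 113300","000 013 103 002 001 000","E05 W0","301200 310200 300300","00 00 00 00 23 10",2,"E032 E121 W13 E231 E241 E021 E131 E141 E011");
("000123 112200","000 022 102 003 000 001","E04 W0","201300 130200 200200","00 00 00 00 10 32",2,"E033 W12 E121 E231 E021 E251 E012 E152 E132");
("00123 11033","000 001 010 100 320","W0","10010 10100 11000","0 0 0 0 2",0,"E011 E021 E121 E031 E131 E231 W11");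
("00123 11022","000 001 110 130 100","W0","10230 00330 11000","0 0 0 0 2",0,"E011 E232 W11 E041 E141 E021 E121");
("00123 12021","000 330 301 302 303","W0","20130 02130 00220","0 0 0 0 2",2,"E233 E013 W13 E043 E023 E033 E143 E123 E133");
("000123 113030","000 013 103 000 002 001","E03 W0","301020 310020 300030","00 00 00 10 00 22",2,"E042 E121 W13 E241 E251 E021 E141 E151 E011");
("000123 112020","000 023 103 002 001 000","E05 W0","301200 230100 300300","00 00 00 00 23 10",2,"E032 W12 E121 E231 E241 E021 E142 E012 E132");
("000123 113003","000 012 102 003 000 001","E04 W0","201300 210300 200200","00 00 00 00 10 32",2,"E033 E121 W13 E231 E021 E251 E131 E011 E151");
("000123 112002","000 023 103 000 002 001","E03 W0","301020 230010 300030","00 00 00 10 00 22",2,"E042 W12 E121 E241 E251 E021 E152 E012 E142");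
("0000123 1122000","000 023 103 001 002 001 000","E06 W0 E35","2013000 1302000 1001000","000 000 000 000 312 001 100",2,"E031 W12 E121 E241 E231 E021 E132 E012 E142");
("00123 01203 12030","000 013 010 032 100","W2","10001 10100 02200","0 0 0 2 0",0,"E123 E021 E232 E041 W03 E241 W13");
("00123 01032 12300","000 103 302 010 100","W2","10001 10010 02002","0 0 2 0 0",0,"E143 E031 W02 E041 E242 E341 W13");
("000123 001032 120030","000 110 102 103 100 101","W0 W1","103200 013200 001100","00 00 00 00 23 32",2,"E231 E011 W21 E051 E021 E031 E151 E121 E131");
("000123 001032 120003","000 110 103 102 101 100","W0 W1","102300 012300 001100","00 00 00 00 23 32",2,"E231 E011 W21 E041 E031 E021 E141 E131 E121");
("0123 1023 1203 1230","000 013 001 202","","2013 2130 1010","",2,"E021 W01 W21 E032 E232 W11 W32 E121 E011");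
("0123 1023 1203 1320","000 022 132 021","","3012 3102 0202","",0,"E133 W22 E012 W12 W32 E121 W02");
("00123 01023 12300","000 301 203 230 202","W2","13002 12021 23001","0 0 2 0 0",2,"E241 W11 E032 E042 E013 E141 E233 W01 E343");
("00123 01230 12003","000 101 310 302 303","W2","32010 31130 23010","0 0 0 0 2",2,"E341 W12 E023 E011 E132 E033 W01 E231 E241");
("00123 01023 01203 10032","000 021 101 003 001","W3","30120 23010 20020","0 0 0 0 3",2,"E033 W22 E121 E021 E231 W01 E132 W12 E012");
("00123 01320 12003","000 130 001 100 320","W2","10010 02020 10100","0 0 0 0 2",0,"E021 E133 W01 E031 E231 E342 W13");
("00123 01023 01230 10032","000 023 103 003 001","W3","00110 03030 20020","0 0 0 0 3",2,"E033 W22 E121 W01 E241 E021 E142 E012 W12");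
("000123 001203 120003","000 110 103 102 101 100","W0 W1","102300 012300 001100","00 00 00 00 33 02",2,"E231 E011 W21 E041 E031 E021 E141 E131 E121");
("0123 1023 1122","000 001 130 100","","1001 0022 1100","",0,"E011 E233 W21 E031 E131 W11 W01");
("0123 1023 1133","000 001 100 320","","1010 1023 1100","",0,"E011 W11 W01 E021 E121 E232 W21");
("0123 1023 1313","000 310 302 303","","2013 0132 0011","",2,"E231 W23 E013 E033 W13 E023 W01 E121 E131");
("0123 1023 1221","000 330 302 303","","2013 0213 0011","",2,"E231 E013 W23 E033 W13 E023 E133 W03 E123");
("00123 01023 13310","000 002 020 100 000","E04","10010 30300 33000","0 0 0 0 1",0,"E012 E022 E122 E031 W12 W02 W21");
("00123 01023 12201","000 003 030 000 100","E03","10001 20200 22000","0 0 0 1 0",0,"E013 E023 E123 E041 W13 W03 W21");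
("0123 0132 1023 1032 1203","000 110 101 100","","1001 0101 0011","",2,"E231 E011 W41 E021 W21 W31 E121 W01 W11");
("0123 1032 1203 1230","000 103 320 100","","1001 1032 0202","",0,"E133 W11 W31 E031 W21 E232 W03");
("00123 00132 01023 13020","000 300 120 100 101","W3","22000 21300 32001","0 0 0 3 0",2,"E341 E122 E021 E041 W22 E142 W12 W02 E242");
("0123 1230 1331","000 010 032 100","","1001 1100 1230","",0,"W11 E011 E122 E031 W03 E131 W21");
("00123 01230 12012","000 001 000 020 100","E02","10001 30030 11000","0 0 1 0 0",0,"E011 E032 W11 E041 E141 W03 W22");
("00123 00132 01302 13002","000 300 101 120 100","W3","22000 21030 32100","0 0 0 0 3",2,"E241 E132 E031 E021 W22 E122 W11 W03 E232");
("00123 00132 01203 12003","000 200 101 110 100","W3","33000 23010 23100","0 0 0 0 2",2,"E241 E031 E133 E021 E123 W23 E231 W13 W02");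
("00123 01302 12030","000 103 110 302 101","W2","13002 03102 03003","0 0 0 2 0",2,"E142 E021 W03 E041 E342 E011 E241 W13 E121");
("00123 00132 01023 12003","000 200 110 101 100","W3","33000 23100 23010","0 0 0 0 2",2,"E341 E021 E123 E031 E133 W23 E231 W01 W11");
("00123 01023 01302 10203","000 021 002 101 001","W3","20310 13200 30300","0 0 0 0 2",2,"E022 W12 E131 E031 W02 E231 W22 E122 E012");
("00123 01023 01320 10032","000 013 103 003 001","W3","00110 01010 20020","0 0 0 0 3",2,"E033 E121 W23 W01 E241 E021 W11 E141 E011");
("00123 01032 01230 10320","000 021 003 001 101","W3","30201 23100 20200","0 0 0 3 0",2,"E023 W12 E141 E041 E241 W03 E122 W22 E012");
("000123 012030 102300","000 001 133 100 320 000","E05 W1","100100 112200 110000","00 00 00 00 02 10",0,"E011 W03 E233 E031 E131 E342 W21");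
("000123 012003 102300","000 012 033 102 000 001","E04 W1","331100 321000 123000","00 00 00 00 10 02",2,"E051 E131 W23 W01 E031 E351 E023 E011 E122");
("00123 01331 13020","000 001 000 020 100","E02","10001 30030 11000","0 0 1 0 0",0,"E011 E032 W23 E041 E141 W03 W11");
("00123 01032 10203 12003","000 110 102 101 100","W0","10230 01230 00220","0 0 0 0 2",2,"E233 E011 W31 E031 E021 W21 E131 E121 W11");
("00123 01023 10320 12030","000 011 003 001 101","W2","30201 31200 20200","0 0 0 3 0",2,"E023 E141 W13 E041 E241 W03 E011 E121 W32");
("0123 1032 1122 1203","000 332 100 220","","1010 2013 2301","",4,"E021 W13 W33 E032 W22 W02 E012 E232 E122");
("0123 1032 1133 1203","000 003 113 013","","0011 0101 2200","",4,"E231 E131 E013 E121 W23 W33 E023 W01 W13");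
("0123 1032 1203 1221","000 113 110 100","","1001 0011 0220","",4,"E031 E231 E123 E021 W31 W03 E013 W13 W21");
("0123 1032 1203 1212","000 232 332 112","","0110 0123 3021","",4,"E121 W01 W12 E232 W32 W22 E022 E132 E012");
("0123 0132 1023 1032 1302","000 120 101 100","","1001 0303 0011","",2,"E231 W41 E011 E021 W21 W31 W02 W12 E122");
("00123 01032 10230 12030","000 102 110 100 101","W1","10010 00110 03030","0 0 0 0 3",2,"E132 E021 W21 E041 E011 W31 E241 E121 W01");
("00123 01133 13020","000 022 000 001 202","E02","20013 23010 10010","0 0 1 0 0",2,"E031 E142 W11 E042 E342 W01 E012 E132 W21");
("00123 01122 12003","000 023 000 103 001","E02","20013 13002 10001","0 0 1 0 0",2,"E041 W12 E131 W02 E341 E031 E142 E012 W23");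
("00123 01212 12003","000 002 000 020 100","E02","10001 30030 33000","0 0 1 0 0",0,"E012 E032 E132 E041 W23 W03 W12");
("00123 01133 13002","000 003 030 000 100","E03","10001 20200 22000","0 0 0 1 0",0,"E013 E023 E123 E041 W22 W03 W13");
("00123 01313 13002","000 012 102 000 001","E03","30102 31002 10001","0 0 0 1 0",2,"E041 E121 W13 W01 E021 E241 W23 E011 E141");
("000123 012003 102030","000 001 133 000 100 320","E03 W1","100010 112020 110000","00 00 00 10 00 02",0,"E011 W01 E243 E041 E141 E452 W21");
("000123 012003 103031","000 000 002 000 020 100","E03 E01","100001 300030 303000","00 01 00 10 00 00",0,"E022 E042 E242 E051 W13 W03 W21");
("00123 01221 12030","000 023 103 001 000","E04","20130 13020 10010","0 0 0 0 1",2,"E031 W12 E121 W01 E231 E021 E132 E012 W23");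
("00123 01122 12030","000 002 020 100 000","E04","10010 30300 33000","0 0 0 0 1",0,"E012 E022 E122 E031 W23 W02 W12");
("000123 012030 103002","000 011 003 000 020 100","E03 W1","100001 312000 202000","00 00 00 10 02 00",0,"E023 E042 E011 E051 W22 W03 E151");
("0000123 0012003 1200003","000 021 201 101 003 000 001","E05 W0 W1","0022000 0312000 1023000","000 000 000 000 211 100 002",2,"E043 E122 E131 E031 E341 E022 E142 W23 E012");
("00123 01032 10320 12030","000 110 103 100 101","W0","10010 01010 00220","0 0 0 0 2",2,"E233 E011 W31 E041 W21 E021 E141 W11 E121");
("0123 1122 1302","000 203 220 202","","3102 0132 0101","",2,"E131 E022 W12 E032 E012 W22 E232 E122 W03");
("0123 1212 1302","000 010 100 013","","1010 1100 0202","",0,"E133 E011 W21 E021 W11 E121 W02");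
("00123 01302 13031","000 002 000 020 100","E02","10001 30030 33000","0 0 1 0 0",0,"E012 E032 E132 E041 W12 W03 W21");
("00123 01023 10302 12003","000 002 021 101 001","W3","23010 12300 33000","0 0 0 0 2",2,"E012 W02 E231 E031 W12 E131 W21 E122 E022");
("000123 012012 103020","000 000 001 000 020 100","E03 E01","100001 300030 101000","00 01 00 10 00 00",0,"E021 E042 W23 E051 E251 W03 W12");
("000123 001203 120300","000 220 201 200 203 202","W0 W1","300300 030300 001100","00 00 00 00 33 02",2,"E231 E012 W22 E052 E042 E022 E152 E142 E122");
("00123 01023 01302 10032","000 011 101 003 001","W3","30120 31020 20020","0 0 0 0 3",2,"E033 E121 W23 E021 E231 W01 E011 E131 W11");
("0123 1032 1133 1320","000 121 100 130","","1010 0022 0123","",4,"E021 E233 W01 W11 W21 E131 W33 E033 E011");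
("0123 1122 1331","000 023 220 022","","0132 3102 0101","",3,"E131 E022 W21 W13 E232 E122 W03 E032 E012");
("0123 1133 1331","000 101 001 221","","0110 0123 1010","",4,"E121 W01 E021 E232 E011 W11 E031 E132 W21");
("0123 1221 1313","000 130 033 031","","0132 2013 0033","",3,"E232 W23 W12 E011 E131 W01 E121 E023 E033");
("0123 1313 1331","000 001 221 101","","0101 0231 1100","",4,"E131 W03 E011 E122 E031 W21 E021 E232 W11");
("0123 1032 1221 1331","000 101 121 100","","1001 0330 0101","",4,"E031 E122 E131 W31 E011 W03 W13 W23 E021");
("01122 11202","000 230 203 202 220","W0","30120 02310 00110","0 0 0 0 3",2,"E231 E042 E012 E032 E022 W12 E123 E242 E133");
("01133 10122","000 001 220 010 100","W1","20310 10010 11000","0 0 0 0 3",0,"E011 E031 E131 E041 E141 E022 W01");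
("01133 10313","000 332 310 130 100","W1","30120 30210 33110","0 0 0 0 2",4,"E041 E343 W02 E232 E132 E122 E012 E033 E142");
("0123 1032 1122 1320","000 332 112 232","","0101 0231 3210","",4,"E131 W03 W32 E122 W22 W12 E012 E232 E032");
("0123 1122 1221","000 001 011 101","","0101 0110 1100","",4,"E131 E121 E011 E231 E031 E021 W11 W02 W21");
("0123 1212 1221","000 011 101 001","","0011 0101 1001","",4,"E231 E131 E031 E121 E021 E011 W21 W01 W11");
("01122 11303","000 002 202 332 232","W0","03300 01320 33000","0 0 0 0 3",4,"E122 E243 E012 E133 E022 W12 E032 E233 E042");
("01122 12201","000 303 003 030 100","W1","02200 20020 20200","0 0 0 0 1",0,"E023 E033 E233 E041 E013 W01 E133");
("01122 10313","000 022 202 102 001","W1","00220 03120 30120","0 0 0 0 2",2,"E041 E122 E131 E022 E031 E341 E012 E142 W02");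
("0123 1122 1212","000 202 232 332","","0011 0220 3311","",4,"E231 E123 W12 W03 E012 W22 E032 E133 E022");
("01122 10212","000 101 110 020 100","W1","20130 30030 31130","0 0 0 0 3",4,"E041 E032 E141 E021 E011 E121 W01 E233 E131");
("0123 1133 1230","000 302 303 310","","2130 0321 0110","",2,"E121 W13 E033 E023 W23 E013 W03 E131 E231");
("0123 1133 1212","000 033 031 330","","0132 2130 0330","",3,"E122 E033 W12 W21 E133 E233 W02 E013 E023");
("0123 1133 1313","000 221 101 001","","0011 0312 1001","",4,"E231 W02 E031 E132 E021 W21 E011 E122 W11");
("01133 10212","000 013 303 103 001","W1","00330 01320 20130","0 0 0 0 3",2,"E041 E131 E123 E023 E341 E031 W01 E141 E011");
("0123 1032 1212 1313","000 101 110 221","","2121 3131 3021","",4,"W33 W22 W12 E021 E011 E121 E031 E132 W02");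
("01133 11202","000 121 221 001 101","W0","02200 02130 10010","0 0 0 0 2",4,"E123 E142 E031 E232 E041 W11 E021 E242 E011");
("0123 1032 1203 1313","000 130 121 100","","1001 0202 0312","",4,"E031 E133 W02 W21 W31 E121 W13 E013 E021");
("01122 10133","000 001 330 010 100","W1","30210 10010 11000","0 0 0 0 2",0,"E011 E031 E131 E041 E141 E023 W01");
("001122 120201","000 001 010 210 000 100","E04 W0","003300 101000 110000","00 00 00 00 10 13",0,"E011 E021 E121 E051 E151 E251 W12");
("001133 120102","000 101 320 020 000 100","E04 W0","002200 300300 112200","00 00 00 00 10 12",4,"E051 E032 E151 E252 E011 W12 E121 E022 E131");
("00123 01331 13200","000 022 001 202 000","E04","20130 23100 10100","0 0 0 0 1",2,"E021 E132 W11 E032 E232 W03 E012 E122 W21");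
("001122 120102","000 032 302 001 202 000","E05 W0","102300 120300 100100","00 00 00 00 13 10",2,"E031 E123 E142 E042 E342 E023 E133 W11 E013");
("001122 110202","000 232 230 030 000 100","E04 W0","003300 200200 033000","00 00 00 00 10 13",4,"E051 E033 E122 E253 E132 W12 E152 E353 E012");
("001133 110202","000 033 203 001 303 000","E05 W0","103200 320100 100100","00 00 00 00 12 10",2,"E031 E143 E122 E043 E022 E343 E013 W13 E133");
("00123 01023 01230 10320","000 011 003 001 101","W3","30201 31200 20200","0 0 0 3 0",2,"E023 E141 W13 E041 E241 W03 E011 E121 W21");
("0000123 0012030 1200030","000 022 202 102 000 002 001","E04 W0 W1","0022000 0312000 3012000","000 000 000 000 100 002 221",2,"E052 E122 E131 E022 E031 E361 E012 E162 W23");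
("00123 00132 01203 13200","000 300 100 120 101","W3","22000 21030 32001","0 0 3 0 0",2,"E241 E132 E031 E041 W22 E142 W03 W11 E342");
("001133 120201","000 012 302 000 102 001","E03 W0","003030 013020 302010","00 00 00 10 00 22",2,"E051 E141 E123 E253 E041 E023 W12 E011 E151");
("001122 110303","000 032 302 001 202 000","E05 W0","102300 120300 100100","00 00 00 00 13 10",2,"E031 E123 E142 E042 E342 E023 E133 W13 E013");
("001133 110303","000 101 020 320 000 100","E04 W0","002200 303000 112200","00 00 00 00 10 12",4,"E051 E022 E151 E352 E011 W11 E131 E032 E121");
("00123 01221 12300","000 001 030 000 100","E03","10001 20200 11000","0 0 0 1 0",0,"E011 E023 W22 E041 E141 W03 W11");
("00123 01212 12300","000 013 001 000 303","E03","30102 21300 10100","0 0 0 1 0",2,"E021 W11 E143 E043 W02 E243 W22 E121 E011");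
("001122 112200","000 302 120 320 100 000","E05 W0","003300 301200 331100","00 00 00 00 13 10",0,"W12 E242 E132 E041 E142 E342 E122");
("001122 110033","000 302 120 320 100 000","E05 W0","003300 301200 331100","00 00 00 00 13 10",0,"W12 E242 E132 E041 E142 E342 E122");
("0001122 1120200","000 022 102 001 003 001 000","E06 E35 W0","3012000 2301000 1001000","000 000 000 000 221 010 100",2,"E031 W12 E121 E241 E021 E231 E012 E132 E142");
("0001133 1120002","000 103 100 230 130 100 000","E06 W0 E25","1010000 1032000 0220000","000 000 000 000 313 001 100",0,"E123 E243 E143 E021 W13 E233 E133");
("001122 110022","000 002 220 020 100 000","E05 W0","003300 300300 330000","00 00 00 00 13 10",0,"E012 E032 E132 E041 W12 E022 E122");
("001133 110022","000 103 230 130 100 000","E05 W0","002200 203100 223300","00 00 00 00 12 10",0,"E143 E343 E133 E041 W13 E243 E123");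
("0001122 1120002","000 002 100 220 020 100 000","E06 W0 E25","1010000 2013000 3300000","000 000 000 000 212 001 100",0,"E012 E042 E142 E021 W12 E032 E132");
("0001133 1120200","000 023 103 002 001 001 000","E06 E45 W0","3012000 2301000 3003000","000 000 000 000 223 233 100",2,"E032 W12 E121 E231 E241 E021 E142 E012 E132");
("001133 110033","000 003 330 030 100 000","E05 W0","002200 200200 220000","00 00 00 00 12 10",0,"E013 E033 E133 E041 W13 E023 E123");
("0001133 1130003","000 003 100 330 030 100 000","E06 W0 E25","1010000 3012000 2200000","000 000 000 000 313 001 100",0,"E013 E043 E143 E021 W13 E033 E133");
("00001122 11220000","000 023 103 001 002 000 001 000","E07 E05 W0 E36","20130000 13020000 10010000","0000 0000 0000 0000 2112 0100 0001 1000",2,"E031 W12 E121 E241 E231 E021 E132 E012 E142");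
("00001133 11220000","000 022 102 003 003 000 001 000","E07 E05 W0 E34","20130000 13020000 20020000","0000 0000 0000 0000 0001 0100 1222 1000",2,"E033 W12 E121 E231 E021 E261 E012 E162 E132");
("001133 112200","000 001 330 000 010 100","E03 W0","302010 100010 110000","00 00 00 10 00 22",0,"E011 E041 E141 E051 E151 E023 W11");
("000123 012003 103200","000 303 002 030 000 100","E04 W1","123000 200200 303000","00 00 00 00 10 02",0,"E022 E033 W21 E051 E013 W03 E133");
("00123 01313 13200","000 001 020 100 000","E04","10010 30300 11000","0 0 0 0 1",0,"E011 E022 W23 E031 E131 W02 W11");
("000123 012120 103200","000 000 001 020 100 000","E05 E01","100010 300300 101000","00 01 00 00 00 10",0,"E021 E032 W23 E041 E241 W02 W12");
("00123 00132 01302 12300","000 200 100 110 101","W3","33000 23010 23001","0 0 2 0 0",2,"E241 E031 E133 E041 E143 W23 E341 W02 W13");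
("000123 012201 103002","000 000 003 030 000 100","E04 E01","100001 200200 202000","00 01 00 00 10 00",0,"E023 E033 E233 E051 W22 W03 W11");
("0123 0132 1212 1313","000 010 221 100","","1001 1100 1212","",0,"W21 E011 W02 E031 W13 E131 W31");
("0123 0132 1122 1133","000 221 010 100","","1001 1010 1122","",0,"W21 E021 W11 E031 W01 E231 W31");
("000123 012030 103310","000 000 002 020 100 000","E05 E01","100010 300300 303000","00 01 00 00 00 10",0,"E022 E032 E232 E041 W13 W02 W21");
("001122 113300","000 001 220 000 010 100","E03 W0","203010 100010 110000","00 00 00 10 00 33",0,"E011 E041 E141 E051 E151 E022 W11");
("0001122 1130300","000 012 102 003 001 001 000","E06 E45 W0","2013000 2103000 2002000","000 000 000 000 332 322 100",2,"E033 E121 W13 E231 E021 E241 E131 E011 E141");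
("1122 1212 1221","000 131 033 003","","3113 0022 2002","",1,"W22 E233 E033 W12 E023 E011 E131 W01 E121");
("1133 1212 1221","000 100 213 010","","1100 1001 3322","",1,"E011 E031 W02 E131 W13 W21 E022 E123 E232");
("01133 10133 11033","000 003 030 100 000","E04","10010 20200 22000","0 0 0 0 1",0,"E013 E023 E123 E031 W23 W13 W03");
("01122 10122 11022","000 002 020 100 000","E04","10010 30300 33000","0 0 0 0 1",0,"E012 E022 E122 E031 W22 W12 W02")].

(** Node 0 is the empty configuration; nodes 1 to 3 consist of a single word. A hint may follow an
    edge only towards a larger index, which makes the analysis terminate. *)
Definition raw_nodes : seq (nat * String.string * option (nat * String.string) *
    seq (nat * String.string)) := [::
(0,"",None,[:: (1,"012"); (1,"021"); (2,"0123"); (3,"0123"); (2,"0213"); (3,"0213"); (2,"0312"); (3,"0312")]);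
(3,"123",Some (0,"01"),[:: (4,"3012"); (5,"3012"); (6,"34012"); (6,"43012"); (7,"3012"); (8,"3012"); (9,"34012"); (9,"43012"); (10,"34012"); (10,"43012"); (11,"3012"); (12,"3012"); (13,"3012"); (14,"3012"); (15,"3012"); (16,"3012"); (17,"34012"); (17,"43012"); (18,"43012"); (18,"34012"); (19,"34012"); (19,"43012")]);
(4,"1122",Some (1,"023"),[:: (11,"3012"); (11,"2013"); (13,"2031"); (17,"12034"); (15,"0123"); (15,"0132"); (17,"03124"); (17,"02134"); (20,"0123"); (21,"0123"); (21,"1032"); (21,"0132"); (21,"1023"); (22,"40132"); (22,"40123"); (23,"40123")]);
(4,"1133",Some (2,"023"),[:: (14,"3021"); (12,"2013"); (14,"2031"); (18,"21043"); (16,"0123"); (16,"0132"); (18,"30142"); (18,"20143"); (20,"0123"); (21,"2031"); (24,"1032"); (21,"3021"); (24,"1023"); (25,"40132"); (25,"40123"); (26,"40123")]);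
(4,"0123 1203",Some (0,"13"),[:: (27,"3012"); (28,"3021"); (29,"42013"); (30,"42013"); (31,"0123"); (28,"0123"); (32,"42013"); (33,"42013"); (34,"40123"); (35,"40123"); (36,"04123"); (32,"04123"); (37,"2013"); (38,"2013"); (39,"2013"); (40,"2013"); (41,"2013"); (42,"2013"); (43,"42013"); (44,"42013"); (45,"40123"); (46,"04123")]);
(4,"0123 1302",Some (0,"13"),[:: (31,"2031"); (47,"2031"); (36,"42031"); (48,"42031"); (31,"1023"); (27,"2031"); (49,"42031"); (50,"42031"); (51,"04123"); (52,"40123"); (53,"452031"); (53,"542031"); (48,"04123"); (33,"04123"); (54,"452031"); (54,"542031"); (55,"2031"); (56,"2031"); (57,"42031"); (58,"42031"); (59,"04123"); (60,"04123"); (61,"542031"); (61,"452031")]);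
(5,"00123 12300",Some (3,"203"),[:: (62,"34012"); (30,"13024"); (32,"04132"); (29,"03124"); (36,"03142"); (53,"345012"); (63,"01234"); (64,"015234"); (65,"34012")]);
(4,"0123 1023",Some (0,"23"),[:: (31,"3012"); (27,"1023"); (31,"0123"); (31,"1023"); (49,"41023"); (50,"41023"); (36,"41023"); (48,"41023"); (49,"40123"); (50,"40123"); (36,"40123"); (48,"40123"); (54,"450123"); (54,"540123"); (53,"450123"); (53,"540123"); (55,"0123"); (55,"1023"); (58,"41023"); (57,"41023"); (58,"40123"); (57,"40123"); (61,"450123"); (61,"540123")]);
(4,"0123 1032",Some (0,"23"),[:: (66,"0123"); (28,"1032"); (28,"0123"); (27,"2031"); (32,"41032"); (33,"41032"); (29,"41032"); (30,"41032"); (29,"40123"); (30,"40123"); (32,"40123"); (33,"40123"); (39,"0123"); (40,"0123"); (42,"0123"); (42,"1032"); (38,"0123"); (38,"1032"); (44,"41032"); (43,"41032"); (43,"40123"); (44,"40123")]);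
(5,"00123 12030",Some (3,"304"),[:: (62,"42013"); (30,"14032"); (36,"04123"); (29,"04132"); (32,"02143"); (53,"425013"); (62,"01243"); (67,"015234"); (65,"42013")]);
(5,"00123 12003",Some (3,"402"),[:: (62,"23014"); (30,"12043"); (32,"03124"); (36,"02134"); (29,"02143"); (53,"235014"); (62,"01234"); (53,"015234"); (65,"01234")]);
(4,"0123 1331",Some (1,"230"),[:: (40,"3021"); (42,"2013"); (68,"0132"); (45,"04123"); (69,"0123"); (70,"0123"); (71,"40123")]);
(4,"0123 1221",Some (2,"130"),[:: (39,"3021"); (38,"0123"); (72,"0132"); (43,"04123"); (73,"0123"); (70,"0123"); (74,"40123")]);
(4,"0123 1313",Some (1,"120"),[:: (40,"2013"); (42,"1032"); (68,"0123"); (44,"04123"); (75,"0123"); (76,"0123"); (77,"40123")]);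
(4,"0123 1212",Some (1,"213"),[:: (39,"2013"); (55,"0123"); (42,"0123"); (57,"04123"); (76,"0123"); (69,"0123"); (78,"40123")]);
(4,"0123 1122",Some (1,"123"),[:: (41,"3021"); (37,"2013"); (39,"0123"); (46,"40123"); (79,"0123"); (75,"0123"); (80,"40123")]);
(4,"0123 1133",Some (2,"123"),[:: (38,"2013"); (55,"2031"); (40,"0123"); (60,"40123"); (79,"0123"); (73,"0123"); (81,"40123")]);
(5,"00123 12120",Some (1,"231"),[:: (65,"01234"); (44,"14032"); (82,"40321"); (80,"10234"); (83,"510234")]);
(5,"00123 12201",Some (2,"240"),[:: (65,"42013"); (43,"03124"); (82,"30241"); (81,"01234"); (84,"501234")]);
(5,"00123 12012",Some (1,"341"),[:: (65,"34012"); (44,"12043"); (82,"20431"); (78,"10234"); (85,"510234")]);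
(4,"1122 1133",Some (4,"0123"),[:: (70,"3012"); (76,"3021"); (70,"2013"); (76,"2031"); (79,"1023"); (79,"1032"); (79,"0123"); (79,"0132"); (86,"0132"); (86,"1023")]);
(4,"1122 1212",Some (5,"0312"),[:: (86,"0123"); (86,"0213")]);
(5,"01122 13301",Some (2,"412"),[:: (78,"31024"); (80,"01243"); (83,"031245")]);
(5,"01122 10122",Some (1,"234"),[:: (87,"13024"); (87,"03124"); (88,"013245")]);
(4,"1133 1212",Some (6,"1203"),[:: (86,"0123"); (86,"2031")]);
(5,"01133 12201",Some (1,"412"),[:: (87,"31042"); (81,"01234"); (84,"031254")]);
(5,"01133 10133",Some (2,"234"),[:: (78,"13042"); (78,"03142"); (89,"013254")]);
(4,"0123 1023 1230",Some (7,"201"),[:: (90,"1023"); (91,"43012"); (92,"0123"); (93,"40123")]);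
(4,"0123 1032 1203",Some (8,"301"),[:: (94,"0123"); (95,"1023"); (96,"42013"); (92,"0132"); (97,"42013"); (97,"40123"); (98,"40123")]);
(5,"00123 01032 10230",Some (7,"324"),[:: (99,"14023"); (100,"04132"); (101,"02134"); (102,"052143")]);
(5,"00123 01032 10320",Some (9,"324"),[::]);
(4,"0123 1023 1203",Some (3,"301"),[:: (95,"1023"); (103,"0123"); (104,"40123"); (105,"40123")]);
(5,"00123 01032 10203",Some (8,"423"),[::]);
(5,"00123 01032 10302",Some (3,"423"),[:: (99,"23014"); (98,"03124"); (106,"02134"); (102,"501234")]);
(5,"00123 01203 10230",Some (3,"234"),[:: (99,"34012"); (98,"04132"); (106,"03142"); (107,"501234")]);
(5,"00123 01203 10320",Some (8,"234"),[::]);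
(5,"00123 01023 10203",Some (7,"423"),[:: (99,"01234"); (101,"13042"); (97,"10234"); (102,"153024")]);
(4,"0123 1032 1331",Some (1,"230"),[::]);
(4,"0123 1032 1221",Some (1,"321"),[::]);
(4,"0123 1032 1122",Some (10,"0123"),[::]);
(4,"0123 1032 1133",Some (10,"0123"),[::]);
(4,"0123 1032 1313",Some (2,"231"),[::]);
(4,"0123 1032 1212",Some (2,"320"),[::]);
(5,"00123 01032 10221",Some (1,"432"),[::]);
(5,"00123 01032 10313",Some (2,"342"),[::]);
(5,"00123 01203 10331",Some (2,"423"),[::]);
(5,"00123 01122 10203",Some (1,"243"),[::]);
(4,"0123 1023 1302",Some (3,"301"),[:: (103,"1023"); (104,"41023"); (95,"0123"); (105,"41023")]);
(5,"00123 01023 10302",Some (7,"403"),[:: (101,"13042"); (91,"01234"); (108,"03142"); (106,"02134"); (109,"501234"); (110,"01234"); (111,"501234")]);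
(5,"00123 01023 10230",Some (3,"304"),[:: (106,"14023"); (105,"04123"); (112,"04132"); (101,"02134"); (113,"501234"); (114,"01234"); (115,"501234")]);
(5,"00123 01023 10320",Some (3,"324"),[:: (116,"41032"); (106,"14023"); (98,"12043"); (117,"510234")]);
(5,"00123 01230 10302",Some (3,"203"),[:: (106,"13042"); (101,"04123"); (112,"03124"); (105,"03142"); (113,"054123"); (118,"01243"); (119,"501234")]);
(5,"00123 01302 10320",Some (7,"234"),[:: (99,"03142"); (101,"14023"); (100,"13024"); (102,"154032")]);
(6,"000123 001023 120003",Some (7,"514"),[:: (120,"234015"); (102,"314025"); (102,"214035"); (121,"123054"); (122,"2346015")]);
(6,"000123 001023 120030",Some (3,"405"),[:: (123,"235014"); (117,"031245"); (117,"021345"); (124,"023154"); (125,"6012345")]);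
(4,"0123 1023 1212",Some (1,"231"),[:: (126,"1023"); (127,"0123"); (128,"41023")]);
(4,"0123 1023 1331",Some (1,"230"),[:: (126,"0123"); (127,"0123"); (128,"40123")]);
(5,"00123 01023 10212",Some (1,"342"),[:: (129,"10234"); (130,"01234"); (131,"10234"); (132,"510234")]);
(5,"00123 01023 10331",Some (1,"340"),[:: (133,"01234"); (131,"10234"); (128,"01234"); (134,"501234")]);
(5,"00123 01221 10302",Some (2,"241"),[:: (135,"01243"); (136,"10234"); (137,"01234"); (138,"051234")]);
(5,"00123 01133 10302",Some (2,"243"),[:: (139,"03124"); (140,"01234"); (137,"01234"); (141,"501234")]);
(6,"000123 001023 120012",Some (1,"451"),[:: (142,"123054"); (143,"230541"); (132,"130245"); (132,"120345"); (144,"6102345")]);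
(5,"00123 00132 12003",Some (11,"4023"),[:: (145,"01234"); (146,"01234"); (101,"01243"); (120,"501234")]);
(5,"00123 00132 12300",Some (11,"2034"),[:: (145,"34012"); (147,"01243"); (147,"01234"); (148,"501234")]);
(6,"000123 001302 120300",Some (7,"315"),[:: (120,"245013"); (102,"415023"); (102,"215043"); (121,"124035"); (122,"2456013")]);
(5,"00123 12003 12120",Some (12,"02134"),[::]);
(4,"0123 1032 1230",Some (3,"203"),[:: (95,"3012"); (103,"0132"); (149,"40123"); (112,"40123")]);
(6,"000123 001230 120030",Some (7,"413"),[:: (120,"253014"); (102,"513024"); (121,"125043"); (102,"213054"); (122,"2536014")]);
(4,"0123 0132 1313",Some (2,"213"),[:: (126,"0132"); (133,"04132")]);
(4,"0123 1212 1331",Some (5,"2301"),[::]);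
(4,"0123 1221 1331",Some (10,"0312"),[::]);
(5,"00123 01331 10331",Some (2,"423"),[:: (128,"10234"); (128,"01234"); (134,"015234")]);
(4,"0123 0132 1212",Some (1,"213"),[:: (150,"0123"); (151,"04123")]);
(4,"0123 1133 1221",Some (6,"1302"),[::]);
(5,"00123 01221 10221",Some (1,"423"),[:: (152,"10234"); (152,"01234"); (153,"015234")]);
(4,"0123 1122 1313",Some (5,"1203"),[::]);
(4,"0123 1212 1313",Some (13,"0213"),[::]);
(5,"00123 01313 10313",Some (2,"324"),[:: (154,"10234"); (154,"01234"); (155,"015234")]);
(5,"00123 01212 13031",Some (2,"431"),[::]);
(4,"0123 1122 1133",Some (10,"0123"),[::]);
(5,"00123 01122 13310",Some (2,"321"),[::]);
(5,"00123 01133 12201",Some (1,"421"),[::]);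
(5,"01133 01212 10320",Some (6,"2314"),[::]);
(6,"000123 013310 103310",Some (2,"432"),[::]);
(6,"000123 012201 102201",Some (1,"532"),[::]);
(6,"000123 013031 103031",Some (2,"542"),[::]);
(4,"1122 1133 1212",Some (4,"0123"),[::]);
(5,"00123 01331 12012",Some (1,"341"),[::]);
(6,"000123 012120 102120",Some (1,"342"),[::]);
(6,"000123 013103 103103",Some (2,"352"),[::]);
(4,"0123 0132 1023 1320",Some (3,"213"),[:: (156,"40123")]);
(5,"00123 01023 01203 10302",Some (3,"412"),[:: (157,"13042")]);
(4,"0123 0132 1023 1230",Some (8,"213"),[::]);
(5,"00123 01023 01230 10023",Some (3,"314"),[:: (158,"01234"); (159,"04123"); (160,"01234"); (161,"501234")]);
(4,"0123 1032 1203 1320",Some (14,"0123"),[::]);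
(4,"0123 0132 1023 1302",Some (9,"312"),[::]);
(5,"00123 01032 01203 10302",Some (8,"412"),[::]);
(5,"00123 01032 01203 10023",Some (9,"413"),[::]);
(5,"00123 01032 01203 10032",Some (8,"423"),[::]);
(5,"00123 01023 10203 12003",Some (9,"403"),[::]);
(5,"00123 01032 01320 10032",Some (9,"324"),[::]);
(5,"00123 00132 01023 12030",Some (15,"3124"),[:: (157,"01234")]);
(6,"000123 001032 010302 102003",Some (8,"523"),[::]);
(4,"0123 0132 1023 1203",Some (7,"312"),[:: (159,"40123")]);
(5,"00123 01023 01203 10203",Some (7,"423"),[:: (157,"13042")]);
(5,"00123 01023 01203 10023",Some (7,"423"),[:: (162,"02134"); (156,"03142"); (163,"02134"); (164,"502134")]);
(5,"00123 00132 01023 13002",Some (11,"4123"),[:: (157,"10243")]);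
(6,"000123 001203 010230 102300",Some (8,"324"),[::]);
(5,"00123 01023 01320 10023",Some (3,"324"),[:: (158,"02134"); (159,"04123"); (160,"02134"); (161,"502134")]);
(6,"000123 001023 010302 103002",Some (3,"523"),[::]);
(5,"00123 00132 01023 10302",Some (9,"423"),[::]);
(6,"000123 001023 010302 100302",Some (3,"523"),[:: (164,"120345"); (164,"021345"); (165,"013245"); (166,"012345"); (167,"0162345")]);
(5,"00123 01032 01230 10032",Some (7,"324"),[:: (157,"12034")]);
(6,"000123 001023 010230 102030",Some (7,"423"),[::]);
(5,"00123 00132 01023 10230",Some (8,"324"),[::]);
(6,"000123 001023 010230 100230",Some (7,"423"),[:: (161,"120345"); (161,"021345"); (168,"013245"); (169,"012345"); (170,"0162345")]);
(5,"00123 01230 10032 12030",Some (9,"302"),[::]);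
(6,"000123 001320 010023 102030",Some (8,"425"),[::]);
(5,"00123 00132 01203 10320",Some (8,"234"),[::]);
(6,"000123 001230 010302 100302",Some (7,"325"),[:: (171,"120345"); (171,"021345"); (168,"015234"); (172,"012354"); (173,"0162345")]);
(6,"000123 000132 012003 102003",Some (15,"5234"),[::]);
(6,"000123 001032 010032 100320",Some (9,"435"),[::]);
(7,"0000123 0001302 0120003 1020003",Some (8,"624"),[::]);
(6,"000123 000132 013002 103002",Some (11,"5234"),[::]);
(6,"000123 001032 010032 100203",Some (8,"534"),[::]);
(7,"0000123 0001023 0120030 1020030",Some (8,"526"),[::]);
(4,"0123 0132 1023 1331",Some (2,"321"),[::]);
(4,"0123 1023 1212 1331",Some (5,"2301"),[::]);
(5,"00123 01023 01331 10331",Some (2,"432"),[::]);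
(5,"00123 01032 01212 10023",Some (2,"431"),[::]);
(5,"00123 01023 10212 12012",Some (2,"430"),[::]);
(5,"00123 01212 01331 10023",Some (5,"3412"),[::]);
(6,"000123 001212 010023 103031",Some (2,"542"),[::]);
(5,"00123 00132 01023 10331",Some (2,"432"),[::]);
(6,"000123 001023 010331 100331",Some (2,"543"),[::]);
(5,"00123 00132 01212 10320",Some (1,"324"),[::]);
(5,"00123 01221 01302 10221",Some (1,"423"),[::]);
(5,"00123 01133 01221 10302",Some (6,"2413"),[::]);
(6,"000123 001221 010221 100302",Some (1,"534"),[::]);
(5,"00123 01032 01221 10032",Some (1,"432"),[::]);
(5,"00123 01133 10302 12201",Some (1,"421"),[::]);
(6,"000123 001133 010302 102201",Some (1,"532"),[::]);
(6,"000123 001032 010032 100313",Some (2,"453"),[::]);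
(6,"001133 001212 010320 100320",Some (6,"3425"),[::]);
(7,"0000123 0001023 0130031 1030031",Some (2,"652"),[::]);
(5,"00123 00132 12003 13002",Some (16,"40123"),[::]);
(5,"00123 00132 01302 12003",Some (15,"4123"),[:: (174,"01234")]);
(5,"00123 00132 01203 12300",Some (15,"2134"),[:: (175,"01234")]);
(6,"000123 000132 012300 102300",Some (15,"3245"),[::]);
(5,"00123 01032 01230 10230",Some (7,"324"),[:: (162,"04123"); (163,"04123"); (156,"02134"); (164,"504123")]);
(4,"0123 0132 1023 1212",Some (1,"231"),[::]);
(5,"00123 00132 01023 10212",Some (1,"342"),[::]);
(5,"00123 01032 01221 10221",Some (1,"432"),[::]);
(6,"000123 001032 010221 100221",Some (1,"543"),[::]);
(5,"00123 01032 01313 10313",Some (2,"342"),[::]);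
(6,"000123 001032 010313 100313",Some (2,"453"),[::]);
(5,"00123 00132 01023 01320 12030",Some (15,"3124"),[::]);
(5,"00123 00132 01023 10032 12030",Some (17,"34201"),[::]);
(5,"00123 01023 01230 10023 10230",Some (8,"324"),[::]);
(5,"00123 00132 01023 01203 13002",Some (11,"4123"),[::]);
(5,"00123 00132 01023 01230 10023",Some (8,"324"),[::]);
(6,"000123 001023 001230 010023 100230",Some (8,"435"),[::]);
(5,"00123 01023 01302 10023 10302",Some (9,"423"),[::]);
(5,"00123 00132 01023 01302 10023",Some (9,"423"),[::]);
(6,"000123 001023 001302 010023 100302",Some (9,"534"),[::]);
(6,"000123 000132 001023 013002 103002",Some (11,"5234"),[::]);
(6,"000123 000132 001023 010302 100302",Some (9,"534"),[::]);
(7,"0000123 0001023 0010023 0100302 1000302",Some (9,"645"),[::]);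
(6,"000123 000132 001023 012030 102030",Some (15,"4235"),[::]);
(6,"000123 000132 001023 010230 100230",Some (8,"435"),[::]);
(7,"0000123 0001023 0010023 0100230 1000230",Some (8,"546"),[::]);
(6,"000123 001230 001302 010230 100302",Some (9,"345"),[::]);
(6,"000123 000132 001203 010320 100320",Some (8,"345"),[::]);
(7,"0000123 0001230 0010230 0100302 1000302",Some (9,"456"),[::]);
(5,"00123 00132 01302 10203 12003",Some (17,"42301"),[::]);
(5,"00123 00132 01203 10302 12300",Some (17,"24301"),[::])].

Local Open Scope int_scope.
(** Polynomials are coefficient lists with the constant term first. The positions over a general
    field need not specialise to those over GF(4): what [fam_ok] compares is which sets of
    differences and points are bases. *)
Definition raw_fams : seq (nat * String.string * String.string * seq (seq (seq int)) *
    seq (seq (seq int))) := [::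
(2%N,"23 32","",
 [:: [:: [::]];
  [:: [:: 1]];
  [:: [:: 1; 1]];
  [:: [:: 2; 1]]],
 [::]);
(3%N,"122 230","",
 [:: [:: [:: 1]; [::]];
  [:: [:: 1; 1]; [::]];
  [:: [::]; [:: 1; 1]];
  [:: [::]; [:: 1]];
  [:: [::]; [::]]],
 [::]);
(3%N,"133 320","",
 [:: [:: [:: 1]; [::]];
  [:: [:: 1; 1]; [::]];
  [:: [::]; [:: 1; 1]];
  [:: [::]; [:: 1]];
  [:: [::]; [::]]],
 [::]);
(3%N,"230 203","",
 [:: [:: [::]; [::]];
  [:: [:: 1]; [::]];
  [:: [::]; [:: 1]];
  [:: [:: 1; 1]; [::]];
  [:: [::]; [:: 1; 1]]],
 [::]);
(4%N,"","1122 1133 1212 1313",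
 [:: [:: [::]; [::]; [::]];
  [:: [:: 1]; [::]; [::]];
  [:: [::]; [:: 1]; [::]];
  [:: [::]; [::]; [:: 1]]],
 [:: [:: [:: -1]; [:: 0; -1]; [:: 0; 1]];
  [:: [:: 0; 1]; [:: 1]; [:: -1]];
  [:: [:: 0; -1]; [:: -1]; [:: 0; 1]];
  [:: [:: 1]; [:: 0; 1]; [:: -1]]]);
(4%N,"2300","1212 1221",
 [:: [:: [::]; [::]; [::]];
  [:: [:: -1]; [::]; [::]];
  [:: [::]; [:: 1]; [::]];
  [:: [::]; [::]; [:: 1]];
  [:: [:: -1; -1]; [::]; [::]]],
 [:: [:: [:: 1; 1]; [:: 0; -1]; [:: 1; 1]];
  [:: [:: 1; 1]; [:: 1; 1]; [:: 0; -1]]]);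
(4%N,"3200","1313 1331",
 [:: [:: [::]; [::]; [::]];
  [:: [:: -1]; [::]; [::]];
  [:: [::]; [:: 1]; [::]];
  [:: [::]; [::]; [:: 1]];
  [:: [:: -1; -1]; [::]; [::]]],
 [:: [:: [:: 1; 1]; [:: 0; -1]; [:: 1; 1]];
  [:: [:: 1; 1]; [:: 1; 1]; [:: 0; -1]]]);
(3%N,"320 302","",
 [:: [:: [::]; [::]];
  [:: [:: 1]; [::]];
  [:: [::]; [:: 1]];
  [:: [:: 1; 1]; [::]];
  [:: [::]; [:: 1; 1]]],
 [::]);
(3%N,"320 203","",
 [:: [:: [::]; [::]];
  [:: [:: 1]; [::]];
  [:: [::]; [:: 1; 1]];
  [:: [:: 1; 1]; [::]];
  [:: [::]; [:: 1]]],
 [::]);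
(3%N,"230 302","",
 [:: [:: [::]; [::]];
  [:: [:: 1]; [::]];
  [:: [::]; [:: 1; 1]];
  [:: [:: 1; 1]; [::]];
  [:: [::]; [:: 1]]],
 [::]);
(4%N,"","0123 1032 1122 1133",
 [:: [:: [::]; [::]; [::]];
  [:: [:: 1]; [::]; [::]];
  [:: [::]; [:: 1]; [::]];
  [:: [::]; [::]; [:: 1]]],
 [:: [:: [:: 1]; [:: 0; -1]; [:: -1; 1]];
  [:: [::]; [:: -1; 1]; [:: 0; -1]];
  [:: [:: -1]; [:: 0; 1]; [:: 0; -1]];
  [:: [:: -1]; [:: -1; 1]; [:: 1; -1]]]);
(4%N,"2300","1023 1032",
 [:: [:: [::]; [::]; [::]];
  [:: [:: 1]; [::]; [::]];
  [:: [::]; [:: 1]; [::]];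
  [:: [::]; [::]; [:: 1]];
  [:: [:: 1; 1]; [::]; [::]]],
 [:: [:: [::]; [:: -1; -1]; [:: 1]];
  [:: [::]; [:: 1]; [:: -1; -1]]]);
(5%N,"","11220 10203 01023",
 [:: [:: [::]; [::]; [::]; [::]];
  [:: [:: 1]; [::]; [::]; [::]];
  [:: [::]; [:: 1]; [::]; [::]];
  [:: [::]; [::]; [:: 1]; [::]];
  [:: [::]; [::]; [::]; [:: 1]]],
 [:: [:: [:: -1]; [:: 0; -1]; [:: 0; 1]; [::]];
  [:: [::]; [:: 0; -1]; [::]; [:: -1; 1]];
  [:: [:: 1]; [::]; [:: 0; -1]; [:: -1; 1]]]);
(4%N,"","0132 1023 1133 1122",
 [:: [:: [::]; [::]; [::]];
  [:: [:: 1]; [::]; [::]];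
  [:: [::]; [:: 1]; [::]];
  [:: [::]; [::]; [:: 1]]],
 [:: [:: [:: 1]; [:: 0; -1]; [:: -1; 1]];
  [:: [::]; [:: -1; 1]; [:: 0; -1]];
  [:: [:: -1]; [:: 0; 1]; [:: 0; -1]];
  [:: [:: -1]; [:: -1; 1]; [:: 1; -1]]]);
(4%N,"","0123 1032 1203 1320",
 [:: [:: [::]; [::]; [::]];
  [:: [:: 1]; [::]; [::]];
  [:: [::]; [:: 1]; [::]];
  [:: [::]; [::]; [:: 1]]],
 [:: [:: [:: 1]; [:: 0; -1]; [:: -1; 1]];
  [:: [::]; [:: -1; -1]; [:: 0; 1]];
  [:: [:: -1; -1]; [::]; [:: 1]];
  [:: [:: 0; -1]; [:: 1]; [::]]]);
(4%N,"3200","1032 1023",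
 [:: [:: [::]; [::]; [::]];
  [:: [:: 1]; [::]; [::]];
  [:: [::]; [:: 1]; [::]];
  [:: [::]; [::]; [:: 1]];
  [:: [:: 1; 1]; [::]; [::]]],
 [:: [:: [::]; [:: -1; -1]; [:: 1]];
  [:: [::]; [:: 1]; [:: -1; -1]]]);
(5%N,"","12300 13200 10023 10032",
 [:: [:: [::]; [::]; [::]; [::]];
  [:: [:: 1]; [::]; [::]; [::]];
  [:: [::]; [:: 1]; [::]; [::]];
  [:: [::]; [::]; [:: 1]; [::]];
  [:: [::]; [::]; [::]; [:: 1]]],
 [:: [:: [:: 0; -1]; [:: -1; 1]; [::]; [::]];
  [:: [:: -1; 1]; [:: 0; -1]; [::]; [::]];
  [:: [::]; [::]; [:: 0; -1]; [:: -1; 1]];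
  [:: [::]; [::]; [:: -1; 1]; [:: 0; -1]]]);
(5%N,"","13200 13020 12300 12003 10023",
 [:: [:: [::]; [::]; [::]; [::]];
  [:: [:: 1]; [::]; [::]; [::]];
  [:: [::]; [:: 1]; [::]; [::]];
  [:: [::]; [::]; [:: 1]; [::]];
  [:: [::]; [::]; [::]; [:: 1]]],
 [:: [:: [:: 0; -1]; [:: -1; 1]; [::]; [::]];
  [:: [:: 0; -1]; [::]; [:: -1; 1]; [::]];
  [:: [:: -1; 1]; [:: 0; -1]; [::]; [::]];
  [:: [:: -1; 1]; [::]; [::]; [:: 0; -1]];
  [:: [::]; [::]; [:: -1; 1]; [:: 0; -1]]])].
Local Close Scope int_scope.
Local Close Scope string_scope.
Local Open Scope ring_scope.

Definition certs : seq mcert := Eval vm_compute in map mkcert raw_certs.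
Definition nodes : seq node := Eval vm_compute in map mknode raw_nodes.
Definition fams : seq fam := Eval vm_compute in map mkfam raw_fams.

(** * Search for hints and their verification *)

Definition relab (N : nat) (p : seq nat) (x : seq g4) : seq g4 :=
  [seq if l \in p then wnth x (index l p) else O4 | l <- iota 0 N].
Definition par (N : nat) (x y : seq g4) : bool :=
  has (fun g => all (fun i => wnth x i == gmul g (wnth y i)) (iota 0 N)) [:: I4; A4; B4].
Definition emb (N : nat) (p : seq nat) (xs ys : seq (seq g4)) : bool :=
  [&& uniq p, all (fun l => l < N)%N p & all (fun x => has (par N (relab N p x)) ys) xs].

Definition waddn (N : nat) (x y : seq g4) : seq g4 :=
  [seq gadd (wnth x i) (wnth y i) | i <- iota 0 N].
Definition unit1 (N l : nat) : seq g4 := [seq if i == l then I4 else O4 | i <- iota 0 N].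
(** Label sequences of length [k] for a new word: a letter sits on an old vertex, with a label below
    [n], or on a new vertex, which receives the next label [m]. Numbering new vertices by appearance
    removes their symmetry. The second component is the resulting number of vertices. *)
Fixpoint gen (k n m : nat) : seq (seq nat * nat) :=
  if k is k'.+1 then
    [seq (l :: s.1, s.2) | l <- iota 0 n, s <- gen k' n m] ++
    [seq (m :: s.1, s.2) | s <- gen k' n m.+1]
  else [:: ([::], m)].

Fixpoint sublists (T : Type) (k : nat) (s : seq T) : seq (seq T) :=
  match k, s with
  | 0, _ => [:: [::]]
  | _, [::] => [::]
  | k'.+1, x :: s' => map (cons x) (sublists k' s') ++ sublists k s'
  end.
Fixpoint inserts (T : Type) (x : T) (s : seq T) : seq (seq T) :=
  if s is y :: s' then (x :: s) :: map (cons y) (inserts x s') else [:: [:: x]].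
Fixpoint perms (T : Type) (s : seq T) : seq (seq T) :=
  if s is x :: s' then flatten (map (inserts x) (perms s')) else [:: [::]].
Fixpoint scalings (s : seq (seq g4)) : seq (seq (seq g4)) :=
  if s is x :: s' then
    [seq map (gmul g) x :: t | g <- [:: I4; A4; B4], t <- scalings s'] else [:: [::]].

Definition code_at (L : seq (seq g4)) (i : nat) : BinNums.N :=
  foldr (fun w r => BinNat.N.add (BinNat.N.double (BinNat.N.double r))
    (match wnth w i with
     | O4 => BinNums.N0
     | I4 => BinNums.Npos BinNums.xH
     | A4 => BinNums.Npos (BinNums.xO BinNums.xH)
     | B4 => BinNums.Npos (BinNums.xI BinNums.xH)
     end)) BinNums.N0 L.
Fixpoint ins (x : BinNums.N * nat) (s : seq (BinNums.N * nat)) : seq (BinNums.N * nat) :=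
  if s is y :: s' then if BinNat.N.leb x.1 y.1 then x :: s else y :: ins x s' else [:: x].
(** The nonzero columns of a list of words, read as numbers in base 4 and sorted: lists that differ
    only by a permutation of the vertices get the same codes, and the indices kept with the codes
    give the permutation. *)
Definition keyl (N : nat) (L : seq (seq g4)) : seq (BinNums.N * nat) :=
  foldr (fun i r => let cd := code_at L i in
    if cd is BinNums.N0 then r else ins (cd, i) r) [::] (iota 0 N).
Fixpoint same (s t : seq (BinNums.N * nat)) : bool :=
  match s, t with
  | [::], [::] => true
  | x :: s', y :: t' => if BinNat.N.eqb x.1 y.1 then same s' t' else false
  | _, _ => false
  end.
Definition weight (w : seq g4) : nat := count (fun x => x != O4) w.

Definition cert0 := MCert [::] [::] [::] [::] [::] 0 [::].
Definition node0 := Node 0 [::] None [::].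

Definition entries : seq (nat * seq nat * nat * seq (BinNums.N * nat)) :=
  Eval vm_compute in
  [seq let ct := nth cert0 certs i in
       (i, map weight (cW ct), size (cT ct), keyl (size (cT ct)) (cW ct)) | i <- iota 0 (size certs)].

Definition supp (N : nat) (L : seq (seq g4)) : nat :=
  count (fun i => has (fun w => wnth w i != O4) L) (iota 0 N).

(* Unlike [has] and [||], this stops at the first success under [vm_compute]. *)
Fixpoint first (S T : Type) (p : S -> option T) (s : seq S) : option T :=
  if s is x :: s' then if p x is Some y then Some y else first p s' else None.

(* Why a word [w], added to the words of a node, is harmless or impossible: it
   belongs to the family of the node (a vertex of the family joined to a vertex,
   two vertices of the family joined, a point of the family), it leads to another
   node, or it completes a configuration of [certs]. *)
Variant hint := HV of nat & nat | HVV of nat & nat | HY of nat | HE of nat | HB of nat & seq nat.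

Definition fam0 := Fam 0 [::] [::] [::] [::].

Definition hint_ok (j N : nat) (w : seq g4) (nd : node) (h : hint) : bool :=
  match h with
  | HE k => let e := nth (0%N, [::]) (nE nd) k in
      [&& (j < e.1)%N, (e.1 < size nodes)%N, nn (nth node0 nodes e.1) == size e.2
        & emb N e.2 (nX (nth node0 nodes e.1)) (w :: nX nd)]
  | HB i p => [&& (i < size certs)%N, size p == size (cT (nth cert0 certs i))
            & emb N p (cW (nth cert0 certs i)) (w :: nX nd)]
  | HV i l => if nF nd is Some fp then let f := nth fam0 fams fp.1 in
      [&& (i < size (fV f))%N, (l < N)%N &
          par N w (waddn N (relab N fp.2 (nth [::] (fV f) i)) (unit1 N l))] else false
  | HVV i i' => if nF nd is Some fp then let f := nth fam0 fams fp.1 in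
      [&& (i < size (fV f))%N, (i' < size (fV f))%N &
          par N w (waddn N (relab N fp.2 (nth [::] (fV f) i)) (relab N fp.2 (nth [::] (fV f) i')))] else false
  | HY i => if nF nd is Some fp then let f := nth fam0 fams fp.1 in
      (i < size (fY f))%N && par N w (relab N fp.2 (nth [::] (fY f) i)) else false
  end.

(** Combines the new word with at most four old ones, in every order and with every scaling, and
    compares sorted column codes with those of the certificates. *)
Definition search_bad (N : nat) (w : seq g4) (X : seq (seq g4)) : option hint :=
  first (fun k => first (fun S =>
    let m := supp N (w :: S) in
    let es := [seq e <- entries | (e.1.2 == m) && (size e.1.1.2 == k.+1)] in
    if es is [::] then None else
    first (fun L =>
      let wt := map weight L in
      let es' := [seq e <- es | e.1.1.2 == wt] in
      if es' is [::] then None else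
      first (fun L2 => let kl := keyl N L2 in
        first (fun e => if same kl e.2 then
          Some (HB e.1.1.1 [seq nth 0%N (unzip2 kl) (index v (unzip2 e.2)) | v <- iota 0 m])
          else None) es') (scalings L)) (perms (w :: S))) (sublists k X)) (iota 0 5).

(** Untrusted: the hint found is checked again by [node_ok]. The fallback [HY 0] has been tried
    before and refused, so a failed search cannot pass that check. *)
Definition search (j N : nat) (w : seq g4) (nd : node) : hint :=
  let try h := if hint_ok j N w nd h then Some h else None in
  let nv := if nF nd is Some fp then size (fV (nth fam0 fams fp.1)) else 0%N in
  let ny := if nF nd is Some fp then size (fY (nth fam0 fams fp.1)) else 0%N in
  let o := first (fun t => t tt) [::
    (fun _ => first (fun k => try (HE k)) (iota 0 (size (nE nd))));
    (fun _ => first (fun i => first (fun l => try (HV i l)) (iota 0 N)) (iota 0 nv));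
    (fun _ => first (fun i => first (fun l => try (HVV i l)) (iota 0 nv)) (iota 0 nv));
    (fun _ => first (fun i => try (HY i)) (iota 0 ny));
    (fun _ => search_bad N w (nX nd))] in
  if o is Some h then h else HY 0.

(** Up to a scalar and the order of the vertices these are the only nontrivial words, by
    [word_shape]. *)
Definition shapes : seq (seq g4) := [:: [:: I4; A4; B4]; [:: I4; I4; A4; A4]].

(* By the symmetries of the words of [shapes], other label sequences are redundant. *)
Definition canonical (ls : seq nat) : bool :=
  match ls with
  | [:: i; j; k] => (i < j)%N && (i < k)%N
  | [:: i; j; k; l] => (i < j)%N && (k < l)%N
  | _ => true
  end.

Definition cands (n : nat) (sh : seq g4) : seq (seq nat * nat) :=
  [seq c <- gen (size sh) n n | uniq c.1 && canonical c.1].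

(** The search runs once, here; [nodes_ok] only replays the resulting checks. *)
Definition hints : seq (seq (seq hint)) := Eval vm_compute in
  [seq let nd := nth node0 nodes j in
       [seq [seq search j c.2 (relab c.2 c.1 sh) nd | c <- cands (nn nd) sh] | sh <- shapes]
     | j <- iota 0 (size nodes)].

Definition node_ok (j : nat) : bool :=
  let nd := nth node0 nodes j in
  (if nF nd is Some fp then
     [&& (fp.1 < size fams)%N, uniq fp.2, size fp.2 == fk (nth fam0 fams fp.1)
       & all (fun l => l < nn nd)%N fp.2] else true) &&
  all (fun i => let sh := nth [::] shapes i in
    let cs := cands (nn nd) sh in let hs := nth [::] (nth [::] hints j) i in
    (size cs == size hs) &&
    all (fun p => hint_ok j p.1.2 (relab p.1.2 p.1.1 sh) nd p.2) (zip cs hs)) (iota 0 2).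

Lemma nodes_ok : all node_ok (iota 0 (size nodes)).
Proof. by vm_compute. Qed.

(** The columns of [F7], [V1], [P1], [P3] and [Y9], in the order used by [cN] and by [NN]. *)
Definition cols_of (n : nat) : seq (seq g4) :=
  map (map nat_g4) (nth [::] [::
   [:: [:: 0; 0; 1]; [:: 0; 1; 0]; [:: 0; 1; 1]; [:: 1; 0; 0]; [:: 1; 0; 1]; [:: 1; 1; 0]; [:: 1; 1; 1]];
   [:: [:: 1; 0; 0]; [:: 0; 1; 0]; [:: 0; 0; 1]; [:: 1; 1; 0]; [:: 0; 1; 1]; [:: 1; 3; 1]; [:: 1; 3; 2];
       [:: 1; 2; 1]; [:: 1; 0; 2]];
   [:: [:: 0; 0; 1]; [:: 1; 1; 0]; [:: 1; 2; 0]; [:: 1; 0; 1]; [:: 1; 0; 2]; [:: 1; 0; 3]; [:: 0; 1; 1];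
       [:: 0; 1; 2]; [:: 0; 1; 3]];
   [:: [:: 0; 0; 1]; [:: 1; 1; 0]; [:: 1; 2; 0]; [:: 1; 3; 0]; [:: 1; 0; 1]; [:: 1; 0; 2]; [:: 1; 0; 3];
       [:: 0; 1; 1]; [:: 0; 1; 2]];
   [:: [:: 1; 0; 0]; [:: 0; 1; 0]; [:: 0; 0; 1]; [:: 1; 1; 0]; [:: 1; 0; 1]; [:: 0; 1; 1]; [:: 2; 2; 1];
       [:: 2; 1; 0]; [:: 1; 2; 1]]]%N n).

Lemma certs_ok : all (fun ct => (cN ct < 5)%N && cert_ok ct (cols_of (cN ct))) certs.
Proof. by vm_compute. Qed.

Lemma cols_nonpar n : (n < 5)%N -> nonpar (cols_of n).
Proof. by case: n => [|[|[|[|[|n]]]]] // _; vm_compute. Qed.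

(** * Classification of the words of a represented matroid *)

Section Classification.
Variables (K : finFieldType) (a : K).
Hypothesis (ha : a ^+ 2 = a + 1) (char2 : 1 + 1 = 0 :> K).
Hypothesis evsurj : forall x : K, exists g, x = ev a g.
Variables (Vt E : finType) (c : E -> fvec K Vt).
Hypothesis sum0 : forall e, \sum_u c e u = 0.
Hypothesis noN : forall n, (n < 5)%N -> exists N, target a N (cols_of n) /\ ~ has_minor (Mplus c) N.

Notation ev := (ev a).
Notation wv := (wv a).
Notation dl := (@dl K Vt).
Notation present := (present a c).

Lemma no_cert i (rs : seq Vt) : (i < size certs)%N -> uniq rs ->
  size rs = size (cT (nth cert0 certs i)) ->
  (forall w, w \in cW (nth cert0 certs i) -> mpresent a c rs w) -> False.
Proof.
move=> ic urs srs pr; have /(all_nthP cert0)/(_ i ic)/andP[n5 ok] := certs_ok.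
have [N [tN]] := noN n5; apply.
exact: (cert_sound ha char2 sum0 ok (cols_nonpar n5) tN urs srs pr).
Qed.

Lemma present_mpresent rs w : present rs w -> mpresent a c rs w.
Proof.
case=> e [s [s0 es]]; exists e, s; split=> // u ur _.
by rewrite es !ffunE ur.
Qed.

Lemma wv_relab (u0 : Vt) (rs : seq Vt) (p : seq nat) (x : seq g4) :
  uniq rs -> all (fun l => l < size rs)%N p ->
  wv rs (relab (size rs) p x) = wv (map (nth u0 rs) p) x.
Proof.
move=> urs pl; apply/ffunP => u; rewrite !ffunE.
have [ur|nur] := boolP (u \in rs); last first.
  case: ifP => // /mapP[l lp ul]; case/negP: nur; rewrite ul mem_nth //.
  exact: (allP pl).
have iu : (index u rs < size rs)%N by rewrite index_mem.
rewrite /wnth /relab (nth_map 0%N) ?size_iota // nth_iota // add0n.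
have mE : (u \in map (nth u0 rs) p) = (index u rs \in p).
  apply/mapP/idP => [[l lp ->]|ip]; first by rewrite index_uniq // (allP pl).
  by exists (index u rs); rewrite ?nth_index.
rewrite mE; case: ifP => // ip; congr (ev (nth _ _ _)).
elim: p pl {mE} ip => //= l p IH /andP[lN pl]; rewrite inE.
have -> : (nth u0 rs l == u) = (l == index u rs).
  by apply/eqP/eqP => [<-|->]; rewrite ?index_uniq // nth_index.
rewrite eq_sym; case: eqP => //= _ ip; by rewrite IH.
Qed.

Lemma wv_par (rs : seq Vt) x y : par (size rs) x y -> exists s, s != 0 /\ wv rs x = s *: wv rs y.
Proof.
case/hasP => g gin /allP H; exists (ev g); split.
  by rewrite (ev_eq0 ha); move: gin; rewrite !inE; case: (g).
apply/ffunP => u; rewrite !ffunE; case: ifP => [ur|_]; last by rewrite [_ *: _]mulr0.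
by have := H (index u rs); rewrite mem_iota index_mem ur => /(_ isT)/eqP ->; rewrite ev_mul.
Qed.

Lemma wv_waddn (rs : seq Vt) x y : wv rs (waddn (size rs) x y) = wv rs x + wv rs y.
Proof.
apply/ffunP => u; rewrite !ffunE; case: ifP => [ur|_]; last by rewrite addr0.
by rewrite {1}/wnth (nth_map 0%N) ?size_iota ?index_mem // nth_iota ?index_mem // add0n ev_add.
Qed.

Lemma wv_unit1 (u0 : Vt) (rs : seq Vt) l : uniq rs -> (l < size rs)%N ->
  wv rs (unit1 (size rs) l) = dl (nth u0 rs l).
Proof.
move=> urs lN; apply/ffunP => u; rewrite !ffunE; case: ifP => [ur|/negbT nur].
  rewrite /wnth (nth_map 0%N) ?size_iota ?index_mem // nth_iota ?index_mem // add0n.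
  have -> : (u == nth u0 rs l) = (index u rs == l).
    by apply/eqP/eqP => [->|<-]; rewrite ?index_uniq // nth_index.
  by case: ifP.
by rewrite (_ : (u == _) = false) //; apply: contraNF nur => /eqP ->; rewrite mem_nth.
Qed.

Lemma wv_cat (rs ext : seq Vt) x : (size x <= size rs)%N -> wv (rs ++ ext) x = wv rs x.
Proof.
move=> sx; apply/ffunP => u; rewrite !ffunE mem_cat index_cat.
case: (boolP (u \in rs)) => //= ur; case: ifP => // _; rewrite /wnth nth_default //=.
by rewrite (leq_trans sx) // leq_addr.
Qed.

Lemma presentZ rs x y : par (size rs) x y -> present rs y -> present rs x.
Proof.
move=> /wv_par[s [s0 es]] [e [t [t0 et]]]; exists e, (t * s^-1).
by rewrite mulf_neq0 ?invr_eq0 // et es scalerA -mulrA mulVf ?mulr1.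
Qed.

Lemma emb_present (u0 : Vt) (rs : seq Vt) p xs ys : uniq rs -> emb (size rs) p xs ys ->
  (forall y, y \in ys -> present rs y) ->
  [/\ uniq (map (nth u0 rs) p) & forall x, x \in xs -> present (map (nth u0 rs) p) x].
Proof.
move=> urs /and3P[up pl /allP H] pr; split.
  rewrite map_inj_in_uniq // => l l' lp lp' /eqP.
  by rewrite nth_uniq ?(allP pl) // => /eqP.
move=> x /H /hasP[y /pr py] /presentZ/(_ py).
by case=> e [s [s0 es]]; exists e, s; rewrite -wv_relab.
Qed.

Definition trivial_word (v : fvec K Vt) : Prop :=
  v = 0 \/ exists u u' (s : K), v = s *: (dl u - dl u').

Lemma sum_wv (rs : seq Vt) w : uniq rs ->
  \sum_u wv rs w u = ev (gsum [seq wnth w i | i <- iota 0 (size rs)]).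
Proof.
move=> urs; rewrite ev_gsum_iota //; case: rs urs => [|u0 rs] urs.
  by rewrite big_ord0 big1 // => u _; rewrite ffunE.
have := @wv_sum K a Vt (MCert [::] (map (fun=> [::]) (u0 :: rs)) [::] [::] [::] 0 [::]) (u0 :: rs) urs.
rewrite size_map => /(_ erefl (fun=> 1) w u0).
rewrite (eq_bigr (fun u => wv (u0 :: rs) w u)) => [->|u _]; last exact: mulr1.
by apply: eq_bigr => i _; rewrite mulr1.
Qed.

(** Three equal values sum to [x] in characteristic 2, so there is a further vertex [r0]. Merging
    all other vertices into [r0] gives it the value [x] too, and the word 1111 with the six edges on
    four vertices is [F7]. *)
Lemma word_class3 e (x : K) (u1 u2 u3 : Vt) : x != 0 -> uniq [:: u1; u2; u3] ->
  c e u1 = x -> c e u2 = x -> c e u3 = x -> False.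
Proof.
move=> x0 u123 e1 e2 e3.
have [r0 r0N] : exists r0, r0 \notin [:: u1; u2; u3].
  apply/existsP; apply: contraNT x0 => /existsPn all3; rewrite -(sum0 e).
  have big3 : \sum_u c e u = \sum_(u <- [:: u1; u2; u3]) c e u.
    rewrite [RHS]big_uniq //=; apply: eq_bigl => u.
    by have := all3 u; rewrite negbK => ->.
  by rewrite big3 !big_cons big_nil e1 e2 e3 addr0 (addrr2 char2) addr0.
apply: (@no_cert 0 [:: r0; u1; u2; u3]) => //; first by rewrite cons_uniq r0N.
move=> w; rewrite inE => /eqP ->; exists e, x; split=> // u.
rewrite !inE /=; rewrite !inE !negb_or in r0N; case/and3P: r0N => r1 r2 r3.
move: u123 => /=; rewrite !inE negb_or andbT => /andP[/andP[n12 n13] n23].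
case/or4P => /eqP -> ; rewrite ?eqxx ?(negPf r1) ?(negPf r2) ?(negPf r3) ?(negPf n12) ?(negPf n13) ?(negPf n23) //= ?e1 ?e2 ?e3 /wnth /= mulr1 //.
Qed.

Definition shaped (v : fvec K Vt) : Prop :=
  exists sh us s, [/\ sh \in shapes, uniq us, size us = size sh, s != 0 & v = s *: wv us sh].

(** Each nonzero value occurs at most twice. Since 1 + [a] + [a^2] = 0 is the only linear relation
    between these values over the prime field, sum zero means that the three multiplicities have the
    same parity: all are 1, or each is 0 or 2, and (2, 2, 2) is excluded by a certificate. *)
Lemma word_shape e : trivial_word (c e) \/ shaped (c e).
Proof.
pose l g := enum [set u | c e u == ev g].
have memg g u : (u \in l g) = (c e u == ev g) by rewrite mem_enum inE.
have ul g : uniq (l g) by apply: enum_uniq.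
have evI : injective ev.
  move=> p q; case: (eqVneq p q) => // npq e1; exfalso.
  have : ev (gadd p q) == 0 by rewrite ev_add // e1 (addrr2 char2).
  by rewrite (ev_eq0 ha); move: npq; case: (p); case: (q).
have dis g h u : g != h -> u \in l g -> u \notin l h.
  by move=> gh; rewrite !memg => /eqP ->; apply: contraNN gh => /eqP/evI ->.
have le2 g : g != O4 -> (size (l g) <= 2)%N.
  move=> g0; rewrite leqNgt; apply/negP.
  have := ul g; have := memg g; case: (l g) => [|u1 [|u2 [|u3 s]]] // mg us _.
  have cE u : u \in [:: u1, u2, u3 & s] -> c e u = ev g by rewrite mg => /eqP.
  apply: (@word_class3 e (ev g) u1 u2 u3); rewrite ?(ev_eq0 ha) //; try by apply: cE; rewrite !inE eqxx ?orbT.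
  by move: us => /=; rewrite !inE !negb_or => /and4P[/and3P[-> -> _] /andP[-> _] _ _].
have vE : c e = wv (l I4 ++ l A4 ++ l B4)
    (nseq (size (l I4)) I4 ++ nseq (size (l A4)) A4 ++ nseq (size (l B4)) B4).
  apply/ffunP => u; rewrite ffunE !mem_cat !index_cat /wnth !nth_cat !size_nseq.
  have [uI|nI] := boolP (u \in l I4).
    by rewrite /= index_mem uI nth_nseq index_mem uI; move: uI; rewrite memg => /eqP.
  rewrite /= ltnNge leq_addr /= addKn; have [uA|nA] := boolP (u \in l A4).
    by rewrite /= index_mem uA nth_nseq index_mem uA; move: uA; rewrite memg => /eqP.
  rewrite /= ltnNge leq_addr /= addKn; have [uB|nB] := boolP (u \in l B4).
    by rewrite nth_nseq index_mem uB; move: uB; rewrite memg => /eqP.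
  have [g ug] := evsurj (c e u); move: nI nA nB; rewrite !memg ug.
  by case: (g); rewrite /= ?eqxx.
have uc : uniq (l I4 ++ l A4 ++ l B4).
  rewrite !cat_uniq !ul /= andbT; apply/andP; split.
    apply/hasPn => u; rewrite mem_cat => /orP[]; [exact: (@dis A4 I4) | exact: (@dis B4 I4)].
  by apply/hasPn => u; apply: (@dis B4 A4).
have := sum0 e; rewrite {1}vE sum_wv //.
move: vE uc (le2 I4 isT) (le2 A4 isT) (le2 B4 isT).
have cI u : u \in l I4 -> c e u = 1 by rewrite memg => /eqP.
have cA u : u \in l A4 -> c e u = a by rewrite memg => /eqP.
have cB u : u \in l B4 -> c e u = a ^+ 2 by rewrite memg => /eqP.
move: cI cA cB {memg ul dis le2}; move: (l I4) (l A4) (l B4) => lI lA lB {l}.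
have wv2 x y g : uniq [:: x; y] -> wv [:: x; y] [:: g; g] = ev g *: (dl x - dl y).
  rewrite /= inE andbT => xy; apply/ffunP => u; rewrite !ffunE !inE /=.
  have [->|ux] := eqVneq u x; first by rewrite (negPf xy) /= subr0 [_ *: _]mulr1.
  rewrite /=; have [_|uy] := eqVneq u y; last by rewrite subrr [_ *: _]mulr0.
  by rewrite /wnth /= sub0r (oppr2 char2) [_ *: _]mulr1.
have tr2 x y g v : v = wv [:: x; y] [:: g; g] -> uniq [:: x; y] -> trivial_word v.
  by move=> -> /wv2 ->; right; exists x, y, (ev g).
have sc4 x y z t g h s : ev g = s -> gmul g A4 = h -> g != O4 ->
    uniq [:: x; y; z; t] -> shaped (wv [:: x; y; z; t] [:: g; g; h; h]).
  move=> gs gh g0 us; exists [:: I4; I4; A4; A4], [:: x; y; z; t], (ev g).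
  split=> //; first by rewrite (ev_eq0 ha).
  apply/ffunP => u; rewrite !ffunE; case: ifP => _; last by rewrite [_ *: _]mulr0.
  rewrite [_ *: _](_ : _ = ev (gmul g (wnth [:: I4; I4; A4; A4] (index u [:: x; y; z; t])))); last by rewrite ev_mul.
  congr ev; rewrite -gh; case: (index _ _) => [|[|[|[|n]]]] //=; rewrite /wnth /= ?nth_nil; by case: (g).
case: lI => [|x1 [|x2 [|? ?]]] // cI; case: lA => [|y1 [|y2 [|? ?]]] // cA;
  case: lB => [|z1 [|z2 [|? ?]]] // cB vE uc _ _ _ => /eqP; rewrite (ev_eq0 ha) //= => _.
- by left; left; rewrite vE; apply/ffunP => u; rewrite !ffunE.
- by left; apply: tr2 vE uc.
- by left; apply: tr2 vE uc.
- by right; rewrite vE; apply: (sc4 _ _ _ _ A4 B4 _ erefl).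
- right; exists [:: I4; A4; B4], [:: x1; y1; z1], 1; split=> //; first exact: oner_neq0.
  by rewrite scale1r.
- by left; apply: tr2 vE uc.
- right; have -> : c e = wv [:: z1; z2; x1; x2] [:: B4; B4; I4; I4].
    rewrite vE -[[:: z1; z2; x1; x2]]/(map (nth z1 [:: x1; x2; z1; z2]) [:: 2; 3; 0; 1]%N).
    by rewrite -wv_relab.
  apply: (sc4 _ _ _ _ B4 I4 _ erefl) => //.
  by rewrite -[[:: z1; z2; x1; x2]]/([:: z1; z2] ++ [:: x1; x2]) uniq_catC.
- by right; rewrite vE; apply: (sc4 _ _ _ _ I4 A4 _ erefl).
(* Every value occurs twice. Merging [z1] with [y1] gives the value [a] + [a^2] = 1 there, so the
   word becomes 11123. *)
exfalso; apply: (@no_cert 1 [:: y1; x1; x2; y2; z2]) => //.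
  move: uc => /=; rewrite !inE !negb_or !andbT.
  move=> /and5P[/and5P[n1 n2 n3 n4 n5] /and4P[m1 m2 m3 m4] /and3P[o1 o2 o3] /andP[p1 p2] _].
  by rewrite (eq_sym y1 x1) (eq_sym y1 x2) n1 n2 n3 n5 m1 m2 m4 o1 o3 p2.
move=> w; rewrite inE => /eqP ->; exists e, 1; split; first exact: oner_neq0.
move=> u; rewrite !inE /= mul1r.
case/or4P => [/eqP->|/eqP->|/eqP->|/orP[]/eqP->]; rewrite ?eqxx //=.
- by case: ifP => // _ _; rewrite cI ?inE ?eqxx // /wnth /=; case: ifP.
- by case: ifP => // _ _; case: ifP => // _; rewrite cI ?inE ?eqxx ?orbT.
- case: ifP => // _ _; case: ifP => [/eqP x1y|_].
    by move: uc; rewrite x1y /= !inE eqxx !orbT.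
  case: ifP => [/eqP x1y|_].
    by move: uc; rewrite x1y /= !inE eqxx !orbT ?andbF.
  by rewrite cA ?inE ?eqxx ?orbT.
- case: ifP => // _ _; case: ifP => [/eqP x1y|_].
    by move: uc; rewrite x1y /= !inE eqxx !orbT.
  case: ifP => [/eqP x1y|_].
    by move: uc; rewrite x1y /= !inE eqxx !orbT ?andbF.
  case: ifP => [/eqP x1y|_].
    by move: uc; rewrite x1y /= !inE eqxx !orbT ?andbF.
  by rewrite cB ?inE ?eqxx ?orbT.
Qed.


Lemma index_filter (T : eqType) (p : pred T) (s : seq T) x y :
  p x -> p y -> (index x s < index y s)%N ->
  (index x (filter p s) < index y (filter p s))%N.
Proof.
move=> px py; elim: s => //= z s IH; case: eqP => [->|zx].
  by case: eqP => // zy _; rewrite px /= eqxx; case: eqP.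
case: eqP => // zy lt; case: ifP => pz /=; last exact: IH.
by move/eqP/negPf: zx => ->; move/eqP/negPf: zy => ->; apply: IH.
Qed.

(** The labelling of a word relative to [rs0] is found by [gen]: vertices that are not listed are
    appended in order of appearance, and [add] collects those met so far. *)
Lemma gen_mem (us rs0 add : seq Vt) : uniq us -> {in us, forall u, u \notin add} ->
  let rs := rs0 ++ add in let ext := [seq u <- us | u \notin rs] in
  ([seq index u (rs ++ ext) | u <- us], size (rs ++ ext)) \in gen (size us) (size rs0) (size rs).
Proof.
elim: us add => [|u us IH] add /=; first by rewrite cats0 inE.
case/andP=> nu uus na; rewrite mem_cat.
have [ur|nur] /= := boolP (u \in rs0 ++ add).
  apply/orP; left.
  have u0 : u \in rs0.
    by move: ur; rewrite mem_cat (negPf (na u (mem_head _ _))) orbF.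
  apply/allpairsP; exists (index u rs0, ([seq index v ((rs0 ++ add) ++ [seq v <- us | v \notin rs0 ++ add]) | v <- us],
     size ((rs0 ++ add) ++ [seq v <- us | v \notin rs0 ++ add]))).
  split; rewrite /= ?mem_iota ?index_mem //.
    by apply: IH => // v vus; apply: na; rewrite inE vus orbT.
  by rewrite -catA index_cat u0.
apply/orP; right; apply/mapP.
have := IH (rcons add u) uus; rewrite -rcons_cat => /(_ _).
have fE : [seq v <- us | v \notin rcons (rs0 ++ add) u] = [seq v <- us | v \notin rs0 ++ add].
  apply: eq_in_filter => v vus; rewrite mem_rcons inE negb_or.
  by case: eqP => // vu; rewrite -vu vus in nu.
cbv zeta; rewrite fE size_rcons => H; exists ([seq index v (rcons (rs0 ++ add) u ++ [seq v <- us | v \notin rs0 ++ add]) | v <- us],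
     size (rcons (rs0 ++ add) u ++ [seq v <- us | v \notin rs0 ++ add])).
  apply: H => v vus; rewrite mem_rcons inE negb_or na ?inE ?vus ?orbT // andbT.
  by apply: contraNneq nu => <-.
rewrite /= cat_rcons; congr (_ :: _, _).
by rewrite index_cat (negPf nur) /= eqxx addn0.
Qed.

Definition inF (f : fam) (rs : seq Vt) (v : fvec K Vt) : Prop :=
  exists s : K, s != 0 /\
  [\/ exists i u, (i < size (fV f))%N /\ v = s *: (wv rs (nth [::] (fV f) i) + dl u),
      exists i i', [/\ (i < size (fV f))%N, (i' < size (fV f))%N &
        v = s *: (wv rs (nth [::] (fV f) i) + wv rs (nth [::] (fV f) i'))]
    | exists2 i, (i < size (fY f))%N & v = s *: wv rs (nth [::] (fY f) i)].

Definition classified : Prop := (forall e, trivial_word (c e)) \/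
  exists i rs, [/\ (i < size fams)%N, uniq rs, size rs = fk (nth fam0 fams i) &
    forall e, trivial_word (c e) \/ inF (nth fam0 fams i) rs (c e)].

Lemma wv_gmul (rs : seq Vt) (g : g4) (w : seq g4) : wv rs (map (gmul g) w) = ev g *: wv rs w.
Proof.
apply/ffunP => u; rewrite !ffunE; case: ifP => _; last by rewrite [_ *: _]mulr0.
rewrite /wnth; have [lt|ge] := ltnP (index u rs) (size w); first by rewrite (nth_map O4) // ev_mul.
by rewrite !nth_default ?size_map // [_ *: _]mulr0.
Qed.

(* The order in which the vertices of a shaped word are listed can be adapted to [rs]. *)
Lemma shaped_order (rs : seq Vt) v : shaped v ->
  exists sh us s, [/\ sh \in shapes, uniq us, size us = size sh, s != 0 & v = s *: wv us sh] /\
   match us with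
   | [:: u1; u2; u3] => (index u1 rs <= index u2 rs)%N && (index u1 rs <= index u3 rs)%N
   | [:: u1; u2; u3; u4] => (index u1 rs <= index u2 rs)%N && (index u3 rs <= index u4 rs)%N
   | _ => true
   end.
Proof.
case=> sh [us [s [shs uus sus s0 ->]]].
have gn (g : g4) : g != O4 -> s * ev g != 0 by move=> g0; rewrite mulf_neq0 // (ev_eq0 ha).
move: shs sus; rewrite !inE => /orP[]/eqP -> /=.
  case: us uus => [|u1 [|u2 [|u3 [|? ?]]]] // uus _.
  have wr (x y z : Vt) : uniq [:: x; y; z] -> wv [:: x; y; z] [:: I4; A4; B4] = ev A4 *: wv [:: y; z; x] [:: I4; A4; B4].
    move=> ux; rewrite -[[:: y; z; x]]/(map (nth z [:: x; y; z]) [:: 1; 2; 0]%N).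
    by rewrite -wv_relab // -wv_gmul.
  have u2' : uniq [:: u2; u3; u1] by rewrite -(rot_uniq 1) in uus.
  have u3' : uniq [:: u3; u1; u2] by rewrite -(rot_uniq 1) in u2'.
  have [l12|l21] := leqP (index u1 rs) (index u2 rs).
    have [l13|l31] := leqP (index u1 rs) (index u3 rs).
      by exists [:: I4; A4; B4], [:: u1; u2; u3], s; rewrite l12 l13.
    exists [:: I4; A4; B4], [:: u3; u1; u2], (s * ev A4 * ev A4); rewrite (ltnW l31) (leq_trans (ltnW l31)) //.
    split=> //; split=> //; first by rewrite mulf_neq0 ?gn // (ev_eq0 ha).
    by rewrite (wr u1) // (wr u2) // !scalerA ?mulrA.
  have [l23|l32] := leqP (index u2 rs) (index u3 rs).
    exists [:: I4; A4; B4], [:: u2; u3; u1], (s * ev A4); rewrite l23 (ltnW l21).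
    by split=> //; split=> //; rewrite ?gn // wr // scalerA.
  exists [:: I4; A4; B4], [:: u3; u1; u2], (s * ev A4 * ev A4); rewrite (ltnW l32) (ltnW (ltn_trans l32 l21)).
  split=> //; split=> //; first by rewrite mulf_neq0 ?gn // (ev_eq0 ha).
  by rewrite (wr u1) // (wr u2) // !scalerA ?mulrA.
case: us uus => [|u1 [|u2 [|u3 [|u4 [|? ?]]]]] // uus _.
have ws (x y z t : Vt) : uniq [:: x; y; z; t] ->
    wv [:: x; y; z; t] [:: I4; I4; A4; A4] = wv [:: y; x; z; t] [:: I4; I4; A4; A4].
  move=> ux; rewrite -[[:: y; x; z; t]]/(map (nth z [:: x; y; z; t]) [:: 1; 0; 2; 3]%N).
  by rewrite -wv_relab.
have wt (x y z t : Vt) : uniq [:: x; y; z; t] ->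
    wv [:: x; y; z; t] [:: I4; I4; A4; A4] = wv [:: x; y; t; z] [:: I4; I4; A4; A4].
  move=> ux; rewrite -[[:: x; y; t; z]]/(map (nth z [:: x; y; z; t]) [:: 0; 1; 3; 2]%N).
  by rewrite -wv_relab.
have us1 (x y z t : Vt) : uniq [:: x; y; z; t] -> uniq [:: y; x; z; t].
  by rewrite -[[:: y; x; z; t]]/([:: y] ++ [:: x] ++ [:: z; t]) uniq_catCA.
have us2 (x y z t : Vt) : uniq [:: x; y; z; t] -> uniq [:: x; y; t; z].
  move=> ux; rewrite (perm_uniq (_ : perm_eq _ [:: x; y; z; t])) //.
  by rewrite !perm_cons -[[:: t; z]]/([:: t] ++ [:: z]) perm_catC.
have [l12|l21] := leqP (index u1 rs) (index u2 rs); have [l34|l43] := leqP (index u3 rs) (index u4 rs).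
- by exists [:: I4; I4; A4; A4], [:: u1; u2; u3; u4], s; rewrite l12 l34.
- exists [:: I4; I4; A4; A4], [:: u1; u2; u4; u3], s; rewrite l12 (ltnW l43).
  by split=> //; split=> //; [apply: us2 | rewrite wt].
- exists [:: I4; I4; A4; A4], [:: u2; u1; u3; u4], s; rewrite l34 (ltnW l21).
  by split=> //; split=> //; [apply: us1 | rewrite ws].
exists [:: I4; I4; A4; A4], [:: u2; u1; u4; u3], s; rewrite (ltnW l43) (ltnW l21).
by split=> //; split=> //; [apply/us2/us1 | rewrite ws // wt //; apply: us1].
Qed.

(** Carries the order obtained from [shaped_order] over to labels. All vertices outside [rs] have
    index [size rs] there; such ties are resolved by the order in [us], in which new vertices are
    appended. *)
Lemma index_ext (rs us : seq Vt) u1 u2 : u1 != u2 -> u1 \in us -> u2 \in us ->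
  (index u1 us < index u2 us)%N -> (index u1 rs <= index u2 rs)%N ->
  (index u1 (rs ++ [seq u <- us | u \notin rs]) < index u2 (rs ++ [seq u <- us | u \notin rs]))%N.
Proof.
move=> n12 m1 m2 lt le; rewrite !index_cat.
have [r1|nr1] := boolP (u1 \in rs); have [r2|nr2] := boolP (u2 \in rs).
- rewrite ltn_neqAle le andbT; apply: contraNneq n12 => e12.
  by rewrite -(nth_index u1 r1) e12 nth_index.
- by rewrite (leq_trans (_ : (_ < size rs)%N)) ?index_mem ?leq_addr.
- by move: le; rewrite leqNgt (leq_trans (_ : (index u2 rs < size rs)%N)) ?index_mem // memNindex.
by rewrite ltn_add2l; apply: index_filter.
Qed.

Lemma fin_all_or (T : finType) (P : T -> Prop) (Q : Prop) :
  (forall e, P e \/ Q) -> (forall e, P e) \/ Q.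
Proof.
move=> H; suff : (forall e, e \in enum T -> P e) \/ Q.
  by case=> [K'|]; [left=> e; apply: K'; rewrite mem_enum | right].
elim: (enum T) => [|x s [IH|]]; [by left | | by right].
have [Px|] := H x; last by right.
by left=> e; rewrite inE => /orP[/eqP->|/IH].
Qed.

Lemma nodes_words : all (fun nd => all (fun w => size w <= nn nd)%N (nX nd)) nodes.
Proof. by vm_compute. Qed.

(** Induction along the graph of nodes, where [d] bounds how many nodes can still follow. The hint
    for an element keeps it in the family of the node, passes to a later node, or produces an
    excluded minor. *)
Lemma node_sound d j (rs : seq Vt) : (j < size nodes)%N -> (size nodes - j <= d)%N ->
  uniq rs -> size rs = nn (nth node0 nodes j) ->
  (forall w, w \in nX (nth node0 nodes j) -> present rs w) -> classified.
Proof.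
elim: d j rs => [|d IH] j rs jn; first by rewrite leqn0 subn_eq0 leqNgt jn.
move=> jd urs; set nd := nth node0 nodes j => srs pr.
have /allP/(_ j) := nodes_ok; rewrite mem_iota jn => /(_ isT).
rewrite /node_ok -/nd => /andP[fok /allP sok].
have szw w : w \in nX nd -> (size w <= size rs)%N.
  by have /(all_nthP node0)/(_ j jn)/allP H := nodes_words; rewrite srs => /H.
pose P e := trivial_word (c e) \/ (if nF nd is Some fp then
   forall u0, inF (nth fam0 fams fp.1) (map (nth u0 rs) fp.2) (c e) else False).
have step e : P e \/ classified.
  have [tr|/(shaped_order rs)[sh [us [s [[shs uus sus s0 cE] ord]]]]] := word_shape e; first by left; left.
  have [u0 usu0] : exists u0, u0 \in us.
    by move: shs sus; rewrite !inE => /orP[]/eqP->; case: us {uus cE ord} => [|u us] // _; exists u; rewrite mem_head.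
  (* New vertices are appended at the end, so the labels of the old words and of the family remain
     valid. *)
  pose ext := [seq u <- us | u \notin rs]; pose rs' := rs ++ ext.
  have urs' : uniq rs'.
    rewrite cat_uniq urs filter_uniq // andbT; apply/hasPn => u; rewrite mem_filter.
    by case/andP.
  pose ls := [seq index u rs' | u <- us].
  have usin u : u \in us -> u \in rs'.
    by move=> uu; rewrite mem_cat mem_filter uu andbT orbN.
  have lgen : (ls, size rs') \in gen (size us) (size rs) (size rs).
    have := @gen_mem us rs [::] uus; rewrite cats0; apply=> u _; by rewrite in_nil.
  have lsE : map (nth u0 rs') ls = us.
    rewrite -map_comp -[RHS]map_id; apply/eq_in_map => u uu /=; by rewrite nth_index ?usin.
  have uls : uniq ls by rewrite -(map_inj_in_uniq (f := nth u0 rs')) ?lsE // => x y xl yl /eqP;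
    rewrite nth_uniq // ?(introT mapP) //; [move/eqP | |];
    [by [] | by case/mapP: xl => u /usin ? ->; rewrite index_mem | by case/mapP: yl => u /usin ? ->; rewrite index_mem].
  have lslt : all (fun l => l < size rs')%N ls.
    by apply/allP => _ /mapP[u /usin ur ->]; rewrite index_mem.
  have can : canonical ls.
    clear usin lgen lsE uls lslt; move: shs sus uus ord; rewrite /ls /rs' /ext !inE => /orP[]/eqP->.
      case: (us) => [|u1 [|u2 [|u3 [|? ?]]]] // _ uus /andP[o1 o2].
      have [n12 n13 n23] : [/\ u1 != u2, u1 != u3 & u2 != u3].
        by move: (uus) => /=; rewrite !inE !negb_or !andbT => /andP[/andP[]].
      by apply/andP; split; apply: index_ext; rewrite ?inE ?eqxx ?orbT //= ?eqxx ?(negPf n12) ?(negPf n13) ?(negPf n23).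
    case: (us) => [|u1 [|u2 [|u3 [|u4 [|? ?]]]]] // _ uus /andP[o1 o2].
    have [[n12 n13 n14] [n23 n24 n34]] : [/\ u1 != u2, u1 != u3 & u1 != u4] /\ [/\ u2 != u3, u2 != u4 & u3 != u4].
      by move: (uus) => /=; rewrite !inE !negb_or !andbT => /and3P[/and3P[-> -> ->] /andP[-> ->] ->].
    by apply/andP; split; apply: index_ext; rewrite ?inE ?eqxx ?orbT //= ?eqxx ?(negPf n12) ?(negPf n13) ?(negPf n23) ?(negPf n14) ?(negPf n24) ?(negPf n34).
  have [i i2 shE] : exists2 i, i \in iota 0 2 & sh = nth [::] shapes i.
    by move: shs; rewrite !inE => /orP[]/eqP->; [exists 0%N | exists 1%N].
  have := sok i i2; rewrite -shE; set cs := cands _ _; set hs := nth _ _ _.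
  case/andP=> /eqP shs' /(all_nthP ((([::], 0%N)), HY 0)) hok.
  have incs : (ls, size rs') \in cs by rewrite mem_filter /= uls can -srs -sus.
  have icz : (index (ls, size rs') cs < size (zip cs hs))%N by rewrite size_zip -shs' minnn index_mem.
  have := hok _ icz; rewrite nth_zip // nth_index //=; set h := nth _ hs _.
  set w := relab _ _ _.
  have wE : wv rs' w = wv us sh by rewrite (wv_relab u0) ?lsE.
  have pw : present rs' w by exists e, s; rewrite wE.
  have pr' x : x \in w :: nX nd -> present rs' x.
    rewrite inE => /orP[/eqP->//|xX]; have [e' [s' [s'0 e'E]]] := pr x xX.
    by exists e', s'; rewrite wv_cat // szw.
  have relF fp : nF nd = Some fp -> forall v, wv rs' (relab (size rs') fp.2 v) = wv (map (nth u0 rs) fp.2) v.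
    move=> nf v; rewrite nf in fok; case/and4P: fok => _ _ _ /allP fl.
    rewrite (wv_relab u0) //; last first.
      by apply/allP => l /fl ln; rewrite size_cat srs ltn_addr.
    congr wv; apply/eq_in_map => l /fl ln; by rewrite nth_cat srs ln.
  have mapd fp u1 : nF nd = Some fp -> map (nth u1 rs) fp.2 = map (nth u0 rs) fp.2.
    move=> nf; rewrite nf in fok; case/and4P: fok => _ _ _ /allP fl.
    by apply/eq_in_map => l /fl ln; apply: set_nth_default; rewrite srs.
  case: h => [k l|k k'|k|k|k p] /=.
  - case nf: (nF nd) => [fp|//] /and3P[kf lN /wv_par[t [t0 tE]]]; left; right; rewrite nf => u1.
    exists (s * t); rewrite mulf_neq0 //; split=> //; apply: Or31; exists k, (nth u0 rs' l); split=> //.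
    by rewrite cE -wE tE wv_waddn relF // (wv_unit1 u0) // scalerA (mapd _ u1 nf).
  - case nf: (nF nd) => [fp|//] /and3P[kf lN /wv_par[t [t0 tE]]]; left; right; rewrite nf => u1.
    exists (s * t); rewrite mulf_neq0 //; split=> //; apply: Or32; exists k, k'; split=> //.
    by rewrite cE -wE tE wv_waddn !relF // scalerA (mapd _ u1 nf).
  - case nf: (nF nd) => [fp|//] /andP[kf /wv_par[t [t0 tE]]]; left; right; rewrite nf => u1.
    exists (s * t); rewrite mulf_neq0 //; split=> //; apply: Or33; exists k => //.
    by rewrite cE -wE tE !relF // scalerA (mapd _ u1 nf).
  - set ed := nth _ _ _; case/and4P => je en /eqP ne /(emb_present u0 urs')/(_ pr')[ue pe].
    right; apply: (IH ed.1 _ en _ ue) => //; last by rewrite size_map.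
    by rewrite -ltnS (leq_trans _ jd) // ltn_sub2l.
  case/and3P => kc /eqP sp /(emb_present u0 urs')/(_ pr')[ue pe].
  exfalso; apply: (no_cert kc ue); first by rewrite size_map.
  by move=> x xc; apply/present_mpresent/pe.
(* Either some element leads to a later node, which yields the classification, or all elements lie
   in the family of this node. *)
have [aP|//] := fin_all_or step.
have [u0 _|V0] := pickP (fun u : Vt => true); last first.
  by left=> e; have [//|[sh [[|u us] [s [shs _ sus _ _]]]]] := word_shape e; [move: shs sus; rewrite !inE => /orP[]/eqP-> | have := V0 u].
case nf: (nF nd) => [fp|]; last by left=> e; have [//|] := aP e; rewrite /P nf.
move: (fok); rewrite nf => /and4P[f1 f2 /eqP f3 /allP f4].
right; exists fp.1, (map (nth u0 rs) fp.2); split=> //.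
- rewrite map_inj_in_uniq // => x y /f4 xn /f4 yn /eqP; by rewrite nth_uniq ?srs // => /eqP.
- by rewrite size_map.
move=> e; have [|] := aP e; first by left.
by rewrite nf => /(_ u0); right.
Qed.

Theorem words_classified : classified.
Proof. by apply: (@node_sound (size nodes) 0 [::]) => //; rewrite /= ?subn0. Qed.

End Classification.

(** * Transfer of rank functions between fields *)

Section Bases.
Variable M : matroid.

Lemma rank_closure (I Y : {set M}) :
  (forall e, e \in Y -> rank (e |: I) = rank I) -> rank (I :|: Y) = rank I.
Proof.
have [n] := ubnP #|Y|; elim: n Y => // n IH Y ltYn H.
have [->|[e eY]] := set_0Vmem Y; first by rewrite setU0.
have IH' : rank (I :|: (Y :\ e)) = rank I.
  apply: IH => [|x /setD1P[_ /H] //]; by rewrite (cardsD1 e) eY in ltYn.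
have := rank_submod (e |: I) (I :|: (Y :\ e)); rewrite H // IH'.
have -> : e |: I :|: (I :|: (Y :\ e)) = I :|: Y.
  by apply/setP => x; rewrite !inE; case: eqP => [->|]; case: (x \in I); rewrite ?eY ?orbT.
have := @rankS M I ((e |: I) :&: (I :|: (Y :\ e))); have := rankS (subsetUl I Y).
have -> : I \subset (e |: I) :&: (I :|: (Y :\ e)).
  by apply/subsetP => x xI; rewrite !inE xI !orbT.
by move=> h1 /(_ isT); lia.
Qed.

Lemma indep_extend (I Y : {set M}) : rank I = #|I| ->
  exists B : {set M}, [/\ I \subset B, B \subset I :|: Y, rank B = #|B| & rank B = rank (I :|: Y)].
Proof.
have [n] := ubnP (rank (I :|: Y) - rank I); elim: n I => // n IH I ltn rI.
case: (pickP (fun e => (e \in Y) && (rank (e |: I) != rank I))) => [e /andP[eY ne]|H]; last first.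
  exists I; split=> //; first exact: subsetUl.
  by apply/esym/rank_closure => e eY; have := H e; rewrite eY /= => /negbFE/eqP.
have eI : e \notin I.
  by apply: contraNN ne => eI; rewrite (setUidPr _) // sub1set.
have ge := rankS (subsetUr [set e] I); have le := rank_le_card (e |: I).
rewrite cardsU1 eI in le.
have re : rank (e |: I) = #|e |: I| by rewrite cardsU1 eI; move/eqP: ne; lia.
have UE : e |: I :|: Y = I :|: Y.
  by apply/setP => x; rewrite !inE; case: eqP => [->|]; rewrite ?eY ?orbT.
have [|//|B [s1 s2 s3 s4]] := IH (e |: I).
  have := rankS (subsetUl (e |: I) Y); rewrite UE re cardsU1 eI; move/eqP: ne; lia.
rewrite UE in s2 s4; exists B; split=> //; exact: subset_trans (subsetUr _ _) s1.
Qed.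

Lemma indep_sub (I B : {set M}) : I \subset B -> rank B = #|B| -> rank I = #|I|.
Proof.
move=> IB rB; have := rankU_le I (B :\: I); have := rank_le_card (B :\: I).
have -> : I :|: (B :\: I) = B by rewrite setDE setUIr setUCr setIT; apply/setUidPr.
have := rank_le_card I; have := cardsID I B; rewrite (setIidPr IB); lia.
Qed.

End Bases.

(** A maximal independent subset of [X] extends to a basis for [A1], which is also one for [A2]; its
    subsets stay independent there. *)
Lemma col_rank_le_of_bases (F1 F2 : fieldType) (d : nat) (G : finType) (A1 : 'I_d -> G -> F1)
    (A2 : 'I_d -> G -> F2) (X : {set G}) :
  (forall B : {set G}, #|B| = d -> col_rank A1 B = d -> col_rank A2 B = d) -> col_rank A1 setT = d ->
  (col_rank A1 X <= col_rank A2 X)%N.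
Proof.
move=> H fT; pose M1 := col_matroid A1; pose M2 := col_matroid A2.
have [|I [_ IX rI rX]] := @indep_extend M1 set0 X; first by rewrite rank0 cards0.
rewrite set0U in IX rX.
have [B [IB _ rB rT]] := @indep_extend M1 I setT rI.
rewrite setUT [RHS]fT in rT.
have cB : #|B| = d by rewrite -rB.
have rB2 : @rank M2 B = #|B| by rewrite [LHS]H.
have r2 := @indep_sub M2 I B IB rB2.
have := @rankS M2 I X IX; rewrite r2 -rI rX; by [].
Qed.

Lemma col_rank_eq_of_bases (F1 F2 : fieldType) (d : nat) (G : finType) (A1 : 'I_d -> G -> F1)
    (A2 : 'I_d -> G -> F2) (X : {set G}) :
  (forall B : {set G}, #|B| = d -> col_rank A1 B = d <-> col_rank A2 B = d) ->
  col_rank A1 setT = d -> col_rank A2 setT = d ->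
  col_rank A1 X = col_rank A2 X.
Proof.
move=> H f1 f2; apply/eqP; rewrite eqn_leq; apply/andP; split.
  by apply: col_rank_le_of_bases => // B cB /H; apply.
by apply: col_rank_le_of_bases => // B cB /H; apply.
Qed.

Lemma col_rank_det (F : fieldType) (d : nat) (G : finType) (A : 'I_d -> G -> F) (B : {set G}) (g0 : G) :
  #|B| = d ->
  (col_rank A B == d) = (\det (\matrix_(i < d, j < d) A j (nth g0 (enum B) i)) != 0).
Proof.
move=> cB; set N := \matrix_(i, j) _.
have sX : size [seq mxcol A e | e in B] == d by rewrite size_image cB.
pose X := Tuple sX.
have -> : (col_rank A B == d) = free X by rewrite /free /col_rank (eqP sX).
have XE (i : 'I_d) (j : 'I_d) : (X`_i : fvec F 'I_d) j = N i j.
  by rewrite mxE (nth_map g0) -?cardE ?cB // ffunE.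
have sumE (k : 'I_d -> F) j : (\sum_i k i *: X`_i : fvec F 'I_d) j = ((\row_i k i) *m N) 0 j.
  rewrite sum_ffunE mxE; apply: eq_bigr => i _; by rewrite ffunE XE !mxE.
apply/idP/idP.
  move/freeP => fX; apply/negP => /det0P[v v0 vN]; case/negP: v0; apply/eqP/rowP => i; rewrite mxE.
  apply: (fX (fun i => v 0 i)); apply/ffunP => j; rewrite sumE ffunE.
  have -> : \row_i v 0 i = v by apply/rowP => l; rewrite mxE.
  by rewrite vN mxE.
move=> dN; apply/freeP => k k0 i.
have : (\row_i k i) *m N = 0 by apply/rowP => j; rewrite -sumE k0 ffunE mxE.
move/(congr1 (mulmx^~ (invmx N))); rewrite mulmxK ?unitmxE ?unitfE // mul0mx => /rowP/(_ i).
by rewrite !mxE.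
Qed.

Section ListDet.
Variables (T : Type) (z o : T) (add mul : T -> T -> T) (opp : T -> T).

(** Expansion along the first row over bare operations: the same definition is evaluated on codes,
    on integer polynomials and on rational unknowns. *)
Fixpoint ldet (n : nat) (A : nat -> nat -> T) : T :=
  if n is n'.+1 then
    foldr (fun j r => let x := mul (A 0%N j) (ldet n' (fun i l => A i.+1 (bump j l))) in
                      add (if odd j then opp x else x) r) z (iota 0 n)
  else o.

Lemma ldet_det (R : comNzRingType) (f : T -> R) n (A : nat -> nat -> T) :
  f z = 0 -> f o = 1 -> (forall x y, f (add x y) = f x + f y) ->
  (forall x y, f (mul x y) = f x * f y) -> (forall x, f (opp x) = - f x) ->
  f (ldet n A) = \det (\matrix_(i < n, j < n) f (A i j)).
Proof.
move=> fz fo fa fm fn; elim: n A => [|n IH] A; first by rewrite det_mx00.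
rewrite (expand_det_row _ ord0) /ldet -/ldet.
pose g j := f (A 0%N j) * ((-1) ^+ j * f (ldet n (fun i l => A i.+1 (bump j l)))).
transitivity (\sum_(j < n.+1) g j).
  rewrite -(big_mkord xpredT) /index_iota subn0; elim: (iota 0 n.+1) => [|j s IHs]; first by rewrite big_nil.
  rewrite big_cons -IHs /= fa; congr (_ + _); rewrite /g -signr_odd.
  by case: (odd j); rewrite ?fn fm ?expr1 ?expr0 ?mulN1r ?mulrN ?mul1r.
apply: eq_bigr => j _; rewrite mxE /g /cofactor add0n IH; congr (_ * (_ * \det _)).
by apply/matrixP => i l; rewrite !mxE.
Qed.
End ListDet.

Fixpoint padd (p q : seq int) : seq int :=
  match p, q with
  | [::], _ => q
  | _, [::] => p
  | x :: p', y :: q' => intZmod.addz x y :: padd p' q'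
  end.
Definition popp (p : seq int) : seq int := map intZmod.oppz p.
Fixpoint pmul (p q : seq int) : seq int :=
  if p is x :: p' then padd (map (intRing.mulz x) q) (0 :: pmul p' q) else [::].

Section Evaluation.
Variables (F : fieldType) (t : F).
Fixpoint pev (p : seq int) : F := if p is x :: p' then pev p' * t + x%:~R else 0.

Lemma pev_add p q : pev (padd p q) = pev p + pev q.
Proof.
elim: p q => [|x p IH] [|y q] /=; rewrite ?add0r ?addr0 // IH -[intZmod.addz x y]/(x + y) intrD mulrDl.
by rewrite addrACA.
Qed.

Lemma pev_opp p : pev (popp p) = - pev p.
Proof. by elim: p => [|x p IH] /=; rewrite ?oppr0 // IH -[intZmod.oppz x]/(- x) intrN mulNr opprD. Qed.

Lemma pev_scale x q : pev (map (intRing.mulz x) q) = x%:~R * pev q.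
Proof.
elim: q => [|y q IH] /=; rewrite ?mulr0 // IH -[intRing.mulz x y]/(x * y) intrM mulrDr mulrA //.
Qed.

Lemma pev_mul p q : pev (pmul p q) = pev p * pev q.
Proof.
elim: p => [|x p IH] /=; rewrite ?mul0r // pev_add pev_scale /= IH addr0 mulrDl addrC; congr (_ + _).
by rewrite mulrAC.
Qed.

Lemma pev_horner p : pev p = (Poly (map intr p)).[t].
Proof. by rewrite horner_Poly; elim: p => //= x p ->. Qed.
End Evaluation.

Definition pzero (p : seq int) : bool := all (fun x : int => x == 0) p.
(** A coefficient 1 or -1 survives reduction to any characteristic, so the polynomial is nonzero,
    with finitely many roots, over every field. *)
Definition punit (p : seq int) : bool := has (fun x : int => (x == 1) || (x == -1)) p.

Lemma pev_zero (F : fieldType) (t : F) p : pzero p -> pev t p = 0.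
Proof. by elim: p => //= x p IH /andP[/eqP-> /IH->]; rewrite mul0r add0r. Qed.

Lemma punit_neq0 (F : fieldType) p : punit p -> Poly (map (intr : int -> F) p) != 0.
Proof.
move/hasP => [x xp x1]; apply/eqP => /(congr1 (fun q : {poly F} => q`_(index x p))).
rewrite coef_Poly (nth_map 0) ?index_mem // nth_index // coef0 => /eqP.
by case/orP: x1 => /eqP->; rewrite ?mulrNz ?oppr_eq0 oner_eq0.
Qed.

Lemma avoid_roots (F : fieldType) (ps : seq {poly F}) (s : seq F) :
  all (fun p => p != 0) ps -> uniq s -> (\sum_(p <- ps) size p < size s)%N ->
  exists2 t, t \in s & all (fun p => ~~ root p t) ps.
Proof.
elim: ps s => [|p ps IH] s /=.
  by move=> _ us; rewrite big_nil; case: s us => // t s _ _; exists t; rewrite ?mem_head.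
case/andP=> p0 ps0 us; rewrite big_cons => lt.
have [||t] := IH [seq t <- s | ~~ root p t] ps0; first exact: filter_uniq.
  have E1 : (size [seq t <- s | root p t] + size [seq t <- s | ~~ root p t] = size s)%N.
    by rewrite !size_filter -[RHS](count_predC (root p)).
  have E2 : (size [seq t <- s | root p t] < size p)%N.
    exact: max_poly_roots p0 (filter_all _ s) (filter_uniq _ us).
  rewrite -(ltn_add2l (size [seq t <- s | root p t])) E1 (leq_ltn_trans _ lt) //.
  by rewrite leq_add2r ltnW.
by rewrite mem_filter => /andP[t1 t2] t3; exists t; rewrite ?t1.
Qed.

Lemma mem_sublists (T : eqType) (s u : seq T) : subseq s u -> s \in sublists (size s) u.
Proof.
elim: u s => [|y u IH] [|x s] //=; case: eqP => [->|_] su; rewrite mem_cat.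
  by apply/orP; left; apply: map_f; apply: IH.
by rewrite (IH (x :: s)) // orbT.
Qed.

(** All differences of two vertices of the family, then its points. The coordinate at the first
    vertex is dropped, which loses nothing on vectors of sum zero. *)
Definition rowsK (f : fam) : seq (seq g4) :=
  let d := (fk f).-1 in
  let hats := [seq [seq if i == l.+1 then I4 else O4 | l <- iota 0 d] | i <- iota 0 (fk f)]
              ++ map behead (fV f) in
  [seq [seq gadd (wnth (nth [::] hats p.1) l) (wnth (nth [::] hats p.2) l) | l <- iota 0 d]
     | p <- [seq p <- [seq (i, j) | i <- iota 0 (fk f + size (fV f)), j <- iota 0 (fk f + size (fV f))]
             | (p.1 < p.2)%N]]
  ++ map behead (fY f).
Definition rowsF (f : fam) : seq (seq (seq int)) :=
  let d := (fk f).-1 in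
  [seq [seq padd (nth [::] (nth [::] (fP f) p.1) l) (popp (nth [::] (nth [::] (fP f) p.2) l)) | l <- iota 0 d]
     | p <- [seq p <- [seq (i, j) | i <- iota 0 (fk f + size (fV f)), j <- iota 0 (fk f + size (fV f))]
             | (p.1 < p.2)%N]]
  ++ fQ f.

Definition detK (d : nat) (R : seq (seq g4)) (s : seq nat) : g4 :=
  ldet O4 I4 gadd gmul id d (fun i j => wnth (nth [::] R (nth 0%N s i)) j).
Definition detF (d : nat) (R : seq (seq (seq int))) (s : seq nat) : seq int :=
  ldet [::] [:: 1] padd pmul popp d (fun i j => nth [::] (nth [::] R (nth 0%N s i)) j).

(** For each set of [d] rows, a determinant that is zero over GF(4) must be identically zero as a
    polynomial, and a nonzero one must correspond to a polynomial with a coefficient 1 or -1.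
    Outside finitely many parameters both matrices then have the same bases. *)
Definition fam_ok (f : fam) : bool :=
  let d := (fk f).-1 in let RK := rowsK f in let RF := rowsF f in
  let ss := sublists d (iota 0 (size RK)) in
  [&& (0 < fk f)%N, size (fQ f) == size (fY f),
      all (fun w => gsum w == I4) (fV f), all (fun w => gsum w == O4) (fY f),
      all (fun w => size w == fk f) (fV f ++ fY f),
      has (fun s => detK d RK s != O4) ss
    & all (fun s => if detK d RK s == O4 then pzero (detF d RF s) else punit (detF d RF s)) ss].

Lemma fams_ok : all fam_ok fams.
Proof. by vm_compute. Qed.

Inductive lab (H Y Fr : Type) := Loop | Edge of H + Fr & H + Fr | Pt of Y.
Arguments Loop {H Y Fr}. Arguments Edge {H Y Fr}. Arguments Pt {H Y Fr}.

(* Vectors of labelled elements: the vertices of [H] and the points of [Y] sit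
   at given positions, and the vertices of [Fr] are free. *)
Section Labels.
Variables (F : fieldType) (d : nat) (H Y Fr : finType).
Variables (hp : H -> fvec F 'I_d) (yp : Y -> fvec F 'I_d).
Let vT : vectType F := (fvec F 'I_d * fvec F Fr)%type.

Definition fdl (u : Fr) : fvec F Fr := [ffun x => (x == u)%:R : F^o].
Definition vv (x : H + Fr) : vT := match x with inl i => (hp i, 0) | inr u => (0, fdl u) end.
Definition lvec (l : lab H Y Fr) : vT :=
  match l with Loop => 0 | Edge x y => vv x - vv y | Pt y => (yp y, 0) end.

Definition vsub (f : Fr) (b x : H + Fr) : H + Fr := if x == inr f then b else x.
Definition lsub (f : Fr) (b : H + Fr) (l : lab H Y Fr) : lab H Y Fr :=
  if l is Edge x y then Edge (vsub f b x) (vsub f b y) else l.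

(** Contraction of the edge between [f] and [b]: subtracting the coordinate at [f] times [w] kills
    exactly the line of [w] and replaces the vertex [f] by [b] in all other elements. *)
Lemma lsub_dim (E : finType) (l : E -> lab H Y Fr) (X : {set E}) e f b :
  e \in X -> (l e = Edge (inr f) b \/ l e = Edge b (inr f)) -> b != inr f ->
  \dim (sp (lvec \o l) X) = (\dim (sp (lvec \o lsub f b \o l) X)).+1.
Proof.
move=> eX le bf.
pose w : vT := vv (inr f) - vv b.
pose T0 (v : vT) : vT := v - (v.2 f : F) *: w.
have T0l : linear T0.
  move=> k u v; rewrite /T0; have -> : (k *: u + v).2 f = k * u.2 f + v.2 f by rewrite /= !ffunE.
  have aux (x y z t : vT) : x + y - (z + t) = (x - z) + (y - t) by rewrite opprD addrACA.
  by rewrite scalerDl -scalerA aux -scalerBr.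
have [T TE] := linear_Hom T0l.
have vb : (vv b).2 f = 0.
  case: b bf {le w T0 T0l T TE} => [i|u] bf /=; rewrite ffunE //.
  by have [fu|//] := eqVneq f u; rewrite fu eqxx in bf.
have Tvv x : T (vv x) = vv (vsub f b x).
  rewrite TE /T0 /vsub; case: eqP => [->|nx].
    by rewrite /= ffunE eqxx scale1r /w opprB addrCA subrr addr0.
  suff -> : (vv x).2 f = 0 by rewrite scale0r subr0.
  case: x nx => [i|u] nx /=; rewrite ffunE //.
  by case: eqP nx => // ->.
have Tl x : T (lvec x) = lvec (lsub f b x).
  case: x => [|x y|y] /=; rewrite ?linear0 ?linearB /= ?Tvv //.
  by rewrite TE /T0 /= ffunE scale0r subr0.
have -> : sp (lvec \o lsub f b \o l) X = (T @: sp (lvec \o l) X)%VS.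
  by rewrite -sp_lin; apply: eq_sp => x _ /=; rewrite Tl.
have wf : w.2 f = 1.
  transitivity (fdl f f - (vv b).2 f); first by rewrite /w /= !ffunE.
  by rewrite vb subr0 ffunE eqxx.
have w0 : w != 0.
  apply/eqP => w0; move: wf; rewrite w0 /= ffunE => /esym/eqP; by rewrite oner_eq0.
have wX : w \in sp (lvec \o l) X.
  have := mem_sp (lvec \o l) eX; case: le => le; rewrite /= le //.
  by rewrite -memvN opprB.
have -> : \dim (sp (lvec \o l) X) = (\dim (sp (lvec \o l) X :&: lker T) + \dim (T @: sp (lvec \o l) X))%N.
  by rewrite limg_ker_dim.
suff -> : (sp (lvec \o l) X :&: lker T)%VS = <[w]>%VS by rewrite dim_vline w0.
apply/vspaceP => v; rewrite memv_cap memv_ker; apply/andP/vlineP => [[_ /eqP]|[k ->]].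
  by rewrite TE /T0 => /eqP; rewrite subr_eq0 => /eqP ->; exists (v.2 f).
split; first exact: memvZ.
by rewrite linearZ /= [T w]TE /T0 wf scale1r subrr scaler0.
Qed.

Lemma dim_fst (E : finType) (g : E -> fvec F 'I_d) (X : {set E}) :
  \dim (sp (fun e => (g e, 0) : vT) X) = \dim (sp g X).
Proof.
pose T0 (v : fvec F 'I_d) : vT := (v, 0).
have T0l : linear T0 by move=> k u v; rewrite /T0; congr (_, _); rewrite /= scaler0 addr0.
have [T TE] := linear_Hom T0l.
have -> : sp (fun e => (g e, 0) : vT) X = (T @: sp g X)%VS.
  by rewrite -sp_lin; apply: eq_sp => e _; rewrite /= TE.
apply: limg_dim_eq; apply/eqP; rewrite -subv0; apply/subvP => v; rewrite memv_cap memv_ker TE.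
by case/andP => _ /eqP[->]; rewrite mem0v.
Qed.
End Labels.

Section TwoFields.
Variables (F1 F2 : fieldType) (d : nat) (H Y Fr : finType).
Variables (hp1 : H -> fvec F1 'I_d) (yp1 : Y -> fvec F1 'I_d).
Variables (hp2 : H -> fvec F2 'I_d) (yp2 : Y -> fvec F2 'I_d).
Let v1 := @lvec F1 d H Y Fr hp1 yp1.
Let v2 := @lvec F2 d H Y Fr hp2 yp2.

Let bound (l : lab H Y Fr) : Prop :=
  match l with Edge (inl _) (inl _) | Loop | Pt _ => True | _ => False end.
Let occ (u : Fr) (l : lab H Y Fr) : bool :=
  if l is Edge x y then (x == inr u) || (y == inr u) else false.

(* An edge at a free vertex can be contracted, which identifies that vertex with
   the other end; so only elements on the fixed positions matter. *)
Lemma free_vertices (E : finType) :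
  (forall (l : E -> lab H Y Fr) (X : {set E}), (forall e, bound (l e)) ->
     \dim (sp (v1 \o l) X) = \dim (sp (v2 \o l) X)) ->
  forall (l : E -> lab H Y Fr) (X : {set E}), \dim (sp (v1 \o l) X) = \dim (sp (v2 \o l) X).
Proof.
move=> base l X.
(* Induction on the number of free vertices in use: the substitution removes [f] and creates no new
   one. *)
have [n] := ubnP #|[set u | [exists e in X, occ u (l e)]]|; elim: n l => // n IH l ltn.
pose bad e := (e \in X) && match l e with
  | Edge (inr f) b => b != inr f | Edge b (inr f) => b != inr f | _ => false end.
case: (pickP bad) => [e /andP[eX be]|nobad].
  have [f [b [le bf]]] : exists f b, (l e = Edge (inr f) b \/ l e = Edge b (inr f)) /\ b != inr f.
    move: be; case: (l e) => // [[x|f]] [y|g] // ne.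
    - by exists g, (inl x); split; [right | ].
    - by exists f, (inl y); split; [left | ].
    - by exists f, (inr g); split; [left | ].
  rewrite (lsub_dim hp1 yp1 eX le bf) (lsub_dim hp2 yp2 eX le bf); congr _.+1.
  apply: (IH (lsub f b \o l)); rewrite ltnS in ltn; apply: leq_trans _ ltn.
  have fin : f \in [set u | [exists e in X, occ u (l e)]].
    by rewrite inE; apply/existsP; exists e; rewrite eX /=; case: le => -> /=; rewrite eqxx ?orbT.
  rewrite (cardsD1 f [set u | [exists e in X, occ u (l e)]]) fin ltnS; apply: subset_leq_card.
  apply/subsetP => u; rewrite !inE => /existsP[e' /andP[e'X]] /=.
  have bocc : b = inr u -> occ u (l e) by move=> bu; case: le => -> /=; rewrite bu eqxx ?orbT.
  case le': (l e') => [|x y|y] //= xy; apply/andP; split.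
    apply/eqP => uf; move: xy; rewrite uf /vsub.
    by case: ifP => xf; case: ifP => yf; rewrite ?(negPf bf) ?xf ?yf.
  apply/existsP; move: xy; rewrite /vsub; case: ifP => _; case: ifP => _ /orP[]/eqP xy;
    try (by exists e; rewrite eX bocc);
    by exists e'; rewrite e'X le' /= xy eqxx ?orbT.
(* No edge of [X] joins a free vertex to anything else, so the remaining edges at free vertices have
   both ends equal and vector zero. *)
pose l' e := if e \in X then if l e is Edge (inr _) _ then Loop else if l e is Edge _ (inr _) then Loop else l e
  else Loop.
have vE (F : fieldType) (hp : H -> fvec F 'I_d) (yp : Y -> fvec F 'I_d) :
    sp (lvec hp yp \o l) X = sp (lvec hp yp \o l') X.
  apply: eq_sp => e eX /=; rewrite /l' eX; have := nobad e; rewrite /bad eX /=.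
  by case: (l e) => // [[x|f]] [y|g] //= => /negbFE/eqP // [->]; rewrite subrr.
rewrite !vE; apply: base => e; rewrite /l'; case: (e \in X) => //.
by case: (l e) => // [[x|f]] [y|g].
Qed.
End TwoFields.

Lemma sublistsP (T : eqType) k (s u : seq T) : s \in sublists k u -> subseq s u /\ size s = k.
Proof.
elim: u k s => [|y u IH] [|k] s //=; rewrite ?inE; try by move=> /eqP->; rewrite ?sub0seq.
rewrite mem_cat => /orP[/mapP[s' /IH[h1 h2] ->]|/IH[h1 h2]]; first by rewrite /= eqxx h1 h2.
by split=> //; apply: subseq_trans h1 (subseq_cons u y).
Qed.

Lemma subseq_enum (T : finType) (B : {set T}) : subseq (enum B) (enum T).
Proof. by rewrite enumT; apply: filter_subseq. Qed.

Definition hatsK (f : fam) : seq (seq g4) :=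
  [seq [seq if i == l.+1 then I4 else O4 | l <- iota 0 (fk f).-1] | i <- iota 0 (fk f)]
  ++ map behead (fV f).
Definition hpairs (f : fam) : seq (nat * nat) :=
  [seq p <- [seq (i, j) | i <- iota 0 (fk f + size (fV f)), j <- iota 0 (fk f + size (fV f))] | (p.1 < p.2)%N].

Lemma mem_hpairs f i j : (i < fk f + size (fV f))%N -> (j < fk f + size (fV f))%N -> (i < j)%N ->
  (i, j) \in hpairs f.
Proof.
move=> ih jh ij; rewrite mem_filter ij; apply/allpairsP; exists (i, j).
by rewrite !mem_iota.
Qed.

Section FamilyBase.
Variables (K : finFieldType) (a : K).
Hypothesis (ha : a ^+ 2 = a + 1) (char2 : 1 + 1 = 0 :> K).
Variables (f : fam) (F : fieldType) (t : F).
Hypothesis fok : fam_ok f.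
Hypothesis good : forall s, s \in sublists (fk f).-1 (iota 0 (size (rowsK f))) ->
  punit (detF (fk f).-1 (rowsF f) s) -> pev t (detF (fk f).-1 (rowsF f) s) != 0.
Let d := (fk f).-1.
Let g := size (rowsK f).
Let h := (fk f + size (fV f))%N.

Definition AK (l : 'I_d) (j : 'I_g) : K := ev a (wnth (nth [::] (rowsK f) j) l).
Definition AF (l : 'I_d) (j : 'I_g) : F := pev t (nth [::] (nth [::] (rowsF f) j) l).

Let enumS (B : {set 'I_g}) : #|B| = d ->
  [seq val x | x <- enum B] \in sublists d (iota 0 g).
Proof.
move=> cB; have <- : size [seq val x | x <- enum B] = d by rewrite size_map -cardE.
apply: mem_sublists; rewrite -val_enum_ord; apply: map_subseq.
exact: subseq_enum.
Qed.

Let g0 : (0 < d)%N -> 'I_g.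
Proof.
move=> d0; apply: (@Ordinal _ 0); move: fok => /and5P[k0 _ _ _ _].
have : (0, 1)%N \in hpairs f by apply: mem_hpairs => //; rewrite /d in d0; lia.
rewrite /g /rowsK size_cat size_map -/(hpairs f); by case: (hpairs f).
Defined.

Let detKE (B : {set 'I_g}) (e0 : 'I_g) : #|B| = d ->
  (col_rank AK B == d) = (detK d (rowsK f) [seq val x | x <- enum B] != O4).
Proof.
move=> cB; rewrite (col_rank_det _ e0) // -(ev_eq0 ha) /detK.
rewrite (ldet_det (R := K) (f := ev a)) //; [|exact: ev_add|exact: ev_mul|by move=> x; rewrite oppr2].
congr (_ != 0); congr (\det _); apply/matrixP => i j; rewrite !mxE /AK; congr (ev a (wnth (nth _ _ _) _)).
by rewrite (nth_map e0) // -cardE cB.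
Qed.

Let detFE (B : {set 'I_g}) (e0 : 'I_g) : #|B| = d ->
  (col_rank AF B == d) = (pev t (detF d (rowsF f) [seq val x | x <- enum B]) != 0).
Proof.
move=> cB; rewrite (col_rank_det _ e0) // /detF.
rewrite (ldet_det (R := F) (f := pev t)) //; [|by rewrite /= mul0r add0r|exact: pev_add|exact: pev_mul|exact: pev_opp].
congr (_ != 0); congr (\det _); apply/matrixP => i j; rewrite !mxE /AF; congr (pev t (nth _ (nth _ _ _) _)).
by rewrite (nth_map e0) // -cardE cB.
Qed.

Lemma AK_AF (X : {set 'I_g}) : col_rank AK X = col_rank AF X.
Proof.
(* In dimension 0 there need not be a column to serve as a default; both ranks are then 0. *)
have [d0|d0] := posnP d.
  have Z (F' : fieldType) (A : 'I_d -> 'I_g -> F') : col_rank A X = 0%N.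
    apply/eqP; rewrite -leqn0 -d0; apply: leq_trans (dimvS (subvf _)) _.
    by rewrite dim_fvec card_ord.
  by rewrite !Z.
have e0 := g0 d0; move: (fok) => /and5P[k0 _ _ _ /and3P[_ /hasP[s sS ns] /allP cS]].
have eqB (B : {set 'I_g}) : #|B| = d -> (col_rank AK B == d) = (col_rank AF B == d).
  move=> cB; rewrite (detKE e0) // (detFE e0) //; have sB := enumS cB; have := cS _ sB.
  rewrite -/d; case: ifP => [z pz|z pu]; first by rewrite pev_zero // eqxx.
  by rewrite (good sB pu).
have [B cB rB] : exists2 B : {set 'I_g}, #|B| = d & col_rank AK B == d.
  have [sub ss] := sublistsP sS.
  have us : uniq s by rewrite (subseq_uniq sub) ?iota_uniq.
  have sl : all (fun i => i < g)%N s by apply/allP => i /(mem_subseq sub); rewrite mem_iota.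
  pose B := [set j : 'I_g | val j \in s].
  have eB : [seq val x | x <- enum B] =i s.
    move=> i; apply/mapP/idP => [[j]|is_]; first by rewrite mem_enum inE => js ->.
    by exists (Ordinal (allP sl _ is_)) => //; rewrite mem_enum inE.
  have uB : uniq [seq val x | x <- enum B] by rewrite map_inj_uniq ?enum_uniq //; apply: val_inj.
  have cB : #|B| = d by rewrite /d -ss -(perm_size (uniq_perm uB us eB)) size_map -cardE.
  exists B => //; rewrite (detKE e0) //.
  have -> // : [seq val x | x <- enum B] = s.
  apply: (@irr_sorted_eq _ ltn ltn_trans ltnn) => //.
    apply: (@subseq_sorted _ ltn ltn_trans _ _ _ (iota_ltn_sorted 0 g)).
    by rewrite -val_enum_ord map_subseq // subseq_enum.
  exact: (@subseq_sorted _ ltn ltn_trans _ _ sub (iota_ltn_sorted 0 g)).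
have full (F' : fieldType) (A : 'I_d -> 'I_g -> F') : col_rank A B == d -> col_rank A setT = d.
  move=> /eqP rA; have h1 := col_rankS A (subsetT B).
  have h2 : (col_rank A setT <= d)%N.
    by apply: leq_trans (dimvS (subvf _)) _; rewrite dim_fvec card_ord.
  by apply/eqP; rewrite eqn_leq h2 -[leqLHS]rA h1.
apply: col_rank_eq_of_bases; last 2 first; try by apply: full; rewrite -?eqB.
by move=> B' cB'; split=> /eqP; [rewrite eqB | rewrite -eqB] => // /eqP.
Qed.

Definition hK (i : 'I_h) : fvec K 'I_d := [ffun l : 'I_d => ev a (wnth (nth [::] (hatsK f) i) l) : K^o].
Definition yK (i : 'I_(size (fY f))) : fvec K 'I_d := [ffun l : 'I_d => ev a (wnth (nth [::] (fY f) i) l.+1) : K^o].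
Definition hF (i : 'I_h) : fvec F 'I_d := [ffun l : 'I_d => pev t (nth [::] (nth [::] (fP f) i) l) : F^o].
Definition yF (i : 'I_(size (fY f))) : fvec F 'I_d := [ffun l : 'I_d => pev t (nth [::] (nth [::] (fQ f) i) l) : F^o].

Lemma family_base (Fr E : finType) (l : E -> lab 'I_h 'I_(size (fY f)) Fr) (X : {set E}) :
  \dim (sp (lvec hK yK \o l) X) = \dim (sp (lvec hF yF \o l) X).
Proof.
apply: free_vertices => {}l {}X bl.
(* Over both fields an element is the same column, up to a sign, or zero ([None]). The sign records
   the orientation of an edge; in characteristic 2 it disappears. *)
pose P (e : E) (gs : option 'I_g * bool) :=
  lvec hK yK (l e) = (oapp (mxcol AK) 0 gs.1, 0) /\
  lvec hF yF (l e) = ((-1) ^+ gs.2 *: oapp (mxcol AF) 0 gs.1, 0).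
have sQ : size (fQ f) = size (fY f) by move: fok => /and5P[_ /eqP].
have ex e : exists gs, P e gs.
  have hp (i j : 'I_h) : (i < j)%N -> exists k : 'I_g,
     hK i - hK j = mxcol AK k /\ hF i - hF j = mxcol AF k.
    move=> ij; have ijp := mem_hpairs (ltn_ord i) (ltn_ord j) ij.
    have ki : (index (val i, val j) (hpairs f) < g)%N.
      rewrite /g /rowsK size_cat size_map -/(hpairs f).
      by apply: leq_trans (leq_addr _ _); rewrite index_mem.
    exists (Ordinal ki); split; apply/ffunP => x; rewrite !ffunE /=.
      rewrite /AK /= /rowsK -/(hpairs f) nth_cat size_map index_mem ijp.
      rewrite (nth_map (0, 0)%N) ?index_mem // nth_index //= {3}/wnth (nth_map 0%N) ?size_iota // nth_iota // ev_add //.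
      by rewrite (oppr2 char2).
    rewrite /AF /= /rowsF -/(hpairs f) nth_cat size_map index_mem ijp.
    rewrite (nth_map (0, 0)%N) ?index_mem // nth_index //= (nth_map 0%N) ?size_iota // nth_iota // pev_add pev_opp //.
  rewrite /P; have := bl e; case: (l e) => [|[i|//] [j|//]|y] _.
  - by exists (None, false); split=> /=; rewrite ?scaler0.
  - have pairB (F' : fieldType) (u v : fvec F' 'I_d) :
       ((u, 0) - (v, 0) : fvec F' 'I_d * fvec F' Fr)%type = (u - v, 0) by rewrite -[LHS]/(u - v, 0 - 0) subr0.
    have [ij|ji|ij] := ltngtP i j.
    + have [k [k1 k2]] := hp i j ij; exists (Some k, false); split; rewrite /= pairB.
        by rewrite k1.
      by rewrite expr0 scale1r k2.
    + have [k [k1 k2]] := hp j i ji; exists (Some k, true); split; rewrite /= pairB.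
        by rewrite -k1; congr (_, _); apply/ffunP => x; rewrite !ffunE !(oppr2 char2) addrC.
      by rewrite expr1 scaleN1r -k2 opprB.
    by exists (None, false); split; rewrite /= (val_inj ij) subrr ?scaler0.
  have ki : (size (hpairs f) + y < g)%N.
    by rewrite /g /rowsK size_cat size_map -/(hpairs f) size_map ltn_add2l.
  exists (Some (Ordinal ki), false); split; rewrite /= ?expr0 ?scale1r; congr (_, _); apply/ffunP => x; rewrite !ffunE.
    rewrite /AK /= /rowsK -/(hpairs f) nth_cat size_map ltnNge leq_addr /= addKn.
    by rewrite (nth_map [::]) // /wnth nth_behead.
  by rewrite /AF /= /rowsF -/(hpairs f) nth_cat size_map ltnNge leq_addr /= addKn.
have [gs gsP] := fin_all_exists ex.
pose Z := [set k | [exists e in X, (gs e).1 == Some k]].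
have spZ (F' : fieldType) (A : 'I_d -> 'I_g -> F') (sg : E -> F') : (forall e, sg e != 0) ->
    sp (fun e => sg e *: oapp (mxcol A) 0 (gs e).1) X = sp (mxcol A) Z.
  move=> sg0; apply/eqP; rewrite eqEsubv; apply/andP; split; apply/spP => e eX.
    case ge: (gs e).1 => [k|] /=; last by rewrite scaler0 mem0v.
    by apply/memvZ/mem_sp; rewrite inE; apply/existsP; exists e; rewrite eX ge eqxx.
  move: eX; rewrite inE => /existsP[e' /andP[e'X /eqP ge]].
  have := mem_sp (fun e => sg e *: oapp (mxcol A) 0 (gs e).1) e'X; rewrite ge /=.
  by move/(memvZ (sg e')^-1); rewrite scalerA mulVf // scale1r.
have EK : sp (lvec hK yK \o l) X = sp (fun e => (1 *: oapp (mxcol AK) 0 (gs e).1, 0) : fvec K 'I_d * fvec K Fr)%type X.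
  by apply: eq_sp => e _ /=; have [-> _] := gsP e; rewrite scale1r.
have EF : sp (lvec hF yF \o l) X = sp (fun e => ((-1) ^+ (gs e).2 *: oapp (mxcol AF) 0 (gs e).1, 0) : fvec F 'I_d * fvec F Fr)%type X.
  by apply: eq_sp => e _ /=; have [_ ->] := gsP e.
rewrite EK EF !dim_fst (spZ _ _ (fun=> 1)) ?(spZ _ _ (fun e => (-1) ^+ (gs e).2)) //.
- exact: AK_AF.
- by move=> e; rewrite signr_eq0.
by move=> e; rewrite oner_eq0.
Qed.
End FamilyBase.

Section FamilyRepresentable.
Variables (K : finFieldType) (a : K).
Hypothesis (ha : a ^+ 2 = a + 1) (char2 : 1 + 1 = 0 :> K).
Variables (M : matroid) (Vt : finType) (c : M -> fvec K Vt).
Hypothesis sum0 : forall e, \sum_u c e u = 0.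
Hypothesis repc : represents c.

Lemma family_representable (f : fam) (rs : seq Vt) :
  fam_ok f -> uniq rs -> size rs = fk f ->
  (forall e, trivial_word (c e) \/ inF a f rs (c e)) ->
  exists q, prime_power q /\ forall F : fieldType, at_least q F -> representable F M.
Proof.
move=> fok urs srs cP.
pose d := (fk f).-1; pose h := (fk f + size (fV f))%N.
pose ds := [seq detF d (rowsF f) s | s <- sublists d (iota 0 (size (rowsK f)))].
pose ps := [seq p <- ds | punit p].
pose n := (\sum_(p <- ps) size p)%N.
(* A prime power above [n] is enough: [n] is the total size of the polynomials to be kept nonzero,
   and each has fewer roots than its size. *)
exists (2 ^ n.+1)%N; split; first by exists 2, n.+1.
move=> F [s [us ss]].
have [t _ tP] : exists2 t : F, t \in s & all (fun p => ~~ root p t) [seq Poly (map (intr : int -> F) p) | p <- ps].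
  apply: avoid_roots => //.
    by rewrite all_map; apply/allP => p; rewrite mem_filter => /andP[pu _]; apply: punit_neq0.
  rewrite ss (leq_ltn_trans (_ : _ <= n)%N) //; last by rewrite (ltn_trans (ltnSn n)) // ltn_expl.
  rewrite big_map /n; apply: leq_sum => p _; apply: leq_trans (size_Poly _) _; by rewrite size_map.
have good s' : s' \in sublists (fk f).-1 (iota 0 (size (rowsK f))) ->
    punit (detF (fk f).-1 (rowsF f) s') -> pev t (detF (fk f).-1 (rowsF f) s') != 0.
  move=> s'S pu; rewrite pev_horner; move/allP: tP; apply; apply: (map_f (fun p => Poly (map intr p))).
  by rewrite mem_filter pu; apply: (map_f (detF d (rowsF f))).
have k0 : (0 < fk f)%N by case/and5P: fok.
have u0 : Vt by move: k0; rewrite -srs; case: (rs).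
have sd (l : 'I_d) : (l.+1 < size rs)%N by rewrite srs; have := ltn_ord l; rewrite /d; lia.
pose vT : vectType K := (fvec K 'I_d * fvec K Vt)%type.
(* The coordinate at the first vertex of [rs] is dropped, and the vertices outside [rs] become free.
   The map is injective on vectors of sum zero, so it preserves all ranks. *)
pose T0 (v : fvec K Vt) : vT :=
  ([ffun l : 'I_d => v (nth u0 rs l.+1)], [ffun u => (if u \in rs then 0 else v u) : K^o]).
have T0l : linear T0.
  move=> k u v; rewrite /T0; congr (_, _); apply/ffunP => x; rewrite !ffunE //.
  by case: ifP => // _; rewrite [_ *: _]mulr0 addr0.
have [T TE] := linear_Hom T0l.
pose hK' := @hK K a f; pose yK' := @yK K a f.
pose vvK := @vv K d 'I_h Vt hK'; pose lv := @lvec K d 'I_h 'I_(size (fY f)) Vt hK' yK'.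
have Tdl u : exists x, T (dl K u) = vvK x.
  have [ur|nur] := boolP (u \in rs).
    have iu : (index u rs < fk f)%N by rewrite -srs index_mem.
    have ih : (index u rs < h)%N by rewrite ltn_addr.
    exists (inl (Ordinal ih)); rewrite TE; congr (_, _); apply/ffunP => x; rewrite !ffunE /=; last first.
      by case: ifP => // nx; case: eqP => // xu; rewrite xu ur in nx.
    rewrite /hatsK nth_cat size_map size_iota iu (nth_map 0%N) ?size_iota // nth_iota // add0n.
    rewrite /wnth (nth_map 0%N) ?size_iota // nth_iota // add0n.
    have -> : (nth u0 rs x.+1 == u) = (index u rs == x.+1).
      by apply/eqP/eqP => [<-|<-]; rewrite ?index_uniq ?sd ?nth_index.
    by case: ifP.
  exists (inr u); rewrite TE; congr (_, _); apply/ffunP => x; rewrite !ffunE.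
    by case: eqP => // xu; case/negP: nur; rewrite -xu mem_nth ?sd.
  by case: ifP => // xr; case: eqP => // xu; rewrite xu (negPf nur) in xr.
have Twv w : T (wv a rs w) = ([ffun l : 'I_d => ev a (wnth w l.+1) : K^o], 0).
  rewrite TE; congr (_, _); apply/ffunP => x; rewrite !ffunE.
    by rewrite mem_nth ?sd // index_uniq ?sd.
  by case: (x \in rs).
have TV i : (i < size (fV f))%N -> exists x, T (wv a rs (nth [::] (fV f) i)) = vvK x.
  move=> iV; have ih : (fk f + i < h)%N by rewrite ltn_add2l.
  exists (inl (Ordinal ih)); rewrite Twv; congr (_, _); apply/ffunP => x; rewrite !ffunE /=.
  rewrite /hatsK nth_cat size_map size_iota ltnNge leq_addr /= addKn (nth_map [::]) //.
  by rewrite /wnth nth_behead.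
have opp2 (v : vT) : - v = v by rewrite -scaleN1r (oppr2 char2) scale1r.
have ex e : exists ls : lab 'I_h 'I_(size (fY f)) Vt * K, ls.2 != 0 /\ T (c e) = ls.2 *: lv ls.1.
  case: (cP e) => [[->|[x [y [s' ->]]]]|[s' [s0 [[i [u [iV ->]]]|[i [j [iV jV ->]]]|[i iY ->]]]]].
  - by exists (Loop, 1); split; rewrite /= ?oner_neq0 // linear0 scaler0.
  - have [->|s0] := eqVneq s' 0.
      by exists (Loop, 1); split; rewrite /= ?oner_neq0 // scale0r linear0 scaler0.
    have [x' xE] := Tdl x; have [y' yE] := Tdl y.
    by exists (Edge x' y', s'); split=> //; rewrite linearZ linearB /= xE yE.
  - have [x' xE] := TV i iV; have [y' yE] := Tdl u.
    by exists (Edge x' y', s'); split=> //; rewrite linearZ linearD /= xE yE -/(vvK y') [- vvK y']opp2.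
  - have [x' xE] := TV i iV; have [y' yE] := TV j jV.
    by exists (Edge x' y', s'); split=> //; rewrite linearZ linearD /= xE yE -/(vvK y') [- vvK y']opp2.
  by exists (Pt (Ordinal iY), s'); split=> //; rewrite linearZ /= Twv.
have [ls lsP] := fin_all_exists ex.
pose l e := (ls e).1.
apply: (@represents_representable F (fvec F 'I_d * fvec F Vt)%type _
  (@lvec F d 'I_h 'I_(size (fY f)) Vt (hF t) (yF t) \o l)).
move=> X; rewrite -(family_base ha char2 fok good) -repc.
have -> : sp (lvec hK' yK' \o l) X = (T @: sp c X)%VS.
  rewrite -sp_lin; apply/esym/(@sp_scale _ _ _ _ _ (fun e => (ls e).2)) => e _; exact: lsP.
apply: limg_dim_eq; apply/eqP; rewrite -subv0; apply/subvP => v; rewrite memv_cap memv_ker TE => /andP[vX /eqP Tv].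
pose S0 (v : fvec K Vt) : K^o := \sum_u v u.
have S0l : linear S0.
  by move=> k x y; rewrite /S0 scaler_sumr -big_split /=; apply: eq_bigr => u _; rewrite !ffunE.
have [S SE] := linear_Hom S0l.
have v0 : \sum_u v u = 0.
  have /subvP/(_ v vX) : (sp c X <= lker S)%VS by apply/spP => e _; rewrite memv_ker SE; apply/eqP/sum0.
  by rewrite memv_ker SE => /eqP.
have vz u : u != nth u0 rs 0 -> v u = 0.
  move=> ur0; have [ur|nur] := boolP (u \in rs); last first.
    by have /ffunP/(_ u) := congr1 snd Tv; rewrite !ffunE (negPf nur).
  have i0 : (0 < index u rs)%N by rewrite lt0n; apply: contraNneq ur0 => i0; rewrite -{1}(nth_index u0 ur) i0.
  have il : ((index u rs).-1 < d)%N by rewrite -ltnS prednK // /d prednK // -srs index_mem.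
  have /ffunP/(_ (Ordinal il)) := congr1 fst Tv; rewrite !ffunE /= prednK // nth_index //.
rewrite memv0; apply/eqP/ffunP => u; rewrite ffunE; have [->|/vz//] := eqVneq u (nth u0 rs 0).
by move: v0; rewrite (bigD1 (nth u0 rs 0)) //= big1 ?addr0.
Qed.

Theorem classified_representable : classified a c ->
  exists q, prime_power q /\ forall F : fieldType, at_least q F -> representable F M.
Proof.
case=> [tr|[i [rs [iF urs srs cP]]]]; last first.
  by apply: family_representable urs srs cP; move/(all_nthP fam0): fams_ok; apply.
have [u0 _|V0] := pickP (fun u : Vt => true).
  (* With trivial words only, the matroid is graphic: a family with a single fixed vertex suffices,
     and all other vertices are free. *)
  pose f1 := Fam 1 [::] [::] [:: [::]] [::].
  by apply: (@family_representable f1 [:: u0]) => // e; left.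
exists 2; split; first by exists 2, 1.
move=> F _; apply: (@represents_representable F F^o _ (fun=> 0)) => X; rewrite -repc.
have -> : sp (fun _ : M => 0 : F^o) X = 0%VS by apply/eqP; rewrite -subv0; apply/spP => e _; rewrite mem0v.
have -> : sp c X = 0%VS.
  apply/eqP; rewrite -subv0; apply/spP => e _; rewrite memv0; apply/eqP/ffunP => u; by have := V0 u.
by rewrite !dimv0.
Qed.
End FamilyRepresentable.

(** * Frame templates *)

Section SpanInduction.
Variables (F : fieldType) (vT : vectType F) (E : finType) (phi : E -> vT) (S : {set E}).

Lemma sp_ind (P : vT -> Prop) : P 0 -> (forall k u v, P u -> P v -> P (k *: u + v)) ->
  (forall e, e \in S -> P (phi e)) -> forall v, v \in sp phi S -> P v.
Proof.
move=> P0 PD Pe v; rewrite /sp => vS; rewrite (coord_span (X := in_tuple [seq phi e | e in S]) vS).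
elim/big_rec: _ => // i u _ Pu; apply: PD => //.
have /imageP[e eS ->] : (in_tuple [seq phi e | e in S])`_i \in [seq phi e | e in S] by apply: mem_nth.
exact: Pe.
Qed.

Lemma sp_comb v : v \in sp phi S ->
  exists2 k : E -> F, forall e, e \notin S -> k e = 0 & v = \sum_e k e *: phi e.
Proof.
move: v; apply: sp_ind.
- by exists (fun=> 0) => //; rewrite big1 // => e _; rewrite scale0r.
- move=> k u v [ku ku0 ->] [kv kv0 ->]; exists (fun e => k * ku e + kv e).
    by move=> e eS; rewrite ku0 // kv0 // mulr0 addr0.
  rewrite scaler_sumr -big_split; apply: eq_bigr => e _ /=; by rewrite scalerDl scalerA.
move=> e eS; exists (fun e' => (e' == e)%:R) => [e'|].
  by case: eqP => // ->; rewrite eS.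
rewrite (bigD1 e) //= eqxx scale1r big1 ?addr0 // => e' /negPf->; by rewrite scale0r.
Qed.

Lemma sp_sum (k : E -> F) : (forall e, e \notin S -> k e = 0) -> \sum_e k e *: phi e \in sp phi S.
Proof.
move=> k0; apply: memv_suml => e _; have [eS|/k0->] := boolP (e \in S); first exact/memvZ/mem_sp.
by rewrite scale0r mem0v.
Qed.

Lemma sp_free (k : E -> F) : \dim (sp phi S) = #|S| -> (forall e, e \notin S -> k e = 0) ->
  \sum_e k e *: phi e = 0 -> forall e, k e = 0.
Proof.
move=> dS k0 sk e; apply/eqP/negPn/negP => ke.
have eS : e \in S by apply: contraNT ke => /k0->.
have pe : phi e \in sp phi (S :\ e).
  have : k e *: phi e \in sp phi (S :\ e).
    move: sk; rewrite (bigD1 e) //= => /eqP; rewrite addr_eq0 => /eqP ->; rewrite memvN.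
    apply: memv_suml => e' e'e; have [e'S|/k0->] := boolP (e' \in S); last by rewrite scale0r mem0v.
    by apply/memvZ/mem_sp; rewrite !inE e'e.
  by move/(memvZ (k e)^-1); rewrite scalerA mulVf // scale1r.
have : (\dim (sp phi S) <= #|S :\ e|)%N.
  apply: leq_trans (dimvS (_ : _ <= sp phi (S :\ e))%VS) _.
    by apply/spP => e' e'S; have [->|ne] := eqVneq e' e; rewrite // mem_sp // !inE ne.
  by apply: leq_trans (dim_span _) _; rewrite size_image.
by rewrite dS (cardsD1 e S) eS ltnn.
Qed.

(** A maximal [I] that does not yet span [t] leaves an element [j] that is parallel to [t] once
    [C0 :|: I] is contracted. A vector known only to lie in a span is thus realised by an element of
    a minor. *)
Lemma sp_maximal (C0 : {set E}) t : t \in sp phi (C0 :|: S) -> t \notin sp phi C0 ->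
  exists (I : {set E}) (j : E), [/\ I \subset S, j \in S, j \notin C0 :|: I, t \notin sp phi (C0 :|: I) &
    exists2 k : F, k != 0 & phi j - k *: t \in sp phi (C0 :|: I)].
Proof.
move=> tS t0; pose P (I : {set E}) := (I \subset S) && (t \notin sp phi (C0 :|: I)).
have P0 : P set0 by rewrite /P sub0set setU0.
case: (@maxset_exists _ P set0 P0) => I /maxsetP[/andP[IS tI] mI] _.
have [j jS jI] : exists2 j, j \in S & phi j \notin sp phi (C0 :|: I).
  apply/exists_inP; apply: contraNT tI => /exists_inPn H.
  apply: (subvP _ _ tS); apply/spP => e; rewrite inE => /orP[eC|eS].
    by apply: mem_sp; rewrite inE eC.
  exact: negbNE (H e eS).
have jCI : j \notin C0 :|: I by apply: contraNN jI => /(mem_sp phi).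
exists I, j; split=> //.
have tj : t \in sp phi (C0 :|: (j |: I)).
  apply/negPn/negP => tn; have := mI (j |: I); rewrite /P subUset sub1set jS IS tn => /(_ isT (subsetUr _ _)) jE.
  by case/negP: jCI; rewrite inE -jE setU11 orbT.
have : t \in (sp phi (C0 :|: I) + <[phi j]>)%VS.
  apply: (subvP _ _ tj); apply/spP => e; rewrite !inE => e'.
  have [->|ej] := eqVneq e j; first by rewrite memvE; apply: addvSr.
  rewrite (subvP (addvSl _ _)) // mem_sp // !inE; move: e'; by rewrite (negPf ej).
case/memv_addP => u uI [_ /vlineP[m ->] tE].
have m0 : m != 0 by apply: contraNneq tI => m0; rewrite tE m0 scale0r addr0.
exists m^-1; rewrite ?invr_eq0 // tE scalerDr scalerA mulVf // scale1r opprD addrCA subrr addr0 memvN.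
exact: memvZ.
Qed.
End SpanInduction.

Section SpanMinor.
Variables (F : fieldType) (B E : finType) (A : B -> E -> F) (C D : {set E}).

Lemma inj_represents (N : finType) (wT vT : vectType F) (p : N -> wT) (T : 'Hom(wT, vT)) (psi : N -> vT) (c : N -> F) :
  (forall x, c x != 0 /\ psi x = c x *: T (p x)) -> (forall w, w \in sp p setT -> T w = 0 -> w = 0) ->
  forall X, \dim (sp psi X) = \dim (sp p X).
Proof.
move=> pE inj X.
have -> : sp psi X = (T @: sp p X)%VS.
  by rewrite -sp_lin; apply/(@sp_scale _ _ _ _ _ c) => e _; apply: pE.
apply: limg_dim_eq; apply/eqP; rewrite -subv0; apply/subvP => v; rewrite memv_cap memv_ker => /andP[vX /eqP Tv].
by rewrite (inj v) ?mem0v //; apply: (subvP (spS _ (subsetT X))).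
Qed.

(** [io] places a representation of [N] among the columns; agreement with actual columns is required
    only modulo the contracted span, which must not meet the image of [io]. *)
Lemma span_minor (N : matroid) (wT : vectType F) (p : N -> wT) (io : wT -> fvec F B) (C1 : {set E})
    (f : N -> E) (c : N -> F) :
  represents p -> linear io -> injective f -> (forall x, f x \notin C :|: D :|: C1) ->
  [disjoint C1 & C :|: D] ->
  (forall x, c x != 0 /\ mxcol A (f x) - c x *: io (p x) \in sp (mxcol A) (C :|: C1)) ->
  (forall w, w \in sp p setT -> io w \in sp (mxcol A) (C :|: C1) -> w = 0) ->
  has_minor (underlying (@rminor F (rmx A) C D)) N.
Proof.
move=> rp iol finj fC dC fE inj.
have [T TK] := exists_lker (sp (mxcol A) (C :|: C1)); have [io' ioE] := linear_Hom iol.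
have inj' w : w \in sp p setT -> (T \o io')%VF w = 0 -> w = 0.
  by move=> wp /eqP; rewrite comp_lfunE -memv_ker TK ioE => /(inj w wp).
apply: (@rminor_linear F B E A C D _ T C1 N (fun x => T (io (p x))) f c) => //.
- move=> X; rewrite (@inj_represents N wT _ p (T \o io')%VF _ (fun=> 1) _ inj') // => x.
  by rewrite oner_neq0 scale1r comp_lfunE ioE.
- move=> x; have [c0 ce] := fE x; split=> //; apply/eqP.
  by rewrite -subr_eq0 -linearZ -linearB -memv_ker TK.
- by rewrite TK.
- by rewrite TK capvSr.
Qed.

Definition gval (x : underlying (@rminor F (rmx A) C D)) : E := val (val x).

Lemma gval_inj : injective gval.
Proof. by move=> u v /val_inj/val_inj. Qed.

Lemma gval_notin x : gval x \notin C :|: D.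
Proof.
rewrite inE negb_or; apply/andP; split; first by have := valP (val x); rewrite inE.
by have := valP x; rewrite !inE.
Qed.

Lemma gval_represents (wT : vectType F) (T : 'Hom(fvec F B, wT)) :
  lker T = sp (mxcol A) C -> represents (fun x => T (mxcol A (gval x))).
Proof. exact: rminor_represents. Qed.

Lemma span_represents (wT : vectType F) (p : underlying (@rminor F (rmx A) C D) -> wT) (io : wT -> fvec F B) :
  linear io -> (forall x, mxcol A (gval x) - io (p x) \in sp (mxcol A) C) ->
  (forall w, w \in sp p setT -> io w \in sp (mxcol A) C -> w = 0) ->
  represents p.
Proof.
move=> iol fE inj X.
have [T TK] := exists_lker (sp (mxcol A) C); have [io' ioE] := linear_Hom iol.
rewrite -(rminor_represents (D := D) TK) (@inj_represents _ wT _ p (T \o io')%VF _ (fun=> 1)) // => [x|w wp].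
  rewrite oner_neq0 scale1r comp_lfunE ioE; split=> //; apply/eqP.
  by rewrite -subr_eq0 -linearB -memv_ker TK; apply: fE.
by move=> /eqP; rewrite comp_lfunE -memv_ker TK ioE => /(inj w wp).
Qed.
End SpanMinor.

Section Template.
Variables (K : finFieldType) (Phi : frame_template K).
Let C := tC Phi.
Let X := tX Phi.
Let Y0 := tY0 Phi.
Let Y1 := tY1 Phi.
Let Y := (C + Y0 + Y1)%type.

(* A column outside C, Y_0, Y_1 is either given by an element of Lambda and a frame
   column, or it is the sum of a unit column and a column of Y_1. *)
Definition espec (B' : finType) := (fvec K X * (B' -> K) + B' * Y1)%type.
Definition good_spec (B' : finType) (s : espec B') : Prop :=
  if s is inl lw then lw.1 \in tLambda Phi /\ frame_column (tGamma Phi) lw.2 else True.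
Definition bmx (B' E' : finType) (de : B' -> fvec K Y) (spec : E' -> espec B')
    (r : X + B') (e : Y + E') : K :=
  match e with
  | inl y => match r with inl x => tA1 x y | inr b => de b y end
  | inr e => match spec e with
      | inl lw => match r with inl x => lw.1 x | inr b => lw.2 b end
      | inr by_ => match r with
          | inl x => tA1 x (inr by_.2)
          | inr b => (b == by_.1)%:R + de b (inr by_.2)
          end
      end
  end.
Definition Cset (E' : finType) : {set Y + E'} := [set inl (inl (inl c)) | c : C].
Definition Dset (E' : finType) : {set Y + E'} := [set inl (inr y) | y : Y1].

Lemma bmx_conforms (B' E' : finType) (de : B' -> fvec K Y) (spec : E' -> espec B') :
  (forall b, de b \in tDelta Phi) -> (forall e, good_spec (spec e)) ->
  conforms Phi (@rminor K (rmx (bmx de spec)) (Cset E') (Dset E')).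
Proof.
move=> deP sP; exists B', E', (bmx de spec); split; last first.
  exists id, (fun=> 1); split; [by exists id | by move=> e; rewrite oner_neq0 |].
  by move=> v; rewrite (_ : [ffun e => 1 * v (id e)] = v) //; apply/ffunP => e; rewrite ffunE mul1r.
pose A' (r : X + B') (e : Y + E') : K :=
  match e with
  | inr e' => if spec e' is inr by_ then if r is inr b then (b == by_.1)%:R else 0 else bmx de spec r e
  | _ => bmx de spec r e end.
exists A', [set e | if spec e is inr _ then true else false]; split.
- split=> //; split; [|split; [|split; [|split]]].
  + by move=> z; rewrite inE /A' => + x; case: (spec z).
  + move=> z; rewrite inE /A'; case: (spec z) => // -[b y] _; exists b.
    by rewrite /= eqxx; split=> // b' /negPf->.
  + move=> e; rewrite inE /A'; have := sP e; case se: (spec e) => [[l w]|//] [_ fw] _.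
    have [f1 f2] := fw; split; first by rewrite (eq_card (_ : _ =i [set b | w b != 0])) // => b; rewrite !inE /= se.
    move=> [b wb]; have [|b0 [w0 wP]] := f2; first by exists b; move: wb; rewrite /= se.
    exists b0; split; first by rewrite /= se.
    by move=> b' b'0; rewrite /= se; apply: wP.
  + move=> e; rewrite inE /A'; have := sP e; case se: (spec e) => [[l w]|//] [lL _] _.
    by rewrite (_ : [ffun _ => _] = l) //; apply/ffunP => x; rewrite ffunE /= se.
  + by move=> b; rewrite (_ : [ffun _ => _] = de b) //; apply/ffunP => y; rewrite ffunE.
- by [].
- by move=> b e; rewrite inE /A'; case: (spec e).
move=> z; rewrite inE /A' /=; case: (spec z) => // -[b y] _; exists y => -[x|b'] //=.
by rewrite add0r.
Qed.

(** With [bmx_conforms] this describes conforming matrices by two free functions [de] and [spec], to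
    which rows and columns can be added without leaving the template. *)
Lemma conforms_bmx (B' E' : finType) (A : X + B' -> Y + E' -> K) : mx_conforms A ->
  exists (de : B' -> fvec K Y) (spec : E' -> espec B'),
    [/\ forall b, de b \in tDelta Phi, forall e, good_spec (spec e) & forall r e, A r e = bmx de spec r e].
Proof.
case=> A' [Z [[h1 [h2 [h3 [h4 [h5 h6]]]]] a1 a2 a3]].
pose de b : fvec K Y := [ffun y => A' (inr b) (inl y)].
have ex e : exists s : espec B', good_spec s /\ forall r, A r (inr e) =
    match s with
    | inl lw => match r with inl x => lw.1 x | inr b => lw.2 b end
    | inr by_ => match r with
          | inl x => tA1 x (inr by_.2) | inr b => (b == by_.1)%:R + de b (inr by_.2) end
    end.
  have [eZ|neZ] := boolP (e \in Z); last first.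
    exists (inl ([ffun x => A' (inl x) (inr e)], fun b => A' (inr b) (inr e))).
    split; first by split; [apply: h5 | apply: h4].
    by move=> [x|b] /=; rewrite ?ffunE a2.
  have [y yP] := a3 e eZ; have [b [b1 b0]] := h3 e eZ.
  exists (inr (b, y)); split=> // -[x|b'] /=; rewrite yP ?h2 // ?h1 ?add0r // ffunE; congr (_ + _).
  by have [->|/b0] := eqVneq b' b.
have [spec sP] := fin_all_exists ex.
exists de, spec; split=> [b|e|[x|b] [y|e]]; [exact: h6|by case: (sP e)|..]; rewrite ?a1 /bmx ?h1 ?ffunE //;
  by case: (sP e).
Qed.

Definition mk (B' : finType) (u : fvec K X) (w : fvec K B') : fvec K (X + B')%type :=
  [ffun r => match r with inl x => u x | inr b => w b end].

Definition A1z (z : fvec K Y) : fvec K X := [ffun x => \sum_y z y * tA1 x y : K^o].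
Definition dz (d z : fvec K Y) : K := \sum_y z y * d y.
Definition colz (B' : finType) (de : B' -> fvec K Y) (z : fvec K Y) : fvec K (X + B')%type :=
  mk (A1z z) [ffun b => dz (de b) z : K^o].
Definition zdl (y : Y) : fvec K Y := [ffun y' => (y' == y)%:R : K^o].

Lemma colz_linear (B' : finType) (de : B' -> fvec K Y) : linear (colz de).
Proof.
move=> k z z'; apply/ffunP => -[x|b]; rewrite !ffunE /= ?/dz scaler_sumr -big_split; apply: eq_bigr => y _ /=;
  by rewrite !ffunE mulrDl -mulrA.
Qed.

Lemma zdl_sum (z : fvec K Y) : z = \sum_y z y *: zdl y.
Proof.
apply/ffunP => x; rewrite sum_ffunE (bigD1 x) //= !ffunE eqxx big1 => [|u /negPf ux].
  by rewrite addr0 /= [_ *: _]mulr1.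
by rewrite !ffunE eq_sym ux [_ *: _]mulr0.
Qed.

Lemma sum_zdl (y : Y) (g : Y -> K) : \sum_y' zdl y y' * g y' = g y.
Proof.
rewrite (bigD1 y) //= ffunE eqxx mul1r big1 ?addr0 // => y' /negPf ny; by rewrite ffunE ny mul0r.
Qed.

Lemma colz_zdl (B' E' : finType) (de : B' -> fvec K Y) (spec : E' -> espec B') y :
  mxcol (bmx de spec) (inl y) = colz de (zdl y).
Proof. by apply/ffunP => -[x|b]; rewrite !ffunE /= ?/dz sum_zdl. Qed.

Definition Csupp (z : fvec K Y) : Prop := forall y, (if y is inl (inl _) then false else true) -> z y = 0.

Lemma colz_C (B' E' : finType) (de : B' -> fvec K Y) (spec : E' -> espec B') z :
  Csupp z -> colz de z \in sp (mxcol (bmx de spec)) (Cset E').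
Proof.
move=> zC; have [T TE] := linear_Hom (colz_linear de).
rewrite -TE (zdl_sum z) linear_sum; apply: memv_suml => y _; rewrite linearZ /= TE -(colz_zdl _ spec).
case: y => [[c|y0]|y1]; try by rewrite zC // scale0r mem0v.
by apply/memvZ/mem_sp/imsetP; exists c.
Qed.

(** The part of the span of the columns of [C] that is visible in the rows of [X]; once Delta is
    known to vanish, contracting [C] is working modulo this space. *)
Definition Wsp : {vspace fvec K X} := sp (fun c : C => A1z (zdl (inl (inl c)))) setT.

Lemma memW u : u \in Wsp -> exists2 z, Csupp z & A1z z = u.
Proof.
move: u; apply: sp_ind.
- exists 0 => [y _|]; first by rewrite ffunE.
  by apply/ffunP => x; rewrite !ffunE big1 // => y _; rewrite ffunE mul0r.
- move=> k _ _ [z zC <-] [z' zC' <-]; exists (k *: z + z').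
    by move=> y yC; rewrite !ffunE zC // zC' // [_ *: _]mulr0 addr0.
  apply/ffunP => x; rewrite !ffunE scaler_sumr -big_split; apply: eq_bigr => y _ /=.
  by rewrite !ffunE mulrDl -mulrA.
move=> c _; exists (zdl (inl (inl c))) => //.
by move=> [[c'|y0]|y1] //= _; rewrite ffunE.
Qed.

Lemma sp_C_W (B' E' : finType) (de : B' -> fvec K Y) (spec : E' -> espec B') v :
  v \in sp (mxcol (bmx de spec)) (Cset E') -> exists2 z, Csupp z & v = colz de z.
Proof.
move: v; apply: sp_ind.
- exists 0 => [y _|]; first by rewrite ffunE.
  by apply/ffunP => -[x|b]; rewrite !ffunE /= ?/dz big1 // => y _; rewrite ffunE mul0r.
- move=> k _ _ [z zC ->] [z' zC' ->]; exists (k *: z + z'); last by rewrite colz_linear.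
  by move=> y yC; rewrite !ffunE zC // zC' // [_ *: _]mulr0 addr0.
move=> e /imsetP[c _ ->]; exists (zdl (inl (inl c))); last exact: colz_zdl.
by move=> [[c'|y0]|y1] //= _; rewrite ffunE.
Qed.

Lemma Csupp_W z : Csupp z -> A1z z \in Wsp.
Proof.
move=> zC; have -> : A1z z = \sum_y (z y : K) *: A1z (zdl y).
  apply/ffunP => x; rewrite !ffunE sum_ffunE; apply: eq_bigr => y _; rewrite !ffunE sum_zdl //.
apply: memv_suml => y _; case: y => [[c|y0]|y1]; try by rewrite zC // scale0r mem0v.
by apply/memvZ; apply: (mem_sp (fun c : C => A1z (zdl (inl (inl c))))); rewrite inE.
Qed.
End Template.

Section Reduction.
Variables (K : finFieldType) (a : K).
Hypothesis (ha : a ^+ 2 = a + 1) (char2 : 1 + 1 = 0 :> K).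
Variable Phi : frame_template K.
Variable NN : nat -> matroid.
Hypothesis tgt : forall n, (n < 5)%N -> target a (NN n) (cols_of n).
Hypothesis noNN : forall n M, (n < 5)%N -> conforms Phi M -> ~ has_minor (underlying M) (NN n).
Notation ev := (ev a).
Notation Gam := (tGamma Phi).
Notation Y1 := (tY1 Phi).
Notation Y := (tC Phi + tY0 Phi + tY1 Phi)%type.

Lemma frame0 (B' : finType) : frame_column Gam (fun _ : B' => 0 : K).
Proof.
split; last by case=> b; rewrite eqxx.
by rewrite (eq_card0 (_ : _ =i pred0)) // => b; rewrite !inE eqxx.
Qed.

Lemma frame_delta (B' : finType) (b0 : B') : frame_column Gam (fun b => (b == b0)%:R : K).
Proof.
split.
  rewrite (_ : [set b | _] = [set b0]) ?cards1 //; apply/setP => b; rewrite !inE.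
  by case: (b == b0); rewrite ?oner_neq0 ?eqxx.
by move=> _; exists b0; rewrite eqxx; split=> // b /negPf->; rewrite eqxx.
Qed.

Lemma frame_edge (B' : finType) (b0 b1 : B') : b0 != b1 ->
  frame_column Gam (fun b => (b == b0)%:R + (b == b1)%:R : K).
Proof.
move=> n01; split.
  rewrite (_ : [set b | _] = [set b0; b1]) ?cards2 ?n01 //; apply/setP => b; rewrite !inE.
  have [->|_] := eqVneq b b0; first by rewrite (negPf n01) addr0 oner_neq0.
  by rewrite add0r; case: (b == b1); rewrite ?oner_neq0 ?eqxx.
move=> _; exists b0; rewrite eqxx (negPf n01) addr0; split=> // b /negPf->; rewrite add0r.
by case: (b == b1); rewrite ?eqxx // => _; exists 1%g; rewrite ?group1 // (oppr2 char2).
Qed.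

Definition w3 (B2 : finType) (v : 'I_3 -> g4) (b : 'I_3 + B2) : K :=
  if b is inl i then ev (v i) else 0.

Lemma frame_01 (B2 : finType) (v : 'I_3 -> g4) : (exists i, v i = O4) ->
  (forall i, v i = O4 \/ v i = I4) -> frame_column Gam (@w3 B2 v).
Proof.
move=> [i0 v0] v01; split.
  apply: leq_trans (_ : #|inl @: (~: [set i0])| <= 2)%N.
    apply/subset_leq_card/subsetP => -[i|b]; rewrite !inE /= ?eqxx // => vi.
    by apply: imset_f; rewrite !inE; apply: contraNneq vi => ->; rewrite v0.
  by apply: leq_trans (leq_imset_card _ _) _; rewrite cardsC1 card_ord.
case=> -[i|b] /=; rewrite ?eqxx //; case: (v01 i) => vi; rewrite vi ?eqxx // => _.
exists (inl i); rewrite /= vi; split=> // -[j|b] _ /=; rewrite ?eqxx //.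
by case: (v01 j) => ->; rewrite ?eqxx // => _; exists 1%g; rewrite ?group1 // (oppr2 char2).
Qed.

Definition io3 (B2 : finType) (v : fvec K 'I_3) : fvec K ('I_3 + B2)%type :=
  [ffun b => if b is inl i then v i else 0].

Lemma mkD (B' : finType) k (u u' : fvec K (tX Phi)) (w w' : fvec K B') :
  mk (k *: u + u') (k *: w + w') = k *: mk u w + mk u' w'.
Proof. by apply/ffunP => -[x|b]; rewrite !ffunE. Qed.

Lemma io3_linear B2 : linear (io3 B2).
Proof. by move=> k u v; apply/ffunP => -[i|b]; rewrite !ffunE // [_ *: _]mulr0 addr0. Qed.

Lemma sub_mem0 (vT : vectType K) (U : {vspace vT}) (u v : vT) : u = v -> u - v \in U.
Proof. by move=> ->; rewrite subrr mem0v. Qed.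

Lemma dz0 (z : fvec K Y) : dz 0 z = 0.
Proof. by rewrite /dz big1 // => y _; rewrite ffunE mulr0. Qed.

(** Otherwise [l] acts as one extra coordinate above the frame part. A column of [F7] then needs
    only two frame entries, its first coordinate being supplied by [l], and [F7] is a minor of a
    conforming matroid. *)
Lemma lambda_W l : l \in tLambda Phi -> l \in Wsp Phi.
Proof.
move=> lL; apply/negPn/negP => lW.
have [idx [idxI idxL rN]] := tgt (isT : 0 < 5)%N.
pose cd (x : NN 0) := nth [::] (cols_of 0) (idx x).
have ck : all (fun w => all (fun i => (wnth w i == O4) || (wnth w i == I4)) (iota 0 3)) (cols_of 0) by vm_compute.
have cd01 x (i : 'I_3) : wnth (cd x) i = O4 \/ wnth (cd x) i = I4.
  have /(all_nthP [::])/(_ (idx x) (idxL x))/allP/(_ (val i)) := ck; rewrite mem_iota ltn_ord => /(_ isT).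
  by case/orP => /eqP; [left | right].
pose v (x : NN 0) (i : 'I_3) := if i == ord0 then O4 else wnth (cd x) i.
pose spec (x : NN 0) : espec Phi ('I_3 + 'I_0)%type := inl (if wnth (cd x) 0 == I4 then l else 0, w3 (v x)).
have D0 : 0 \in tDelta Phi by case: (tDelta_zmod Phi).
have L0 : 0 \in tLambda Phi by case: (tLambda_zmod Phi).
have cf := @bmx_conforms K Phi ('I_3 + 'I_0)%type (NN 0) (fun=> 0) spec (fun=> D0).
apply: (noNN (isT : 0 < 5)%N (cf _)) => [x|].
  split=> /=; first by case: ifP.
  apply: frame_01; first by exists ord0; rewrite /v eqxx.
  by move=> i; rewrite /v; case: ifP => // _; left.
pose io (w : fvec K 'I_3) := mk ((w ord0 : K) *: l)
  ([ffun b => if b is inl i then if i == ord0 then 0 else w i else 0] : fvec K ('I_3 + 'I_0)%type).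
apply: (@span_minor K _ _ _ _ _ (NN 0) (fvec K 'I_3) _ io set0 inr (fun=> 1) rN).
- move=> k u w; rewrite /io -mkD; congr mk; first by rewrite !ffunE scalerDl scalerA.
  apply/ffunP => -[i|b]; rewrite !ffunE; last by rewrite [_ *: _]mulr0 addr0.
  by case: ifP => // _; rewrite [_ *: _]mulr0 addr0.
- by move=> x y [].
- by move=> x; rewrite !inE orbF negb_or; apply/andP; split; apply/imsetP => -[].
- by rewrite -setI_eq0 set0I.
- move=> x; split; [exact: oner_neq0 | rewrite scale1r; apply: sub_mem0].
  apply/ffunP => -[y|[i|[//]]]; rewrite !ffunE /=.
    change ((if wnth (cd x) 0 == I4 then l else 0) y = ev (wnth (cd x) 0) *: l y).
    have [] : wnth (cd x) 0 = O4 \/ wnth (cd x) 0 = I4 := cd01 x ord0; move=> ->; rewrite /= ?ffunE ?[_ *: _]mul0r //.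
    by rewrite [_ *: _]mul1r.
  by rewrite /v -/(cd x); case: ifP; rewrite ?ffunE.
move=> w _; rewrite setU0 => /sp_C_W[z zC /ffunP E].
have wi (i : 'I_3) : i != ord0 -> w i = 0.
  by move=> /negPf i0; have := E (inr (inl i)); rewrite !ffunE i0 dz0.
have w0 : w ord0 = 0.
  apply/eqP/negPn/negP => w0; case/negP: lW.
  have : (w ord0 : K) *: l \in Wsp Phi.
    rewrite (_ : _ *: _ = A1z z) ?Csupp_W //; apply/ffunP => x; have := E (inl x).
    by rewrite /io /colz ![mk _ _ _]ffunE.
  by move/(memvZ (w ord0 : K)^-1); rewrite scalerA mulVf // scale1r.
by apply/ffunP => i; rewrite ffunE; have [->|/wi] := eqVneq i ord0.
Qed.

(** Otherwise the combination [z] of template columns, corrected by an element of Lambda, is [k] on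
    every row that carries [de]. On three such rows this gives the column 111; the other six columns
    of [F7] have at most two nonzero entries and are frame columns. *)
Lemma delta_vanish (de : fvec K Y) (z : fvec K Y) : de \in tDelta Phi -> A1z z \in tLambda Phi -> dz de z = 0.
Proof.
move=> deD lL; apply/eqP/negPn/negP => kz; set k := dz de z in kz.
have [idx [idxI idxL rN]] := tgt (isT : 0 < 5)%N.
pose cd (x : NN 0) := nth [::] (cols_of 0) (idx x).
have ck : all (fun w => all (fun i => (wnth w i == O4) || (wnth w i == I4)) (iota 0 3)) (cols_of 0) by vm_compute.
have cd01 x (i : 'I_3) : wnth (cd x) i = O4 \/ wnth (cd x) i = I4.
  have /(all_nthP [::])/(_ (idx x) (idxL x))/allP/(_ (val i)) := ck; rewrite mem_iota ltn_ord => /(_ isT).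
  by case/orP => /eqP; [left | right].
have ck6 : all (fun j => (j == 6) || has (fun i => wnth (nth [::] (cols_of 0) j) i == O4) (iota 0 3)) (iota 0 7) by vm_compute.
(* The row [None] repeats [de]: the contracted columns agree there with the three main rows, whereas
   [t] does not. The rows [Some y] carry zero and serve to recover a deleted column of Y_1, as the
   difference of a column in which it is added to a unit column and that unit column. *)
pose B2 : finType := option Y1; pose B' : finType := ('I_3 + B2)%type.
pose E' : finType := (NN 0 + (bool + (Y1 + Y1)))%type.
pose v (x : NN 0) (i : 'I_3) := if idx x == 6 then O4 else wnth (cd x) i.
pose dl' (b0 : B') : B' -> K := fun b => (b == b0)%:R.
pose spec (e : E') : espec Phi B' := match e with
  | inl x => inl (0, w3 (v x))
  | inr (inl true) => inl (A1z z, fun=> 0)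
  | inr (inl false) => inl (0, dl' (inr None))
  | inr (inr (inl y)) => inl (0, dl' (inr (Some y)))
  | inr (inr (inr y)) => inr (inr (Some y), y) end.
pose de' (b : B') : fvec K Y := if b is inr (Some _) then 0 else de.
have D0 : 0 \in tDelta Phi by case: (tDelta_zmod Phi).
have L0 : 0 \in tLambda Phi by case: (tLambda_zmod Phi).
have cf := @bmx_conforms K Phi B' E' de' spec.
apply: (noNN (isT : 0 < 5)%N (cf _ _)) => [[i|[y|]]//|[x|[[]|[y|y]]]|] //=.
- split=> //=; apply: frame_01; last by move=> i; rewrite /v; case: ifP => // _; left.
  have /allP/(_ (idx x)) := ck6; rewrite mem_iota (idxL x) => /(_ isT) /orP[i6|/hasP[i]].
    by exists ord0; rewrite /v i6.
  rewrite mem_iota => /andP[_ i3] /eqP i0; exists (Ordinal i3); rewrite /v; by case: ifP.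
- by split=> //; apply: frame0.
- by split=> //; apply: frame_delta.
- by split=> //; apply: frame_delta.
set A := bmx de' spec.
pose E1 : {set Y + E'} := [set e | if e is inr (inr (inr (inl _))) then true else false].
pose S : {set Y + E'} := [set e | match e with inl (inl (inr _)) | inr (inr (inl _)) | inr (inr (inr (inr _))) => true | _ => false end].
pose C0 := Cset Phi E' :|: E1.
pose one3 : fvec K 'I_3 := [ffun=> 1 : K^o].
pose t : fvec K (tX Phi + B')%type := mk 0 (io3 B2 one3).
have P0 u : u \in sp (mxcol A) C0 -> forall i, u (inr (inl i)) = u (inr (inr None)).
  move: u; apply: sp_ind => [i|k' u w Pu Pw i|e]; first by rewrite !ffunE.
    by rewrite !ffunE Pu Pw.
  rewrite inE => /orP[/imsetP[c _ ->] i|]; first by rewrite !ffunE.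
  by rewrite inE; case: e => // -[//|[//|[y|//]]] _ i; rewrite !ffunE.
(* All these vectors are constant on the three main rows, so the contraction can meet the image of
   [io3] only in multiples of [t]. *)
have PS u : u \in sp (mxcol A) (C0 :|: S) -> forall i, u (inr (inl i)) = u (inr (inl ord0)).
  move: u; apply: sp_ind => [i|k' u w Pu Pw i|e]; first by rewrite !ffunE.
    by rewrite !ffunE Pu Pw.
  rewrite inE => /orP[/(mem_sp (mxcol A))/P0 H i|]; first by rewrite !H.
  rewrite inE; case: e => [[[//|y]|//]|[//|[[]|[//|y]]]] _ i; rewrite !ffunE //=.
have t0 : t \notin sp (mxcol A) C0.
  apply/negP => /P0/(_ ord0); rewrite !ffunE => /eqP; by rewrite oner_eq0.
have tS : t \in sp (mxcol A) (C0 :|: S).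
  have inS e : e \in C0 :|: S -> mxcol A e \in sp (mxcol A) (C0 :|: S) by apply: mem_sp.
  have [T TE] := linear_Hom (colz_linear de').
  have cz : colz de' z \in sp (mxcol A) (C0 :|: S).
    rewrite -TE (zdl_sum z) linear_sum; apply: memv_suml => y _; rewrite linearZ /= TE -(colz_zdl _ spec).
    apply: memvZ; case: y => [[c|y]|y].
    - by apply: inS; rewrite !inE; apply/orP; left; apply/orP; left; apply/imsetP; exists c.
    - by apply: inS; rewrite !inE orbT.
    have -> : mxcol A (inl (inr y)) = mxcol A (inr (inr (inr (inr y)))) - mxcol A (inr (inr (inr (inl y)))).
      by apply/ffunP => -[x|b]; rewrite !ffunE /= ?subr0 ?ffunE ?subr0 // /dl' addrAC subrr add0r.
    by apply: memvB; apply: inS; rewrite !inE ?orbT.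
  have -> : t = k^-1 *: (colz de' z - mxcol A (inr (inr (inl true)))) - mxcol A (inr (inr (inl false))).
    apply/ffunP => -[x|[i|[y|]]]; rewrite !ffunE /=.
    - by rewrite !ffunE subrr [_ *: _]mulr0 subr0.
    - by rewrite subr0 -/k /dl' /= subr0 [_ *: _]mulVf.
    - by rewrite dz0 subrr scaler0 /dl' /= subr0.
    by rewrite subr0 -/k /dl' /= [_ *: _]mulVf // subrr.
  by apply: memvB; [apply/memvZ/memvB => // | ]; apply: inS; rewrite !inE ?orbT.
have [I [j [IS jS jCI tI [m m0 jt]]]] := sp_maximal tS t0.
pose f (x : NN 0) : Y + E' := if idx x == 6 then j else inr (inl x).
have CE : Cset Phi E' :|: (E1 :|: I) = C0 :|: I by rewrite setUA.
have SD e : e \in S -> e \notin Cset Phi E' :|: Dset Phi E'.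
  rewrite !inE negb_or => eS; apply/andP; split; apply/imsetP => -[c _ eE]; by rewrite eE in eS.
have fj x y : j <> inr (inl x) /\ (idx x == 6 -> idx y == 6 -> x = y).
  split=> [jE|/eqP x6 /eqP y6]; first by rewrite jE inE in jS.
  by apply: idxI; rewrite x6.
apply: (@span_minor K _ _ A _ _ (NN 0) (fvec K 'I_3) _ (fun w => mk 0 (io3 B2 w)) (E1 :|: I) f
  (fun x => if idx x == 6 then m else 1) rN).
- by move=> k' u w; rewrite io3_linear -mkD scaler0 addr0.
- move=> x y; rewrite /f; case: ifP => x6; case: ifP => y6 //; last by case.
  + by move=> _; apply: (fj x y).2.
  + by move=> jE; case: (fj y y).1.
  by move=> jE; case: (fj x x).1.
- move=> x; rewrite -setUA [Dset _ _ :|: _]setUC setUA CE inE negb_or /f; case: ifP => _.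
    by rewrite jCI; have := SD j jS; rewrite inE negb_or => /andP[].
  apply/andP; split; last by apply/imsetP => -[].
  rewrite !inE orbF !negb_or; apply/andP; split; first by apply/imsetP => -[].
  by apply: contraTN IS => xI; apply/subsetPn; exists (inr (inl x)) => //; rewrite inE.
- rewrite -setI_eq0; apply/eqP/setP => e; rewrite !inE; apply/negP => /andP[/orP[eE|eI] eCD].
    by case/orP: eCD => /imsetP[c _ eE']; rewrite eE' in eE.
  by have := SD e (subsetP IS e eI); rewrite inE eCD.
- move=> x; rewrite CE /f; case: ifP => [/eqP x6|x6].
    split=> //; rewrite (_ : mk 0 _ = t) //; congr (mk 0 (io3 _ _)); apply/ffunP => i; rewrite !ffunE x6.
    by case: i => -[|[|[|//]]].
  split; [exact: oner_neq0 | rewrite scale1r; apply: sub_mem0].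
  by apply/ffunP => -[y|[i|b]]; rewrite !ffunE //= ?ffunE // /v x6.
move=> w _; rewrite CE => wI.
have wi := PS _ (subvP (spS _ (setUS C0 IS)) _ wI).
have wE : mk 0 (io3 B2 w) = (w ord0 : K) *: t.
  apply/ffunP => -[x|[i|b]]; rewrite !ffunE ?[_ *: _]mulr0 //.
  by have := wi i; rewrite !ffunE => ->; rewrite [_ *: _]mulr1.
have w0 : w ord0 = 0.
  apply/eqP/negPn/negP => w0; case/negP: tI; move: wI; rewrite wE => /(memvZ (w ord0 : K)^-1).
  by rewrite scalerA mulVf // scale1r.
by apply/ffunP => i; have := wi i; rewrite !ffunE w0.
Qed.

End Reduction.

Section TemplateWords.
Variables (K : finFieldType) (a : K).
Hypothesis (ha : a ^+ 2 = a + 1) (char2 : 1 + 1 = 0 :> K).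
Hypothesis evsurj : forall x : K, exists g, x = ev a g.
Variable Phi : frame_template K.
Variable NN : nat -> matroid.
Hypothesis tgt : forall n, (n < 5)%N -> target a (NN n) (cols_of n).
Hypothesis noNN : forall n M, (n < 5)%N -> conforms Phi M -> ~ has_minor (underlying M) (NN n).
Notation Gam := (tGamma Phi).
Notation X := (tX Phi).
Notation Y0 := (tY0 Phi).
Notation Y1 := (tY1 Phi).
Notation Y := (tC Phi + tY0 Phi + tY1 Phi)%type.

Let dvan (de z : fvec K Y) : de \in tDelta Phi -> A1z z \in tLambda Phi -> dz de z = 0.
Proof. exact: (delta_vanish char2 tgt noNN). Qed.
Let L0 : 0 \in tLambda Phi. Proof. by case: (tLambda_zmod Phi). Qed.
Let D0 : 0 \in tDelta Phi. Proof. by case: (tDelta_zmod Phi). Qed.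

Lemma lin_sub (vT wT : vectType K) (f : vT -> wT) : linear f -> forall x y, f (x - y) = f x - f y.
Proof. by move=> fl x y; have := fl (-1) y x; rewrite !scaleN1r => H; rewrite addrC H addrC. Qed.

Lemma lin_add (vT wT : vectType K) (f : vT -> wT) : linear f -> forall x y, f (x + y) = f x + f y.
Proof. by move=> fl x y; have := fl 1 x y; rewrite !scale1r. Qed.

Lemma lin_sum (vT wT : vectType K) (f : vT -> wT) : linear f ->
  forall (I : finType) (k : I -> K) (v : I -> vT), f (\sum_i k i *: v i) = \sum_i k i *: f (v i).
Proof.
move=> fl I k v; have [T TE] := linear_Hom fl.
by rewrite -TE linear_sum; apply: eq_bigr => i _; rewrite linearZ /= TE.
Qed.

Lemma A1z_linear : linear (@A1z K Phi).
Proof.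
move=> k z z'; apply/ffunP => x; rewrite !ffunE scaler_sumr -big_split; apply: eq_bigr => y _ /=.
by rewrite !ffunE mulrDl -mulrA.
Qed.

(** Zero lies in Lambda, so by [delta_vanish] a combination of template columns is determined by its
    rows in [X]. *)
Lemma colz_A1z0 (B' : finType) (de : B' -> fvec K Y) z :
  (forall b, de b \in tDelta Phi) -> A1z z = 0 -> colz de z = 0.
Proof.
move=> deD z0; apply/ffunP => -[x|b]; rewrite !ffunE; first by have /ffunP/(_ x) := z0; rewrite !ffunE.
by rewrite dvan ?deD // z0.
Qed.

Lemma colz_W (B' E' : finType) (de : B' -> fvec K Y) (spec : E' -> espec Phi B') z :
  (forall b, de b \in tDelta Phi) -> A1z z \in Wsp Phi ->
  colz de z \in sp (mxcol (bmx de spec)) (Cset Phi E').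
Proof.
move=> deD /memW[z' z'C zE].
have -> : colz de z = colz de z'; last exact: colz_C.
apply/eqP; rewrite -subr_eq0 -(lin_sub (colz_linear de)) colz_A1z0 //.
by rewrite (lin_sub A1z_linear) zE subrr.
Qed.

Lemma frame_ext (B' B2 : finType) (w : B' -> K) : frame_column Gam w ->
  frame_column Gam (fun b : B' + B2 => if b is inl b' then w b' else 0).
Proof.
case=> w2 wP; split.
  apply: leq_trans w2; apply: leq_trans (leq_imset_card inl _); apply/subset_leq_card/subsetP => -[b|b].
    by rewrite !inE => wb; apply: imset_f; rewrite inE.
  by rewrite !inE eqxx.
case=> -[b|b] wb; last by rewrite eqxx in wb.
have [|b0 [b1 bP]] := wP; first by exists b.
exists (inl b0); split=> // -[b'|b'] nb; last by rewrite eqxx.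
by move=> wb'; apply: bP => //; apply: contraNneq nb => ->.
Qed.

Lemma frame_vertices (B2 : finType) (u v : option B2) :
  frame_column Gam (fun b : B2 => if u == v then 0 else (Some b == u)%:R + (Some b == v)%:R).
Proof.
case: (eqVneq u v) => [_|uv]; first exact: frame0.
have H b0 (w : B2 -> K) : (forall b, w b = (b == b0)%:R) -> frame_column Gam w.
  move=> wE; split.
    rewrite (eq_card (_ : _ =i [set b | (b == b0)%:R != 0 :> K])); first by case: (frame_delta Phi b0).
    by move=> b; rewrite !inE wE.
  move=> _; exists b0; rewrite wE eqxx; split=> [//|b /negPf nb]; by rewrite wE nb eqxx.
case: u v uv => [u|] [v|] uv.
- exact: frame_edge.
- by apply: (H u) => b; rewrite addr0.
- by apply: (H v) => b; rewrite add0r.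
by case/eqP: uv.
Qed.

Section Words.
Variables (B' E' : finType) (de : B' -> fvec K Y) (spec : E' -> espec Phi B').
Hypothesis deD : forall b, de b \in tDelta Phi.
Hypothesis specP : forall e, good_spec (spec e).
Let A0 := bmx de spec.
(** Vertices: the rows outside [X], one for each element of Y_1, and [None], whose entry makes the
    coordinate sum zero. *)
Let Vt : finType := option (B' + Y1)%type.
Let B2 : finType := (B' + Y1)%type.
(** The matrix is enlarged by all edges on [Vt] and, for each [y] in Y_1, by the column [y] plus a
    unit vector in a new row. Contracting the latter lets the new vertex stand for the deleted
    column [y]. *)
Let E2 : finType := (E' + (Vt * Vt + Y1))%type.
Let de2 (b : B2) : fvec K Y := if b is inl b' then de b' else 0.
Let spec2 (e : E2) : espec Phi B2 := match e with
  | inl e' => match spec e' with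
     | inl lw => inl (lw.1, fun b : B2 => if b is inl b' then lw.2 b' else 0)
     | inr by_ => inr (inl by_.1, by_.2) end
  | inr (inl uv) => inl (0, fun b : B2 => if uv.1 == uv.2 then 0 else (Some b == uv.1)%:R + (Some b == uv.2)%:R)
  | inr (inr y) => inr (inr y, y) end.
Let A2 := bmx de2 spec2.

Let conf2 : conforms Phi (@rminor K (rmx A2) (Cset Phi E2) (Dset Phi E2)).
Proof.
apply: bmx_conforms; first by case=> [b|y]; [apply: deD | apply: D0].
case=> [e|[[u v]|y]]; last exact: I.
  have := specP e; rewrite /good_spec /spec2; case: (spec e) => [[l w]|s _]; last exact: I.
  by case=> lL fw; split; [apply: lL | apply: frame_ext].
split; [exact: L0 | exact: frame_vertices].
Qed.

Let ext (v : fvec K (X + B')%type) : fvec K (X + B2)%type :=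
  [ffun r => match r with inl x => v (inl x) | inr (inl b) => v (inr b) | inr (inr y) => 0 end].
Let emb (e : Y + E') : Y + E2 := match e with inl y => inl y | inr e => inr (inl e) end.
Let ct (y : Y1) : Y + E2 := inr (inr (inr y)).
Let ext_linear : linear ext.
Proof. by move=> k u v; apply/ffunP => -[x|[b|y]]; rewrite !ffunE // [_ *: _]mulr0 addr0. Qed.

Let mxcolE (F : fieldType) (B E : finType) (A : B -> E -> F) e b : mxcol A e b = A b e.
Proof. exact: ffunE. Qed.

Let extE v r : ext v r = match r with inl x => v (inl x) | inr (inl b) => v (inr b) | inr (inr y) => 0 end.
Proof. exact: ffunE. Qed.

Let ext_col e : mxcol A2 (emb e) = ext (mxcol A0 e).
Proof.
apply/ffunP => r; rewrite extE; case: e => [y|e]; case: r => [x|[b|y']]; rewrite !mxcolE; try exact: erefl.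
- exact: ffunE.
- by rewrite /A2 /A0 /bmx /emb /spec2; case: (spec e).
- by rewrite /A2 /A0 /bmx /emb /spec2; case: (spec e).
rewrite /A2 /bmx /emb /spec2; case: (spec e) => [lw|[b0 y0]]; first exact: erefl.
by rewrite ffunE addr0.
Qed.

Let ext_C v : v \in sp (mxcol A0) (Cset Phi E') -> ext v \in sp (mxcol A2) (Cset Phi E2).
Proof.
have [T TE] := linear_Hom ext_linear.
move: v; apply: sp_ind; first by rewrite -TE linear0 mem0v.
  by move=> k u v uU vU; rewrite ext_linear memvD // memvZ.
move=> e /imsetP[c _ ->]; rewrite -(ext_col (inl _)); apply: mem_sp; by apply/imsetP; exists c.
Qed.

Let ext_ct y : ext (colz de (zdl (inr y))) = mxcol A2 (ct y) - mk 0 [ffun b => (b == inr y)%:R : K^o].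
Proof.
have dzz d : dz d (zdl (inr y)) = d (inr y) :> K by rewrite /dz sum_zdl.
apply/ffunP => r; rewrite extE [in RHS]ffunE [(- _ : fvec K _) r]ffunE mxcolE.
case: r => [x|[b|y']]; rewrite ![mk _ _ _]ffunE.
- by rewrite ffunE sum_zdl ffunE subr0.
- by rewrite !ffunE dzz subr0 /= add0r.
by rewrite /= !ffunE addr0 subrr.
Qed.

Let N := @rminor K (rmx A0) (Cset Phi E') (Dset Phi E').
Hypothesis conN : forall S : {set underlying N}, (#|S| <= #|Y0|)%N -> spanning (~: S).

Variable q : 'End(fvec K X).
Hypothesis qK : lker q = Wsp Phi.
Let ab (y : Y1) : fvec K X := q (A1z (zdl (inr y))).
(** Indices of a basis of the Y_1-columns modulo [Wsp]: words involve only these, which makes their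
    coefficients unique. *)
Variable J : {set Y1}.
Hypothesis J1 : \dim (sp ab J) = #|J|.
Hypothesis J2 : sp ab J = sp ab setT.
Let zJ (w : fvec K Vt) : fvec K Y := \sum_y (w (Some (inr y)) : K) *: zdl (inr y).
Let io (w : fvec K Vt) : fvec K (X + B')%type :=
  colz de (zJ w) + mk 0 [ffun b => w (Some (inl b))].

Let qW u : u \in Wsp Phi -> q u = 0.
Proof. by rewrite -qK memv_ker => /eqP. Qed.

Let zJ_linear : linear zJ.
Proof.
move=> k u v; rewrite /zJ scaler_sumr -big_split; apply: eq_bigr => y _ /=; by rewrite !ffunE scalerDl scalerA.
Qed.

Let io_linear : linear io.
Proof.
move=> k u v; rewrite /io zJ_linear colz_linear scalerDr addrACA; congr (_ + _).
by rewrite -mkD scaler0 addr0; congr mk; apply/ffunP => b; rewrite !ffunE.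
Qed.

Let qzJ w : q (A1z (zJ w)) = \sum_y (w (Some (inr y)) : K) *: ab y.
Proof.
have [T TE] := linear_Hom A1z_linear.
by rewrite -TE !linear_sum; apply: eq_bigr => y _; rewrite !linearZ /= TE.
Qed.

(** The coefficients on [J] are read off modulo [Wsp], and the entry at [None] is minus the sum of
    the others. What remains is a combination of template columns that lies in [Wsp] on [X], hence
    in the span of [C]. *)
Let wordof (zz : fvec K Y) (wb : fvec K B') : q (A1z zz) \in sp ab setT ->
  exists w : fvec K Vt, [/\ \sum_u w u = 0, forall y, y \notin J -> w (Some (inr y)) = 0 &
    colz de zz + mk 0 wb - io w \in sp (mxcol A0) (Cset Phi E')].
Proof.
rewrite -J2 => /sp_comb[k k0 kE].
pose g (u : B' + Y1) : K := match u with inl b => wb b | inr y => k y end.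
pose w : fvec K Vt := [ffun u => (if u is Some v then g v else - \sum_(v : Vt | v != None) oapp g 0 v) : K^o].
exists w; split.
- rewrite (bigD1 None) //= ffunE [X in _ + X](eq_bigr (oapp g 0)) ?addNr // => -[v|//] _; by rewrite ffunE.
- by move=> y yJ; rewrite ffunE /= k0.
rewrite /io.
have -> : [ffun b => w (Some (inl b))] = wb by apply/ffunP => b; rewrite !ffunE.
rewrite opprD addrACA subrr addr0 -(lin_sub (colz_linear de)); apply: colz_W => //.
rewrite -qK memv_ker (lin_sub A1z_linear) linearB /= qzJ kE subr_eq0; apply/eqP/eq_bigr => y _; by rewrite ffunE.
Qed.

(** A part in Lambda lies in [Wsp], so it is a combination of columns of [C], and by [delta_vanish]
    that combination is zero in the rows outside [X]. *)
Let colE (e : Y + E') : e \notin Cset Phi E' :|: Dset Phi E' ->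
  (forall y0, e = inl (inl (inr y0)) -> q (A1z (zdl (inl (inr y0)))) \in sp ab setT) ->
  exists zz wb, mxcol A0 e = colz de zz + mk 0 wb /\ q (A1z zz) \in sp ab setT.
Proof.
case: e => [[[c|y0]|y1]|e]; rewrite inE negb_or => /andP[eC eD] H.
- by case/imsetP: eC; exists c.
- exists (zdl (inl (inr y0))), 0; split; last exact: H.
  rewrite colz_zdl (_ : mk 0 0 = 0) ?addr0 //; by apply/ffunP => -[x|b]; rewrite !ffunE.
- by case/imsetP: eD; exists y1.
have := specP e; case se: (spec e) => [[l w]|[b y]] /=.
  case=> lL _; have /memW[z zC zE] := lambda_W char2 tgt noNN lL.
  exists z, [ffun b => w b : K^o]; split; last by rewrite qW ?mem0v // Csupp_W.
  apply/ffunP => -[x|b]; rewrite !ffunE /= se /=.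
    by rewrite -zE ffunE addr0.
  by rewrite dvan ?add0r // zE.
move=> _; exists (zdl (inr y)), [ffun b' => (b' == b)%:R : K^o]; split.
  by apply/ffunP => -[x|b']; rewrite !ffunE /= se /= ?/dz sum_zdl ?addr0 // addrC.
by apply: (mem_sp ab); rewrite inE.
Qed.

Let gv (x : underlying N) : Y + E' := gval x.

Let notCD (x : underlying N) : gv x \notin Cset Phi E' :|: Dset Phi E'.
Proof. exact: gval_notin. Qed.

Let gvI : injective gv.
Proof. exact: gval_inj. Qed.

(** There are at most [#|Y0|] elements from Y_0, so by [conN] the others span; those all lie, modulo
    [Wsp], over the span of the columns of Y_1. *)
Let y0U (x : underlying N) y0 : gv x = inl (inl (inr y0)) ->
  q (A1z (zdl (inl (inr y0)))) \in sp ab setT.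
Proof.
move=> xy.
pose S : {set underlying N} := [set x | if gv x is inl (inl (inr _)) then true else false].
have cS : (#|S| <= #|Y0|)%N.
  rewrite -(card_imset _ gvI) -[#|Y0|]cardsT.
  apply: leq_trans (leq_imset_card (fun y => inl (inl (inr y)) : Y + E') setT).
  apply/subset_leq_card/subsetP => _ /imsetP[u + ->]; rewrite inE.
  by case: (gv u) => [[[//|y]|//]|//] _; apply: imset_f; rewrite inE.
have [T TK] := exists_lker (sp (mxcol A0) (Cset Phi E')).
have rT : represents (fun x => T (mxcol A0 (gv x))) := gval_represents TK.
pose phi (x : underlying N) := T (mxcol A0 (gv x)).
have : phi x \in sp phi (~: S).
  rewrite (_ : sp phi (~: S) = sp phi setT) ?mem_sp ?inE //.
  by apply/eqP; rewrite eqEdim spS ?subsetT //= !rT (conN cS).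
pose P v := exists2 v', T v' = v & q [ffun x => v' (inl x)] \in sp ab setT.
have fl k (u v : fvec K (X + B')%type) : q [ffun x => (k *: u + v) (inl x)] =
   k *: q [ffun x => u (inl x)] + q [ffun x => v (inl x)].
  by rewrite -linearP; congr (q _); apply/ffunP => z; rewrite !ffunE.
have PS v : v \in sp phi (~: S) -> P v.
  move: v; apply: sp_ind.
  - exists 0; rewrite ?linear0 //; rewrite (_ : [ffun _ => _] = 0) ?linear0 ?mem0v //.
    by apply/ffunP => z; rewrite !ffunE.
  - move=> k _ _ [u' <- uU] [v' <- vU]; exists (k *: u' + v'); first by rewrite linearP.
    by rewrite fl memvD // memvZ.
  move=> e; rewrite !inE => eS; exists (mxcol A0 (gv e)) => //.
  have [|zz [wb [-> zU]]] := colE (notCD e).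
    by move=> y ey; rewrite ey in eS.
  by rewrite (_ : [ffun _ => _] = A1z zz) //; apply/ffunP => z; rewrite !ffunE addr0.
case/PS => v' Tv' vU.
have : mxcol A0 (gv x) - v' \in lker T by rewrite memv_ker linearB /= Tv' subrr.
rewrite TK => /sp_C_W[z zC zE].
have -> : q (A1z (zdl (inl (inr y0)))) = q [ffun x => v' (inl x)] + q (A1z z).
  rewrite -linearD; congr (q _); apply/ffunP => x'; have /ffunP/(_ (inl x')) := zE.
  rewrite xy colz_zdl !ffunE => <-; by rewrite addrCA subrr addr0.
by rewrite (qW (Csupp_W zC)) addr0.
Qed.

Let io2 (w : fvec K Vt) : fvec K (X + B2)%type := mk 0 [ffun b => w (Some b)].

Let io2_linear : linear io2.
Proof.
move=> k u v; rewrite /io2 -mkD scaler0 addr0; congr mk; by apply/ffunP => b; rewrite !ffunE.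
Qed.

(** In the enlarged matrix, modulo the contracted columns [ct y], a word becomes a plain vector on
    the vertices with no part in [X]. *)
Let io_io2 (w : fvec K Vt) : (forall y, y \notin J -> w (Some (inr y)) = 0) ->
  ext (io w) - io2 w \in sp (mxcol A2) [set ct y | y in J].
Proof.
move=> wJ.
have -> : ext (io w) - io2 w = \sum_y (w (Some (inr y)) : K) *: mxcol A2 (ct y).
  rewrite /io (lin_add ext_linear) /zJ (lin_sum (colz_linear de)) (lin_sum ext_linear).
  rewrite (eq_bigr (fun y => (w (Some (inr y)) : K) *: mxcol A2 (ct y) -
     (w (Some (inr y)) : K) *: mk 0 [ffun b => (b == inr y)%:R : K^o])) => [|y _]; last first.
    by rewrite ext_ct scalerBr.
  rewrite sumrB -!addrA -[RHS]addr0; congr (_ + _).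
  have -> : \sum_y (w (Some (inr y)) : K) *: mk (0 : fvec K X) ([ffun b => (b == inr y)%:R : K^o] : fvec K B2) =
     mk (0 : fvec K X) ([ffun b => (if b is inr y then w (Some (inr y)) else 0) : K^o] : fvec K B2).
    apply/ffunP => -[x|[b|y']]; rewrite sum_ffunE !ffunE.
    - by rewrite big1 // => y _; rewrite !ffunE [_ *: _]mulr0.
    - by rewrite big1 // => y _; rewrite !ffunE [_ *: _]mulr0.
    rewrite (bigD1 y') //= !ffunE eqxx [_ *: _]mulr1 big1 ?addr0 // => y /negPf ny.
    by rewrite !ffunE -[inr _ == inr _]/(y' == y) eq_sym ny [_ *: _]mulr0.
  apply/ffunP => -[x|[b|y]]; rewrite !ffunE ?subr0 ?oppr0 ?add0r ?subrr ?addr0 ?(oppr2 char2) //.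
  by rewrite (addrr2 char2).
apply: memv_suml => y _; have [yJ|/wJ->] := boolP (y \in J); last by rewrite scale0r mem0v.
by apply/memvZ/mem_sp/imset_f.
Qed.

(** The words represent [N], and [N] together with all edges is a minor of a matroid that conforms
    to the template. So [Mplus c] has none of the five excluded minors, and the classification of
    words applies. *)
Theorem template_words : exists q, prime_power q /\
  forall F : fieldType, at_least q F -> representable F (underlying N).
Proof.
have ex (x : underlying N) : exists w : fvec K Vt, [/\ \sum_u w u = 0, forall y, y \notin J -> w (Some (inr y)) = 0 &
    mxcol A0 (gv x) - io w \in sp (mxcol A0) (Cset Phi E')].
  by have [|zz [wb [-> zU]]] := colE (notCD x); [move=> y0; apply: y0U | apply: wordof].
have [c cP] := fin_all_exists ex.
have sum0 e : \sum_u c e u = 0 by case: (cP e).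
pose P (w : fvec K Vt) := \sum_u w u = 0.
have P0 : P 0 by rewrite /P big1 // => u _; rewrite ffunE.
have PD k u v : P u -> P v -> P (k *: u + v).
  rewrite /P => pu pv; rewrite (eq_bigr (fun i => k * u i + v i)) => [|i _]; last by rewrite !ffunE.
  have pu' : \sum_i (u i : K) = 0 := pu; have pv' : \sum_i (v i : K) = 0 := pv.
  transitivity (k * (\sum_i (u i : K)) + \sum_i (v i : K)); last by rewrite pu' pv' mulr0 addr0.
  by rewrite mulr_sumr -big_split.
have wz w : P w -> (forall u, w (Some u) = 0) -> w = 0.
  move=> Pw ws; apply/ffunP => -[u|]; rewrite ffunE ?ws //; move: Pw; rewrite /P (bigD1 None) //= big1 ?addr0 //.
  by case.
have [A1 A1E] := linear_Hom A1z_linear.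
(* A word that vanishes modulo [C] is zero: its part on [J] by independence modulo [Wsp], its part
   on [B'] by the vanishing of Delta, its entry at [None] by the sum. *)
have repc : represents (M := underlying N) c.
  apply: (span_represents io_linear) => [x|w wc]; first by case: (cP x).
  have Pw : P w by move: w wc; apply: sp_ind => // e _; apply: sum0.
  have Jw y : y \notin J -> w (Some (inr y)) = 0.
    move: w wc {Pw}; apply: sp_ind => [|k u v h1 h2|e _] yJ; rewrite ?ffunE //; last by case: (cP e) => _ ->.
    by rewrite ?ffunE h1 // h2 // [_ *: _]mulr0 addr0.
  case/sp_C_W => z zC zE.
  have A1E' : A1z (zJ w) = A1z z.
    by apply/ffunP => x; have /ffunP/(_ (inl x)) := zE; rewrite !ffunE addr0.
  have wy y : w (Some (inr y)) = 0.
    apply: (sp_free (phi := ab) (S := J) (k := fun y => w (Some (inr y)))) => //.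
    by rewrite -qzJ A1E' qW // Csupp_W.
  have zJ0 : zJ w = 0 by rewrite /zJ big1 // => y _; rewrite wy scale0r.
  apply: wz => // -[b|y] //; have /ffunP/(_ (inr b)) := zE; rewrite /io zJ0 !ffunE.
  rewrite [dz _ z]dvan // -?A1E' ?zJ0 -?A1E ?linear0 //.
  by rewrite /dz big1 ?add0r // => y _; rewrite ffunE mul0r.
apply: (classified_representable ha char2 sum0 repc); apply: words_classified => // n n5.
exists (NN n); split; first exact: tgt.
move=> mN; apply: (noNN n5 conf2); apply: has_minor_trans mN.
pose f (x : underlying N + Vt * Vt) : Y + E2 :=
  match x with inl x => emb (gv x) | inr uv => inr (inr (inl uv)) end.
have embI : injective emb by move=> [y|e] [y'|e'] // [->].
have SM := @span_minor K (X + B2)%type (Y + E2)%type A2 (Cset Phi E2) (Dset Phi E2) (Mplus c) (fvec K Vt)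
  (cphi c) io2 [set ct y | y in J] f (fun=> 1) (Mplus_represents (c := c)) io2_linear.
apply: SM.
- move=> [x|uv] [x'|uv'] //=; [by move/embI/gvI-> | | | by case=> ->].
    by case: (gv x).
  by case: (gv x').
- move=> [x|uv] /=; last first.
    by rewrite !inE !negb_or; apply/andP; split; [apply/andP; split|]; apply/imsetP => -[].
  have := notCD x; rewrite !inE !negb_or => /andP[xC xD]; apply/andP; split; [apply/andP; split|].
  - apply: contraNN xC => /imsetP[c0 _]; case: (gv x) => //= y [->]; by apply/imsetP; exists c0.
  - apply: contraNN xD => /imsetP[c0 _]; case: (gv x) => //= y [->]; by apply/imsetP; exists c0.
  by apply/imsetP => -[y _]; case: (gv x).
- rewrite -setI_eq0; apply/eqP/setP => e; rewrite !inE; apply/negP => /andP[/imsetP[y _ ->]].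
  by case/orP => /imsetP[].
- move=> x; split; [exact: oner_neq0 | rewrite scale1r]; case: x => [x|[u v]] /=; last first.
    apply: sub_mem0; apply/ffunP => -[x|b]; rewrite !ffunE //= ?ffunE //.
    case: (eqVneq u v) => [->|_]; first by rewrite subrr.
    by rewrite (oppr2 char2).
  have [_ cJ cx] := cP x.
  have -> : mxcol A2 (emb (gv x)) - io2 (c x) =
     ext (mxcol A0 (gv x) - io (c x)) + (ext (io (c x)) - io2 (c x)).
    have [T TE] := linear_Hom ext_linear; rewrite ext_col -!TE linearB /= addrA subrK //.
  rewrite memvD //; first by apply: (subvP (spS _ (subsetUl _ _))); apply: ext_C.
  by apply: (subvP (spS _ (subsetUr _ _))); apply: io_io2.
move=> w wc.
have Pw : P w.
  move: w wc; apply: sp_ind => // -[x|[u v]] _ /=; first exact: sum0.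
  rewrite /P (eq_bigr (fun i => dl K u i - dl K v i)) => [|i _]; last by rewrite !ffunE.
  by rewrite sumrB !sum_dlE subrr.
(* Shape of the contracted span: a combination of [C] plus multiples [m y] of the columns [ct y].
   For a vector without part in [X], independence of [J] modulo [Wsp] forces [m] to vanish. *)
pose Q v := exists (z : fvec K Y) (m : Y1 -> K), [/\ Csupp z, forall y, y \notin J -> m y = 0 &
   v = colz de2 (z + \sum_y m y *: zdl (inr y)) + mk 0 ([ffun b => (if b is inr y then m y else 0) : K^o] : fvec K B2)].
have [CZ CZE] := linear_Hom (colz_linear de2).
have QS v : v \in sp (mxcol A2) (Cset Phi E2 :|: [set ct y | y in J]) -> Q v.
  have m0 : mk (0 : fvec K X) ([ffun b => (if b is inr y then (0 : K) else 0) : K^o] : fvec K B2) = 0.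
    by apply/ffunP => -[x|[b|y]]; rewrite !ffunE.
  move: v; apply: sp_ind.
  - exists 0, (fun=> 0); split=> //; first by move=> y _; rewrite ffunE.
    by rewrite m0 addr0 add0r big1 => [|y _]; rewrite ?scale0r // -CZE linear0.
  - move=> k _ _ [z [m [zC mJ ->]]] [z' [m' [zC' mJ' ->]]].
    exists (k *: z + z'), (fun y => k * m y + m' y); split.
    + by move=> y yC; rewrite !ffunE zC // zC' // [_ *: _]mulr0 addr0.
    + by move=> y yJ; rewrite mJ // mJ' // mulr0 addr0.
    rewrite scalerDr addrACA -colz_linear -mkD scaler0 addr0; congr (colz _ _ + mk 0 _).
      rewrite scalerDr addrACA; congr (_ + _); rewrite scaler_sumr -big_split; apply: eq_bigr => y _ /=.
      by rewrite scalerDl scalerA.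
    by apply/ffunP => -[b|y]; rewrite !ffunE // [_ *: _]mulr0 addr0.
  move=> e; rewrite inE => /orP[/imsetP[c0 _ ->]|/imsetP[y yJ ->]].
    exists (zdl (inl (inl c0))), (fun=> 0); split=> //; first by move=> [[c'|y0]|y1] //= _; rewrite ffunE.
    by rewrite m0 addr0 big1 ?addr0 ?colz_zdl // => y _; rewrite scale0r.
  exists 0, (fun y' => (y' == y)%:R); split; first by move=> y' _; rewrite ffunE.
    by move=> y' y'J; case: eqP => // yy; rewrite yy yJ in y'J.
  rewrite add0r (bigD1 y) //= eqxx scale1r big1 ?addr0 => [|y' /negPf->]; last by rewrite scale0r.
  apply/ffunP => -[x|[b|y']]; rewrite !ffunE /= ?/dz ?sum_zdl ?addr0 ?add0r ?ffunE //=.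
  by rewrite addr0 add0r.
case/QS => z [m [zC mJ wE]].
have de2D b : de2 b \in tDelta Phi by case: b => [b|y] /=; rewrite ?deD ?D0.
have zm : A1z (z + \sum_y m y *: zdl (inr y)) = 0.
  apply/ffunP => x; have : io2 w (inl x) = 0 by rewrite !ffunE.
  rewrite wE [LHS]ffunE [X in _ + X = _](_ : _ = 0); last by rewrite !ffunE.
  by rewrite addr0 [LHS]ffunE => ->; rewrite ffunE.
have my y : m y = 0.
  apply: (sp_free (phi := ab) (S := J)) => //.
  have := congr1 q zm; rewrite -A1E !linearD /= !linear_sum linear0 A1E qW ?add0r ?Csupp_W // => E0.
  by rewrite -[RHS]E0; apply: eq_bigr => y' _; rewrite !linearZ /= A1E.
move: wE; rewrite colz_A1z0 // add0r => /ffunP wE.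
apply: wz => // b; have := wE (inr b); rewrite !ffunE => ->; by case: b.
Qed.
End Words.

Theorem template_representable (M : rmatroid K) : conforms Phi M ->
  (forall S : {set underlying M}, (#|S| <= #|Y0|)%N -> spanning (~: S)) ->
  exists q, prime_power q /\ forall F : fieldType, at_least q F -> representable F (underlying M).
Proof.
case=> B' [E' [A [mcA risoM]]] conM.
have [de [spec [deD sP AE]]] := conforms_bmx mcA.
have sE : <<[seq mxrow A b | b : X + B']>>%VS = <<[seq mxrow (bmx de spec) b | b : X + B']>>%VS.
  by congr span; apply: eq_map => b; apply/ffunP => e; rewrite !ffunE AE.
rewrite /rmx sE in risoM.
pose N := @rminor K (rmx (bmx de spec)) (Cset Phi E') (Dset Phi E').
have mNM : miso (underlying N) (underlying M) := riso_miso risoM.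
have [g [bg gr]] := mNM.
have conN (S : {set underlying N}) : (#|S| <= #|Y0|)%N -> spanning (~: S).
  move=> cS; have := conM (g @: S); rewrite /spanning card_imset; last exact: bij_inj.
  move/(_ cS); have gT : g @: setT = setT.
    by case: bg => h hK gK; apply/setP => y; rewrite inE; apply/imsetP; exists (h y); rewrite ?inE ?gK.
  have -> : ~: (g @: S) = g @: (~: S).
    by apply/setP => y; case: bg => h hK gK; rewrite -[y]gK inE !(mem_imset _ _ (can_inj hK)) inE.
  by rewrite -{1}gT !gr.
suff [q [pq H]] : exists q, prime_power q /\ forall F : fieldType, at_least q F -> representable F (underlying N).
  by exists q; split=> // F qF; apply: representable_miso mNM (H F qF).
have [q qK] := exists_lker (Wsp Phi).
pose ab (y : Y1) : fvec K X := q (A1z (zdl (inr y))).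
pose MA := @col_matroid K X Y1 (fun x y => ab y x).
have rab (S : {set Y1}) : @rank MA S = \dim (sp ab S).
  by congr (\dim _); apply: eq_sp => y _; apply/ffunP => x; rewrite ffunE.
have [|J [_ _ J1 J2]] := @indep_extend MA set0 setT; first by rewrite rank0 cards0.
rewrite set0U !rab in J1 J2.
by apply: (template_words deD sP conN qK J1); apply/eqP; rewrite eqEdim spS ?subsetT //= J2.
Qed.

End TemplateWords.

(** * Representations normalised on a frame *)

Lemma enum_sorted (n : nat) (s : seq nat) : sorted ltn s -> all (fun i => i < n)%N s ->
  [seq val x | x <- enum [set j : 'I_n | val j \in s]] = s.
Proof.
move=> ss sn; apply: (@irr_sorted_eq _ ltn ltn_trans ltnn) => //.
  apply: (@subseq_sorted _ ltn ltn_trans _ _ _ (iota_ltn_sorted 0 n)).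
  by rewrite -val_enum_ord map_subseq // subseq_enum.
move=> i; apply/mapP/idP => [[j]|is_]; first by rewrite mem_enum inE => js ->.
by exists (Ordinal (allP sn _ is_)) => //; rewrite mem_enum inE.
Qed.

Section FrameRepresentation.
Variables (K : finFieldType) (a : K).
Hypothesis (ha : a ^+ 2 = a + 1) (char2 : 1 + 1 = 0 :> K).
Variables (F : fieldType) (vT : vectType F) (d n : nat) (cols : seq (seq g4)) (P : 'I_n -> vT).
Let cA (l : 'I_d) (k : 'I_n) : K := ev a (wnth (nth [::] cols k) l).
Hypothesis dimE : forall X : {set 'I_n}, \dim (sp P X) = col_rank cA X.

Let det_dim (e0 : 'I_n) (s : seq nat) : sorted ltn s -> size s = d -> all (fun i => i < n)%N s ->
  #|[set j : 'I_n | val j \in s]| = d /\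
  (\dim (sp P [set j : 'I_n | val j \in s]) == d) = (detK d cols s != O4).
Proof.
move=> ss sd sn; have eS := enum_sorted ss sn.
have cS : #|[set j : 'I_n | val j \in s]| = d by rewrite -sd -{2}eS size_map -cardE.
split=> //; rewrite dimE (col_rank_det _ e0) // -(ev_eq0 ha) /detK.
rewrite (ldet_det (R := K) (f := ev a)) //; [|exact: ev_add|exact: ev_mul|by move=> x; rewrite oppr2].
congr (_ != 0); congr (\det _); apply/matrixP => i j; rewrite !mxE /cA; congr (ev a (wnth (nth _ _ _) _)).
by rewrite -[in RHS]eS (nth_map e0) // -cardE cS.
Qed.

(* Coordinates are chosen so that the elements [b] are the unit vectors and [u]
   is the all-one vector; every other vector is scaled to have first nonzero
   coordinate 1. *)
Lemma frame_rep (b : seq nat) (u : 'I_n) : sorted ltn b -> size b = d ->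
  all (fun i => i < n)%N b -> detK d cols b != O4 ->
  (forall i, (i < d)%N -> let s := rcons (rem (nth 0%N b i) b) u in
     [&& sorted ltn s, size s == d, all (fun i => i < n)%N s & detK d cols s != O4]) ->
  exists Y : nat -> nat -> F,
  [/\ forall i j, (i < d)%N -> (j < d)%N -> Y (nth 0%N b i) j = (i == j)%:R,
      forall j, (j < d)%N -> Y u j = 1,
      forall k i, (k < n)%N -> (i < d)%N -> Y k i != 0 -> (forall j, (j < i)%N -> Y k j = 0) -> Y k i = 1
    & forall s, sorted ltn s -> size s = d -> all (fun i => i < n)%N s ->
      (ldet 0 1 +%R *%R -%R d (fun i j => Y (nth 0%N s i) j) == 0) = (detK d cols s == O4)].
Proof.
move=> sb zb bn db du.
pose bo (i : 'I_d) : 'I_n := insubd u (nth 0%N b i).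
have bnth (i : 'I_d) : (nth 0%N b i < n)%N by apply: (allP bn); rewrite mem_nth ?zb.
have boE (i : 'I_d) : val (bo i) = nth 0%N b i by rewrite val_insubd bnth.
have ub : uniq b by apply: (sorted_uniq ltn_trans ltnn).
have BsE : [set j : 'I_n | val j \in b] = bo @: setT.
  apply/setP => j; rewrite inE; apply/idP/imsetP => [jb|[i _ ->]]; last by rewrite boE mem_nth ?zb.
  have il : (index (val j) b < d)%N by rewrite -zb index_mem.
  by exists (Ordinal il) => //; apply: val_inj; rewrite boE nth_index.
have dB : \dim (sp (P \o bo) setT) = d.
  by have [_] := det_dim u sb zb bn; rewrite db BsE sp_imset => /eqP.
have fullB : sp (P \o bo) setT = sp P setT.
  apply/eqP; rewrite eqEdim dB -sp_imset spS ?subsetT //= dimE.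
  by apply: leq_trans (dimvS (subvf _)) _; rewrite dim_fvec card_ord.
have ex k : exists v : 'I_d -> F, P k = \sum_i v i *: P (bo i).
  have : P k \in sp (P \o bo) setT by rewrite fullB mem_sp ?inE.
  by case/sp_comb => v _ ->; exists v.
have fr (k : 'I_d -> F) : \sum_i k i *: P (bo i) = 0 -> forall i, k i = 0.
  apply: (sp_free (phi := P \o bo) (S := setT)); first by rewrite dB cardsT card_ord.
  by move=> e; rewrite inE.
have [lam lamE] := ex u.
(* Otherwise [u] together with the basis elements other than [i] would lie in a space of dimension
   less than [d]. *)
have lam0 i : lam i != 0.
  apply/eqP => li; have /and4P[h1 /eqP h2 h3 h4] := du i (ltn_ord i).
  have [_] := det_dim u h1 h2 h3; rewrite h4; set S := [set j | _] => /eqP dS.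
  have : (\dim (sp P S) <= #|[set: 'I_d] :\ i|)%N.
    apply: leq_trans (dimvS (_ : _ <= sp (P \o bo) (setT :\ i))%VS) _; last first.
      by apply: leq_trans (dim_span _) _; rewrite size_image.
    apply/spP => k; rewrite inE mem_rcons inE => /orP[/eqP ku|].
      rewrite (val_inj ku : k = u) lamE; apply: (sp_sum (P \o bo)) => e.
      by rewrite !inE andbT negbK => /eqP ->.
    rewrite mem_rem_uniq // inE => /andP[ki kb].
    have il : (index (val k) b < d)%N by rewrite -zb index_mem.
    have -> : k = bo (Ordinal il) by apply: val_inj; rewrite boE nth_index.
    apply: (mem_sp (P \o bo)); rewrite !inE andbT; apply: contraNneq ki => <-; by rewrite /= nth_index.
  by rewrite dS setTD cardsC1 card_ord; have := ltn_ord i; lia.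
(* Rescaling the basis by the coordinates of [u] turns [u] into the all-one vector. *)
pose T0 (v : fvec F 'I_d) : vT := \sum_i (v i * lam i : F) *: P (bo i).
have T0l : linear T0.
  move=> k x y; rewrite /T0 scaler_sumr -big_split; apply: eq_bigr => i _ /=.
  by rewrite !ffunE scalerA -scalerDl mulrDl mulrA.
have [T TE] := linear_Hom T0l.
(* Each vector is divided by its first nonzero coordinate; a zero vector keeps the scalar 1. *)
have ex2 k : exists cy : F * fvec F 'I_d, [/\ cy.1 != 0, P k = cy.1 *: T0 cy.2 &
    cy.2 = 0 \/ exists i, cy.2 i = 1 /\ forall j : 'I_d, (j < i)%N -> cy.2 j = 0].
  have [v vE] := ex k; pose y : fvec F 'I_d := [ffun i => v i / lam i : F^o].
  have yE : P k = T0 y by rewrite vE; apply: eq_bigr => i _; rewrite ffunE mulfVK.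
  clearbody y.
  case: (pickP (fun i => y i != 0)) => [i0 y0|yz]; last first.
    exists (1, 0); split; rewrite /= ?oner_neq0 //; last by left.
    rewrite yE scale1r; congr T0; apply/ffunP => i; rewrite [RHS]ffunE; exact/eqP/negbFE/(yz i).
  case: (@arg_minnP _ i0 (fun i => y i != 0) (fun i => val i) y0) => i yi mi.
  exists (y i, (y i : F)^-1 *: y); split=> //=.
    by rewrite yE -!TE linearZ /= scalerA mulfV // scale1r.
  right; exists i; rewrite !ffunE; split; first by rewrite [_ *: _]mulVf.
  move=> j ji; rewrite ffunE; have [->|yj] := eqVneq (y j) 0; first by rewrite [_ *: _]mulr0.
  by have := mi j yj; rewrite leqNgt ji.
have [cy cyP] := fin_all_exists ex2.
pose Y (k j : nat) : F := if insub k is Some k' then if insub j is Some j' then (cy k').2 j' else 0 else 0.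
have YE (k : 'I_n) (j : 'I_d) : Y k j = (cy k).2 j by rewrite /Y !valK.
have Tz v : T0 v = 0 -> v = 0.
  move=> /fr H; apply/ffunP => i; rewrite ffunE; have /eqP := H i; rewrite mulf_eq0 (negPf (lam0 i)) orbF.
  by move/eqP.
exists Y; split.
- move=> i j id_ jd; rewrite -(boE (Ordinal id_)) (YE _ (Ordinal jd)).
  have [c0 yE yn] := cyP (bo (Ordinal id_)); set y := (cy _).2 in yE yn *; set c := (cy _).1 in c0 yE.
  have key l : (c * (y l * lam l)) = (l == Ordinal id_)%:R.
    apply/eqP; rewrite -subr_eq0; apply/eqP; move: l; apply: fr.
    rewrite (eq_bigr (fun l => c *: ((y l * lam l : F) *: P (bo l)) - (l == Ordinal id_)%:R *: P (bo l))) => [|l _]; last first.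
      by rewrite scalerBl scalerA.
    rewrite sumrB -scaler_sumr -/(T0 y) -yE (bigD1 (Ordinal id_)) //= eqxx scale1r big1 ?addr0 ?subrr //.
    by move=> l /negPf->; rewrite scale0r.
  have yz l : l != Ordinal id_ -> y l = 0.
    move=> /negPf nl; have /eqP := key l; rewrite nl !mulf_eq0 (negPf c0) (negPf (lam0 l)) orbF; by move/eqP.
  have [ij|ij] := eqVneq i j; last by apply: yz; apply: contraNneq ij => /(congr1 val)/= ->.
  have jE : Ordinal jd = Ordinal id_ by apply: val_inj; rewrite /= ij.
  rewrite jE; case: yn => [y0|[i1 [y1 _]]].
    by have := key (Ordinal id_); rewrite y0 ffunE mul0r mulr0 eqxx => /eqP; rewrite eq_sym oner_eq0.
  have [i1E|/yz] := eqVneq i1 (Ordinal id_); first by rewrite -i1E y1.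
  by rewrite y1 => /eqP; rewrite oner_eq0.
- move=> j jd; rewrite (YE u (Ordinal jd)); have [c0 yE yn] := cyP u; set y := (cy _).2 in yE yn *; set c := (cy _).1 in c0 yE.
  have key l : c * y l = 1.
    apply: (mulIf (lam0 l)); rewrite mul1r; apply/eqP; rewrite -subr_eq0; apply/eqP; move: l; apply: fr.
    rewrite (eq_bigr (fun l => c *: ((y l * lam l : F) *: P (bo l)) - lam l *: P (bo l))) => [|l _]; last first.
      by rewrite scalerBl scalerA mulrA.
    by rewrite sumrB -scaler_sumr -/(T0 y) -yE lamE subrr.
  case: yn => [y0|[i1 [y1 _]]].
    by have := key (Ordinal jd); rewrite y0 ffunE mulr0 => /eqP; rewrite eq_sym oner_eq0.
  have c1 : c = 1 by have := key i1; rewrite y1 mulr1.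
  by have := key (Ordinal jd); rewrite c1 mul1r.
- move=> k i kn id_; rewrite (YE (Ordinal kn) (Ordinal id_)) => yi yj.
  have [_ _ [y0|[i1 [y1 yz]]]] := cyP (Ordinal kn); first by rewrite y0 ffunE eqxx in yi.
  have [lt|gt|eq_] := ltngtP i1 i.
  - by have := yj i1 lt; rewrite (YE (Ordinal kn) i1) y1 => /eqP; rewrite oner_eq0.
  - by move: yi; rewrite yz // eqxx.
  by rewrite (_ : Ordinal id_ = i1) //; apply: val_inj.
move=> s ss sd sn; have [cS dS] := det_dim u ss sd sn; apply/esym/negb_inj; rewrite -dS.
set S := [set j | _] in cS dS *.
have -> : \dim (sp P S) = \dim (sp (fun k => (cy k).2) S).
  apply: (@inj_represents F 'I_n _ _ (fun k => (cy k).2) T P (fun k => (cy k).1)) => [k|w _]; last by rewrite TE => /Tz.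
  by have [c0 PE _] := cyP k; rewrite c0 TE.
have -> : sp (fun k => (cy k).2) S = sp (mxcol (fun (l : 'I_d) k => (cy k).2 l : F)) S.
  by apply: eq_sp => k _; apply/ffunP => l; rewrite ffunE.
rewrite -[\dim _]/(col_rank (fun (l : 'I_d) k => (cy k).2 l : F) S) (col_rank_det _ u) //.
rewrite (ldet_det (R := F) (f := id)) //; congr (_ != 0); congr (\det _); apply/matrixP => i j; rewrite !mxE.
rewrite -YE; congr (Y _ _); rewrite -[in RHS](enum_sorted ss sn) (nth_map u) // -cardE cS //.
Qed.
End FrameRepresentation.

(** * The listed matroids as matrices of codes *)

Section Rows.
Variables (K : finFieldType) (a : K).

Definition code_rows (m : nat) (cols : seq (seq g4)) : seq (seq K) :=
  [seq [seq ev a (wnth w i) | w <- cols] | i <- iota 0 m].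

Lemma rows_entry (rows : seq (seq K)) (cols : seq (seq g4)) (i : 'I_(size rows)) (k : 'I_(size cols)) :
  rows = code_rows (size rows) cols ->
  mx_of_rows (size cols) rows i k = ev a (wnth (nth [::] cols k) i).
Proof.
move=> rE; rewrite mxE; have -> : nth [::] rows i = nth [::] (code_rows (size rows) cols) i by rewrite -rE.
rewrite (nth_map 0%N) ?size_iota // nth_iota // add0n.
by rewrite (nth_map [::]).
Qed.

Lemma rows_rep (F : fieldType) (rows : seq (seq K)) (cols : seq (seq g4)) :
  rows = code_rows (size rows) cols ->
  representable F (col_matroid (mx_of_rows (size cols) rows)) ->
  exists r (P : 'I_(size cols) -> fvec F 'I_r), forall X,
    \dim (sp P X) = col_rank (fun (l : 'I_(size rows)) (k : 'I_(size cols)) => ev a (wnth (nth [::] cols k) l)) X.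
Proof.
move=> rE [r [A rA]]; exists r, (mxcol A) => X; rewrite -[LHS]/(col_rank A X) rA.
by congr (\dim _); apply: eq_sp => k _; apply/ffunP => i; rewrite !ffunE rows_entry.
Qed.

Lemma rows_target (r1 r2 r3 : seq K) (cols : seq (seq g4)) :
  [:: r1; r2; r3] = code_rows 3 cols ->
  target a (col_matroid (mx_of_rows (size cols) [:: r1; r2; r3])) cols.
Proof.
move=> rE; exists (fun k => val k); split; [exact: val_inj | by move=> x; apply: ltn_ord | move=> X].
congr (\dim _); apply: eq_sp => k _; apply/ffunP => i; rewrite !ffunE.
exact: esym (@rows_entry [:: r1; r2; r3] cols i k rE).
Qed.
End Rows.

Section Fano.
Variables (K : finFieldType) (a : K).
Hypothesis char2 : 1 + 1 = 0 :> K.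

Lemma F2P (x : 'F_2) : x = 0 \/ x = 1.
Proof. by case: x => -[|[|//]] i; [left | right]; apply: val_inj. Qed.

Definition f2k (x : 'F_2) : K := if x == 0 then 0 else 1.

Fact f2k_zmod : zmod_morphism f2k.
Proof.
have o2 : (1 : 'F_2) - 1 = 0 by rewrite subrr.
have z1 : (0 : 'F_2) - 1 = 1 by apply: val_inj.
move=> x y; rewrite /f2k; have [->|->] := F2P x; have [->|->] := F2P y;
  rewrite ?subr0 ?o2 ?z1 ?eqxx ?oner_eq0 ?subr0 ?subrr //.
by rewrite sub0r oppr2.
Qed.

Fact f2k_monoid : monoid_morphism f2k.
Proof.
split; first by rewrite /f2k oner_eq0.
move=> x y; rewrite /f2k; have [->|->] := F2P x; have [->|->] := F2P y;
  by rewrite ?mul0r ?mulr0 ?mul1r ?eqxx ?oner_eq0 ?mul0r ?mulr0 ?mul1r.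
Qed.

Definition codes (v : 'rV['F_2]_3) : seq g4 := [seq if v 0 (inord l) == 0 then O4 else I4 | l <- iota 0 3].

Lemma codesE v (l : 'I_3) : wnth (codes v) l = if v 0 l == 0 then O4 else I4.
Proof. by rewrite /wnth (nth_map 0%N) ?size_iota // nth_iota // add0n inord_val. Qed.

Lemma codes_in (v : F7) : codes (val v) \in cols_of 0.
Proof.
have /existsP[i /andP[/eqP vi _]] := valP v.
rewrite /codes /=; case: eqP => z0; case: eqP => z1; case: eqP => z2 //.
move: vi; rewrite -(inord_val i); case: i => -[|[|[|//]]] /= _; rewrite ?z0 ?z1 ?z2 => /eqP;
  by rewrite eq_sym oner_eq0.
Qed.

Lemma F7_rank (X : {set F7}) : rank X = \dim (sp (fun v : F7 => cv a (codes (val v))) X).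
Proof.
pose s : {rmorphism 'F_2 -> K} := HB.pack f2k (GRing.isZmodMorphism.Build _ _ f2k f2k_zmod)
  (GRing.isMonoidMorphism.Build _ _ f2k f2k_monoid).
rewrite -[LHS](col_rank_map s); congr (\dim _); apply: eq_sp => v _; apply/ffunP => l.
by rewrite !ffunE codesE /= /f2k; case: ifP.
Qed.

Lemma F7_target : target a F7 (cols_of 0).
Proof.
exists (fun v => index (codes (val v)) (cols_of 0)); split.
- move=> v w e; have := nth_index [::] (codes_in v); rewrite e nth_index ?codes_in // => cE.
  apply/val_inj/rowP => j; have := congr1 (fun c => wnth c j) cE; rewrite !codesE.
  by have [->|->] := F2P (val v 0 j); have [->|->] := F2P (val w 0 j); rewrite ?eqxx ?oner_eq0.
- by move=> v; rewrite index_mem codes_in.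
move=> X; rewrite F7_rank; congr (\dim _); apply: eq_sp => v _; by rewrite nth_index ?codes_in.
Qed.

(** The points of [F7] are vectors over the prime field; numbering them by [cols_of 0] brings [F7]
    to the form of the other matrices. *)
Lemma F7_frame (F : fieldType) : representable F F7 ->
  exists r (P : 'I_7 -> fvec F 'I_r), forall X,
    \dim (sp P X) = col_rank (fun (l : 'I_3) (k : 'I_7) => ev a (wnth (nth [::] (cols_of 0) k) l)) X.
Proof.
case=> r [A rA].
have ck : all (fun w => [&& size w == 3, (index I4 w < 3)%N &
   all (fun i => (wnth w i == O4) || (wnth w i == I4)) (iota 0 3)]) (cols_of 0) by vm_compute.
have ckk (k : 'I_7) := allP ck _ (mem_nth [::] (ltn_ord k : k < size (cols_of 0))%N).
pose vk (k : 'I_7) : 'rV['F_2]_3 := \row_j (if wnth (nth [::] (cols_of 0) k) j == I4 then 1 else 0).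
have nv k : normalized (vk k).
  have /and3P[/eqP s3 i3 _] := ckk k; apply/existsP; exists (Ordinal i3).
  rewrite mxE /wnth nth_index ?eqxx /=; last by rewrite -index_mem s3.
  apply/forallP => j; apply/implyP => ji; rewrite mxE.
  by have /= -> := before_find O4 ji.
have cvk k : codes (vk k) = nth [::] (cols_of 0) k.
  have /and3P[/eqP s3 _ /allP w01] := ckk k; apply: (@eq_from_nth _ O4); first by rewrite size_map size_iota s3.
  move=> i; rewrite size_map size_iota => i3; rewrite -[LHS]/(wnth _ (Ordinal i3)) codesE mxE /=.
  have := w01 i; rewrite mem_iota i3 => /(_ isT); rewrite /wnth.
  by case/orP => /eqP ->; rewrite /= ?eqxx ?oner_eq0.
pose el k : F7 := Sub (vk k) (nv k).
exists r, (fun k => mxcol A (el k)) => X.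
rewrite -[LHS]/(\dim (sp (mxcol A \o el) X)) -sp_imset -[LHS]/(col_rank A (el @: X)) rA F7_rank sp_imset.
by congr (\dim _); apply: eq_sp => k _; apply/ffunP => l; rewrite !ffunE /= cvk.
Qed.
End Fano.

(** A projective frame: [b] is a basis, and [u] may replace any of its elements. Subsets are given
    by increasing lists, which is why [u] comes after the elements it is listed with. *)
Definition frame_ok (d n : nat) (cols : seq (seq g4)) (b : seq nat) (u : nat) : bool :=
  [&& sorted ltn b, size b == d, all (fun i => i < n)%N b, detK d cols b != O4
    & all (fun i => let s := rcons (rem (nth 0%N b i) b) u in
     [&& sorted ltn s, size s == d, all (fun i => i < n)%N s & detK d cols s != O4]) (iota 0 d)].

Definition seq_ok (d n : nat) (s : seq nat) : bool := [&& sorted ltn s, size s == d & all (fun i => i < n)%N s].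

Section FrameRat.
Variables (K : finFieldType) (a : K).
Hypothesis (ha : a ^+ 2 = a + 1) (char2 : 1 + 1 = 0 :> K).

Lemma frame_coords (F : fieldType) (d n : nat) (cols : seq (seq g4)) (b : seq nat) (u : nat) :
  (u < n)%N -> frame_ok d n cols b u ->
  (exists r (P : 'I_n -> fvec F 'I_r), forall X,
    \dim (sp P X) = col_rank (fun (l : 'I_d) (k : 'I_n) => ev a (wnth (nth [::] cols k) l)) X) ->
  exists Y : nat -> nat -> F,
  [/\ forall i j, (i < d)%N -> (j < d)%N -> Y (nth 0%N b i) j = (i == j)%:R,
      forall j, (j < d)%N -> Y u j = 1,
      forall k i, (k < n)%N -> (i < d)%N -> Y k i != 0 -> (forall j, (j < i)%N -> Y k j = 0) -> Y k i = 1,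
      forall s, seq_ok d n s -> detK d cols s == O4 ->
        ldet 0 1 +%R *%R -%R d (fun i j => Y (nth 0%N s i) j) = 0
    & forall s, seq_ok d n s -> detK d cols s != O4 ->
        ldet 0 1 +%R *%R -%R d (fun i j => Y (nth 0%N s i) j) <> 0].
Proof.
move=> un /and5P[h1 /eqP h2 h3 h4 /allP h5] [r [P dE]].
have [|Y [y1 y2 y3 y4]] := frame_rep ha char2 dE (u := Ordinal un) h1 h2 h3 h4.
  by move=> i id_; apply: h5; rewrite mem_iota.
exists Y; split=> // s /and3P[s1 /eqP s2 s3] ds.
  by apply/eqP; rewrite y4.
by apply/eqP; rewrite y4.
Qed.
End FrameRat.

(** * Non-representability over the rationals *)

From mathcomp Require Import lra.
Import Order.TTheory Num.Theory.

Lemma no_omega (x : rat) : x ^+ 2 + x + 1 = 0 -> False.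
Proof. by move=> h; have := sqr_ge0 (x + 1 / 2); lra. Qed.

(** The exponent of 5 is even in a square and odd in five times a square. *)
Lemma no_sqrt5 (x : rat) : x ^+ 2 = 5 -> False.
Proof.
move=> x5; have := divq_num_den x; set p := numq x; set q := denq x => xE.
have q0 : q != 0 by rewrite /q denq_neq0.
have E : (p ^+ 2)%:~R = (5 * q ^+ 2)%:~R :> rat.
  have x5' : x ^+ 2 = (5 : int)%:~R := x5.
  by rewrite intrM !rmorphXn /= -x5' -xE expr_div_n mulfVK // expf_neq0 // intr_eq0.
move/intr_inj: E => E.
have En : (`|p| ^ 2 = 5 * `|q| ^ 2)%N by rewrite -!abszX E abszM.
have qn : (0 < `|q|)%N by rewrite absz_gt0.
have pn : (0 < `|p|)%N by case: posnP En => // ->; rewrite exp0n //; case: (`|q|)%N qn => // n _; rewrite mulnC; case: (_ ^ 2)%N (expn_gt0 n.+1 2).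
have l5 : logn 5 5 = 1%N by vm_compute.
have := congr1 (logn 5) En; rewrite lognM ?expn_gt0 ?qn // !lognX l5; lia.
Qed.

Section NonRational.
Variables (K : finFieldType) (a : K).
Hypothesis (ha : a ^+ 2 = a + 1) (char2 : 1 + 1 = 0 :> K).

(** In this and the following computations [Y k i] is coordinate [i] of element [k]. Names tell how
    a value is found: [b] and [u] come from the frame, [n] and [o] concern a leading coordinate that
    is nonzero and hence 1, [z] is a zero, [s] a value solved from a dependent set, [e] an equation
    that remains. *)
Lemma F7_nonrat : ~ representable rat F7.
Proof.
move=> R; have P := F7_frame a char2 R.
have [Y [yb yu yn dz dn]] := @frame_coords K a ha char2 rat 3 7 (cols_of 0) [:: 0; 1; 3] 6 isT isT P.
have b00 : Y 0%N 0%N = 1 := yb 0%N 0%N isT isT.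
have b01 : Y 0%N 1%N = 0 := yb 0%N 1%N isT isT.
have b02 : Y 0%N 2%N = 0 := yb 0%N 2%N isT isT.
have b10 : Y 1%N 0%N = 0 := yb 1%N 0%N isT isT.
have b11 : Y 1%N 1%N = 1 := yb 1%N 1%N isT isT.
have b12 : Y 1%N 2%N = 0 := yb 1%N 2%N isT isT.
have b20 : Y 3%N 0%N = 0 := yb 2%N 0%N isT isT.
have b21 : Y 3%N 1%N = 0 := yb 2%N 1%N isT isT.
have b22 : Y 3%N 2%N = 1 := yb 2%N 2%N isT isT.
have u0 : Y 6%N 0%N = 1 := yu 0%N isT.
have u1 : Y 6%N 1%N = 1 := yu 1%N isT.
have u2 : Y 6%N 2%N = 1 := yu 2%N isT.
have n20 : Y 2%N 0%N != 0 by apply/eqP => h; have := dn [:: 1; 2; 3]%N isT isT; rewrite /ldet /= !(b00, b01, b02, b10, b11, b12, b20, b21, b22, u0, u1, u2) h; apply; ring.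
have o20 : Y 2%N 0%N = 1 by apply: yn => // -[|[|[|j]]] //= _; rewrite ?(b00).
have z22 : Y 2%N 2%N = 0 by have := dz [:: 0; 1; 2]%N isT isT; rewrite /ldet /= !(b00, b01, b02, b10, b11, b12, b20, b21, b22, u0, u1, u2, o20); lra.
have n40 : Y 4%N 0%N != 0 by apply/eqP => h; have := dn [:: 1; 3; 4]%N isT isT; rewrite /ldet /= !(b00, b01, b02, b10, b11, b12, b20, b21, b22, u0, u1, u2, o20, z22) h; apply; ring.
have o40 : Y 4%N 0%N = 1 by apply: yn => // -[|[|[|j]]] //= _; rewrite ?(b00).
have z41 : Y 4%N 1%N = 0 by have := dz [:: 0; 3; 4]%N isT isT; rewrite /ldet /= !(b00, b01, b02, b10, b11, b12, b20, b21, b22, u0, u1, u2, o20, z22, o40); lra.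
have z50 : Y 5%N 0%N = 0 by have := dz [:: 1; 3; 5]%N isT isT; rewrite /ldet /= !(b00, b01, b02, b10, b11, b12, b20, b21, b22, u0, u1, u2, o20, z22, o40, z41); lra.
have n51 : Y 5%N 1%N != 0 by apply/eqP => h; have := dn [:: 0; 3; 5]%N isT isT; rewrite /ldet /= !(b00, b01, b02, b10, b11, b12, b20, b21, b22, u0, u1, u2, o20, z22, o40, z41, z50) h; apply; ring.
have o51 : Y 5%N 1%N = 1 by apply: yn => // -[|[|[|j]]] //= _; rewrite ?(b00, z50).
have s52 : Y 5%N 2%N = 1 by have := dz [:: 0; 5; 6]%N isT isT; rewrite /ldet /= !(b00, b01, b02, b10, b11, b12, b20, b21, b22, u0, u1, u2, o20, z22, o40, z41, z50, o51); lra.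
have s42 : Y 4%N 2%N = 1 by have := dz [:: 1; 4; 6]%N isT isT; rewrite /ldet /= !(b00, b01, b02, b10, b11, b12, b20, b21, b22, u0, u1, u2, o20, z22, o40, z41, z50, o51, s52); lra.
have s21 : Y 2%N 1%N = 1 by have := dz [:: 2; 3; 6]%N isT isT; rewrite /ldet /= !(b00, b01, b02, b10, b11, b12, b20, b21, b22, u0, u1, u2, o20, z22, o40, z41, z50, o51, s52, s42); lra.
(* The vectors are now 110, 101 and 011, whose determinant is 2 up to sign. *)
by have := dz [:: 2; 4; 5]%N isT isT; rewrite /ldet /= !(b00, b01, b02, b10, b11, b12, b20, b21, b22, u0, u1, u2, o20, z22, o40, z41, z50, o51, s52, s42, s21); lra.
Qed.

Lemma V1_nonrat : ~ representable rat (V1 a).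
Proof.
move=> R; have P := @rows_rep K a rat (code_rows a 3 (cols_of 1)) (cols_of 1) erefl R.
have [Y [yb yu yn dz dn]] := @frame_coords K a ha char2 rat 3 9 (cols_of 1) [:: 0; 1; 2] 7 isT isT P.
have b00 : Y 0%N 0%N = 1 := yb 0%N 0%N isT isT.
have b01 : Y 0%N 1%N = 0 := yb 0%N 1%N isT isT.
have b02 : Y 0%N 2%N = 0 := yb 0%N 2%N isT isT.
have b10 : Y 1%N 0%N = 0 := yb 1%N 0%N isT isT.
have b11 : Y 1%N 1%N = 1 := yb 1%N 1%N isT isT.
have b12 : Y 1%N 2%N = 0 := yb 1%N 2%N isT isT.
have b20 : Y 2%N 0%N = 0 := yb 2%N 0%N isT isT.
have b21 : Y 2%N 1%N = 0 := yb 2%N 1%N isT isT.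
have b22 : Y 2%N 2%N = 1 := yb 2%N 2%N isT isT.
have u0 : Y 7%N 0%N = 1 := yu 0%N isT.
have u1 : Y 7%N 1%N = 1 := yu 1%N isT.
have u2 : Y 7%N 2%N = 1 := yu 2%N isT.
have n30 : Y 3%N 0%N != 0 by apply/eqP => h; have := dn [:: 1; 2; 3]%N isT isT; rewrite /ldet /= !(b00, b01, b02, b10, b11, b12, b20, b21, b22, u0, u1, u2) h; apply; ring.
have o30 : Y 3%N 0%N = 1 by apply: yn => // -[|[|[|j]]] //= _; rewrite ?(b00).
have z32 : Y 3%N 2%N = 0 by have := dz [:: 0; 1; 3]%N isT isT; rewrite /ldet /= !(b00, b01, b02, b10, b11, b12, b20, b21, b22, u0, u1, u2, o30); lra.
have z40 : Y 4%N 0%N = 0 by have := dz [:: 1; 2; 4]%N isT isT; rewrite /ldet /= !(b00, b01, b02, b10, b11, b12, b20, b21, b22, u0, u1, u2, o30, z32); lra.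
have n41 : Y 4%N 1%N != 0 by apply/eqP => h; have := dn [:: 0; 2; 4]%N isT isT; rewrite /ldet /= !(b00, b01, b02, b10, b11, b12, b20, b21, b22, u0, u1, u2, o30, z32, z40) h; apply; ring.
have o41 : Y 4%N 1%N = 1 by apply: yn => // -[|[|[|j]]] //= _; rewrite ?(b00, z40).
have n50 : Y 5%N 0%N != 0 by apply/eqP => h; have := dn [:: 1; 2; 5]%N isT isT; rewrite /ldet /= !(b00, b01, b02, b10, b11, b12, b20, b21, b22, u0, u1, u2, o30, z32, z40, o41) h; apply; ring.
have o50 : Y 5%N 0%N = 1 by apply: yn => // -[|[|[|j]]] //= _; rewrite ?(b00).
have n60 : Y 6%N 0%N != 0 by apply/eqP => h; have := dn [:: 1; 2; 6]%N isT isT; rewrite /ldet /= !(b00, b01, b02, b10, b11, b12, b20, b21, b22, u0, u1, u2, o30, z32, z40, o41, o50) h; apply; ring.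
have o60 : Y 6%N 0%N = 1 by apply: yn => // -[|[|[|j]]] //= _; rewrite ?(b00).
have n80 : Y 8%N 0%N != 0 by apply/eqP => h; have := dn [:: 1; 2; 8]%N isT isT; rewrite /ldet /= !(b00, b01, b02, b10, b11, b12, b20, b21, b22, u0, u1, u2, o30, z32, z40, o41, o50, o60) h; apply; ring.
have o80 : Y 8%N 0%N = 1 by apply: yn => // -[|[|[|j]]] //= _; rewrite ?(b00).
have z81 : Y 8%N 1%N = 0 by have := dz [:: 0; 2; 8]%N isT isT; rewrite /ldet /= !(b00, b01, b02, b10, b11, b12, b20, b21, b22, u0, u1, u2, o30, z32, z40, o41, o50, o60, o80); lra.
have s52 : Y 5%N 2%N = 1 by have := dz [:: 1; 5; 7]%N isT isT; rewrite /ldet /= !(b00, b01, b02, b10, b11, b12, b20, b21, b22, u0, u1, u2, o30, z32, z40, o41, o50, o60, o80, z81); lra.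
have s61 : Y 6%N 1%N = Y 6%N 2%N by have := dz [:: 0; 6; 7]%N isT isT; rewrite /ldet /= !(b00, b01, b02, b10, b11, b12, b20, b21, b22, u0, u1, u2, o30, z32, z40, o41, o50, o60, o80, z81, s52); lra.
have s62 : Y 6%N 2%N = Y 8%N 2%N by have := dz [:: 1; 6; 8]%N isT isT; rewrite /ldet /= !(b00, b01, b02, b10, b11, b12, b20, b21, b22, u0, u1, u2, o30, z32, z40, o41, o50, o60, o80, z81, s52, s61); lra.
have s51 : Y 5%N 1%N = Y 8%N 2%N by have := dz [:: 2; 5; 6]%N isT isT; rewrite /ldet /= !(b00, b01, b02, b10, b11, b12, b20, b21, b22, u0, u1, u2, o30, z32, z40, o41, o50, o60, o80, z81, s52, s61, s62); lra.
have e1 : Y 8%N 2%N + Y 3%N 1%N*Y 4%N 2%N + -1*Y 4%N 2%N*Y 8%N 2%N = 0 by have := dz [:: 3; 4; 6]%N isT isT; rewrite /ldet /= !(b00, b01, b02, b10, b11, b12, b20, b21, b22, u0, u1, u2, o30, z32, z40, o41, o50, o60, o80, z81, s52, s61, s62, s51); lra.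
have e2 : Y 3%N 1%N + Y 8%N 2%N + -1*Y 3%N 1%N*Y 8%N 2%N = 0 by have := dz [:: 3; 7; 8]%N isT isT; rewrite /ldet /= !(b00, b01, b02, b10, b11, b12, b20, b21, b22, u0, u1, u2, o30, z32, z40, o41, o50, o60, o80, z81, s52, s61, s62, s51); lra.
have e3 : 1 + -1*Y 8%N 2%N + -1*Y 4%N 2%N*Y 8%N 2%N = 0 by have := dz [:: 4; 5; 8]%N isT isT; rewrite /ldet /= !(b00, b01, b02, b10, b11, b12, b20, b21, b22, u0, u1, u2, o30, z32, z40, o41, o50, o60, o80, z81, s52, s61, s62, s51); lra.
move: e1 e2 e3; set x := Y 8%N 2%N; set s := Y 3%N 1%N; set t := Y 4%N 2%N => e1 e2 e3.
have x0 : x != 0 by apply/eqP => h; have := dn [:: 0; 1; 8]%N isT isT; rewrite /ldet /= !(b00, b01, b02, b10, b11, b12, b20, b21, b22, u0, u1, u2, o30, z32, z40, o41, o50, o60, o80, z81, s52, s61, s62, s51) -/x h; apply; ring.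
have : x * (x - 1) = 0.
  (* A combination of the three equations that eliminates [s] and [t]. It leaves only x = 1, for
     which [e2] reads 1 = 0. *)
  have E : 2 * (x * (x - 1)) = x * (x + s * t + -1 * t * x) + (s - x) * (1 + -1 * x + -1 * t * x) - (s + x + -1 * s * x) by ring.
  by move: E; rewrite e1 e2 e3; lra.
move/eqP; rewrite mulf_eq0 (negPf x0) subr_eq0 /= => /eqP x1; move: e2; rewrite x1; lra.
Qed.

Definition cols_V2 : seq (seq g4) := map (map nat_g4) [:: [:: 1; 0; 0; 0]; [:: 0; 1; 0; 0]; [:: 0; 0; 1; 0]; [:: 0; 0; 0; 1]; [:: 1; 3; 2; 3]; [:: 1; 2; 3; 3]; [:: 1; 2; 2; 2]; [:: 0; 1; 1; 2]]%N.

Lemma V2_nonrat : ~ representable rat (V2 a).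
Proof.
move=> R; have P := @rows_rep K a rat (code_rows a 4 cols_V2) cols_V2 erefl R.
have [Y [yb yu yn dz dn]] := @frame_coords K a ha char2 rat 4 8 cols_V2 [:: 1; 2; 4; 6] 7 isT isT P.
have b00 : Y 1%N 0%N = 1 := yb 0%N 0%N isT isT.
have b01 : Y 1%N 1%N = 0 := yb 0%N 1%N isT isT.
have b02 : Y 1%N 2%N = 0 := yb 0%N 2%N isT isT.
have b03 : Y 1%N 3%N = 0 := yb 0%N 3%N isT isT.
have b10 : Y 2%N 0%N = 0 := yb 1%N 0%N isT isT.
have b11 : Y 2%N 1%N = 1 := yb 1%N 1%N isT isT.
have b12 : Y 2%N 2%N = 0 := yb 1%N 2%N isT isT.
have b13 : Y 2%N 3%N = 0 := yb 1%N 3%N isT isT.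
have b20 : Y 4%N 0%N = 0 := yb 2%N 0%N isT isT.
have b21 : Y 4%N 1%N = 0 := yb 2%N 1%N isT isT.
have b22 : Y 4%N 2%N = 1 := yb 2%N 2%N isT isT.
have b23 : Y 4%N 3%N = 0 := yb 2%N 3%N isT isT.
have b30 : Y 6%N 0%N = 0 := yb 3%N 0%N isT isT.
have b31 : Y 6%N 1%N = 0 := yb 3%N 1%N isT isT.
have b32 : Y 6%N 2%N = 0 := yb 3%N 2%N isT isT.
have b33 : Y 6%N 3%N = 1 := yb 3%N 3%N isT isT.
have u0 : Y 7%N 0%N = 1 := yu 0%N isT.
have u1 : Y 7%N 1%N = 1 := yu 1%N isT.
have u2 : Y 7%N 2%N = 1 := yu 2%N isT.
have u3 : Y 7%N 3%N = 1 := yu 3%N isT.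
have z00 : Y 0%N 0%N = 0 by have := dz [:: 0; 2; 4; 6]%N isT isT; rewrite /ldet /= !(b00, b01, b02, b03, b10, b11, b12, b13, b20, b21, b22, b23, b30, b31, b32, b33, u0, u1, u2, u3); lra.
have n01 : Y 0%N 1%N != 0 by apply/eqP => h; have := dn [:: 0; 1; 4; 6]%N isT isT; rewrite /ldet /= !(b00, b01, b02, b03, b10, b11, b12, b13, b20, b21, b22, b23, b30, b31, b32, b33, u0, u1, u2, u3, z00) h; apply; ring.
have o01 : Y 0%N 1%N = 1 by apply: yn => // -[|[|[|j]]] //= _; rewrite ?(b00, z00).
have n30 : Y 3%N 0%N != 0 by apply/eqP => h; have := dn [:: 2; 3; 4; 6]%N isT isT; rewrite /ldet /= !(b00, b01, b02, b03, b10, b11, b12, b13, b20, b21, b22, b23, b30, b31, b32, b33, u0, u1, u2, u3, z00, o01) h; apply; ring.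
have o30 : Y 3%N 0%N = 1 by apply: yn => // -[|[|[|j]]] //= _; rewrite ?(b00).
have z31 : Y 3%N 1%N = 0 by have := dz [:: 1; 3; 4; 6]%N isT isT; rewrite /ldet /= !(b00, b01, b02, b03, b10, b11, b12, b13, b20, b21, b22, b23, b30, b31, b32, b33, u0, u1, u2, u3, z00, o01, o30); lra.
have n50 : Y 5%N 0%N != 0 by apply/eqP => h; have := dn [:: 2; 4; 5; 6]%N isT isT; rewrite /ldet /= !(b00, b01, b02, b03, b10, b11, b12, b13, b20, b21, b22, b23, b30, b31, b32, b33, u0, u1, u2, u3, z00, o01, o30, z31) h; apply; ring.
have o50 : Y 5%N 0%N = 1 by apply: yn => // -[|[|[|j]]] //= _; rewrite ?(b00).
have z53 : Y 5%N 3%N = 0 by have := dz [:: 1; 2; 4; 5]%N isT isT; rewrite /ldet /= !(b00, b01, b02, b03, b10, b11, b12, b13, b20, b21, b22, b23, b30, b31, b32, b33, u0, u1, u2, u3, z00, o01, o30, z31, o50); lra.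
have s03 : Y 0%N 3%N = 1 by have := dz [:: 0; 1; 4; 7]%N isT isT; rewrite /ldet /= !(b00, b01, b02, b03, b10, b11, b12, b13, b20, b21, b22, b23, b30, b31, b32, b33, u0, u1, u2, u3, z00, o01, o30, z31, o50, z53); lra.
have s32 : Y 3%N 2%N = Y 3%N 3%N by have := dz [:: 1; 2; 3; 7]%N isT isT; rewrite /ldet /= !(b00, b01, b02, b03, b10, b11, b12, b13, b20, b21, b22, b23, b30, b31, b32, b33, u0, u1, u2, u3, z00, o01, o30, z31, o50, z53, s03); lra.
have s33 : Y 3%N 3%N = Y 5%N 2%N by have := dz [:: 2; 3; 5; 6]%N isT isT; rewrite /ldet /= !(b00, b01, b02, b03, b10, b11, b12, b13, b20, b21, b22, b23, b30, b31, b32, b33, u0, u1, u2, u3, z00, o01, o30, z31, o50, z53, s03, s32); lra.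
have s02 : Y 0%N 2%N = 1 + -1*Y 5%N 2%N by have := dz [:: 0; 2; 5; 7]%N isT isT; rewrite /ldet /= !(b00, b01, b02, b03, b10, b11, b12, b13, b20, b21, b22, b23, b30, b31, b32, b33, u0, u1, u2, u3, z00, o01, o30, z31, o50, z53, s03, s32, s33); lra.
have e1 : Y 5%N 1%N + -1*Y 5%N 2%N + -1*Y 5%N 1%N*Y 5%N 2%N = 0 by have := dz [:: 0; 1; 5; 6]%N isT isT; rewrite /ldet /= !(b00, b01, b02, b03, b10, b11, b12, b13, b20, b21, b22, b23, b30, b31, b32, b33, u0, u1, u2, u3, z00, o01, o30, z31, o50, z53, s03, s32, s33, s02); lra.
have e2 : -1*Y 5%N 1%N + -1*Y 5%N 2%N + Y 5%N 1%N*Y 5%N 2%N = 0 by have := dz [:: 3; 4; 5; 7]%N isT isT; rewrite /ldet /= !(b00, b01, b02, b03, b10, b11, b12, b13, b20, b21, b22, b23, b30, b31, b32, b33, u0, u1, u2, u3, z00, o01, o30, z31, o50, z53, s03, s32, s33, s02); lra.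
(* The sum of [e1] and [e2] is twice this entry up to sign; it vanishes, although it is the
   determinant of a basis. *)
have q0 : Y 5%N 2%N = 0 by lra.
by have := dn [:: 1; 2; 5; 6]%N isT isT; rewrite /ldet /= !(b00, b01, b02, b03, b10, b11, b12, b13, b20, b21, b22, b23, b30, b31, b32, b33, u0, u1, u2, u3, z00, o01, o30, z31, o50, z53, s03, s32, s33, s02) q0; apply; ring.
Qed.

Definition cols_V3 : seq (seq g4) := map (map nat_g4) [:: [:: 1; 0; 0; 0]; [:: 0; 1; 0; 0]; [:: 0; 0; 1; 0]; [:: 0; 0; 0; 1]; [:: 1; 2; 2; 0]; [:: 0; 1; 1; 1]; [:: 1; 3; 2; 1]; [:: 1; 3; 1; 0]; [:: 1; 1; 3; 0]]%N.

Lemma V3_nonrat : ~ representable rat (V3 a).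
Proof.
move=> R; have P := @rows_rep K a rat (code_rows a 4 cols_V3) cols_V3 erefl R.
have [Y [yb yu yn dz dn]] := @frame_coords K a ha char2 rat 4 9 cols_V3 [:: 0; 1; 2; 5] 6 isT isT P.
have b00 : Y 0%N 0%N = 1 := yb 0%N 0%N isT isT.
have b01 : Y 0%N 1%N = 0 := yb 0%N 1%N isT isT.
have b02 : Y 0%N 2%N = 0 := yb 0%N 2%N isT isT.
have b03 : Y 0%N 3%N = 0 := yb 0%N 3%N isT isT.
have b10 : Y 1%N 0%N = 0 := yb 1%N 0%N isT isT.
have b11 : Y 1%N 1%N = 1 := yb 1%N 1%N isT isT.
have b12 : Y 1%N 2%N = 0 := yb 1%N 2%N isT isT.
have b13 : Y 1%N 3%N = 0 := yb 1%N 3%N isT isT.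
have b20 : Y 2%N 0%N = 0 := yb 2%N 0%N isT isT.
have b21 : Y 2%N 1%N = 0 := yb 2%N 1%N isT isT.
have b22 : Y 2%N 2%N = 1 := yb 2%N 2%N isT isT.
have b23 : Y 2%N 3%N = 0 := yb 2%N 3%N isT isT.
have b30 : Y 5%N 0%N = 0 := yb 3%N 0%N isT isT.
have b31 : Y 5%N 1%N = 0 := yb 3%N 1%N isT isT.
have b32 : Y 5%N 2%N = 0 := yb 3%N 2%N isT isT.
have b33 : Y 5%N 3%N = 1 := yb 3%N 3%N isT isT.
have u0 : Y 6%N 0%N = 1 := yu 0%N isT.
have u1 : Y 6%N 1%N = 1 := yu 1%N isT.
have u2 : Y 6%N 2%N = 1 := yu 2%N isT.
have u3 : Y 6%N 3%N = 1 := yu 3%N isT.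
have z30 : Y 3%N 0%N = 0 by have := dz [:: 1; 2; 3; 5]%N isT isT; rewrite /ldet /= !(b00, b01, b02, b03, b10, b11, b12, b13, b20, b21, b22, b23, b30, b31, b32, b33, u0, u1, u2, u3); lra.
have n31 : Y 3%N 1%N != 0 by apply/eqP => h; have := dn [:: 0; 2; 3; 5]%N isT isT; rewrite /ldet /= !(b00, b01, b02, b03, b10, b11, b12, b13, b20, b21, b22, b23, b30, b31, b32, b33, u0, u1, u2, u3, z30) h; apply; ring.
have o31 : Y 3%N 1%N = 1 by apply: yn => // -[|[|[|j]]] //= _; rewrite ?(b00, z30).
have n40 : Y 4%N 0%N != 0 by apply/eqP => h; have := dn [:: 1; 2; 4; 5]%N isT isT; rewrite /ldet /= !(b00, b01, b02, b03, b10, b11, b12, b13, b20, b21, b22, b23, b30, b31, b32, b33, u0, u1, u2, u3, z30, o31) h; apply; ring.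
have o40 : Y 4%N 0%N = 1 by apply: yn => // -[|[|[|j]]] //= _; rewrite ?(b00).
have z43 : Y 4%N 3%N = 0 by have := dz [:: 0; 1; 2; 4]%N isT isT; rewrite /ldet /= !(b00, b01, b02, b03, b10, b11, b12, b13, b20, b21, b22, b23, b30, b31, b32, b33, u0, u1, u2, u3, z30, o31, o40); lra.
have n70 : Y 7%N 0%N != 0 by apply/eqP => h; have := dn [:: 1; 2; 5; 7]%N isT isT; rewrite /ldet /= !(b00, b01, b02, b03, b10, b11, b12, b13, b20, b21, b22, b23, b30, b31, b32, b33, u0, u1, u2, u3, z30, o31, o40, z43) h; apply; ring.
have o70 : Y 7%N 0%N = 1 by apply: yn => // -[|[|[|j]]] //= _; rewrite ?(b00).
have z73 : Y 7%N 3%N = 0 by have := dz [:: 0; 1; 2; 7]%N isT isT; rewrite /ldet /= !(b00, b01, b02, b03, b10, b11, b12, b13, b20, b21, b22, b23, b30, b31, b32, b33, u0, u1, u2, u3, z30, o31, o40, z43, o70); lra.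
have n80 : Y 8%N 0%N != 0 by apply/eqP => h; have := dn [:: 1; 2; 5; 8]%N isT isT; rewrite /ldet /= !(b00, b01, b02, b03, b10, b11, b12, b13, b20, b21, b22, b23, b30, b31, b32, b33, u0, u1, u2, u3, z30, o31, o40, z43, o70, z73) h; apply; ring.
have o80 : Y 8%N 0%N = 1 by apply: yn => // -[|[|[|j]]] //= _; rewrite ?(b00).
have z83 : Y 8%N 3%N = 0 by have := dz [:: 0; 1; 2; 8]%N isT isT; rewrite /ldet /= !(b00, b01, b02, b03, b10, b11, b12, b13, b20, b21, b22, b23, b30, b31, b32, b33, u0, u1, u2, u3, z30, o31, o40, z43, o70, z73, o80); lra.
have s82 : Y 8%N 2%N = 1 by have := dz [:: 1; 5; 6; 8]%N isT isT; rewrite /ldet /= !(b00, b01, b02, b03, b10, b11, b12, b13, b20, b21, b22, b23, b30, b31, b32, b33, u0, u1, u2, u3, z30, o31, o40, z43, o70, z73, o80, z83); lra.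
have s41 : Y 4%N 1%N = 1 by have := dz [:: 2; 4; 5; 6]%N isT isT; rewrite /ldet /= !(b00, b01, b02, b03, b10, b11, b12, b13, b20, b21, b22, b23, b30, b31, b32, b33, u0, u1, u2, u3, z30, o31, o40, z43, o70, z73, o80, z83, s82); lra.
have s32 : Y 3%N 2%N = Y 4%N 2%N by have := dz [:: 0; 3; 4; 5]%N isT isT; rewrite /ldet /= !(b00, b01, b02, b03, b10, b11, b12, b13, b20, b21, b22, b23, b30, b31, b32, b33, u0, u1, u2, u3, z30, o31, o40, z43, o70, z73, o80, z83, s82, s41); lra.
have s71 : Y 7%N 1%N = Y 7%N 2%N by have := dz [:: 0; 5; 6; 7]%N isT isT; rewrite /ldet /= !(b00, b01, b02, b03, b10, b11, b12, b13, b20, b21, b22, b23, b30, b31, b32, b33, u0, u1, u2, u3, z30, o31, o40, z43, o70, z73, o80, z83, s82, s41, s32); lra.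
have e1 : -1 + Y 3%N 3%N + -1*Y 3%N 3%N*Y 8%N 1%N + Y 4%N 2%N*Y 8%N 1%N = 0 by have := dz [:: 0; 3; 6; 8]%N isT isT; rewrite /ldet /= !(b00, b01, b02, b03, b10, b11, b12, b13, b20, b21, b22, b23, b30, b31, b32, b33, u0, u1, u2, u3, z30, o31, o40, z43, o70, z73, o80, z83, s82, s41, s32, s71); lra.
have e2 : -1*Y 3%N 3%N + Y 4%N 2%N + Y 3%N 3%N*Y 4%N 2%N = 0 by have := dz [:: 1; 3; 4; 6]%N isT isT; rewrite /ldet /= !(b00, b01, b02, b03, b10, b11, b12, b13, b20, b21, b22, b23, b30, b31, b32, b33, u0, u1, u2, u3, z30, o31, o40, z43, o70, z73, o80, z83, s82, s41, s32, s71); lra.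
have e3 : 1 + -1*Y 3%N 3%N + Y 3%N 3%N*Y 7%N 2%N = 0 by have := dz [:: 2; 3; 6; 7]%N isT isT; rewrite /ldet /= !(b00, b01, b02, b03, b10, b11, b12, b13, b20, b21, b22, b23, b30, b31, b32, b33, u0, u1, u2, u3, z30, o31, o40, z43, o70, z73, o80, z83, s82, s41, s32, s71); lra.
have e4 : -1 + Y 7%N 2%N + -1*Y 4%N 2%N*Y 7%N 2%N + Y 4%N 2%N*Y 8%N 1%N = 0 by have := dz [:: 3; 5; 7; 8]%N isT isT; rewrite /ldet /= !(b00, b01, b02, b03, b10, b11, b12, b13, b20, b21, b22, b23, b30, b31, b32, b33, u0, u1, u2, u3, z30, o31, o40, z43, o70, z73, o80, z83, s82, s41, s32, s71); lra.
move: e1 e2 e3 e4; set g := Y 3%N 3%N; set c := Y 4%N 2%N; set m := Y 8%N 1%N; set w := Y 7%N 2%N => e1 e2 e3 e4.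
(* Elimination leaves 2 c = 2, and for c = 1 equation [e2] becomes 1 = 0. *)
have E : 2 * c - 2 = g * (-1 + w + -1 * c * w + c * m) - (1 - c) * (1 + -1 * g + g * w) + (1 - m) * (-1 * g + c + g * c) + (-1 + g + -1 * g * m + c * m) by ring.
have c1 : c = 1 by move: E; rewrite e1 e2 e3 e4; lra.
by move: e2; rewrite c1; lra.
Qed.

Lemma P1_nonrat : ~ representable rat (P1 a).
Proof.
move=> R; have P := @rows_rep K a rat (code_rows a 3 (cols_of 2)) (cols_of 2) erefl R.
have [Y [yb yu yn dz dn]] := @frame_coords K a ha char2 rat 3 9 (cols_of 2) [:: 3; 4; 6] 7 isT isT P.
have b00 : Y 3%N 0%N = 1 := yb 0%N 0%N isT isT.
have b01 : Y 3%N 1%N = 0 := yb 0%N 1%N isT isT.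
have b02 : Y 3%N 2%N = 0 := yb 0%N 2%N isT isT.
have b10 : Y 4%N 0%N = 0 := yb 1%N 0%N isT isT.
have b11 : Y 4%N 1%N = 1 := yb 1%N 1%N isT isT.
have b12 : Y 4%N 2%N = 0 := yb 1%N 2%N isT isT.
have b20 : Y 6%N 0%N = 0 := yb 2%N 0%N isT isT.
have b21 : Y 6%N 1%N = 0 := yb 2%N 1%N isT isT.
have b22 : Y 6%N 2%N = 1 := yb 2%N 2%N isT isT.
have u0 : Y 7%N 0%N = 1 := yu 0%N isT.
have u1 : Y 7%N 1%N = 1 := yu 1%N isT.
have u2 : Y 7%N 2%N = 1 := yu 2%N isT.
have n00 : Y 0%N 0%N != 0 by apply/eqP => h; have := dn [:: 0; 4; 6]%N isT isT; rewrite /ldet /= !(b00, b01, b02, b10, b11, b12, b20, b21, b22, u0, u1, u2) h; apply; ring.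
have o00 : Y 0%N 0%N = 1 by apply: yn => // -[|[|[|j]]] //= _; rewrite ?(b00).
have z02 : Y 0%N 2%N = 0 by have := dz [:: 0; 3; 4]%N isT isT; rewrite /ldet /= !(b00, b01, b02, b10, b11, b12, b20, b21, b22, u0, u1, u2, o00); lra.
have n10 : Y 1%N 0%N != 0 by apply/eqP => h; have := dn [:: 1; 4; 6]%N isT isT; rewrite /ldet /= !(b00, b01, b02, b10, b11, b12, b20, b21, b22, u0, u1, u2, o00, z02) h; apply; ring.
have o10 : Y 1%N 0%N = 1 by apply: yn => // -[|[|[|j]]] //= _; rewrite ?(b00).
have z11 : Y 1%N 1%N = 0 by have := dz [:: 1; 3; 6]%N isT isT; rewrite /ldet /= !(b00, b01, b02, b10, b11, b12, b20, b21, b22, u0, u1, u2, o00, z02, o10); lra.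
have z20 : Y 2%N 0%N = 0 by have := dz [:: 2; 4; 6]%N isT isT; rewrite /ldet /= !(b00, b01, b02, b10, b11, b12, b20, b21, b22, u0, u1, u2, o00, z02, o10, z11); lra.
have n21 : Y 2%N 1%N != 0 by apply/eqP => h; have := dn [:: 2; 3; 6]%N isT isT; rewrite /ldet /= !(b00, b01, b02, b10, b11, b12, b20, b21, b22, u0, u1, u2, o00, z02, o10, z11, z20) h; apply; ring.
have o21 : Y 2%N 1%N = 1 by apply: yn => // -[|[|[|j]]] //= _; rewrite ?(b00, z20).
have n50 : Y 5%N 0%N != 0 by apply/eqP => h; have := dn [:: 4; 5; 6]%N isT isT; rewrite /ldet /= !(b00, b01, b02, b10, b11, b12, b20, b21, b22, u0, u1, u2, o00, z02, o10, z11, z20, o21) h; apply; ring.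
have o50 : Y 5%N 0%N = 1 by apply: yn => // -[|[|[|j]]] //= _; rewrite ?(b00).
have z52 : Y 5%N 2%N = 0 by have := dz [:: 3; 4; 5]%N isT isT; rewrite /ldet /= !(b00, b01, b02, b10, b11, b12, b20, b21, b22, u0, u1, u2, o00, z02, o10, z11, z20, o21, o50); lra.
have n80 : Y 8%N 0%N != 0 by apply/eqP => h; have := dn [:: 4; 6; 8]%N isT isT; rewrite /ldet /= !(b00, b01, b02, b10, b11, b12, b20, b21, b22, u0, u1, u2, o00, z02, o10, z11, z20, o21, o50, z52) h; apply; ring.
have o80 : Y 8%N 0%N = 1 by apply: yn => // -[|[|[|j]]] //= _; rewrite ?(b00).
have s01 : Y 0%N 1%N = 1 by have := dz [:: 0; 6; 7]%N isT isT; rewrite /ldet /= !(b00, b01, b02, b10, b11, b12, b20, b21, b22, u0, u1, u2, o00, z02, o10, z11, z20, o21, o50, z52, o80); lra.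
have s81 : Y 8%N 1%N = 1 by have := dz [:: 0; 6; 8]%N isT isT; rewrite /ldet /= !(b00, b01, b02, b10, b11, b12, b20, b21, b22, u0, u1, u2, o00, z02, o10, z11, z20, o21, o50, z52, o80, s01); lra.
have s12 : Y 1%N 2%N = 1 by have := dz [:: 1; 4; 7]%N isT isT; rewrite /ldet /= !(b00, b01, b02, b10, b11, b12, b20, b21, b22, u0, u1, u2, o00, z02, o10, z11, z20, o21, o50, z52, o80, s01, s81); lra.
have s22 : Y 2%N 2%N = Y 8%N 2%N by have := dz [:: 2; 3; 8]%N isT isT; rewrite /ldet /= !(b00, b01, b02, b10, b11, b12, b20, b21, b22, u0, u1, u2, o00, z02, o10, z11, z20, o21, o50, z52, o80, s01, s81, s12); lra.
have e1 : 1 + -1*Y 5%N 1%N + Y 5%N 1%N*Y 8%N 2%N = 0 by have := dz [:: 1; 5; 8]%N isT isT; rewrite /ldet /= !(b00, b01, b02, b10, b11, b12, b20, b21, b22, u0, u1, u2, o00, z02, o10, z11, z20, o21, o50, z52, o80, s01, s81, s12, s22); lra.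
have e2 : -1 + Y 8%N 2%N + -1*Y 5%N 1%N*Y 8%N 2%N = 0 by have := dz [:: 2; 5; 7]%N isT isT; rewrite /ldet /= !(b00, b01, b02, b10, b11, b12, b20, b21, b22, u0, u1, u2, o00, z02, o10, z11, z20, o21, o50, z52, o80, s01, s81, s12, s22); lra.
(* The sum of the two equations identifies the unknowns, and the negative of their common value is
   then a primitive cube root of unity. *)
have pr : Y 8%N 2%N = Y 5%N 1%N by lra.
apply: (@no_omega (- (Y 5%N 1%N))); move: e1; rewrite pr; lra.
Qed.

Definition cols_P2 : seq (seq g4) := map (map nat_g4) [:: [:: 1; 0; 0; 0]; [:: 0; 1; 0; 0]; [:: 0; 0; 1; 0]; [:: 0; 0; 0; 1]; [:: 1; 2; 1; 3]; [:: 0; 1; 1; 1]; [:: 1; 1; 0; 3]; [:: 1; 1; 1; 0]]%N.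

Lemma P2_nonrat : ~ representable rat (P2 a).
Proof.
move=> R; have P := @rows_rep K a rat (code_rows a 4 cols_P2) cols_P2 erefl R.
have [Y [yb yu yn dz dn]] := @frame_coords K a ha char2 rat 4 8 cols_P2 [:: 0; 1; 2; 3] 4 isT isT P.
have b00 : Y 0%N 0%N = 1 := yb 0%N 0%N isT isT.
have b01 : Y 0%N 1%N = 0 := yb 0%N 1%N isT isT.
have b02 : Y 0%N 2%N = 0 := yb 0%N 2%N isT isT.
have b03 : Y 0%N 3%N = 0 := yb 0%N 3%N isT isT.
have b10 : Y 1%N 0%N = 0 := yb 1%N 0%N isT isT.
have b11 : Y 1%N 1%N = 1 := yb 1%N 1%N isT isT.
have b12 : Y 1%N 2%N = 0 := yb 1%N 2%N isT isT.
have b13 : Y 1%N 3%N = 0 := yb 1%N 3%N isT isT.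
have b20 : Y 2%N 0%N = 0 := yb 2%N 0%N isT isT.
have b21 : Y 2%N 1%N = 0 := yb 2%N 1%N isT isT.
have b22 : Y 2%N 2%N = 1 := yb 2%N 2%N isT isT.
have b23 : Y 2%N 3%N = 0 := yb 2%N 3%N isT isT.
have b30 : Y 3%N 0%N = 0 := yb 3%N 0%N isT isT.
have b31 : Y 3%N 1%N = 0 := yb 3%N 1%N isT isT.
have b32 : Y 3%N 2%N = 0 := yb 3%N 2%N isT isT.
have b33 : Y 3%N 3%N = 1 := yb 3%N 3%N isT isT.
have u0 : Y 4%N 0%N = 1 := yu 0%N isT.
have u1 : Y 4%N 1%N = 1 := yu 1%N isT.
have u2 : Y 4%N 2%N = 1 := yu 2%N isT.
have u3 : Y 4%N 3%N = 1 := yu 3%N isT.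
have z50 : Y 5%N 0%N = 0 by have := dz [:: 1; 2; 3; 5]%N isT isT; rewrite /ldet /= !(b00, b01, b02, b03, b10, b11, b12, b13, b20, b21, b22, b23, b30, b31, b32, b33, u0, u1, u2, u3); lra.
have n51 : Y 5%N 1%N != 0 by apply/eqP => h; have := dn [:: 0; 2; 3; 5]%N isT isT; rewrite /ldet /= !(b00, b01, b02, b03, b10, b11, b12, b13, b20, b21, b22, b23, b30, b31, b32, b33, u0, u1, u2, u3, z50) h; apply; ring.
have o51 : Y 5%N 1%N = 1 by apply: yn => // -[|[|[|j]]] //= _; rewrite ?(b00, z50).
have n60 : Y 6%N 0%N != 0 by apply/eqP => h; have := dn [:: 1; 2; 3; 6]%N isT isT; rewrite /ldet /= !(b00, b01, b02, b03, b10, b11, b12, b13, b20, b21, b22, b23, b30, b31, b32, b33, u0, u1, u2, u3, z50, o51) h; apply; ring.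
have o60 : Y 6%N 0%N = 1 by apply: yn => // -[|[|[|j]]] //= _; rewrite ?(b00).
have z62 : Y 6%N 2%N = 0 by have := dz [:: 0; 1; 3; 6]%N isT isT; rewrite /ldet /= !(b00, b01, b02, b03, b10, b11, b12, b13, b20, b21, b22, b23, b30, b31, b32, b33, u0, u1, u2, u3, z50, o51, o60); lra.
have n70 : Y 7%N 0%N != 0 by apply/eqP => h; have := dn [:: 1; 2; 3; 7]%N isT isT; rewrite /ldet /= !(b00, b01, b02, b03, b10, b11, b12, b13, b20, b21, b22, b23, b30, b31, b32, b33, u0, u1, u2, u3, z50, o51, o60, z62) h; apply; ring.
have o70 : Y 7%N 0%N = 1 by apply: yn => // -[|[|[|j]]] //= _; rewrite ?(b00).
have z73 : Y 7%N 3%N = 0 by have := dz [:: 0; 1; 2; 7]%N isT isT; rewrite /ldet /= !(b00, b01, b02, b03, b10, b11, b12, b13, b20, b21, b22, b23, b30, b31, b32, b33, u0, u1, u2, u3, z50, o51, o60, z62, o70); lra.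
have s63 : Y 6%N 3%N = 1 by have := dz [:: 1; 2; 4; 6]%N isT isT; rewrite /ldet /= !(b00, b01, b02, b03, b10, b11, b12, b13, b20, b21, b22, b23, b30, b31, b32, b33, u0, u1, u2, u3, z50, o51, o60, z62, o70, z73); lra.
have s72 : Y 7%N 2%N = 1 by have := dz [:: 1; 3; 4; 7]%N isT isT; rewrite /ldet /= !(b00, b01, b02, b03, b10, b11, b12, b13, b20, b21, b22, b23, b30, b31, b32, b33, u0, u1, u2, u3, z50, o51, o60, z62, o70, z73, s63); lra.
have s61 : Y 6%N 1%N = Y 7%N 1%N by have := dz [:: 2; 3; 6; 7]%N isT isT; rewrite /ldet /= !(b00, b01, b02, b03, b10, b11, b12, b13, b20, b21, b22, b23, b30, b31, b32, b33, u0, u1, u2, u3, z50, o51, o60, z62, o70, z73, s63, s72); lra.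
have e1 : 1 + -1*Y 5%N 2%N*Y 7%N 1%N = 0 by have := dz [:: 0; 3; 5; 7]%N isT isT; rewrite /ldet /= !(b00, b01, b02, b03, b10, b11, b12, b13, b20, b21, b22, b23, b30, b31, b32, b33, u0, u1, u2, u3, z50, o51, o60, z62, o70, z73, s63, s72, s61); lra.
have e2 : -1 + Y 5%N 2%N + -1*Y 5%N 2%N*Y 7%N 1%N + Y 5%N 3%N*Y 7%N 1%N = 0 by have := dz [:: 0; 4; 5; 6]%N isT isT; rewrite /ldet /= !(b00, b01, b02, b03, b10, b11, b12, b13, b20, b21, b22, b23, b30, b31, b32, b33, u0, u1, u2, u3, z50, o51, o60, z62, o70, z73, s63, s72, s61); lra.
have e3 : -1 + Y 5%N 3%N + -1*Y 5%N 3%N*Y 7%N 1%N = 0 by have := dz [:: 2; 4; 5; 7]%N isT isT; rewrite /ldet /= !(b00, b01, b02, b03, b10, b11, b12, b13, b20, b21, b22, b23, b30, b31, b32, b33, u0, u1, u2, u3, z50, o51, o60, z62, o70, z73, s63, s72, s61); lra.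
move: e1 e2 e3; set A := Y 5%N 2%N; set B := Y 5%N 3%N; set m := Y 7%N 1%N => e1 e2 e3.
(* Elimination gives B = 3 m, which turns [e3] into 3 m^2 - 3 m + 1 = 0, of negative
   discriminant. *)
have E : B - 3 * m = m * (-1 + A + -1 * A * m + B * m) + (1 - m) * (1 + -1 * A * m) + (1 + m) * (-1 + B + -1 * B * m) by ring.
have Bm : B = 3 * m by move: E; rewrite e1 e2 e3; lra.
have : 3 * (m - 1 / 2) ^+ 2 + 1 / 4 = 0 by move: e3; rewrite Bm; lra.
by have := sqr_ge0 (m - 1 / 2); lra.
Qed.

Lemma P3_nonrat : ~ representable rat (P3 a).
Proof.
move=> R; have P := @rows_rep K a rat (code_rows a 3 (cols_of 3)) (cols_of 3) erefl R.
have [Y [yb yu yn dz dn]] := @frame_coords K a ha char2 rat 3 9 (cols_of 3) [:: 4; 5; 7] 8 isT isT P.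
have b00 : Y 4%N 0%N = 1 := yb 0%N 0%N isT isT.
have b01 : Y 4%N 1%N = 0 := yb 0%N 1%N isT isT.
have b02 : Y 4%N 2%N = 0 := yb 0%N 2%N isT isT.
have b10 : Y 5%N 0%N = 0 := yb 1%N 0%N isT isT.
have b11 : Y 5%N 1%N = 1 := yb 1%N 1%N isT isT.
have b12 : Y 5%N 2%N = 0 := yb 1%N 2%N isT isT.
have b20 : Y 7%N 0%N = 0 := yb 2%N 0%N isT isT.
have b21 : Y 7%N 1%N = 0 := yb 2%N 1%N isT isT.
have b22 : Y 7%N 2%N = 1 := yb 2%N 2%N isT isT.
have u0 : Y 8%N 0%N = 1 := yu 0%N isT.
have u1 : Y 8%N 1%N = 1 := yu 1%N isT.
have u2 : Y 8%N 2%N = 1 := yu 2%N isT.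
have n00 : Y 0%N 0%N != 0 by apply/eqP => h; have := dn [:: 0; 5; 7]%N isT isT; rewrite /ldet /= !(b00, b01, b02, b10, b11, b12, b20, b21, b22, u0, u1, u2) h; apply; ring.
have o00 : Y 0%N 0%N = 1 by apply: yn => // -[|[|[|j]]] //= _; rewrite ?(b00).
have z02 : Y 0%N 2%N = 0 by have := dz [:: 0; 4; 5]%N isT isT; rewrite /ldet /= !(b00, b01, b02, b10, b11, b12, b20, b21, b22, u0, u1, u2, o00); lra.
have n10 : Y 1%N 0%N != 0 by apply/eqP => h; have := dn [:: 1; 5; 7]%N isT isT; rewrite /ldet /= !(b00, b01, b02, b10, b11, b12, b20, b21, b22, u0, u1, u2, o00, z02) h; apply; ring.
have o10 : Y 1%N 0%N = 1 by apply: yn => // -[|[|[|j]]] //= _; rewrite ?(b00).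
have z11 : Y 1%N 1%N = 0 by have := dz [:: 1; 4; 7]%N isT isT; rewrite /ldet /= !(b00, b01, b02, b10, b11, b12, b20, b21, b22, u0, u1, u2, o00, z02, o10); lra.
have z20 : Y 2%N 0%N = 0 by have := dz [:: 2; 5; 7]%N isT isT; rewrite /ldet /= !(b00, b01, b02, b10, b11, b12, b20, b21, b22, u0, u1, u2, o00, z02, o10, z11); lra.
have n21 : Y 2%N 1%N != 0 by apply/eqP => h; have := dn [:: 2; 4; 7]%N isT isT; rewrite /ldet /= !(b00, b01, b02, b10, b11, b12, b20, b21, b22, u0, u1, u2, o00, z02, o10, z11, z20) h; apply; ring.
have o21 : Y 2%N 1%N = 1 by apply: yn => // -[|[|[|j]]] //= _; rewrite ?(b00, z20).
have n30 : Y 3%N 0%N != 0 by apply/eqP => h; have := dn [:: 3; 5; 7]%N isT isT; rewrite /ldet /= !(b00, b01, b02, b10, b11, b12, b20, b21, b22, u0, u1, u2, o00, z02, o10, z11, z20, o21) h; apply; ring.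
have o30 : Y 3%N 0%N = 1 by apply: yn => // -[|[|[|j]]] //= _; rewrite ?(b00).
have n60 : Y 6%N 0%N != 0 by apply/eqP => h; have := dn [:: 5; 6; 7]%N isT isT; rewrite /ldet /= !(b00, b01, b02, b10, b11, b12, b20, b21, b22, u0, u1, u2, o00, z02, o10, z11, z20, o21, o30) h; apply; ring.
have o60 : Y 6%N 0%N = 1 by apply: yn => // -[|[|[|j]]] //= _; rewrite ?(b00).
have z62 : Y 6%N 2%N = 0 by have := dz [:: 4; 5; 6]%N isT isT; rewrite /ldet /= !(b00, b01, b02, b10, b11, b12, b20, b21, b22, u0, u1, u2, o00, z02, o10, z11, z20, o21, o30, o60); lra.
have s01 : Y 0%N 1%N = 1 by have := dz [:: 0; 7; 8]%N isT isT; rewrite /ldet /= !(b00, b01, b02, b10, b11, b12, b20, b21, b22, u0, u1, u2, o00, z02, o10, z11, z20, o21, o30, o60, z62); lra.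
have s12 : Y 1%N 2%N = 1 by have := dz [:: 1; 5; 8]%N isT isT; rewrite /ldet /= !(b00, b01, b02, b10, b11, b12, b20, b21, b22, u0, u1, u2, o00, z02, o10, z11, z20, o21, o30, o60, z62, s01); lra.
have s31 : Y 3%N 1%N = Y 3%N 2%N by have := dz [:: 3; 4; 8]%N isT isT; rewrite /ldet /= !(b00, b01, b02, b10, b11, b12, b20, b21, b22, u0, u1, u2, o00, z02, o10, z11, z20, o21, o30, o60, z62, s01, s12); lra.
have s32 : Y 3%N 2%N = Y 6%N 1%N by have := dz [:: 3; 6; 7]%N isT isT; rewrite /ldet /= !(b00, b01, b02, b10, b11, b12, b20, b21, b22, u0, u1, u2, o00, z02, o10, z11, z20, o21, o30, o60, z62, s01, s12, s31); lra.
have e1 : -1 + Y 6%N 1%N + -1*Y 2%N 2%N*Y 6%N 1%N = 0 by have := dz [:: 1; 2; 3]%N isT isT; rewrite /ldet /= !(b00, b01, b02, b10, b11, b12, b20, b21, b22, u0, u1, u2, o00, z02, o10, z11, z20, o21, o30, o60, z62, s01, s12, s31, s32); lra.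
have e2 : -1 + Y 2%N 2%N + -1*Y 2%N 2%N*Y 6%N 1%N = 0 by have := dz [:: 2; 6; 8]%N isT isT; rewrite /ldet /= !(b00, b01, b02, b10, b11, b12, b20, b21, b22, u0, u1, u2, o00, z02, o10, z11, z20, o21, o30, o60, z62, s01, s12, s31, s32); lra.
(* The two equations differ by the difference of the unknowns; what remains again asks for a
   primitive cube root of unity. *)
have pr : Y 2%N 2%N = Y 6%N 1%N by lra.
apply: (@no_omega (- (Y 6%N 1%N))); move: e1; rewrite pr; lra.
Qed.

Lemma Y9_nonrat : ~ representable rat (Y9 a).
Proof.
move=> R; have P := @rows_rep K a rat (code_rows a 3 (cols_of 4)) (cols_of 4) erefl R.
have [Y [yb yu yn dz dn]] := @frame_coords K a ha char2 rat 3 9 (cols_of 4) [:: 0; 1; 2] 8 isT isT P.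
have b00 : Y 0%N 0%N = 1 := yb 0%N 0%N isT isT.
have b01 : Y 0%N 1%N = 0 := yb 0%N 1%N isT isT.
have b02 : Y 0%N 2%N = 0 := yb 0%N 2%N isT isT.
have b10 : Y 1%N 0%N = 0 := yb 1%N 0%N isT isT.
have b11 : Y 1%N 1%N = 1 := yb 1%N 1%N isT isT.
have b12 : Y 1%N 2%N = 0 := yb 1%N 2%N isT isT.
have b20 : Y 2%N 0%N = 0 := yb 2%N 0%N isT isT.
have b21 : Y 2%N 1%N = 0 := yb 2%N 1%N isT isT.
have b22 : Y 2%N 2%N = 1 := yb 2%N 2%N isT isT.
have u0 : Y 8%N 0%N = 1 := yu 0%N isT.
have u1 : Y 8%N 1%N = 1 := yu 1%N isT.
have u2 : Y 8%N 2%N = 1 := yu 2%N isT.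
have n30 : Y 3%N 0%N != 0 by apply/eqP => h; have := dn [:: 1; 2; 3]%N isT isT; rewrite /ldet /= !(b00, b01, b02, b10, b11, b12, b20, b21, b22, u0, u1, u2) h; apply; ring.
have o30 : Y 3%N 0%N = 1 by apply: yn => // -[|[|[|j]]] //= _; rewrite ?(b00).
have z32 : Y 3%N 2%N = 0 by have := dz [:: 0; 1; 3]%N isT isT; rewrite /ldet /= !(b00, b01, b02, b10, b11, b12, b20, b21, b22, u0, u1, u2, o30); lra.
have n40 : Y 4%N 0%N != 0 by apply/eqP => h; have := dn [:: 1; 2; 4]%N isT isT; rewrite /ldet /= !(b00, b01, b02, b10, b11, b12, b20, b21, b22, u0, u1, u2, o30, z32) h; apply; ring.
have o40 : Y 4%N 0%N = 1 by apply: yn => // -[|[|[|j]]] //= _; rewrite ?(b00).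
have z41 : Y 4%N 1%N = 0 by have := dz [:: 0; 2; 4]%N isT isT; rewrite /ldet /= !(b00, b01, b02, b10, b11, b12, b20, b21, b22, u0, u1, u2, o30, z32, o40); lra.
have z50 : Y 5%N 0%N = 0 by have := dz [:: 1; 2; 5]%N isT isT; rewrite /ldet /= !(b00, b01, b02, b10, b11, b12, b20, b21, b22, u0, u1, u2, o30, z32, o40, z41); lra.
have n51 : Y 5%N 1%N != 0 by apply/eqP => h; have := dn [:: 0; 2; 5]%N isT isT; rewrite /ldet /= !(b00, b01, b02, b10, b11, b12, b20, b21, b22, u0, u1, u2, o30, z32, o40, z41, z50) h; apply; ring.
have o51 : Y 5%N 1%N = 1 by apply: yn => // -[|[|[|j]]] //= _; rewrite ?(b00, z50).
have n60 : Y 6%N 0%N != 0 by apply/eqP => h; have := dn [:: 1; 2; 6]%N isT isT; rewrite /ldet /= !(b00, b01, b02, b10, b11, b12, b20, b21, b22, u0, u1, u2, o30, z32, o40, z41, z50, o51) h; apply; ring.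
have o60 : Y 6%N 0%N = 1 by apply: yn => // -[|[|[|j]]] //= _; rewrite ?(b00).
have n70 : Y 7%N 0%N != 0 by apply/eqP => h; have := dn [:: 1; 2; 7]%N isT isT; rewrite /ldet /= !(b00, b01, b02, b10, b11, b12, b20, b21, b22, u0, u1, u2, o30, z32, o40, z41, z50, o51, o60) h; apply; ring.
have o70 : Y 7%N 0%N = 1 by apply: yn => // -[|[|[|j]]] //= _; rewrite ?(b00).
have z72 : Y 7%N 2%N = 0 by have := dz [:: 0; 1; 7]%N isT isT; rewrite /ldet /= !(b00, b01, b02, b10, b11, b12, b20, b21, b22, u0, u1, u2, o30, z32, o40, z41, z50, o51, o60, o70); lra.
have s42 : Y 4%N 2%N = 1 by have := dz [:: 1; 4; 8]%N isT isT; rewrite /ldet /= !(b00, b01, b02, b10, b11, b12, b20, b21, b22, u0, u1, u2, o30, z32, o40, z41, z50, o51, o60, o70, z72); lra.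
have s61 : Y 6%N 1%N = Y 6%N 2%N by have := dz [:: 0; 6; 8]%N isT isT; rewrite /ldet /= !(b00, b01, b02, b10, b11, b12, b20, b21, b22, u0, u1, u2, o30, z32, o40, z41, z50, o51, o60, o70, z72, s42); lra.
have s31 : Y 3%N 1%N = Y 6%N 2%N by have := dz [:: 2; 3; 6]%N isT isT; rewrite /ldet /= !(b00, b01, b02, b10, b11, b12, b20, b21, b22, u0, u1, u2, o30, z32, o40, z41, z50, o51, o60, o70, z72, s42, s61); lra.
have e1 : -1 + -1*Y 5%N 2%N*Y 6%N 2%N = 0 by have := dz [:: 3; 4; 5]%N isT isT; rewrite /ldet /= !(b00, b01, b02, b10, b11, b12, b20, b21, b22, u0, u1, u2, o30, z32, o40, z41, z50, o51, o60, o70, z72, s42, s61, s31); lra.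
have e2 : -1*Y 6%N 2%N + Y 7%N 1%N + -1*Y 6%N 2%N*Y 7%N 1%N = 0 by have := dz [:: 4; 6; 7]%N isT isT; rewrite /ldet /= !(b00, b01, b02, b10, b11, b12, b20, b21, b22, u0, u1, u2, o30, z32, o40, z41, z50, o51, o60, o70, z72, s42, s61, s31); lra.
have e3 : -1 + Y 5%N 2%N + -1*Y 5%N 2%N*Y 7%N 1%N = 0 by have := dz [:: 5; 7; 8]%N isT isT; rewrite /ldet /= !(b00, b01, b02, b10, b11, b12, b20, b21, b22, u0, u1, u2, o30, z32, o40, z41, z50, o51, o60, o70, z72, s42, s61, s31); lra.
move: e1 e2 e3; set A := Y 5%N 2%N; set x := Y 6%N 2%N; set w := Y 7%N 1%N => e1 e2 e3.
have E : w - 1 - x = x * (-1 + A + -1 * A * w) + (1 - w) * (-1 + -1 * A * x) by ring.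
have wx : w = 1 + x by move: E; rewrite e1 e3; lra.
(* The last equation is x^2 + x = 1, the golden ratio of the Perles configuration, and it makes 2 x
   + 1 a square root of 5. *)
apply: (@no_sqrt5 (2 * x + 1)); move: e2; rewrite wx; lra.
Qed.

End NonRational.

(** * Connectivity *)

Section CompleteGraph.
Variable n : nat.
Notation ajX X := (adj (val : {e : 'I_n * 'I_n | (e.1 < e.2)%N} -> 'I_n * 'I_n) X).

Lemma adj_symm (X : {set MK n}) : symmetric (ajX X).
Proof. by move=> u v; apply/existsP/existsP => -[e h]; exists e; rewrite orbC. Qed.

Lemma adj_csym (X : {set MK n}) : connect_sym (ajX X).
Proof. exact/sym_connect_sym/adj_symm. Qed.

(** Each component has exactly one root, so the rank counts the vertices that are not roots. *)
Lemma MK_rankE (X : {set MK n}) : rank X = #|[set x : 'I_n | fingraph.root (ajX X) x != x]|.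
Proof.
have cE : components (val : {e : 'I_n * 'I_n | (e.1 < e.2)%N} -> _) X = #|[set x : 'I_n | roots (ajX X) x]|.
  by rewrite /components /n_comp_mem cardsE; apply: eq_card => x; rewrite !inE andbT.
rewrite -[LHS]/(#|'I_n| - components (val : {e : 'I_n * 'I_n | (e.1 < e.2)%N} -> _) X)%N cE.
rewrite -(cardsC [set x | roots (ajX X) x]) addKn; apply: eq_card => x; by rewrite !inE.
Qed.

Lemma edge_root (X : {set MK n}) (e : MK n) : e \in X ->
  fingraph.root (ajX X) (val e).1 = fingraph.root (ajX X) (val e).2.
Proof.
move=> eX; apply/eqP; rewrite root_connect; last exact: adj_csym.
by apply/connect1/existsP; exists e; rewrite eX -surjective_pairing eqxx.
Qed.

(** Of two distinct vertices in one component at least one is not a root. So an edge yields a vertex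
    that is not a root, and two distinct edges yield two, also when they share an end. *)
Lemma MK_simple : simple (MK n).
Proof.
move=> X X2; apply/eqP; rewrite eqn_leq rank_le_card andTb MK_rankE; set nr := [set x | _].
have inr x : (x \notin nr) = (fingraph.root (ajX X) x == x) by rewrite inE negbK.
have two x y : x != y -> fingraph.root (ajX X) x = fingraph.root (ajX X) y -> (x \in nr) || (y \in nr).
  move=> xy rE; apply/negPn; rewrite negb_or !inr; apply/negP => /andP[/eqP xr /eqP yr].
  by rewrite -xr -yr rE eqxx in xy.
have ends (e : MK n) : (val e).1 != (val e).2 by rewrite -val_eqE ltn_eqF // (valP e).
have one e : e \in X -> ((val e).1 \in nr) || ((val e).2 \in nr).
  by move=> eX; apply: two => //; apply: edge_root.
have [X0|] := posnP #|X|; first by rewrite X0.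
rewrite card_gt0 => /set0Pn[e eX].
have nr1 : (0 < #|nr|)%N by rewrite card_gt0; apply/set0Pn; case/orP: (one e eX) => h; eexists; exact: h.
case: (leqP #|X| 1) => X1; first exact: leq_trans X1 nr1.
have [e' e'X ee'] : exists2 e', e' \in X & e' != e.
  have := cardsD1 e X; rewrite eX => cX; have : (0 < #|X :\ e|)%N by lia.
  by rewrite card_gt0 => /set0Pn[e']; rewrite !inE => /andP[]; exists e'.
apply: leq_trans X2 _.
have pair x y : x != y -> x \in nr -> y \in nr -> (2 <= #|nr|)%N.
  move=> xy xn yn; apply: (@leq_trans #|[set x; y]|); first by rewrite cards2 xy.
  by apply/subset_leq_card/subsetP => z; rewrite !inE => /orP[]/eqP->; [move: xn | move: yn]; rewrite inE.
have share x w w' : x \in nr -> w != w' -> w != x -> w' != x ->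
    fingraph.root (ajX X) w = fingraph.root (ajX X) w' -> (2 <= #|nr|)%N.
  move=> xn ww wx w'x rE; case/orP: (two w w' ww rE) => h; apply: pair h xn => //.
have r1 := edge_root eX; have r2 := edge_root e'X.
have nee : val e' != val e by rewrite val_eqE.
have lt1 := valP e; have lt2 := valP e'.
move: (ends e) (ends e') (one e eX) (one e' e'X) r1 r2 nee lt1 lt2.
case: (val e) => u v; case: (val e') => u' v' /= uv u'v' h h' r1 r2 nee lt1 lt2.
have nee' : (u' != u) || (v' != v) by rewrite -negb_and -xpair_eqE.
case/orP: h => hx; case/orP: h' => hy.
- have [E|ne] := eqVneq u u'; last exact: pair ne hx hy.
  subst u'; apply: (share u v v') => //; rewrite 1?eq_sym //.
    by move: nee'; rewrite eqxx.
  by rewrite -r1 -r2.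
- have [E|ne] := eqVneq u v'; last exact: pair ne hx hy.
  subst v'; apply: (share u v u') => //; rewrite 1?eq_sym //.
    by apply: contraTneq lt1 => <-; rewrite -leqNgt ltnW.
  by rewrite -r1 r2.
- have [E|ne] := eqVneq v u'; last exact: pair ne hx hy.
  subst u'; apply: (share v u v') => //; rewrite 1?eq_sym //.
    by apply: contraTneq lt2 => ->; rewrite -leqNgt ltnW.
  by rewrite r1 r2.
have [E|ne] := eqVneq v v'; last exact: pair ne hx hy.
subst v'; apply: (share v u u') => //; first by move: nee'; rewrite eqxx orbF eq_sym.
by rewrite r1 r2.
Qed.

End CompleteGraph.

Lemma MK_rankT n : (n.-1 <= @rank (MK n) setT)%N.
Proof.
rewrite MK_rankE; case: n => // m; set r := fingraph.root _.
have rE (x : 'I_m.+1) : r x = r ord0.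
  have [->//|x0] := eqVneq x ord0.
  have lt : (((ord0 : 'I_m.+1), x).1 < ((ord0 : 'I_m.+1), x).2)%N by rewrite /= lt0n.
  exact: esym (@edge_root m.+1 setT (exist _ (ord0, x) lt) (in_setT _)).
rewrite (cardsD1 (r ord0)); apply: leq_trans (leq_addl _ _).
apply: (@leq_trans #|~: [set r ord0]|); first by rewrite cardsC1 card_ord.
apply/subset_leq_card/subsetP => x; rewrite !inE => xr; by rewrite xr rE eq_sym xr.
Qed.

(** All edges outside the smaller clique are deleted; the additional vertices are then isolated,
    hence roots, and contribute nothing to the rank. *)
Lemma MK_mono n n' : (n <= n')%N -> has_minor (MK n') (MK n).
Proof.
move=> le; pose w : 'I_n -> 'I_n' := widen_ord le.
have wI : injective w by move=> i j /(congr1 val)/= ij; apply: val_inj.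
pose f (e : MK n) : MK n' := Sub (w (val e).1, w (val e).2) (valP e).
have fE e : val (f e) = (w (val e).1, w (val e).2) by [].
apply/has_minorP; exists set0, f; split.
- move=> e e' /(congr1 val); rewrite !fE => -[h1 h2]; apply/val_inj.
  by rewrite [val e]surjective_pairing [val e']surjective_pairing; congr (_, _); apply: wI; apply: val_inj.
- by move=> x; rewrite inE.
move=> X; rewrite rank0 addn0 setU0 !MK_rankE -(card_imset _ wI).
set aj := adj _ X; set aj' := adj _ (f @: X).
have sy : connect_sym aj := @adj_csym n X; have sy' : connect_sym aj' := @adj_csym n' (f @: X).
have step u v : aj' u v -> exists u0 v0, [/\ u = w u0, v = w v0 & aj u0 v0].
  case/existsP => _ /andP[/imsetP[e eX ->]]; rewrite fE => /orP[]/eqP[<- <-].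
    exists (val e).1, (val e).2; split=> //; apply/existsP; exists e; by rewrite eX -surjective_pairing eqxx.
  exists (val e).2, (val e).1; split=> //; apply/existsP; exists e; by rewrite eX -surjective_pairing eqxx orbT.
have stepw u v : aj u v -> aj' (w u) (w v).
  case/existsP => e /andP[eX h]; apply/existsP; exists (f e); rewrite (imset_f f eX) fE.
  by case/orP: h => /eqP ->; rewrite eqxx ?orbT.
have cw u v : connect aj u v -> connect aj' (w u) (w v).
  case/connectP => p + ->; elim: p u => [|x p IH] u /=; first by rewrite connect0.
  by case/andP => /stepw/connect1 ux /IH; apply: connect_trans.
have cw' u y : connect aj' (w u) y -> exists2 v, y = w v & connect aj u v.
  case/connectP => p; elim: p u => [|x p IH] u /=; first by move=> _ ->; exists u.
  case/andP => /step[u0 [x0 [/wI<- -> ux]]] /IH H /H[v -> xv]; exists v => //.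
  exact: connect_trans (connect1 ux) xv.
have rw u : fingraph.root aj' (w u) = w u -> fingraph.root aj u = u \/ exists2 v, v != u & connect aj u v.
  by move=> _; have [->|ne] := eqVneq (fingraph.root aj u) u; [left | right; exists (fingraph.root aj u) => //; apply: connect_root].
have cardr (T : finType) (e : rel T) (a : pred T) : connect_sym e -> (forall x y, a x -> connect e x y -> a y) ->
    #|[set x | a x && (fingraph.root e x != x)]| = (#|[set x | a x]| - #|[set fingraph.root e x | x in [set x | a x]]|)%N.
  move=> se ae.
  have -> : [set fingraph.root e x | x in [set x | a x]] = [set x | a x && (fingraph.root e x == x)].
    apply/setP => y; rewrite inE; apply/imsetP/andP => [[x + ->]|[ay /eqP yr]].
      rewrite inE => ax; split; first exact: ae ax (connect_root _ _).
      by rewrite root_root.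
    by exists y; rewrite ?inE ?yr.
  have -> : [set x | a x] = [set x | a x && (fingraph.root e x == x)] :|: [set x | a x && (fingraph.root e x != x)].
    by apply/setP => x; rewrite !inE; case: (a x); case: eqP.
  rewrite cardsU (_ : _ :&: _ = set0) ?cards0 ?subn0 ?addKn //.
  by apply/setP => x; rewrite !inE; case: (a x); case: eqP.
have a1 := cardr _ aj xpredT sy (fun _ _ _ _ => isT).
have a2 : #|[set x | (x \in codom w) && (fingraph.root aj' x != x)]| = _ := cardr _ aj' (mem (codom w)) sy' _.
have ccl x y : x \in codom w -> connect aj' x y -> y \in codom w.
  by case/codomP => u -> /cw'[v -> _]; apply: codom_f.
have {}a2 := a2 ccl.
rewrite card_imset //.
have -> : #|[set x : 'I_n' | fingraph.root aj' x != x]| = #|[set x | (x \in codom w) && (fingraph.root aj' x != x)]|.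
  apply: eq_card => x; rewrite !inE; case: (boolP (x \in codom w)) => //= nx.
  apply/negbTE; rewrite negbK; apply/eqP.
  have /connectP[[|y p] /= + ->] // := connect_root aj' x.
  by case/andP => /step[u0 [v0 [xE _ _]]]; rewrite xE codom_f in nx.
rewrite a2 (eq_card (_ : [set x | fingraph.root aj x != x] =i [set x | xpredT x && (fingraph.root aj x != x)])) ?a1; last first.
  by move=> x; rewrite !inE.
have -> : [set x | x \in codom w] = w @: setT.
  by apply/setP => x; rewrite inE; apply/codomP/imsetP => [[u ->]|[u _ ->]]; exists u.
have -> : [set x : 'I_n | true] = setT by apply/setP => x; rewrite !inE.
rewrite [in RHS](card_imset _ wI); congr (_ - _)%N.
(* The chosen roots need not correspond under [w]; components are matched by passing to the root in
   the larger graph, which is injective on roots. *)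
pose g (y : 'I_n) := fingraph.root aj' (w y).
rewrite -imset_comp.
have gI : {in [set fingraph.root aj x | x in setT] &, injective g}.
  move=> _ _ /imsetP[x _ ->] /imsetP[y _ ->] /eqP; rewrite root_connect // => /cw'[v /wI <-].
  by rewrite -root_connect // => /eqP; rewrite !root_root.
rewrite -(card_in_imset gI) -imset_comp; congr #|pred_of_set _|; apply: eq_imset => x /=.
rewrite /g; apply/eqP; rewrite root_connect //; apply: cw; rewrite sy; exact: connect_root.
Qed.

(** * Reduction to simple matroids *)

Section Simplification.
Variable M : matroid.

Lemma rank_par (A : {set M}) x y : x \in A -> rank [set x] = 1%N -> rank [set x; y] = 1%N ->
  rank (y |: A) = rank A.
Proof.
move=> xA x1 xy; have := rank_submod A [set x; y].
have := @rankS M [set x] (A :&: [set x; y]); rewrite x1.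
have -> : [set x] \subset A :&: [set x; y] by rewrite sub1set !inE xA eqxx.
have -> : A :|: [set x; y] = y |: A.
  by apply/setP => z; rewrite !inE; case: (eqVneq z x) => [->|_]; rewrite ?xA ?orbT //= orbC.
by have := rankS (subsetUr [set y] A); move=> h1 /(_ isT) h2; rewrite xy; lia.
Qed.

Lemma rank_loop (A : {set M}) x : rank [set x] = 0%N -> rank (x |: A) = rank A.
Proof. by move=> x0; have := rankU_le [set x] A; have := rankS (subsetUr [set x] A); lia. Qed.

(** A maximal set [S] without loops and parallel pairs contains an element parallel to each
    non-loop. [rho] selects it and is [None] on loops, so replacing elements by their
    representatives preserves ranks. *)
Lemma simplification : exists (S : {set M}) (rho : M -> option M),
  [/\ forall Z : {set M}, Z \subset S -> (#|Z| <= 2)%N -> rank Z = #|Z|,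
      forall x, x \in S -> rho x = Some x,
      forall x y, rho x = Some y -> y \in S
    & forall X : {set M}, rank [set y | [exists x in X, rho x == Some y]] = rank X].
Proof.
pose P (S : {set M}) := [forall Z : {set M}, (Z \subset S) && (#|Z| <= 2)%N ==> (rank Z == #|Z|)].
have P0 : P set0.
  by apply/forallP => Z; apply/implyP => /andP[]; rewrite subset0 => /eqP-> _; rewrite rank0 cards0.
case: (@maxset_exists _ P set0 P0) => S /maxsetP[PS mS] _.
have sS (Z : {set M}) : Z \subset S -> (#|Z| <= 2)%N -> rank Z = #|Z|.
  by move=> ZS Z2; have /forallP/(_ Z)/implyP H := PS; apply/eqP/H; rewrite ZS.
have S1 y : y \in S -> rank [set y] = 1%N by move=> yS; rewrite sS ?cards1 // sub1set.
have ex x : exists o : option M, match o with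
    | Some y => [/\ y \in S, rank [set x; y] = 1%N, rank [set x] = 1%N & x \in S -> y = x]
    | None => x \notin S /\ rank [set x] = 0%N end.
  have [xS|xS] := boolP (x \in S); first by exists (Some x); rewrite setUid S1.
  have x1 := rank_le_card [set x]; rewrite cards1 in x1.
  have [x0|x0] := posnP (rank [set x]); first by exists None.
  have {x1}x0 : rank [set x] = 1%N by lia.
  have : ~~ P (x |: S).
    apply/negP => Px; have := mS _ Px (subsetUr _ _) => SE; by rewrite -SE setU11 in xS.
  rewrite negb_forall => /existsP[Z]; rewrite negb_imply => /andP[/andP[ZS Z2] rZ].
  have xZ : x \in Z.
    apply: contraNT rZ => xZ; apply/eqP/sS => //; apply/subsetP => z zZ.
    by have := subsetP ZS z zZ; rewrite !inE; case: eqP => // zx; rewrite -zx zZ in xZ.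
  have cZ := cardsD1 x Z; rewrite xZ in cZ.
  have [/eqP|[y yZ]] := set_0Vmem (Z :\ x).
    rewrite setD_eq0 subset1 => /orP[/eqP ZE|/eqP ZE]; last by rewrite ZE inE in xZ.
    by rewrite ZE x0 cards1 in rZ.
  have /andP[yx yZ'] : (y != x) && (y \in Z) by move: yZ; rewrite !inE.
  have yS : y \in S by have := subsetP ZS y yZ'; rewrite !inE (negPf yx).
  have ZE : Z = [set x; y].
    apply/esym/eqP; rewrite eqEcard; apply/andP; split.
      by apply/subsetP => z; rewrite !inE => /orP[]/eqP->.
    by rewrite cards2 eq_sym yx.
  exists (Some y); split=> //.
  have := rankS (_ : [set x] \subset Z); rewrite x0 ZE sub1set !inE eqxx => /(_ isT).
  move: rZ; have := rank_le_card Z; rewrite ZE cards2 eq_sym yx => h /eqP; lia.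
have [rho rP] := fin_all_exists ex.
exists S, rho; split=> //.
- by move=> x xS; have := rP x; case: (rho x) => [y [_ _ _ /(_ xS)->]//|[]]; rewrite xS.
- by move=> x y h; have := rP x; rewrite h => -[].
move=> X; set I := [set y | _].
have c1 : rank (X :|: I) = rank X.
  apply: rank_closure => y; rewrite inE => /existsP[x /andP[xX /eqP rx]].
  by have := rP x; rewrite rx => -[_ xy x1 _]; apply: rank_par xX x1 xy.
have c2 : rank (I :|: X) = rank I.
  apply: rank_closure => x xX; have := rP x; case rx: (rho x) => [y|].
    case=> yS xy x1 _; apply: (@rank_par _ y) => //; rewrite ?S1 //; last by rewrite setUC.
    by rewrite inE; apply/existsP; exists x; rewrite xX rx eqxx.
  by case=> _ /rank_loop.
by rewrite -c2 setUC c1.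
Qed.
End Simplification.

Lemma imsetC_bij (S T : finType) (f : S -> T) (X : {set S}) : bijective f -> ~: (f @: X) = f @: (~: X).
Proof.
by move=> [h hK fK]; apply/setP => y; rewrite -[y]fK inE !(mem_imset _ _ (can_inj hK)) inE.
Qed.

Lemma k_connected_miso k (M N : matroid) : miso M N -> k_connected k N -> k_connected k M.
Proof.
case=> f [bf fr] kN j X jk [s1 s2 s3]; apply: (kN j (f @: X) jk).
have fT : f @: setT = setT.
  by have [h hK fK] := bf; apply/setP => y; rewrite inE; apply/imsetP; exists (h y); rewrite ?inE ?fK.
by split; rewrite /conn ?imsetC_bij // ?card_imset -?fT ?fr //; apply: bij_inj.
Qed.

Lemma representable_rmatroid (K : fieldType) (M : matroid) : representable K M ->
  exists R : rmatroid K, miso (underlying R) M.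
Proof.
case=> r [A rA]; exists (rmx A); exists id; split; first by exists id.
by move=> X; rewrite imset_id [RHS]rmx_rank rA.
Qed.

Lemma underlying_rdual_miso (K : fieldType) (R : rmatroid K) : miso (underlying (rdual R)) (dual (underlying R)).
Proof.
exists id; split; first by exists id.
by move=> X; rewrite imset_id; apply/esym/underlying_dual.
Qed.

Lemma no_minor_miso L (M N : matroid) : miso M N -> no_minor_in L N -> no_minor_in L M.
Proof.
by move=> iso noN P PL mP; apply: (noN P PL); apply: has_minor_trans mP; apply/miso_minor/miso_sym.
Qed.

Lemma In_nth (T : Type) (x0 : T) (L : seq T) i : (i < size L)%N -> List.In (nth x0 L i) L.
Proof. by elim: L i => //= x L IH [|i] lt; [left | right; apply: IH]. Qed.

(** The structure hypothesis speaks of simple matroids only. Replacing elements by representatives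
    keeps ranks, hence vertical connectivity and the [MK m] minor, and a representation extends back
    to [M] by parallel and zero vectors. *)
Lemma simplify (K : fieldType) (M : matroid) k m : (1 < m)%N ->
  vertically_connected k M -> has_minor M (MK m) ->
  exists N : matroid, [/\ has_minor M N, simple N, vertically_connected k N, has_minor N (MK m) &
    forall F : fieldType, representable F N -> representable F M].
Proof.
move=> m1 vM /has_minorP[C [f [finj fC fr]]].
have [S [rho [sS rS rT rR]]] := simplification M.
pose N := restrict S.
pose im (X : {set M}) : {set M} := [set y | [exists x in X, rho x == Some y]].
pose im' (X : {set M}) : {set N} := [set z | val z \in im X].
have imP (X : {set M}) (y : M) : reflect (exists2 x, x \in X & rho x = Some y) (y \in im X).
  by rewrite inE; apply: (iffP existsP) => [[x /andP[xX /eqP h]]|[x xX h]]; exists x; rewrite ?xX ?h ?eqxx.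
have imS (X : {set M}) (y : M) : y \in im X -> y \in S by case/imP => x _ /rT.
have vim X : val @: (im' X) = im X.
  apply/setP => y; apply/imsetP/idP => [[z + ->]|yX]; first by rewrite inE.
  by exists (exist _ y (imS X y yX)); [rewrite in_set; exact: yX | ].
have rN X : @rank N (im' X) = @rank M X by rewrite -[LHS]/(@rank M (val @: (im' X))) vim rR.
have imU X Y : im (X :|: Y) = im X :|: im Y.
  apply/setP => y; rewrite [RHS]inE; apply/imP/orP => [[x]|[]/imP[x xX h]].
  - by rewrite inE => /orP[] xX h; [left | right]; apply/imP; exists x.
  - by exists x; rewrite // inE xX.
  by exists x; rewrite // inE xX orbT.
exists N; split.
- apply/has_minorP; exists set0, (fun z : N => val z); split; [exact: val_inj | by move=> x; rewrite inE |].
  by move=> X; rewrite rank0 addn0 setU0.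
- move=> X X2; rewrite -[LHS]/(@rank M (val @: X)) sS ?card_imset //; try exact: val_inj.
  by apply/subsetP => _ /imsetP[z _ ->]; apply: valP.
(* [X] is pulled back along [rho]; loops affect no rank and are put into [Xh]. *)
- move=> X cX; pose Xh : {set M} := [set x | if rho x is Some y then y \in val @: X else true].
  have iX : im' Xh = X.
    apply/setP => z; rewrite inE; apply/imP/idP => [[x]|zX].
      by rewrite inE => + rx; rewrite rx mem_imset //; apply: val_inj.
    by exists (val z); rewrite ?inE ?(rS _ (valP z)) ?imset_f.
  have iXC : im' (~: Xh) = ~: X.
    apply/setP => z; rewrite in_set [RHS]in_setC; apply/imP/idP => [[x]|zX].
      by rewrite !inE => + rx; rewrite rx mem_imset //; apply: val_inj.
    exists (val z); last by apply: rS; apply: valP.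
    rewrite !inE (rS _ (valP z)); apply: contra zX => zX.
    by have /imsetP[z' z'X /val_inj->] : val z \in val @: X := zX.
  have iT : im' setT = setT.
    by apply/setP => z; rewrite !inE; apply/existsP; exists (val z); rewrite inE (rS _ (valP z)) eqxx.
  have e1 : @rank N X = @rank M Xh by rewrite -{1}iX rN.
  have e2 : @rank N (~: X) = @rank M (~: Xh) by rewrite -iXC rN.
  have e3 : @rank N setT = @rank M setT by rewrite -iT rN.
  have [|h|h] := vM Xh; first by move: cX; rewrite /conn e1 e2 e3.
    by left; move: h; rewrite /spanning e1 e3.
  by right; move: h; rewrite /spanning e2 e3.
(* As [MK m] is simple, its elements cannot come from loops, since they have rank 1, and two of them
   cannot share a representative, since pairs have rank 2. *)
- have r1 x : @rank (MK m) [set x] = 1%N by rewrite MK_simple ?cards1.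
  have ex x : exists y, rho (f x) = Some y.
    case h: (rho (f x)) => [y|]; [by exists y | exfalso].
    have := fr [set x]; rewrite imset_set1 r1 -(rR (f x |: C)) -(rR C) -!/(im _) imU.
    rewrite (_ : im [set f x] = set0) ?set0U; first by lia.
    by apply/setP => y; rewrite [RHS]inE; apply/imP => -[_ /set1P-> ]; rewrite h.
  have [g gP] := fin_all_exists ex.
  pose g' x : N := Sub (g x) (rT _ _ (gP x)).
  have img (X : {set MK m}) : im (f @: X) = g @: X.
    apply/setP => y; apply/imP/imsetP => [[_ /imsetP[x xX ->]]|[x xX ->]].
      by rewrite gP => -[<-]; exists x.
    by exists (f x); rewrite ?imset_f ?gP.
  have frr (X : {set MK m}) : (rank X + rank (im C) = rank (g @: X :|: im C))%N.
    by have := fr X; rewrite -(rR (f @: X :|: C)) -(rR C) -!/(im _) imU img.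
  have gC x : g x \notin im C.
    apply/negP => gx; have := frr [set x]; rewrite imset_set1 r1 (setUidPr _) ?sub1set //; lia.
  apply/has_minorP; exists (im' C), g'; split.
  + move=> x y /(congr1 val)/= gxy; apply/eqP/negPn/negP => xy.
    have h2 := frr [set x; y]; have h1 := frr [set x].
    rewrite imsetU1 imset_set1 gxy setUid in h2; rewrite imset_set1 gxy in h1.
    have r2 : @rank (MK m) [set x; y] = 2%N by rewrite MK_simple cards2 xy.
    by rewrite r2 -h1 r1 in h2; lia.
  + by move=> x; rewrite in_set; apply: gC.
  move=> X; have vg : val @: (g' @: X :|: im' C) = g @: X :|: im C.
    rewrite imsetU vim -imset_comp; congr (_ :|: _); exact: eq_imset.
  by rewrite -[X in (_ + X)%N]/(@rank M (val @: (im' C))) vim frr -vg.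
move=> F [r [A rA]].
pose p (x : M) : fvec F 'I_r := if rho x is Some y then if insub y is Some z then mxcol A z else 0 else 0.
apply: (@represents_representable F _ M p) => X; rewrite -rN -rA; congr (\dim _).
rewrite -/(sp (mxcol A) (im' X)).
apply/eqP; rewrite eqEsubv; apply/andP; split; apply/spP => x.
  move=> xX; rewrite /p; case h: (rho x) => [y|]; last by rewrite mem0v.
  rewrite insubT; first exact: rT h.
  by move=> yS; apply: mem_sp; rewrite inE; apply/imP; exists x.
rewrite inE => /imP[y yX h].
have -> : mxcol A x = p y by rewrite /p h valK.
exact: mem_sp.
Qed.

(** * Assembly of the two equivalences *)

Section Final.
Variables (K : finFieldType).
Hypothesis cardK : #|K| = 4%N.
Variable a : K.
Hypothesis ha : a ^+ 2 = a + 1.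

(** Translation by 1 permutes the field, so comparing the two sums of all elements gives 4 = 0 in
    [K], and 4 is the square of 1 + 1. *)
Lemma char2_of_card : 1 + 1 = 0 :> K.
Proof.
have h : \sum_(x : K) x = \sum_(x : K) (x + 1) by rewrite [LHS](reindex_inj (addIr 1)).
move: h; rewrite big_split /= sumr_const => /eqP; rewrite -[X in X == _]addr0 (inj_eq (addrI _)) eq_sym.
rewrite (_ : #|_| = 4%N); last by rewrite -cardK; apply: eq_card.
rewrite (_ : 1 *+ 4 = (1 + 1) * (1 + 1)); last by ring.
by rewrite mulf_eq0 orbb => /eqP.
Qed.

Lemma codes_of_card x : exists g, x = ev a g.
Proof.
have char2 := char2_of_card.
have evI : injective (ev a).
  move=> p q; case: (eqVneq p q) => // npq e1; exfalso.
  have : ev a (gadd p q) == 0 by rewrite ev_add // e1 (addrr2 char2).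
  by rewrite (ev_eq0 ha); move: npq; case: (p); case: (q).
pose s := map (ev a) [:: O4; I4; A4; B4].
have us : uniq s by rewrite map_inj_uniq.
have cs : #|s| = #|K| by rewrite (card_uniqP us) cardK.
have /(_ x) := subset_cardP cs (subset_predT _); rewrite [RHS]inE => /mapP[g _ ->].
by exists g.
Qed.

Lemma pchar2 : 2 \in [pchar K].
Proof. by apply/andP; split=> //; apply/eqP; exact: char2_of_card. Qed.

Definition NN n := nth F7 [:: F7; V1 a; P1 a; P3 a; Y9 a] n.

Lemma NN_target n : (n < 5)%N -> target a (NN n) (cols_of n).
Proof.
have R3 k := @rows_target K a (nth [::] (code_rows a 3 (cols_of k)) 0) (nth [::] (code_rows a 3 (cols_of k)) 1)
  (nth [::] (code_rows a 3 (cols_of k)) 2) (cols_of k) erefl.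
case: n => [|[|[|[|[|//]]]]] _; first exact: F7_target char2_of_card.
- exact: (R3 1%N).
- exact: (R3 2%N).
- exact: (R3 3%N).
exact: (R3 4%N).
Qed.

Lemma conforms_SL4 (Phi : frame_template K) (R : rmatroid K) :
  (forall n R', (n < 5)%N -> conforms Phi R' -> ~ has_minor (underlying R') (NN n)) ->
  conforms Phi R ->
  (forall S : {set underlying R}, (#|S| <= #|tY0 Phi|)%N -> spanning (~: S)) ->
  exists q, prime_power q /\ forall F : fieldType, at_least q F -> representable F (underlying R).
Proof. by move=> h; apply: (template_representable ha char2_of_card codes_of_card NN_target h). Qed.

Lemma not_SL4_of_rat (N : matroid) : ~ representable rat N -> ~ SL4 K N.
Proof.
move=> nr [_ [q [_ H]]]; apply/nr/H; exists [seq (i%:R : rat) | i <- iota 0 q].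
rewrite size_map size_iota map_inj_uniq ?iota_uniq //.
by move=> i j /eqP; rewrite eqr_nat => /eqP.
Qed.

Lemma not_SL4_dual (N : matroid) : ~ SL4 K N -> ~ SL4 K (dual N).
Proof. by move=> nN /SL4_dual h; apply/nN/SL4_minor/h/miso_minor/miso_dual_dual. Qed.

Definition short_list := [:: F7; dual F7; V1 a; V2 a; V3 a; P1 a; P2 a; P3 a; Y9 a].
Definition long_list := [:: F7; dual F7; V1 a; dual (V1 a); V2 a; V3 a; dual (V3 a);
  P1 a; dual (P1 a); P2 a; P3 a; dual (P3 a); Y9 a; dual (Y9 a)].

Lemma SL4_no_minor L M : (forall N, List.In N L -> ~ SL4 K N) -> SL4 K M -> no_minor_in L M.
Proof. by move=> h sM N NL /SL4_minor mN; apply: (h N NL (mN _ sM)). Qed.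

Let c2 := char2_of_card.
Let nF7 := not_SL4_of_rat (F7_nonrat ha c2).
Let nV1 := not_SL4_of_rat (V1_nonrat ha c2).
Let nV2 := not_SL4_of_rat (V2_nonrat ha c2).
Let nV3 := not_SL4_of_rat (V3_nonrat ha c2).
Let nP1 := not_SL4_of_rat (P1_nonrat ha c2).
Let nP2 := not_SL4_of_rat (P2_nonrat ha c2).
Let nP3 := not_SL4_of_rat (P3_nonrat ha c2).
Let nY9 := not_SL4_of_rat (Y9_nonrat ha c2).

Lemma short_not_SL4 N : List.In N short_list -> ~ SL4 K N.
Proof.
case=> [<-|[<-|[<-|[<-|[<-|[<-|[<-|[<-|[<-|[]]]]]]]]]];
  [exact: nF7 | exact: not_SL4_dual nF7 | exact: nV1 | exact: nV2 | exact: nV3 | exact: nP1 | exact: nP2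
  | exact: nP3 | exact: nY9].
Qed.

Lemma long_not_SL4 N : List.In N long_list -> ~ SL4 K N.
Proof.
case=> [<-|[<-|[<-|[<-|[<-|[<-|[<-|[<-|[<-|[<-|[<-|[<-|[<-|[<-|[]]]]]]]]]]]]]]];
  [exact: nF7 | exact: not_SL4_dual nF7 | exact: nV1 | exact: not_SL4_dual nV1 | exact: nV2 | exact: nV3
  | exact: not_SL4_dual nV3 | exact: nP1 | exact: not_SL4_dual nP1 | exact: nP2 | exact: nP3
  | exact: not_SL4_dual nP3 | exact: nY9 | exact: not_SL4_dual nY9].
Qed.

Lemma NN_long n : (n < 5)%N -> List.In (NN n) long_list /\ List.In (dual (NN n)) long_list.
Proof.
have I i := @In_nth _ F7 long_list i.
case: n => [|[|[|[|[|//]]]]] _.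
- exact: conj (I 0%N isT) (I 1%N isT).
- exact: conj (I 2%N isT) (I 3%N isT).
- exact: conj (I 7%N isT) (I 8%N isT).
- exact: conj (I 10%N isT) (I 11%N isT).
exact: conj (I 12%N isT) (I 13%N isT).
Qed.

Lemma NN_short n : (n < 5)%N -> List.In (NN n) short_list.
Proof.
have I i := @In_nth _ F7 short_list i.
case: n => [|[|[|[|[|//]]]]] _.
- exact: (I 0%N isT).
- exact: (I 2%N isT).
- exact: (I 5%N isT).
- exact: (I 7%N isT).
exact: (I 8%N isT).
Qed.

Let leq_big (s : nat) (f : 'I_s -> nat) i : (f i <= \sum_i f i)%N.
Proof. by rewrite (bigD1 i) //= leq_addr. Qed.

Theorem highly_connected_case : hypothesisA ->
  exists k : nat, (0 < k)%N /\
     forall M : matroid,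
       k_connected k M -> representable K M -> (2 * k <= #|M|)%N ->
       (SL4 K M <-> no_minor_in long_list M).
Proof.
move=> HA.
have [k [s [t [Phi [Psi [k0 hPhi hPsi hM]]]]]] :=
  HA K 2%N 3%N (fun R => no_minor_in long_list (underlying R)) pchar2 isT (@minor_closed_no_minor K long_list).
pose sP := (\sum_(i < s) #|tY0 (Phi i)|)%N; pose sQ := (\sum_(j < t) #|tY0 (Psi j)|)%N.
have lP i : (#|tY0 (Phi i)| <= sP)%N := leq_big (fun i => #|tY0 (Phi i)|) i.
have lQ j : (#|tY0 (Psi j)| <= sQ)%N := leq_big (fun j => #|tY0 (Psi j)|) j.
(* The 3 yields simplicity, [k] serves the hypothesis, and [sP] and [sQ] make every set Y_0 smaller
   than [k'], so that as many elements always have a spanning complement. *)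
pose k' := (3 + k + sP + sQ)%N.
have [kk sPk sQk] : [/\ (k <= k')%N, (sP < k')%N & (sQ < k')%N].
  by rewrite /k'; clear lP lQ; clearbody sP sQ; split; lia.
exists k'; split=> // M kM rM cM; split; first exact: SL4_no_minor long_not_SL4.
move=> noM; have [R iso] := representable_rmatroid rM.
have kR := k_connected_miso iso kM.
have cR : (2 * k' <= #|underlying R|)%N by have [g [bg _]] := iso; rewrite (bij_eq_card bg).
have noR := no_minor_miso iso noM.
have [||||[i ci]|[j cj]] := hM R noR.
- exact: k_connected_simple kR cR.
- exact: k_connectedW kR.
- by apply: leq_trans cR; rewrite leq_mul2l kk orbT.
- exact: noR _ (or_introl erefl).
- have [||q [pq H]] := conforms_SL4 _ ci.
  + by move=> n R' n5 /hPhi noR' mN; apply: noR' mN; case: (NN_long n5).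
  + move=> S cS; apply: (proj2 (k_connected_small kR cR _)).
    exact: leq_ltn_trans cS (leq_ltn_trans (lP i) sPk).
  split=> //; exists q; split=> // F qF; exact: representable_miso iso (H F qF).
(* Here the template contains the dual matroid. Connectivity is self-dual, and the five minors are
   excluded for the template because their duals are listed too. *)
have isoD := underlying_rdual_miso R.
have kD : k_connected k' (underlying (rdual R)).
  by apply: k_connected_miso isoD _; apply: k_connected_dual.
have [||q [pq H]] := conforms_SL4 _ cj.
- move=> n R' n5 /hPsi noR' /dual_minor mN; apply: (noR' (dual (NN n))); first by case: (NN_long n5).
  by apply: has_minor_trans mN; apply/miso_minor/underlying_rdual_miso.
- move=> S cS; apply: (proj2 (k_connected_small kD cR _)).
  exact: leq_ltn_trans cS (leq_ltn_trans (lQ j) sQk).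
split=> //; exists q; split=> // F qF; apply: representable_miso iso _.
apply: (representable_miso (miso_dual_dual _)); apply: representable_dual.
exact: representable_miso isoD (H F qF).
Qed.

Theorem vertically_connected_case : hypothesisB ->
  exists k n : nat, [/\ (0 < k)%N, (0 < n)%N &
     forall M : matroid,
       vertically_connected k M -> representable K M -> has_minor M (MK n) ->
       (SL4 K M <-> no_minor_in short_list M)].
Proof.
move=> HB.
have [k [n [s [t [Phi [Psi [k0 [n0 [hPhi [hPsi [hM _]]]]]]]]]]] :=
  HB K 2%N 3%N (fun R => no_minor_in short_list (underlying R)) pchar2 isT (@minor_closed_no_minor K short_list).
pose y := (\sum_(i < s) #|tY0 (Phi i)|)%N.
(* A clique on [n'] vertices has rank at least n + y + 1. Sets of at most [y] elements are then
   smaller than the rank, and vertical connectivity makes their complements spanning. *)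
pose k' := (k + y + 1)%N; pose n' := (n + y + 2)%N.
exists k', n'; split=> [||M vM rM mM]; rewrite ?/k' ?/n'; try lia.
split; first exact: SL4_no_minor short_not_SL4.
move=> noM; have [|N [MN sN vN mN up]] := simplify K _ vM mM; first by rewrite /n'; lia.
have [R iso] := representable_rmatroid (representable_minor MN rM).
have noR : no_minor_in short_list (underlying R).
  apply: no_minor_miso iso _ => P PL NP; apply: (noM P PL); exact: has_minor_trans MN NP.
have [f [bf fr]] := iso.
have fT : f @: setT = setT.
  by have [h hK fK] := bf; apply/setP => z; rewrite inE; apply/imsetP; exists (h z); rewrite ?inE ?fK.
have vR : vertically_connected k' (underlying R).
  move=> X cX; have [|h|h] := vN (f @: X).
  - by move: cX; rewrite /conn imsetC_bij // -fT !fr.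
  - by left; move: h; rewrite /spanning -fT !fr.
  by right; move: h; rewrite /spanning imsetC_bij // -fT !fr.
have mR : has_minor (underlying R) (MK n') := has_minor_trans (miso_minor iso) mN.
have rR : (y < @rank (underlying R) setT)%N.
  have /has_minorP[C [g [_ _ gr]]] := mR; have := gr setT; have := MK_rankT n'.
  have := @rankS (underlying R) _ _ (subsetT (g @: setT :|: C)); rewrite /n'; lia.
have [||||i ci] := hM R noR.
- by move=> X X2; rewrite -fr sN card_imset //; apply: bij_inj.
- by apply: vertically_connectedW vR; rewrite /k'; lia.
- by apply: has_minor_trans mR (MK_mono _); rewrite /n'; lia.
- exact: noR _ (or_introl erefl).
have [||q [pq H]] := conforms_SL4 _ ci.
- by move=> m R' m5 /hPhi noR' mm; apply: noR' mm; apply: NN_short.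
- move=> S cS; have := leq_big (fun i => #|tY0 (Phi i)|) i; rewrite -/y => yi.
  by apply: vertically_connected_small vR _ _; rewrite ?/k'; lia.
split=> //; exists q; split=> // F qF; apply: up; exact: representable_miso iso (H F qF).
Qed.
End Final.

Theorem theorem1p5 (K : finFieldType) (cardK : #|K| = 4%N)
    (a : K) (ha : a ^+ 2 = a + 1) :
  (hypothesisA ->
   exists k : nat, (0 < k)%N /\
     forall M : matroid,
       k_connected k M -> representable K M -> (2 * k <= #|M|)%N ->
       (SL4 K M <->
        no_minor_in [:: F7; dual F7; V1 a; dual (V1 a); V2 a; V3 a; dual (V3 a);
                        P1 a; dual (P1 a); P2 a; P3 a; dual (P3 a);
                        Y9 a; dual (Y9 a)] M)) /\
  (hypothesisB ->
   exists k n : nat, [/\ (0 < k)%N, (0 < n)%N &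
     forall M : matroid,
       vertically_connected k M -> representable K M -> has_minor M (MK n) ->
       (SL4 K M <->
        no_minor_in [:: F7; dual F7; V1 a; V2 a; V3 a; P1 a; P2 a; P3 a; Y9 a] M)]).
Proof. by split; [apply: highly_connected_case | apply: vertically_connected_case]. Qed.
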